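(* Let $P=\{p<q\}$ and let $S=(X,S_p)\in\mathrm{Sam}_P$ be a compact, definably stratified space. Then, up to a linear rescaling (i.e. after replacing $S$ by $\lambda S=(\lambda X,\lambda S_p)$ for a suitable $\lambda>0$), the persistent stratified homotopy type $\mathcal P(S)$, indexed over $\Omega\times\mathbb R_+$, is homotopically constant with value $S$ on an open neighborhood of $\Omega\times\{0\}$ in $\Omega\times\mathbb R_+$; that is, there is an open neighborhood $U$ of $\Omega\times\{0\}$ in $\Omega\times\mathbb R_+$ such that $\mathcal P(S)|_U$ is isomorphic in $\mathrm{Ho}(\mathrm{Diag}_P^U)$ to the constant functor with value the stratification diagram $D(S)$.
   Context: Fix $\mathbb R^N$ with Euclidean norm. For $A\subset\mathbb R^N$, $\alpha\ge0$: $A_\alpha=\{y\mid\exists x\in A:\|x-y\|\le\alpha\}$. $\mathbb R_+=[0,\infty)$ as a poset. $\mathrm{Sam}_P$ is the set of pairs $(\mathbb X,\mathbb X_p)$ with $\mathbb X_p\subset\mathbb X\subset\mathbb R^N$. A stratified space over $P=\{p<q\}$ is a space $X$ with a closed subset $S_p$; $S_q=X\setminus S_p$. A stratified $X\subset\mathbb R^N$ is the element $(X,S_p)$ of $\mathrm{Sam}_P$. It is definable (definably stratified) if $S_p,S_q$ are definable in some fixed o-minimal structure (expanding the real field). $\Omega=\{v=(v_l,v_u)\mid 0<v_l<v_u<1\}$ with the order $v\le v'\iff v'_l\le v_l$ and $v_u\le v'_u$, and the topology of $\mathbb R^2$; subsets of $\Omega\times\mathbb R_+$ carry the product order. For $S\in\mathrm{Sam}_P$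 put $s(x)=\min\{d(x,S_p),1\}$ on $X$ ($d(x,\emptyset)=\infty$) and $\mathcal D_{v,p}=s^{-1}[0,v_u]$, $\mathcal D_{v,\{p<q\}}=s^{-1}[v_l,v_u]$, $\mathcal D_{v,q}=s^{-1}[v_l,1]$. $\mathrm{Top}$ is the category of $\Delta$-generated spaces. $\mathrm{Diag}_P$ is the category of diagrams of spaces $D_p\leftarrow D_{\{p<q\}}\to D_q$; weak equivalences are morphisms that are weak homotopy equivalences at each of the three entries. For a small category $U$, $\mathrm{Ho}(\mathrm{Diag}_P^U)$ is the localization of $\mathrm{Diag}_P^U$ at natural transformations that are weak equivalences at each object of $U$. The (parameter-free) persistent stratified homotopy type $\mathcal P(S)$ is the functor $\Omega\times\mathbb R_+\to\mathrm{Diag}_P$, $(v,\alpha)\mapsto\{(\mathcal D_{v,p})_\alpha\hookleftarrow(\mathcal D_{v,\{p<q\}})_\alpha\hookrightarrow(\mathcal D_{v,q})_\alpha\}$, with structure maps the inclusions, regarded in $\mathrm{Ho}(\mathrm{Diag}_P^{\Omega\times\mathbb R_+})$. The stratification diagram of $S$ is $D(S)=\{S_p\leftarrow \mathrm{HoLink}(S)\to S_q\}$ where $\mathrm{HoLink}(S)=\{\gamma:[0,1]\to X\mid\gamma(0)\in S_p,\ \gamma(t)\in S_q\ \forall t>0\}$ (compact-open topology), with maps $\gamma\mapsto\gamma(0)$, $\gamma\mapsto\gamma(1)$. (The functor $D$ induces an equivalence between the homotopy category of stratified spaces over $P$, localized at maps inducing weak equivalences on strata and homotopy links, and $\mathrm{Ho}\,\mathrm{Diag}_P$;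 the two are identified, so the value $S$ means $D(S)$.) *)

(* Defs.v *)
From HB Require Import structures.
From mathcomp Require Import all_boot all_order all_algebra.
From mathcomp Require Import all_classical all_reals all_analysis.
Set Implicit Arguments.
Unset Strict Implicit.
Unset Printing Implicit Defensive.
Import Order.TTheory GRing.Theory Num.Theory numFieldNormedType.Exports.
Local Open Scope classical_set_scope.
Local Open Scope ring_scope.

Record category := Category {
  Ob :> Type;
  Hom : Ob -> Ob -> Type;
  idC : forall x, Hom x x;
  compC : forall x y z, Hom y z -> Hom x y -> Hom x z;
  compC1 : forall x y (f : Hom x y), compC f (idC x) = f;
  comp1C : forall x y (f : Hom x y), compC (idC y) f = f;
  compCA : forall x y z t (f : Hom x y) (g : Hom y z) (h : Hom z t),
    compC h (compC g f) = compC (compC h g) f }.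

Arguments Hom {c}.
Arguments idC {c}.
Arguments compC {c x y z}.

Definition isomorphic (C : category) (x y : C) : Prop :=
  exists (f : Hom x y) (g : Hom y x),
    compC g f = idC x /\ compC f g = idC y.

Record functor (C D : category) := Functor {
  fob :> C -> D;
  fmap : forall x y, Hom x y -> Hom (fob x) (fob y);
  fmap1 : forall x, fmap (idC x) = idC (fob x);
  fmapM : forall x y z (f : Hom x y) (g : Hom y z),
    fmap (compC g f) = compC (fmap g) (fmap f) }.

Arguments fmap {C D} F {x y} : rename.

Record nat_trans (C D : category) (F G : functor C D) := NatTrans {
  component :> forall x, Hom (F x) (G x);
  naturality : forall x y (f : Hom x y),
    compC (component y) (fmap F f) = compC (fmap G f) (component x) }.

Lemma nat_trans_eq (C D : category) (F G : functor C D) (a b : nat_trans F G) :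
  (forall x, a x = b x) -> a = b.
Proof.
case: a b => [a na] [b nb] /= ab.
have e : a = b by apply: functional_extensionality_dep.
by case: b / e nb {ab} => nb; rewrite (Prop_irrelevance na nb).
Qed.

Definition nat_id (C D : category) (F : functor C D) : nat_trans F F.
Proof.
by exists (fun x => idC (F x)) => x y f; rewrite comp1C compC1.
Defined.

Definition nat_comp (C D : category) (F G H : functor C D)
  (b : nat_trans G H) (a : nat_trans F G) : nat_trans F H.
Proof.
exists (fun x => compC (b x) (a x)) => x y f.
by rewrite -compCA naturality compCA naturality compCA.
Defined.

Definition functor_category (C D : category) : category.
Proof.
apply: (@Category (functor C D) (@nat_trans C D) (@nat_id C D) (@nat_comp C D)).
- by move=> F G a; apply: nat_trans_eq => x; rewrite /= compC1.
- by move=> F G a; apply: nat_trans_eq => x; rewrite /= comp1C.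
- by move=> F G H K a b c; apply: nat_trans_eq => x; rewrite /= compCA.
Defined.

Definition functor_comp (B C D : category) (G : functor C D) (F : functor B C) :
  functor B D.
Proof.
exists (fun x => G (F x)) (fun x y f => fmap G (fmap F f)).
- by move=> x; rewrite !fmap1.
- by move=> x y z f g; rewrite !fmapM.
Defined.

Definition constant_functor (C D : category) (d : D) : functor C D.
Proof.
exists (fun=> d) (fun _ _ _ => idC d) => // x y z f g.
by rewrite comp1C.
Defined.

Definition thin_category (T : Type) (le : T -> T -> Prop)
  (lexx : forall x, le x x)
  (le_trans : forall x y z, le y z -> le x y -> le x z) : category.
Proof.
by apply: (@Category T le lexx le_trans) => *; exact: Prop_irrelevance.
Defined.

Definition morphism_class (C : category) :=
  forall x y : C, Hom x y -> Prop.

Definition objectwise (C D : category) (W : morphism_class D) :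
  morphism_class (functor_category C D) :=
  fun F G a => forall x, W _ _ (component a x).

(** The localization C[W^-1]: morphisms are formal composites of morphisms of C
    and formal inverses of morphisms of W, modulo the congruence generated by
    the relations making C -> C[W^-1] a functor that inverts W. *)
Section Localization.
Context (C : category) (W : morphism_class C).

Inductive loc_word : C -> C -> Type :=
| loc_arr x y of Hom x y : loc_word x y
| loc_inv x y (w : Hom x y) of W w : loc_word y x
| loc_comp x y z of loc_word y z & loc_word x y : loc_word x z.

Inductive loc_rel : forall x y, loc_word x y -> loc_word x y -> Prop :=
| loc_refl x y (u : loc_word x y) : loc_rel u u
| loc_sym x y (u v : loc_word x y) : loc_rel u v -> loc_rel v u
| loc_trans x y (u v w : loc_word x y) :
    loc_rel u v -> loc_rel v w -> loc_rel u w
| loc_congr x y z (u u' : loc_word y z) (v v' : loc_word x y) :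
    loc_rel u u' -> loc_rel v v' -> loc_rel (loc_comp u v) (loc_comp u' v')
| loc_assoc x y z t (u : loc_word x y) (v : loc_word y z) (w : loc_word z t) :
    loc_rel (loc_comp w (loc_comp v u)) (loc_comp (loc_comp w v) u)
| loc_comp1r x y (u : loc_word x y) : loc_rel (loc_comp u (loc_arr (idC x))) u
| loc_comp1l x y (u : loc_word x y) : loc_rel (loc_comp (loc_arr (idC y)) u) u
| loc_arrM x y z (f : Hom x y) (g : Hom y z) :
    loc_rel (loc_arr (compC g f)) (loc_comp (loc_arr g) (loc_arr f))
| loc_invl x y (w : Hom x y) (Ww : W w) :
    loc_rel (loc_comp (loc_inv Ww) (loc_arr w)) (loc_arr (idC x))
| loc_invr x y (w : Hom x y) (Ww : W w) :
    loc_rel (loc_comp (loc_arr w) (loc_inv Ww)) (loc_arr (idC y)).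

Definition loc_hom (x y : C) : Type :=
  {c : loc_word x y -> Prop | exists u, c = loc_rel u}.

Definition loc_class x y (u : loc_word x y) : loc_hom x y :=
  exist _ (loc_rel u) (ex_intro _ u erefl).

Lemma loc_class_eq x y (u v : loc_word x y) :
  loc_rel u v -> loc_class u = loc_class v.
Proof.
move=> uv; rewrite /loc_class.
have e : loc_rel u = loc_rel v.
  apply: functional_extensionality_dep => w; apply: propositional_extensionality.
  by split; apply: loc_trans => //; exact: loc_sym.
move: (ex_intro _ u _) (ex_intro _ v _).
by case: _ / e => p q; rewrite (Prop_irrelevance p q).
Qed.

Definition loc_repr x y (c : loc_hom x y) : loc_word x y :=
  projT1 (cid (proj2_sig c)).

Lemma loc_reprK x y (c : loc_hom x y) : loc_class (loc_repr c) = c.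
Proof.
rewrite /loc_repr; case: c => c p /=; case: cid => u /= e.
case: _ / (esym e) p => p; rewrite /loc_class.
by rewrite (Prop_irrelevance (ex_intro _ u erefl) p).
Qed.

Lemma loc_classK x y (u : loc_word x y) : loc_rel (loc_repr (loc_class u)) u.
Proof.
rewrite /loc_repr; case: cid => v /= <-; exact: loc_refl.
Qed.

Definition loc_compose x y z (d : loc_hom y z) (c : loc_hom x y) : loc_hom x z :=
  loc_class (loc_comp (loc_repr d) (loc_repr c)).

Definition localization : category.
Proof.
apply: (@Category C loc_hom (fun x => loc_class (loc_arr (idC x))) loc_compose).
- move=> x y c; rewrite -[RHS]loc_reprK; apply: loc_class_eq.
  apply: loc_trans (loc_comp1r _); apply: loc_congr (loc_classK _).
  exact: loc_refl.
- move=> x y c; rewrite -[RHS]loc_reprK; apply: loc_class_eq.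
  apply: loc_trans (loc_comp1l _); apply: (loc_congr (loc_classK _)).
  exact: loc_refl.
- move=> x y z t a b c; apply: loc_class_eq.
  apply: loc_trans (loc_congr (loc_refl _) (loc_classK _)) _.
  apply: loc_trans (loc_assoc _ _ _) _.
  exact: loc_congr (loc_sym (loc_classK _)) (loc_refl _).
Defined.

End Localization.

Definition simplex (R : realType) (n : nat) : set 'rV[R]_n.+1 :=
  [set x | (forall i, 0 <= x 0 i) /\ \sum_i x 0 i = 1].
Arguments simplex : clear implicits.

Definition delta_open (R : realType) (T : topologicalType) (U : set T) : Prop :=
  forall n (f : simplex R n -> T), continuous f -> open (f @^-1` U).
Arguments delta_open R {T}.

Definition delta_generated (R : realType) (T : topologicalType) : Prop :=
  forall U : set T, delta_open R U -> open U.

Record delta_space (R : realType) := DeltaSpace {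
  delta_carrier :> topologicalType;
  delta_carrierP : delta_generated R delta_carrier }.

Definition Top (R : realType) : category.
Proof.
apply: (@Category (delta_space R) (fun X Y => continuousType X Y)
  (fun X => idfun : continuousType X X)
  (fun X Y Z g f => g \o f : continuousType X Z)).
- by move=> X Y f; apply/continuousEP.
- by move=> X Y f; apply/continuousEP.
- by move=> X Y Z T f g h; apply/continuousEP.
Defined.

(** The Delta-generated coreflection of T: the points of T with the final
    topology for the continuous maps from simplices to T. Arbitrary subspaces and
    mapping spaces need not be Delta-generated, so they enter Top through it; the
    identity deltaify R T -> T is a weak homotopy equivalence. *)
Definition deltaify (R : realType) (T : topologicalType) : Type := T.

Lemma delta_openT (R : realType) (T : topologicalType) :
  delta_open R [set: T].
Proof. by move=> n f _; rewrite preimage_setT; exact: openT. Qed.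

Lemma delta_openI (R : realType) (T : topologicalType) :
  setI_closed (@delta_open R T).
Proof.
move=> A B oA oB n f cf; rewrite preimage_setI.
by apply: openI; [exact: oA|exact: oB].
Qed.

Lemma delta_open_bigU (R : realType) (T : topologicalType) (I : Type)
  (F : I -> set T) :
  (forall i, delta_open R (F i)) -> delta_open R (\bigcup_i F i).
Proof.
move=> oF n f cf; rewrite preimage_bigcup.
by apply: bigcup_open => i _; exact: oF.
Qed.

HB.instance Definition _ (R : realType) (T : topologicalType) :=
  Choice.on (deltaify R T).
HB.instance Definition _ (R : realType) (T : topologicalType) :=
  isOpenTopological.Build (deltaify R T)
    (@delta_openT R T) (@delta_openI R T) (@delta_open_bigU R T).

Lemma deltaify_openE (R : realType) (T : topologicalType)
  (U : set (deltaify R T)) : open U = delta_open R (U : set T).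
Proof. by []. Qed.

Lemma continuous_deltaify (R : realType) (n : nat) (T : topologicalType)
  (f : simplex R n -> T) :
  continuous f -> continuous (f : simplex R n -> deltaify R T).
Proof. by move=> cf; apply/continuousP => U; rewrite deltaify_openE; exact. Qed.

Lemma deltaify_generated (R : realType) (T : topologicalType) :
  delta_generated R (deltaify R T).
Proof.
move=> U oU; rewrite deltaify_openE => n f cf.
exact: oU (continuous_deltaify cf).
Qed.

Definition delta_obj (R : realType) (T : topologicalType) : Top R :=
  DeltaSpace (@deltaify_generated R T).

Lemma deltaify_continuous (R : realType) (S T : topologicalType) (f : S -> T) :
  continuous f -> continuous (f : deltaify R S -> deltaify R T).
Proof.
move=> cf; apply/continuousP => U; rewrite !deltaify_openE => oU n g cg.
apply: (oU n (f \o g)) => x; apply: continuous_comp; first exact: cg.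
exact: cf.
Qed.

Definition delta_map (R : realType) (S T : topologicalType) (f : S -> T)
  (cf : continuous f) : Hom (delta_obj R S) (delta_obj R T) :=
  Continuous.Pack (Continuous.Class
    (isContinuous.Build _ _ _ (@deltaify_continuous R S T f cf))).
Arguments delta_map R {S T f} cf.

Definition unit_itv (R : realType) : set R := [set t | 0 <= t <= 1].
Arguments unit_itv : clear implicits.

Lemma unit_itv0 (R : realType) : unit_itv R 0.
Proof. by rewrite /unit_itv /= lexx ler01. Qed.

Lemma unit_itv1 (R : realType) : unit_itv R 1.
Proof. by rewrite /unit_itv /= lexx ler01. Qed.

Definition I0 (R : realType) : unit_itv R := SigSub (mem_set (@unit_itv0 R)).
Definition I1 (R : realType) : unit_itv R := SigSub (mem_set (@unit_itv1 R)).

Definition cube (R : realType) (n : nat) : set 'rV[R]_n :=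
  [set s | forall i, 0 <= s 0 i <= 1].
Arguments cube : clear implicits.

Definition cube_boundary (R : realType) (n : nat) (s : cube R n) : Prop :=
  exists i, val s 0 i = 0 \/ val s 0 i = 1.

(** Representatives of the elements of pi_n(X, x). *)
Record spheroid (R : realType) (n : nat) (X : topologicalType) (x : X) :=
  Spheroid {
    spheroid_map :> cube R n -> X;
    spheroid_cont : continuous spheroid_map;
    spheroid_base : forall s, cube_boundary s -> spheroid_map s = x }.

Definition spheroid_homotopic (R : realType) (n : nat) (X : topologicalType)
  (x : X) (a b : spheroid R n x) : Prop :=
  exists H : unit_itv R * cube R n -> X,
    [/\ continuous H, forall s, H (I0 R, s) = a s, forall s, H (I1 R, s) = b s
      & forall t s, cube_boundary s -> H (t, s) = x].

Definition spheroid_push (R : realType) (n : nat) (X Y : topologicalType)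
  (f : continuousType X Y) (x : X) (a : spheroid R n x) : spheroid R n (f x).
Proof.
exists (f \o a).
- move=> s; apply: continuous_comp; first exact: spheroid_cont.
  exact: cts_fun.
- by move=> s bs /=; rewrite spheroid_base.
Defined.

Definition joined_by_path (R : realType) (X : topologicalType)
  (x y : X) : Prop :=
  exists g : unit_itv R -> X, [/\ continuous g, g (I0 R) = x & g (I1 R) = y].

(** F descends to a bijection from A modulo EA onto B modulo EB. *)
Definition quotient_bijective (A B : Type) (EA : A -> A -> Prop)
  (EB : B -> B -> Prop) (F : A -> B) : Prop :=
  [/\ forall a a', EA a a' -> EB (F a) (F a'),
      forall a a', EB (F a) (F a') -> EA a a'
    & forall b, exists a, EB (F a) b].

(** The maps induced on pi_n for n > 0 are group morphisms, so bijectivity makes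
    them isomorphisms; pi_0 is treated apart to cover the empty space. *)
Definition weak_homotopy_equivalence (R : realType) : morphism_class (Top R) :=
  fun X Y (f : continuousType X Y) =>
    quotient_bijective (@joined_by_path R X)
      (@joined_by_path R Y) f /\
    forall n (x : X), (0 < n)%N ->
      quotient_bijective (@spheroid_homotopic R n X x)
        (@spheroid_homotopic R n Y (f x)) (@spheroid_push R n X Y f x).

Record span (C : category) := Span {
  sp : C; spq : C; sq : C;
  leg_p : Hom spq sp;
  leg_q : Hom spq sq }.

Record span_hom (C : category) (D E : span C) := SpanHom {
  hp : Hom (sp D) (sp E);
  hpq : Hom (spq D) (spq E);
  hq : Hom (sq D) (sq E);
  comm_p : compC hp (leg_p D) = compC (leg_p E) hpq;
  comm_q : compC hq (leg_q D) = compC (leg_q E) hpq }.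

Lemma span_hom_eq (C : category) (D E : span C) (a b : span_hom D E) :
  hp a = hp b -> hpq a = hpq b -> hq a = hq b -> a = b.
Proof.
case: a b => [ap apq aq c1 c2] [bp bpq bq d1 d2] /= ep epq eq.
move: c1 c2 d1 d2; rewrite ep epq eq => c1 c2 d1 d2.
by rewrite (Prop_irrelevance c1 d1) (Prop_irrelevance c2 d2).
Qed.

Definition span_id (C : category) (D : span C) : span_hom D D.
Proof.
by exists (idC _) (idC _) (idC _); rewrite comp1C compC1.
Defined.

Definition span_comp (C : category) (D E F : span C)
  (b : span_hom E F) (a : span_hom D E) : span_hom D F.
Proof.
exists (compC (hp b) (hp a)) (compC (hpq b) (hpq a)) (compC (hq b) (hq a)).
- by rewrite -compCA comm_p compCA comm_p compCA.
- by rewrite -compCA comm_q compCA comm_q compCA.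
Defined.

Definition span_category (C : category) : category.
Proof.
apply: (@Category (span C) (@span_hom C) (@span_id C) (@span_comp C)).
- by move=> D E a; apply: span_hom_eq; rewrite /= compC1.
- by move=> D E a; apply: span_hom_eq; rewrite /= comp1C.
- by move=> D E F G a b c; apply: span_hom_eq; rewrite /= compCA.
Defined.

Definition DiagP (R : realType) : category := span_category (Top R).

Definition DiagP_weq (R : realType) : morphism_class (DiagP R) :=
  fun D E (a : span_hom D E) =>
    [/\ weak_homotopy_equivalence (hp a), weak_homotopy_equivalence (hpq a)
      & weak_homotopy_equivalence (hq a)].

Definition HoDiagP (R : realType) (U : category) : category :=
  localization (@objectwise U (DiagP R) (@DiagP_weq R)).

Definition enorm (R : realType) (N : nat) (x : 'rV[R]_N) : R :=
  Num.sqrt (\sum_i x 0 i ^+ 2).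

Definition thickening (R : realType) (N : nat) (A : set 'rV[R]_N) (alpha : R) :
  set 'rV[R]_N :=
  [set y | exists2 x, A x & enorm (x - y) <= alpha].

(** In the extended reals, so that the distance to the empty set is +oo. *)
Definition dist (R : realType) (N : nat) (x : 'rV[R]_N) (A : set 'rV[R]_N) :
  \bar R := ereal_inf [set (enorm (x - y))%:E | y in A].

Record sample (R : realType) (N : nat) := Sample {
  carrier : set 'rV[R]_N;
  stratum_p : set 'rV[R]_N;
  stratum_p_sub : stratum_p `<=` carrier }.

Definition stratum_q (R : realType) (N : nat) (S : sample R N) : set 'rV[R]_N :=
  carrier S `\` stratum_p S.

Definition stratified (R : realType) (N : nat) (S : sample R N) : Prop :=
  closed [set x : carrier S | stratum_p S (val x)].

Definition scale (R : realType) (N : nat) (lambda : R) (A : set 'rV[R]_N) :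
  set 'rV[R]_N := [set lambda *: x | x in A].

Definition rescale (R : realType) (N : nat) (lambda : R) (S : sample R N) :
  sample R N :=
  @Sample R N (scale lambda (carrier S)) (scale lambda (stratum_p S))
    (@image_subset _ _ (fun x => lambda *: x) _ _ (@stratum_p_sub R N S)).

(** O-minimal structures on the ordered set R, in the sense of van den Dries,
    that contain the graphs of addition and multiplication. The axiom for
    dimension 1 makes all singletons, hence all parameters, definable. *)
Record ominimal_structure (R : realType) := OMinimal {
  definable :> forall n, set (set 'rV[R]_n);
  definable0 : forall n, definable (@set0 'rV[R]_n);
  definableU : forall n (A B : set 'rV[R]_n),
    definable A -> definable B -> definable (A `|` B);
  definableC : forall n (A : set 'rV[R]_n), definable A -> definable (~` A);
  definable_cyll : forall n (A : set 'rV[R]_n), definable A ->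
    definable [set x : 'rV[R]_n.+1 | A (col' ord0 x)];
  definable_cylr : forall n (A : set 'rV[R]_n), definable A ->
    definable [set x : 'rV[R]_n.+1 | A (col' ord_max x)];
  definable_diag : forall n,
    definable [set x : 'rV[R]_n.+1 | x 0 ord0 = x 0 ord_max];
  definable_proj : forall n (A : set 'rV[R]_n.+1), definable A ->
    definable [set (col' ord_max x : 'rV[R]_n) | x in A];
  definable_lt : definable [set x : 'rV[R]_2 | x 0 ord0 < x 0 ord_max];
  definable_add :
    definable [set x : 'rV[R]_3 | x 0 (inord 0) + x 0 (inord 1) = x 0 (inord 2)];
  definable_mul :
    definable [set x : 'rV[R]_3 | x 0 (inord 0) * x 0 (inord 1) = x 0 (inord 2)];
  definable_dim1 : forall A : set 'rV[R]_1, definable A <->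
    exists s : seq (interval R),
      A = [set x | exists2 J, J \in s & x 0 0 \in J] }.

Definition definably_stratified (R : realType) (M : ominimal_structure R)
  (N : nat) (S : sample R N) : Prop :=
  [/\ stratified S, M N (stratum_p S) & M N (stratum_q S)].

Definition Omega (R : realType) : set (R * R) :=
  [set v | [/\ 0 < v.1, v.1 < v.2 & v.2 < 1]].
Arguments Omega : clear implicits.

(** Points are pairs (v, alpha) with v = (v_l, v_u). *)
Definition OmegaR (R : realType) : set ((R * R) * R) :=
  [set x | Omega R x.1 /\ 0 <= x.2].
Arguments OmegaR : clear implicits.

Definition OmegaR_le (R : realType) (x y : (R * R) * R) : Prop :=
  [/\ y.1.1 <= x.1.1, x.1.2 <= y.1.2 & x.2 <= y.2].

Lemma OmegaR_lexx (R : realType) (x : (R * R) * R) : OmegaR_le x x.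
Proof. by split. Qed.

Lemma OmegaR_le_trans (R : realType) (x y z : (R * R) * R) :
  OmegaR_le y z -> OmegaR_le x y -> OmegaR_le x z.
Proof.
case=> a b c [d e f].
by split; [exact: le_trans a d|exact: le_trans e b|exact: le_trans f c].
Qed.

Definition OmegaR_category (R : realType) : category :=
  @thin_category (OmegaR R) (fun x y => OmegaR_le (val x) (val y))
    (fun x => OmegaR_lexx (val x)) (fun x y z => @OmegaR_le_trans R _ _ _).

Definition sub_category (R : realType) (U : set (OmegaR R)) : category :=
  @thin_category U (fun x y => OmegaR_le (val (val x)) (val (val y)))
    (fun x => OmegaR_lexx (val (val x))) (fun x y z => @OmegaR_le_trans R _ _ _).

Definition sub_inclusion (R : realType) (U : set (OmegaR R)) :
  functor (sub_category U) (OmegaR_category R).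
Proof.
by exists (fun x : U => val x : OmegaR_category R) (fun x y f => f).
Defined.

Definition restriction (R : realType) (U : set (OmegaR R)) (D : category)
  (F : functor (OmegaR_category R) D) : functor (sub_category U) D :=
  functor_comp F (sub_inclusion U).

Section Persistent.
Context (R : realType) (N : nat) (S : sample R N).

Definition strat_dist (x : 'rV[R]_N) : \bar R :=
  Order.min (dist x (stratum_p S)) 1%E.

Definition D_p (v : R * R) : set 'rV[R]_N :=
  [set x | carrier S x /\ (0 <= strat_dist x <= v.2%:E)%E].
Definition D_pq (v : R * R) : set 'rV[R]_N :=
  [set x | carrier S x /\ (v.1%:E <= strat_dist x <= v.2%:E)%E].
Definition D_q (v : R * R) : set 'rV[R]_N :=
  [set x | carrier S x /\ (v.1%:E <= strat_dist x <= 1)%E].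

Lemma thickening_sub (A B : set 'rV[R]_N) (a b : R) :
  A `<=` B -> a <= b -> thickening A a `<=` thickening B b.
Proof.
by move=> AB ab y [x Ax xy]; exists x; [exact: AB|exact: le_trans xy ab].
Qed.

Lemma D_pq_sub_p (v : R * R) : Omega R v -> D_pq v `<=` D_p v.
Proof.
case=> v0 _ _ x [Xx /andP[lx xu]]; split => //; rewrite xu andbT.
by apply: le_trans lx; rewrite lee_fin ltW.
Qed.

Lemma D_pq_sub_q (v : R * R) : Omega R v -> D_pq v `<=` D_q v.
Proof.
case=> _ _ v1 x [Xx /andP[lx xu]]; split => //; rewrite lx /=.
by apply: le_trans xu _; rewrite lee_fin ltW.
Qed.

Lemma D_p_mono (v w : R * R) : v.2 <= w.2 -> D_p v `<=` D_p w.
Proof.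
move=> vw x [Xx /andP[x0 xu]]; split => //; apply/andP; split => //.
by apply: le_trans xu _; rewrite lee_fin.
Qed.

Lemma D_pq_mono (v w : R * R) :
  w.1 <= v.1 -> v.2 <= w.2 -> D_pq v `<=` D_pq w.
Proof.
move=> wv vw x [Xx /andP[lx xu]]; split => //; apply/andP; split.
  by apply: le_trans lx; rewrite lee_fin.
by apply: le_trans xu _; rewrite lee_fin.
Qed.

Lemma D_q_mono (v w : R * R) : w.1 <= v.1 -> D_q v `<=` D_q w.
Proof.
move=> wv x [Xx /andP[lx x1]]; split => //; apply/andP; split => //.
by apply: le_trans lx; rewrite lee_fin.
Qed.

Lemma subfun_continuous (T : topologicalType) (A B : set T) (AB : A `<=` B) :
  continuous (subfun AB).
Proof.
apply: continuous_comp_initial; exact: initial_continuous.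
Qed.

Definition incl (A B : set 'rV[R]_N) (AB : A `<=` B) :
  Hom (delta_obj R A) (delta_obj R B) := delta_map R (@subfun_continuous _ A B AB).

Lemma incl_id (A : set 'rV[R]_N) (AA : A `<=` A) : incl AA = idC (delta_obj R A).
Proof. by apply/continuousEP => x; apply: val_inj. Qed.

Lemma incl_comp (A B C : set 'rV[R]_N) (AB : A `<=` B) (BC : B `<=` C)
  (AC : A `<=` C) : compC (incl BC) (incl AB) = incl AC.
Proof. by apply/continuousEP => x; apply: val_inj. Qed.

Definition persistent_obj (x : OmegaR R) : DiagP R :=
  let v := (val x).1 in let alpha := (val x).2 in
  let Ov := (set_valP x).1 in
  @Span (Top R)
    (delta_obj R (thickening (D_p v) alpha))
    (delta_obj R (thickening (D_pq v) alpha))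
    (delta_obj R (thickening (D_q v) alpha))
    (incl (thickening_sub (D_pq_sub_p Ov) (lexx alpha)))
    (incl (thickening_sub (D_pq_sub_q Ov) (lexx alpha))).

Definition persistent_map (x y : OmegaR R) (xy : OmegaR_le (val x) (val y)) :
  Hom (persistent_obj x) (persistent_obj y).
Proof.
exists
  (incl (thickening_sub (D_p_mono (let: And3 _ h _ := xy in h))
     (let: And3 _ _ h := xy in h)))
  (incl (thickening_sub
     (D_pq_mono (let: And3 h _ _ := xy in h) (let: And3 _ h _ := xy in h))
     (let: And3 _ _ h := xy in h)))
  (incl (thickening_sub (D_q_mono (let: And3 h _ _ := xy in h))
     (let: And3 _ _ h := xy in h))).
- by apply/continuousEP => z; apply: val_inj.
- by apply/continuousEP => z; apply: val_inj.
Defined.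

Definition persistent : functor (OmegaR_category R) (DiagP R).
Proof.
exists persistent_obj persistent_map.
- by move=> x; apply: span_hom_eq; exact: incl_id.
- by move=> x y z f g; apply: span_hom_eq; apply/esym; exact: incl_comp.
Defined.

Definition holink : set {compact-open, unit_itv R -> carrier S} :=
  [set g | [/\ continuous (g : unit_itv R -> carrier S),
     stratum_p S (val (g (I0 R)))
   & forall t : unit_itv R, 0 < val t -> stratum_q S (val (g t))]].

Lemma holink_eval0 (g : holink) : stratum_p S (val (val g (I0 R))).
Proof. by case: (set_valP g). Qed.

Lemma holink_eval1 (g : holink) : stratum_q S (val (val g (I1 R))).
Proof. by case: (set_valP g) => _ _; apply; exact: ltr01. Qed.

Definition holink_p (g : holink) : stratum_p S :=
  SigSub (mem_set (holink_eval0 g)).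
Definition holink_q (g : holink) : stratum_q S :=
  SigSub (mem_set (holink_eval1 g)).

Lemma compact_open_eval (T U : topologicalType) (t : T) :
  continuous (fun g : {compact-open, T -> U} => g t).
Proof.
apply/continuousP => O oO.
have := compact_open_open (@compact_set1 T t) oO.
congr open; apply/seteqP; split => g /=; first by apply; exists t.
by move=> Ogt _ [_ -> <-].
Qed.

Lemma holink_eval_continuous (t : unit_itv R) :
  continuous (fun g : holink => val (val g t) : 'rV[R]_N).
Proof.
move=> g; apply: (@continuous_comp _ _ _ (fun g : holink => val g t) set_val).
  apply: (@continuous_comp _ _ _ set_val
    (fun g : {compact-open, unit_itv R -> carrier S} => g t)).
    exact: initial_continuous.
  exact: compact_open_eval.
exact: initial_continuous.
Qed.

Lemma holink_p_continuous : continuous holink_p.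
Proof. by apply: continuous_comp_initial; exact: holink_eval_continuous. Qed.

Lemma holink_q_continuous : continuous holink_q.
Proof. by apply: continuous_comp_initial; exact: holink_eval_continuous. Qed.

Definition stratification_diagram : DiagP R :=
  @Span (Top R) (delta_obj R (stratum_p S)) (delta_obj R holink)
    (delta_obj R (stratum_q S))
    (delta_map R holink_p_continuous) (delta_map R holink_q_continuous).

End Persistent.

Definition homotopically_constant (R : realType) (U : set (OmegaR R))
  (F : functor (OmegaR_category R) (DiagP R)) (D : DiagP R) : Prop :=
  @isomorphic (HoDiagP R (sub_category U))
    (restriction U F) (constant_functor (sub_category U) D).

(* Main.v *)
Require Import Defs.
From HB Require Import structures.
From mathcomp Require Import all_boot all_order all_algebra.
From mathcomp Require Import all_classical all_reals all_analysis.
From mathcomp Require Import ring lra zify.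
Set Implicit Arguments.
Unset Strict Implicit.
Unset Printing Implicit Defensive.
Import Order.TTheory GRing.Theory Num.Theory numFieldNormedType.Exports.
Local Open Scope classical_set_scope.
Local Open Scope ring_scope.

(** For a compact set K, write d_K for the distance to K, and let S be the closed
    stratum of the compact carrier X. All the spaces in the statement are cut out
    of X by bounds on d_S, or thickened, that is, cut out of the ambient space by
    a bound on d_K for such a K. So everything reduces to flows along which a
    distance function is monotone, and these exist where the distance function
    has no critical value.

    Distance functions are not differentiable, but they have a chain rule: along a
    curve, at a time when both are differentiable, the derivative of d_K is read
    off from any nearest point of K ([dd_chain]). A direction v is therefore
    called good at x if its scalar products with x - p, for all the nearest points
    p of S, and of X if x has left X, have the right signs. If a definable curve
    ran through points without good direction at varying distance t from S, its
    own velocity would be a good direction; so by definable choice and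
    piecewise differentiability of definable functions, good directions exist at
    all points of all small levels ([regular_germ]). In the same way a definable
    curve bounds the size of the good directions by a function that is integrable
    at t = 0, since bounded definable curves have finite length
    ([controlled_germ]); this is the inequality of Kurdyka and Lojasiewicz.

    Good directions form convex sets and persist nearby, so a partition of unity
    turns them into a continuous field, and polygons with small steps along this
    field move points between two levels of d_S while hardly leaving X
    ([euler_push]). Infinitely many such motions, over dyadic bands shrinking to
    S, can be concatenated because their lengths are summable: S is a deformation
    retract of a neighbourhood of it in X, by a deformation that stays off S
    until its end ([collar_exists]). Applied to a compact definable K in the
    ambient space, this makes K a deformation retract of its small thickenings,
    and the admissible size of the thickening is locally uniform when K varies in
    a definable family with one parameter ([magnify]). It also yields retractions,
    which bring the polygons back into X. After magnification of the sample there
    is no obstruction up to distance 3/2.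

    The resulting weak equivalences form a zigzag. Write Y for the part of X at
    distance at most 1 from S, and H for its deformation onto S. Near parameters
    (v, 0) the persistent diagram is equivalent to its values at thickening 0,
    which are included by weak equivalences in the constant diagram with entries
    Y, Y \ S, X \ S ([compression]). In that diagram the inclusion of Y \ S in Y
    may be replaced by the final map of H. Then x |-> (t |-> H (1 - t) x) maps
    Y \ S into the homotopy link, compatibly with both ends, and it is a weak
    equivalence ([collar_link]); finally Y is replaced by S, which is equivalent to
    it by H.

    Weak equivalences are all recognized by one criterion, about lifting motions
    of compact parts of the target ([tracking_weq]); it allows base points to
    move, and it is insensitive to the passage to the Delta-generated topology. *)

(** * First-order definability *)

Section Logic.
Context (R : realType) (M : ominimal_structure R).

(** Variables are numbered; a predicate on valuations stands for a set of any
    dimension beyond its last relevant variable, so that formulas can be combined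
    without matching dimensions. *)
Definition env := nat -> R.
Definition row_of n (e : env) : 'rV[R]_n := \row_(i < n) e i.
Definition dpredn n (P : env -> Prop) :=
  exists2 A : set 'rV[R]_n, M n A & forall e, P e <-> A (row_of n e).
Definition dpred (P : env -> Prop) := exists n, dpredn n P.
Definition upd (e : env) k (y : R) : env := fun i => if i == k then y else e i.
Definition scons (y : R) (e : env) : env := fun i => if i is j.+1 then e j else y.

Lemma eq_dpred P Q : (forall e, P e <-> Q e) -> dpred P -> dpred Q.
Proof.
move=> PQ [n [A MA PA]]; exists n; exists A => // e; rewrite -PQ; exact: PA.
Qed.

Lemma row_ofE n (e : env) i j : row_of n e i j = e j.
Proof. by rewrite mxE. Qed.

Lemma row_of_col'_max n (e : env) : col' ord_max (row_of n.+1 e) = row_of n e.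
Proof. by apply/rowP => i; rewrite !(row_ofE, mxE) /= /bump leqNgt ltn_ord. Qed.

Lemma row_of_col'0 n (e : env) :
  col' ord0 (row_of n.+1 e) = row_of n (fun i => e i.+1).
Proof. by apply/rowP => i; rewrite !(row_ofE, mxE). Qed.

Lemma dpredn_raise n P : dpredn n P -> dpredn n.+1 P.
Proof.
move=> [A MA PA]; exists [set x | A (col' ord_max x)]; first exact: definable_cylr.
by move=> e /=; rewrite row_of_col'_max.
Qed.

Lemma dpredn_raise_to n m P : (n <= m)%N -> dpredn n P -> dpredn m P.
Proof.
move=> /subnK <-; elim: (m - n)%N => // k IH /IH; exact: dpredn_raise.
Qed.

Lemma dpredn_not n P : dpredn n P -> dpredn n (fun e => ~ P e).
Proof.
move=> [A MA PA]; exists (~` A); first exact: definableC.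
by move=> e; rewrite /setC /=; split => nP /PA.
Qed.

Lemma dpredn_or n P Q :
  dpredn n P -> dpredn n Q -> dpredn n (fun e => P e \/ Q e).
Proof.
move=> [A MA PA] [B MB QB]; exists (A `|` B); first exact: definableU.
by move=> e; rewrite /setU /= PA QB.
Qed.

Lemma dpredn_ex n P :
  dpredn n.+1 P -> dpredn n (fun e => exists y, P (upd e n y)).
Proof.
move=> [A MA PA]; eexists; first exact: definable_proj MA.
move=> e /=; split => [[y /PA Ay]|[x Ax xe]].
  exists (row_of n.+1 (upd e n y)) => //; rewrite row_of_col'_max.
  by apply/rowP => i; rewrite !(row_ofE, mxE) /upd ltn_eqF.
exists (x 0 ord_max); apply/PA; suff -> : row_of n.+1 (upd e n (x 0 ord_max)) = x by [].
apply/rowP => i; rewrite ?row_ofE ?mxE /upd; case: eqP => [/eqP ie|/eqP ine].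
  by congr (x _ _); apply: val_inj => /=; rewrite (eqP ie).
have ltin : (i < n)%N by rewrite ltn_neqAle ine -ltnS ltn_ord.
have := congr1 (fun z : 'rV_n => z 0 (Ordinal ltin)) xe; rewrite !(row_ofE, mxE) /= => <-.
by congr (x _ _); apply: val_inj; rewrite /= /bump leqNgt ltin.
Qed.

Lemma dpredn_shift n P : dpredn n P -> dpredn n.+1 (fun e => P (fun i => e i.+1)).
Proof.
move=> [A MA PA]; exists [set x | A (col' ord0 x)]; first exact: definable_cyll.
by move=> e /=; rewrite row_of_col'0 -PA.
Qed.

Lemma dpred_not P : dpred P -> dpred (fun e => ~ P e).
Proof. by move=> [n nP]; exists n; exact: dpredn_not. Qed.

Lemma dpred_or P Q : dpred P -> dpred Q -> dpred (fun e => P e \/ Q e).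
Proof.
move=> [n nP] [m mQ]; exists (maxn n m); apply: dpredn_or.
  exact: dpredn_raise_to (leq_maxl _ _) nP.
exact: dpredn_raise_to (leq_maxr _ _) mQ.
Qed.

Lemma dpred_and P Q : dpred P -> dpred Q -> dpred (fun e => P e /\ Q e).
Proof.
move=> dP dQ; apply: eq_dpred (dpred_not (dpred_or (dpred_not dP) (dpred_not dQ))).
move=> e; split => [|[p q]]; last by case.
by move=> n; split; apply: contrapT => np; apply: n; [left|right].
Qed.

Lemma dpred_imp P Q : dpred P -> dpred Q -> dpred (fun e => P e -> Q e).
Proof.
move=> dP dQ; apply: eq_dpred (dpred_or (dpred_not dP) dQ) => e.
split => [[np p|q //]|pq]; first by [].
by have [p|np] := pselect (P e); [right; exact: pq|left].
Qed.

Lemma dpred_true : dpred (fun=> True).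
Proof.
exists 0%N; exists (~` set0); first exact/definableC/definable0.
by move=> e; split => // _; rewrite /setC /=.
Qed.

Lemma dpred_cst (Q : Prop) : dpred (fun=> Q).
Proof.
have [q|nq] := pselect Q; first by apply: eq_dpred dpred_true.
by apply: eq_dpred (dpred_not dpred_true) => e; split => // /(_ I).
Qed.

Lemma dpredn_shiftn k n P :
  dpredn n P -> dpredn (k + n) (fun e => P (fun i => e (k + i)%N)).
Proof.
move=> nP; elim: k => [|k IH] //.
have := dpredn_shift IH; rewrite addSn; case=> A MA PA; by exists A.
Qed.

Lemma dpredn_eq i j : exists n, dpredn n (fun e => e i = e j).
Proof.
wlog ij : i j / (i <= j)%N.
  move=> h; case/orP: (leq_total i j) => /h // [n [A MA PA]].
  by exists n; exists A => // e; rewrite -PA; split.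
move: ij => /subnKC <-; exists (i + (j - i).+1)%N.
have d : dpredn (j - i).+1 (fun e => e 0 = e (j - i)%N).
  eexists; first exact: definable_diag.
  by move=> e /=; rewrite !(row_ofE, mxE).
have [A MA PA] := dpredn_shiftn i d.
by exists A => // e; rewrite -PA addn0.
Qed.

Lemma dpred_eqv i j : dpred (fun e => e i = e j).
Proof. exact: dpredn_eq. Qed.

Lemma dpred_all_lt n (P : nat -> env -> Prop) :
  (forall i, (i < n)%N -> dpred (P i)) -> dpred (fun e => forall i, (i < n)%N -> P i e).
Proof.
elim: n => [|n IH] dP; first by apply: eq_dpred dpred_true => e; split.
have IH' : forall i, (i < n)%N -> dpred (P i) by move=> i /ltnW; exact: dP.
apply: eq_dpred (dpred_and (IH IH') (dP n (leqnn _))) => e; split.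
  by move=> [a b] i; rewrite ltnS leq_eqVlt => /orP[/eqP -> //|]; exact: a.
by move=> a; split => [i i_n|]; apply: a => //; exact: ltnW.
Qed.

(** A block of fresh coordinates placed after all the old ones can be
    projected away from the end, which is the only projection at hand. *)
Lemma dpredn_ex_block m n P : dpredn (m + n) P ->
  dpredn m (fun e => exists u : env, P (fun i => if (i < m)%N then e i else u (i - m)%N)).
Proof.
elim: n P => [|n IH] P.
  rewrite addn0 => -[A MA PA]; exists A => // e; split.
    case=> u /PA; congr A; apply/rowP => i; by rewrite !(row_ofE, mxE) ltn_ord.
  move=> Ae; exists e; apply/PA; move: Ae; congr A; apply/rowP => i.
  by rewrite !(row_ofE, mxE) ltn_ord.
rewrite addnS => mP; have [A MA PA] := mP.
have [B MB QB] := IH _ (dpredn_ex mP).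
exists B => // e; rewrite -QB; split.
  move=> [u Pu]; exists u, (u n); move/PA: Pu => Au; apply/PA; move: Au; congr A.
  apply/rowP => i; rewrite !(row_ofE, mxE) /upd; case: eqP => // ie.
  by rewrite ie -ltn_subRL subnn ltn0 addKn.
move=> [u [y Puy]]; exists (upd u n y); move/PA: Puy => Au; apply/PA; move: Au; congr A.
apply/rowP => i; rewrite !(row_ofE, mxE) /upd; case: (ltnP i m) => im.
  by rewrite ltn_eqF // (leq_trans im) // leq_addr.
by rewrite -(eqn_add2l m (i - m)%N) (subnKC im).
Qed.

(** Variables can be permuted, identified and added freely although the axioms
    only provide cylinders over the first and the last coordinate and the
    equality of these two: the renamed formula is projected along a block of
    copies of the old variables. *)
Lemma dpred_ren P (s : nat -> nat) : dpred P -> dpred (fun e => P (fun i => e (s i))).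
Proof.
move=> [n nP]; have [A MA PA] := nP.
pose m := \max_(i < n) (s i).+1.
have sm i : (i < n)%N -> (s i < m)%N.
  by move=> i_n; exact: (leq_bigmax (F := fun i : 'I_n => (s i).+1) (Ordinal i_n)).
have [k dQ] : dpred (fun e => P (fun i => e (m + i)%N) /\
   forall i, (i < n)%N -> e (m + i)%N = e (s i)).
  apply: dpred_and; first by exists (m + n)%N; exact: dpredn_shiftn.
  by apply: dpred_all_lt => i i_n; exact: dpred_eqv.
have dQ' : dpredn (m + n + k) (fun e => P (fun i => e (m + i)%N) /\
   forall i, (i < n)%N -> e (m + i)%N = e (s i)).
  by apply: dpredn_raise_to dQ; rewrite leq_addl.
rewrite -addnA in dQ'.
apply: eq_dpred (ex_intro _ m (dpredn_ex_block dQ')) => e; split.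
  move=> [u [/PA Au eu]]; apply/PA; move: Au; congr A; apply/rowP => i.
  rewrite !(row_ofE, mxE) eu ?ltn_ord //; by rewrite sm.
move=> Pe; exists (fun i => e (s i)); split.
  move/PA: Pe => Ae; apply/PA; move: Ae; congr A; apply/rowP => i.
  by rewrite !(row_ofE, mxE) -ltn_subRL subnn ltn0 addKn.
by move=> i i_n; rewrite -ltn_subRL subnn ltn0 addKn sm.
Qed.

Lemma dpred_ex (P : R -> env -> Prop) :
  dpred (fun e => P (e 0%N) (fun i => e i.+1)) -> dpred (fun e => exists y, P y e).
Proof.
move=> [n nP]; have [A MA PA] := nP.
have [k dQ] := dpred_ren (fun i => if i is j.+1 then j else n) (ex_intro _ n nP).
have dQ' : dpredn (n + k).+1 (fun e => P (e n) e).
  by apply: dpredn_raise_to dQ; rewrite leqW // leq_addl.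
have : dpredn (n + k.+1) (fun e => P (e n) e) by rewrite addnS.
move/dpredn_ex_block => h; apply: eq_dpred (ex_intro _ n h) => e; split.
  move=> [u]; rewrite ltnn subnn => Pu; exists (u 0%N).
  have := PA (scons (u 0%N) e); rewrite /= => ->.
  have /= := PA (scons (u 0%N) (fun i => if (i < n)%N then e i else u (i - n)%N)).
  rewrite [X in X <-> _]/= => /iffLR /(_ Pu); congr A.
  by apply/rowP; case => -[|i] lti; rewrite !(row_ofE, mxE) /= ?(ltnW lti).
move=> [y Py]; exists (fun i => if i is 0 then y else e (n + i)%N).
rewrite ltnn subnn.
have /= -> := PA (scons y (fun i => if (i < n)%N then e i else
  match (i - n)%N with 0 => y | _.+1 => e (n + (i - n))%N end)).
have /= := PA (scons y e) => /iffLR /(_ Py); congr A.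
by apply/rowP; case => -[|i] lti; rewrite !(row_ofE, mxE) /= ?(ltnW lti).
Qed.

Lemma dpred_all (P : R -> env -> Prop) :
  dpred (fun e => P (e 0%N) (fun i => e i.+1)) -> dpred (fun e => forall y, P y e).
Proof.
move=> dP.
apply: eq_dpred (dpred_not (dpred_ex (P := fun y e => ~ P y e) (dpred_not dP))) => e.
split => [n y|a [y]]; last by apply.
by apply: contrapT => nPy; apply: n; exists y.
Qed.

Definition dfun (F : env -> R) := dpred (fun e => F (fun i => e i.+1) = e 0%N).

Lemma dfun_ren F (s : nat -> nat) : dfun F -> dfun (fun e => F (fun i => e (s i))).
Proof. by move=> /(dpred_ren (fun i => if i is j.+1 then (s j).+1 else 0%N)). Qed.

(** A definable term is substituted for a variable through its graph. *)
Lemma dpred_subst (P : R -> env -> Prop) F :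
  dpred (fun e => P (e 0%N) (fun i => e i.+1)) -> dfun F -> dpred (fun e => P (F e) e).
Proof.
move=> dP dF; apply: eq_dpred (dpred_ex (P := fun y e => F e = y /\ P y e) _).
  by move=> e; split => [[y [<-]]|Pe] //; exists (F e).
exact: dpred_and.
Qed.

Lemma dfun_subst (G : R -> env -> R) F :
  dfun (fun e => G (e 0%N) (fun i => e i.+1)) -> dfun F -> dfun (fun e => G (F e) e).
Proof.
move=> dG dF.
apply: (dpred_subst (P := fun y e => G y (fun i => e i.+1) = e 0%N)
  (F := fun e => F (fun i => e i.+1))); last exact: (dfun_ren succn dF).
exact: (dpred_ren (fun i => if i is j.+1 then if j is k.+1 then k.+2 else 0%N else 1%N)
  dG).
Qed.

Lemma dfun_var i : dfun (fun e => e i).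
Proof. exact: (dpred_eqv i.+1 0). Qed.

Lemma dfun_cst c : dfun (fun=> c).
Proof.
exists 1%N; exists [set x : 'rV_1 | c = x 0 0]; last by move=> e /=; rewrite ?row_ofE ?mxE.
apply/definable_dim1; exists [:: `[c, c]]; apply/seteqP; split => x /=.
  by move=> <-; exists `[c, c]; rewrite ?inE //= in_itv /= lexx.
by case=> J; rewrite inE => /eqP ->; rewrite in_itv /= => /le_anti.
Qed.

Lemma dpred_basic3 (A : set 'rV[R]_3) F G H : M 3%N A -> dfun F -> dfun G -> dfun H ->
  dpred (fun e => A (\row_(i < 3) if (i == 0 :> nat)%N then F e else if (i == 1 :> nat)%N then G e else H e)).
Proof.
move=> MA dF dG dH.
apply: (dpred_subst (P := fun y e => A (\row_(i < 3) if (i == 0 :> nat)%N then y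
   else if (i == 1 :> nat)%N then G e else H e)) _ dF).
apply: (dpred_subst (P := fun y e => A (\row_(i < 3) if (i == 0 :> nat)%N then e 0%N
   else if (i == 1 :> nat)%N then y else H (fun i => e i.+1))) _ (dfun_ren succn dG)).
apply: (dpred_subst (P := fun y e => A (\row_(i < 3) if (i == 0 :> nat)%N then e 1%N
   else if (i == 1 :> nat)%N then e 0%N else y)) _ (dfun_ren (fun i => i.+2) dH)).
have d : dpred (fun e => A (row_of 3 e)) by exists 3%N; exists A.
apply: eq_dpred (dpred_ren (fun i => if (i == 0)%N then 2%N else if (i == 1)%N then 1%N else 0%N) d).
move=> e; suff -> : row_of 3 (fun i : nat => e (if i == 0 then 2 else if i == 1 then 1 else 0)%N)
  = \row_i (if i == 0 :> nat then e 2 else if i == 1 :> nat then e 1 else e 0)%N by [].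
by apply/rowP => i; rewrite !(row_ofE, mxE); case: i => -[|[|[|]]].
Qed.

Lemma dfun_add F G : dfun F -> dfun G -> dfun (fun e => F e + G e).
Proof.
move=> dF dG; apply: eq_dpred (dpred_basic3 (definable_add M) (dfun_ren succn dF)
  (dfun_ren succn dG) (dfun_var 0)) => e /=.
by rewrite !(row_ofE, mxE) !inordK.
Qed.

Lemma dfun_mul F G : dfun F -> dfun G -> dfun (fun e => F e * G e).
Proof.
move=> dF dG; apply: eq_dpred (dpred_basic3 (definable_mul M) (dfun_ren succn dF)
  (dfun_ren succn dG) (dfun_var 0)) => e /=.
by rewrite !(row_ofE, mxE) !inordK.
Qed.

Lemma dfun_opp F : dfun F -> dfun (fun e => - F e).
Proof.
move=> dF; have := dfun_mul (dfun_cst (-1)) dF.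
by apply: eq_dpred => e; rewrite mulN1r.
Qed.

Lemma dfun_sub F G : dfun F -> dfun G -> dfun (fun e => F e - G e).
Proof. by move=> dF dG; apply: dfun_add => //; exact: dfun_opp. Qed.

Lemma dfun_sum n (F : 'I_n -> env -> R) :
  (forall i, dfun (F i)) -> dfun (fun e => \sum_i F i e).
Proof.
elim: n F => [|n IH] F dF.
  by apply: eq_dpred (dfun_cst 0) => e; rewrite big_ord0.
have := dfun_add (dF ord0) (IH (fun i => F (lift ord0 i)) (fun i => dF _)).
by apply: eq_dpred => e; rewrite big_ord_recl.
Qed.

Lemma dpred_lt F G : dfun F -> dfun G -> dpred (fun e => F e < G e).
Proof.
move=> dF dG.
apply: (dpred_subst (P := fun y e => y < G e) _ dF).
apply: (dpred_subst (P := fun y e => e 0%N < y) _ (dfun_ren succn dG)).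
have d : dpred (fun e => e 0%N < e 1%N).
  by exists 2%N; eexists; [exact: (definable_lt M)|move=> e /=; rewrite !(row_ofE, mxE)].
exact: (dpred_ren (fun i => if i is 0%N then 1%N else 0%N) d).
Qed.

Lemma dpred_le F G : dfun F -> dfun G -> dpred (fun e => F e <= G e).
Proof.
move=> dF dG; apply: eq_dpred (dpred_not (dpred_lt dG dF)) => e.
by split => [/negP|]; rewrite leNgt // => /negP.
Qed.

Lemma dpred_eq F G : dfun F -> dfun G -> dpred (fun e => F e = G e).
Proof.
move=> dF dG; apply: eq_dpred (dpred_and (dpred_le dF dG) (dpred_le dG dF)) => e.
by split => [[? ?]|->] //; apply: le_anti; apply/andP.
Qed.

(** ** Vector-valued functions and families of sets *)
Section Vectors.
Context (N : nat).
Notation V := 'rV[R]_N.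

Definition dvec (F : env -> V) := forall i, dfun (fun e => F e 0 i).
(** Families of subsets of V: the first N variables are the coordinates of the
    point, the others are parameters. *)
Definition dset (K : env -> set V) :=
  dpred (fun e => K (fun i => e (N + i)%N) (row_of N e)).

Lemma dvec_ren F (s : nat -> nat) : dvec F -> dvec (fun e => F (fun i => e (s i))).
Proof. by move=> dF i; apply: (dfun_ren s (dF i)). Qed.

Lemma dvec_row_of (s : nat -> nat) : dvec (fun e => row_of N (fun i => e (s i))).
Proof. by move=> i; apply: eq_dpred (dfun_var (s i)) => e; rewrite ?row_ofE ?mxE. Qed.

Lemma dvec_row_of0 : dvec (row_of N).
Proof. exact: (dvec_row_of id). Qed.

(** The predicate looks at finitely many coordinates of u, so that quantifying
    over infinite valuations is an iterated quantifier. *)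
Lemma dpred_exu n (P : env -> env -> Prop) :
  (forall u u' e, (forall i, (i < n)%N -> u i = u' i) -> P u e -> P u' e) ->
  dpred (fun e => P e (fun i => e (n + i)%N)) -> dpred (fun e => exists u, P u e).
Proof.
elim: n P => [|n IH] P Pn dP.
  apply: eq_dpred dP => e; split => [Pe|[u Pu]]; first by exists e.
  exact: Pn Pu.
have := dpred_ex (P := fun y e => exists u, P (scons y u) e).
move=> h; apply: eq_dpred (h _).
  move=> e; split => [[y [u Pu]]|[u Pu]]; first by exists (scons y u).
  exists (u 0%N), (fun i => u i.+1); apply: Pn Pu.
  by case.
apply: (IH (fun u e => P (scons (e 0%N) u) (fun i => e i.+1))).
  move=> u u' e uu'; apply: Pn => -[|i] //= i_n; exact: uu'.
apply: eq_dpred (dpred_ren (fun i => if i is 0%N then n else if (i <= n)%N then i.-1 else i) dP).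
move=> e; rewrite addn0.
have -> : (fun i : nat => e (if (n.+1 + i)%N is 0 then n else if (n.+1 + i <= n)%N then (n.+1 + i).-1 else (n.+1 + i)%N)) = (fun i => e (n + i.+1)%N).
  apply: funext => i; case: (ltnP n (n.+1 + i)%N) => //; first by rewrite addnS.
  by rewrite addSn leqNgt ltnS leq_addr.
split; apply: Pn => -[|i] //= i_n; by rewrite -ltnS i_n.
Qed.

Lemma dpred_exv (P : V -> env -> Prop) :
  dpred (fun e => P (row_of N e) (fun i => e (N + i)%N)) ->
  dpred (fun e => exists v, P v e).
Proof.
move=> dP; apply: eq_dpred (dpred_exu (n := N) (P := fun u e => P (row_of N u) e) _ dP).
  move=> e; split => [[u Pu]|[v Pv]]; first by exists (row_of N u).
  exists (fun i => if insub i is Some j then v 0 j else 0).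
  suff -> : row_of N (fun i => if insub i is Some j then v 0 j else 0) = v by [].
  by apply/rowP => i; rewrite ?row_ofE ?mxE valK.
move=> u u' e uu'; suff -> : row_of N u = row_of N u' by [].
by apply/rowP => i; rewrite !(row_ofE, mxE) uu'.
Qed.

Lemma dpred_allv (P : V -> env -> Prop) :
  dpred (fun e => P (row_of N e) (fun i => e (N + i)%N)) ->
  dpred (fun e => forall v, P v e).
Proof.
move=> dP.
apply: eq_dpred (dpred_not (dpred_exv (P := fun y e => ~ P y e) (dpred_not dP))) => e.
split => [n y|a [y]]; last by apply.
by apply: contrapT => nPy; apply: n; exists y.
Qed.

(** Membership is stated with a renaming of the parameters because it is used
    under quantifiers, which shift them. *)
Lemma dset_mem (K : env -> set V) (s : nat -> nat) F : dset K -> dvec F ->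
  dpred (fun e => K (fun i => e (s i)) (F e)).
Proof.
move=> dK dF.
apply: eq_dpred (dpred_exv (P := fun v e => (forall i, v 0 i = F e 0 i) /\
   K (fun i => e (s i)) v) _).
  move=> e; split => [[v [vF]]|Ke]; last by exists (F e).
  by have -> : v = F e by apply/rowP.
apply: dpred_and.
  have d i : dpred (fun e => row_of N e 0 i = F (fun i => e (N + i)%N) 0 i).
    by apply: dpred_eq; [exact: dvec_row_of0|exact: dvec_ren].
  have h : dpred (fun e => forall k, (k < N)%N -> forall i : 'I_N, i = k :> nat ->
      row_of N e 0 i = F (fun i => e (N + i)%N) 0 i).
    apply: dpred_all_lt => k kN; apply: eq_dpred (d (Ordinal kN)) => e.
    by split => [h i ik|]; [have -> : i = Ordinal kN by exact: val_inj|apply].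
  by apply: eq_dpred h => e; split => [h i|h k _ i _]; first exact: h (ltn_ord i) _ erefl.
apply: eq_dpred (dpred_ren (fun i => if (i < N)%N then i else (N + s (i - N))%N) dK).
move=> e; suff -> : row_of N (fun i => e (if (i < N)%N then i else (N + s (i - N))%N)) = row_of N e.
  have -> // : (fun i => e (if (N + i < N)%N then (N + i)%N else (N + s (N + i - N))%N)) =
    fun i => e (N + s i)%N.
  by apply: funext => i; rewrite -ltn_subRL subnn ltn0 addKn.
by apply/rowP => i; rewrite !(row_ofE, mxE) ltn_ord.
Qed.

Lemma dset_mem0 (K : env -> set V) F : dset K -> dvec F -> dpred (fun e => K e (F e)).
Proof. exact: (dset_mem id). Qed.

Lemma dset_ren (K : env -> set V) (s : nat -> nat) :
  dset K -> dset (fun e => K (fun i => e (s i))).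
Proof. by move=> dK; apply: (dset_mem (fun i => N + s i)%N dK dvec_row_of0). Qed.

Lemma dset_cst (A : set V) : M N A -> dset (fun=> A).
Proof. by move=> MA; exists N; exists A. Qed.

Lemma dsetP (A : set V) : dset (fun=> A) -> M N A.
Proof.
case=> n [B MB AB].
have d : dpredn (N + n) (fun e => A (row_of N e)).
  by apply: (@dpredn_raise_to n); [exact: leq_addl|exists B].
have [C MC AC] := dpredn_ex_block d.
suff -> : A = C by [].
apply/seteqP; split => x.
  move=> Ax; pose e i : R := if insub i is Some j then x 0 j else 0.
  have ex : row_of N e = x by apply/rowP => i; rewrite ?row_ofE ?mxE /e valK.
  rewrite -ex; apply/AC; exists e; move: Ax; rewrite -{1}ex; congr A.
  by apply/rowP => i; rewrite !(row_ofE, mxE) ltn_ord.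
pose e i : R := if insub i is Some j then x 0 j else 0.
have ex : row_of N e = x by apply/rowP => i; rewrite ?row_ofE ?mxE /e valK.
rewrite -{1}ex => /AC [u]; rewrite -ex; congr A.
by apply/rowP => i; rewrite !(row_ofE, mxE) ltn_ord.
Qed.

Lemma dvec_scale f F : dfun f -> dvec F -> dvec (fun e => f e *: F e).
Proof.
by move=> df dF i; apply: eq_dpred (dfun_mul df (dF i)) => e; rewrite ?row_ofE ?mxE.
Qed.

Lemma dvec_sub F G : dvec F -> dvec G -> dvec (fun e => F e - G e).
Proof.
by move=> dF dG i; apply: eq_dpred (dfun_sub (dF i) (dG i)) => e; rewrite !(row_ofE, mxE).
Qed.

End Vectors.
End Logic.

(** * Definable sets and functions of one variable *)

Section OneVariable.
Context (R : realType) (M : ominimal_structure R).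
Implicit Types (a b c d s t x y z : R) (A P Q : R -> Prop) (h : R -> R).

Definition rgerm a (P : R -> Prop) := exists2 b, a < b & forall t, a < t < b -> P t.
Definition lgerm a (P : R -> Prop) := exists2 b, b < a & forall t, b < t < a -> P t.
Definition dset1 (A : R -> Prop) := dpred M (fun e => A (e 0%N)).
Definition dfun1 (h : R -> R) := dfun M (fun e => h (e 0%N)).

Lemma rgermI a P Q : rgerm a P -> rgerm a Q -> rgerm a (fun t => P t /\ Q t).
Proof.
move=> [b ab Pb] [c ac Qc]; exists (Num.min b c); first by rewrite lt_min ab.
by move=> t; rewrite lt_min => /and3P[at_ tb tc]; split; [apply: Pb|apply: Qc]; rewrite at_.
Qed.

Lemma rgermS a P Q : (forall t, P t -> Q t) -> rgerm a P -> rgerm a Q.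
Proof. by move=> PQ [b ab Pb]; exists b => // t /Pb; exact: PQ. Qed.

Lemma lgermS a P Q : (forall t, P t -> Q t) -> lgerm a P -> lgerm a Q.
Proof. by move=> PQ [b ab Pb]; exists b => // t /Pb; exact: PQ. Qed.

Lemma rgerm_itv a b : a < b -> rgerm a (fun t => a < t < b).
Proof. by move=> ab; exists b. Qed.

Lemma rgermN a P : rgerm a P <-> lgerm (- a) (fun t => P (- t)).
Proof.
split => -[b ab Pb]; exists (- b); rewrite ?ltrN2 //; first last.
- by move=> t tab; rewrite -(opprK t); apply: Pb; lra.
- lra.
- by move=> t tab; apply: Pb; lra.
Qed.

(** The o-minimality axiom speaks of subsets of the space of rows with one entry. *)
Lemma dset1_intervals A : dset1 A ->
  exists s : seq (interval R), A = [set x | exists2 J, J \in s & x \in J].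
Proof.
move=> dA.
have : dset M (fun=> [set x : 'rV[R]_1 | A (x 0 0)]).
  by apply: eq_dpred dA => e; rewrite /= mxE.
move/dsetP/definable_dim1 => [s sA]; exists s; apply/seteqP; split => x /= Ax.
  have : [set x : 'rV[R]_1 | A (x 0 0)] (\row__ x) by rewrite /= mxE.
  by rewrite sA /= => -[J Js]; rewrite mxE => xJ; exists J.
case: Ax => J Js xJ.
have : [set x : 'rV[R]_1 | A (x 0 0)] (\row__ x) by rewrite sA; exists J; rewrite ?mxE.
by rewrite /= mxE.
Qed.

Lemma rgerm_interval (J : interval R) a :
  rgerm a (fun t => t \in J) \/ rgerm a (fun t => ~ t \in J).
Proof.
have [h|] := pselect (forall b, a < b -> exists2 t, a < t < b & t \in J).
  have [|y /andP[ay _] yJ] := h (a + 1); first lra.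
  left; exists y => // t /andP[at_ ty]; have [x /andP[ax xt] xJ] := h t at_.
  by apply: (@interval_is_interval _ J x y); rewrite ?(ltW xt) ?(ltW ty).
move=> /existsNP [b /not_implyP [ab nb]]; right; exists b => // t tab tJ.
by apply: nb; exists t.
Qed.

(** By o-minimality a definable property cannot oscillate on the right of a
    point; all the statements about small parameters below rest on this. *)
Lemma germ_dichotomy A a : dset1 A -> rgerm a A \/ rgerm a (fun t => ~ A t).
Proof.
move=> /dset1_intervals [s ->]; elim: s => [|J s IH].
  by right; exists (a + 1); [lra|move=> t _ [J]].
case: (rgerm_interval J a) => [JJ|nJ].
  by left; apply: rgermS JJ => t tJ; exists J; rewrite // mem_head.
case: IH => [IH|IH].
  by left; apply: rgermS IH => t [K Ks tK]; exists K; rewrite // inE Ks orbT.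
right; apply: rgermS (rgermI nJ IH) => t [tJ tK] [K].
by rewrite inE => /orP[/eqP ->|Ks tK2] //; apply: tK; exists K.
Qed.

Lemma dset1N A : dset1 A -> dset1 (fun t => A (- t)).
Proof.
move=> dA; apply: (dpred_subst (P := fun y _ => A y) _ (dfun_opp (dfun_var M 0))).
exact: dA.
Qed.

Lemma lgerm_dichotomy A a : dset1 A -> lgerm a A \/ lgerm a (fun t => ~ A t).
Proof.
move=> /dset1N dA; case: (germ_dichotomy (- a) dA) => /rgermN; rewrite opprK => h.
  by left; apply: lgermS h => t; rewrite opprK.
by right; apply: lgermS h => t; rewrite opprK.
Qed.

Lemma interval_finite_or_open (J : interval R) :
  finite_set [set` J] \/ exists c d, c < d /\ forall t, c < t < d -> t \in J.
Proof.
have [[x [y [xy xJ yJ]]]|h] := pselect (exists x y, [/\ x < y, x \in J & y \in J]).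
  right; exists x, y; split => // t /andP[xt ty].
  by apply: (@interval_is_interval _ J x y); rewrite //= ltW //= ltW.
left; have [[x xJ]|nx] := pselect (exists x, x \in J); last first.
  by apply: (sub_finite_set _ (finite_set0 _)) => x xJ; apply: nx; exists x.
apply: (sub_finite_set _ (finite_set1 x)) => y yJ /=.
by apply: contrapT => /eqP; rewrite neq_lt => /orP[yx|xy]; apply: h;
  [exists y, x|exists x, y].
Qed.

Lemma finite_or_open A : dset1 A ->
  finite_set [set t | A t] \/ exists c d, c < d /\ forall t, c < t < d -> A t.
Proof.
move=> /dset1_intervals [s ->]; elim: s => [|J s IH].
  by left; apply: (sub_finite_set _ (finite_set0 _)) => x [].
case: (interval_finite_or_open J) => [fJ|[c [d [cd cdJ]]]]; last first.
  right; exists c, d; split => // t /cdJ tJ; exists J => //; exact: mem_head.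
case: IH => [fs|[c [d [cd cds]]]]; last first.
  right; exists c, d; split => // t /cds [K Ks tK]; exists K => //.
  by rewrite inE Ks orbT.
left; apply: (sub_finite_set (B := [set` J] `|` [set t | exists2 K, K \in s & t \in K])).
  by move=> t [K]; rewrite inE => /orP[/eqP -> tJ|Ks tK]; [left|right; exists K].
by rewrite finite_setU.
Qed.

(** Real intervals are uncountable, so o-minimality strengthens the Baire
    property: one of countably many definable sets covering an interval is
    infinite, hence contains an interval. *)
Lemma countable_cover (I : countType) (A : I -> R -> Prop) a b : a < b ->
  (forall i, dset1 (A i)) -> (forall t, a < t < b -> exists i, A i t) ->
  exists i c d, [/\ a <= c, c < d, d <= b & forall t, c < t < d -> A i t].
Proof.
move=> ab dA cov; apply: contrapT => h.
have fin i : finite_set [set t | A i t /\ a < t < b].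
  have d : dset1 (fun t => A i t /\ (a < t /\ t < b)).
    apply: dpred_and; first exact: dA.
    by apply: dpred_and; apply: dpred_lt; rewrite ?(dfun_cst, dfun_var) //; 
      [exact: dfun_cst|exact: dfun_var|exact: dfun_var|exact: dfun_cst].
  case: (finite_or_open d) => [|[c [e [ce h2]]]].
    by apply: sub_finite_set => t /= [? /andP[? ?]].
  exfalso; apply: h; exists i, c, e; split => //; last by move=> t /h2 [].
    rewrite leNgt; apply/negP => ca.
    have : c < (c + Num.min a e) / 2 < e by rewrite /Num.min; case: (ltP a e) => ?; lra.
    by move=> /h2 [_ [+ _]]; rewrite /Num.min; case: (ltP a e) => ?; lra.
  rewrite leNgt; apply/negP => be.
  have : c < (e + Num.max b c) / 2 < e by rewrite /Num.max; case: (ltP b c) => ?; lra.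
  by move=> /h2 [_ [_]]; rewrite /Num.max; case: (ltP b c) => ?; lra.
have ctb : countable [set t | a < t < b].
  apply: (sub_countable (B := \bigcup_(i : I) [set t | A i t /\ a < t < b])).
    by apply: subset_card_le => t /= tab; have [i Ai] := cov t tab; exists i.
  apply: bigcup_countable; first exact: countableP.
  by move=> i _; apply: finite_set_countable.
have := countable_lebesgue_measure0 ctb.
have -> : [set t | a < t < b] = `]a, b[%classic by apply/seteqP; split => t; rewrite /= in_itv.
rewrite lebesgue_measure_itv /= lte_fin ab => /eqP.
by rewrite -EFinB eqe subr_eq0 gt_eqF.
Qed.

Lemma dfun1_comp h F : dfun1 h -> dfun M F -> dfun M (fun e => h (F e)).
Proof. by move=> dh dF; exact: (dfun_subst (G := fun y _ => h y) _ dF). Qed.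

Lemma dpred_rgerm (P : R -> env R -> Prop) F :
  dpred M (fun e => P (e 0%N) (fun i => e i.+1)) -> dfun M F ->
  dpred M (fun e => rgerm (F e) (fun s => P s e)).
Proof.
move=> dP dF.
apply: eq_dpred (dpred_ex (P := fun b e => F e < b /\
    forall t, F e < t -> t < b -> P t e) _).
  move=> e; split => -[b]; first by move=> [ab h]; exists b => // t /andP[]; exact: h.
  by move=> ab h; exists b; split => // t ? ?; apply: h; apply/andP.
have dF1 := dfun_ren succn dF.
apply: dpred_and; first exact: dpred_lt dF1 (dfun_var M 0).
apply: (dpred_all (P := fun t e => F (fun i => e i.+1) < t -> t < e 0%N -> P t (fun i => e i.+1))).
apply: dpred_imp; first exact: dpred_lt (dfun_ren succn dF1) (dfun_var M 0).
apply: dpred_imp; first exact: dpred_lt (dfun_var M 0) (dfun_var M 1).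
exact: (dpred_ren (fun i => if i is j.+1 then j.+2 else 0%N) dP).
Qed.

Lemma dpred_lgerm (P : R -> env R -> Prop) F :
  dpred M (fun e => P (e 0%N) (fun i => e i.+1)) -> dfun M F ->
  dpred M (fun e => lgerm (F e) (fun s => P s e)).
Proof.
move=> dP dF.
have := dpred_rgerm (P := fun s e => P (- s) e) (F := fun e => - F e).
move=> h; apply: eq_dpred (h _ (dfun_opp dF)).
  move=> e; split => [/rgermN|H]; last apply/rgermN; rewrite opprK; last first.
    by apply: lgermS H => t; rewrite opprK.
  by apply: lgermS => t; rewrite opprK.
apply: (dpred_subst (P := fun y e => P y (fun i => e i.+1)) _ (dfun_opp (dfun_var M 0))).
exact: (dpred_ren (fun i => if i is j.+1 then j.+2 else 0%N) dP).
Qed.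

(** ** Monotonicity *)

(** If h took a value below h x, consider the infimum i of the places where it
    does. The condition on the left of i gives h x <= h i, and the condition on
    its right contradicts the choice of i. *)
Lemma local_nondecreasing h a b :
  (forall t, a < t < b -> rgerm t (fun s => h t <= h s)) ->
  (forall t, a < t < b -> lgerm t (fun s => h s <= h t)) ->
  forall x y, a < x -> x <= y -> y < b -> h x <= h y.
Proof.
move=> hr hl x y ax xy yb; rewrite leNgt; apply/negP => hyx.
pose B := [set w | x <= w <= y /\ h w < h x].
have iB : has_inf B.
  by split; [exists y; split => //; rewrite xy lexx|exists x => w [/andP[]]].
pose i := inf B.
have xi : x <= i by apply: lb_le_inf; [case: iB|move=> w [/andP[]]].
have iy : i <= y by apply: ge_inf; [case: iB|split; rewrite ?xy ?lexx].
have iab : a < i < b by lra.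
have noB w : x <= w -> w < i -> h x <= h w.
  move=> xw wi; rewrite leNgt; apply/negP => hw.
  have : i <= w by apply: ge_inf; [case: iB|split => //; lra].
  by lra.
have hxi : h x <= h i.
  move: xi; rewrite le_eqVlt => /orP[/eqP <- //|xi].
  have [c ci hc] := hl _ iab.
  have cm : c < (Num.max c x + i) / 2 < i /\ x <= (Num.max c x + i) / 2.
    by rewrite /Num.max; case: (ltP c x) => ?; lra.
  case: cm => cm xm; apply: le_trans (hc _ cm); apply: noB => //; by case/andP: cm.
have [c ic hc] := hr _ iab.
have [w Bw wc] := @inf_adherent _ B (c - i) (ltac:(lra)) iB.
have iw : i <= w by apply: ge_inf; [case: iB|].
case: Bw => _; rewrite ltNge => /negP; apply; apply: le_trans hxi _.
move: iw; rewrite le_eqVlt => /orP[/eqP <- //|iw]; apply: hc; rewrite iw /=.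
by rewrite /i in iw ic wc *; lra.
Qed.

(** Each point would be the unique minimum of h on an interval with rational
    ends, while there are countably many such intervals and uncountably many
    points. *)
Lemma no_strict_min h a b : a < b -> dfun1 h ->
  ~ (forall t, a < t < b ->
      rgerm t (fun s => h t < h s) /\ lgerm t (fun s => h t < h s)).
Proof.
move=> ab dh H.
pose A (i : rat * rat) t := (ratr i.1 < t /\ t < ratr i.2) /\
  forall s, (ratr i.1 < s /\ s < ratr i.2) -> ~ s = t -> h t < h s.
have dA i : dset1 (A i).
  have dc := dfun_cst M; have dv := dfun_var M.
  apply: dpred_and; first by apply: dpred_and; apply: dpred_lt.
  apply: (dpred_all (P := fun s e => (ratr i.1 < s /\ s < ratr i.2) -> ~ s = e 0%N -> h (e 0%N) < h s)).
  apply: dpred_imp; first by apply: dpred_and; apply: dpred_lt.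
  apply: dpred_imp; first by apply: dpred_not; apply: dpred_eq.
  by apply: dpred_lt; apply: dfun1_comp.
have cov t : a < t < b -> exists i, A i t.
  move=> /H [[q tq hq] [p pt hp]].
  have [q' ] := rat_in_itvoo tq; have [p'] := rat_in_itvoo pt.
  rewrite !in_itv /= => /andP[pp' p't] /andP[tq' q'q].
  exists (p', q'); split => //= s [ps sq] /eqP; rewrite neq_lt => /orP[st|ts].
    by apply: hp; lra.
  by apply: hq; lra.
have [i [c [d [ac cd db Ai]]]] := countable_cover ab dA cov.
have [//|[p1 p2] m1] := Ai ((c + c + d) / 3); first lra.
have [//|[q1 q2] m2] := Ai ((c + d + d) / 3); first lra.
have := m1 _ (conj q1 q2); have := m2 _ (conj p1 p2).
move=> /(_ (ltac:(lra))) u /(_ (ltac:(lra))); lra.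
Qed.

Definition monotone_on a b h :=
  (forall x y, a < x -> x <= y -> y < b -> h x <= h y) \/
  (forall x y, a < x -> x <= y -> y < b -> h y <= h x).

(** Two of the three alternatives being definable, the germ is decided by two
    dichotomies. *)
Lemma germ3 a (P Q S : R -> Prop) : dset1 P -> dset1 Q ->
  (forall t, [\/ P t, Q t | S t]) -> [\/ rgerm a P, rgerm a Q | rgerm a S].
Proof.
move=> dP dQ h; case: (germ_dichotomy a dP) => [|nP]; first by constructor 1.
case: (germ_dichotomy a dQ) => [|nQ]; first by constructor 2.
by constructor 3; apply: rgermS (rgermI nP nQ) => t [? ?]; case: (h t).
Qed.

(** On the right of a, the comparison of h t with the values on each side of t is
    constant by the dichotomy. Strict local extrema are impossible, and each other
    case gives a monotone function by a connectedness argument. *)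
Lemma monotonicity_germ h a : dfun1 h -> exists2 b, a < b & monotone_on a b h.
Proof.
move=> dh; have dv := dfun_var M.
have dt c : dset1 (fun s => h c < h s).
  by apply: dpred_lt; [exact: dfun_cst|exact: dh].
have dt' c : dset1 (fun s => h s < h c).
  by apply: dpred_lt; [exact: dh|exact: dfun_cst].
have tri (x y : R) : ~ x < y -> ~ y < x -> x = y.
  by move=> /negP + /negP; rewrite -!leNgt => ? ?; apply: le_anti; apply/andP.
have r3 t : [\/ rgerm t (fun s => h t < h s), rgerm t (fun s => h s < h t)
   | rgerm t (fun s => h s = h t)].
  case: (germ_dichotomy t (dt t)) => [|n1]; first by constructor 1.
  case: (germ_dichotomy t (dt' t)) => [|n2]; first by constructor 2.
  by constructor 3; apply: rgermS (rgermI n1 n2) => s [? ?]; exact: tri.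
have l3 t : [\/ lgerm t (fun s => h t < h s), lgerm t (fun s => h s < h t)
   | lgerm t (fun s => h s = h t)].
  case: (lgerm_dichotomy t (dt t)) => [|[p p1 n1]]; first by constructor 1.
  case: (lgerm_dichotomy t (dt' t)) => [|[q q1 n2]]; first by constructor 2.
  constructor 3; exists (Num.max p q); first by rewrite gt_max p1.
  by move=> s; rewrite gt_max -andbA => /and3P[? ? ?]; apply: tri;
    [apply: n2|apply: n1]; apply/andP.
have dlt : dpred M (fun e => h (e 1%N) < h (e 0%N)).
  by apply: dpred_lt; apply: dfun1_comp.
have dgt : dpred M (fun e => h (e 0%N) < h (e 1%N)).
  by apply: dpred_lt; apply: dfun1_comp.
have R3 := germ3 a
  (dpred_rgerm (P := fun s e => h (e 0%N) < h s) dlt (dv 0%N))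
  (dpred_rgerm (P := fun s e => h s < h (e 0%N)) dgt (dv 0%N)) r3.
have L3 := germ3 a
  (dpred_lgerm (P := fun s e => h (e 0%N) < h s) dlt (dv 0%N))
  (dpred_lgerm (P := fun s e => h s < h (e 0%N)) dgt (dv 0%N)) l3.
have inc : rgerm a (fun t => rgerm t (fun s => h t <= h s)) ->
    rgerm a (fun t => lgerm t (fun s => h s <= h t)) ->
    exists2 b, a < b & monotone_on a b h.
  move=> r l; have [b ab H] := rgermI r l; exists b => //; left.
  by apply: local_nondecreasing => t /H [].
have dec : rgerm a (fun t => rgerm t (fun s => h s <= h t)) ->
    rgerm a (fun t => lgerm t (fun s => h t <= h s)) ->
    exists2 b, a < b & monotone_on a b h.
  move=> r l; have [b ab H] := rgermI r l; exists b => //; right.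
  move=> x y ax xy yb; rewrite -lerN2.
  apply: (local_nondecreasing (h := fun t => - h t)) ax xy yb => t /H [r' l'].
    by apply: rgermS r' => s; rewrite lerN2.
  by apply: lgermS l' => s; rewrite lerN2.
have wl t P Q : (forall s, P s -> Q s) -> rgerm a (fun t => lgerm t P) -> rgerm a (fun t => lgerm t Q).
  by move=> PQ; apply: rgermS => s; apply: lgermS.
have eqw (x y : R) : x = y -> x <= y by move=> ->.
have eqw' (x y : R) : x = y -> y <= x by move=> ->.
case: R3 => r; case: L3 => l.
- exfalso; have [b ab H] := rgermI r l; exact: no_strict_min ab dh H.
- apply: inc; [apply: rgermS r => t|apply: rgermS l => t].
    by apply: rgermS => s; exact: ltW.
  by apply: lgermS => s; exact: ltW.
- apply: inc; [apply: rgermS r => t|apply: rgermS l => t].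
    by apply: rgermS => s; exact: ltW.
  by apply: lgermS => s; exact: eqw.
- apply: dec; [apply: rgermS r => t|apply: rgermS l => t].
    by apply: rgermS => s; exact: ltW.
  by apply: lgermS => s; exact: ltW.
- exfalso; have [b ab H] := rgermI r l.
  apply: (no_strict_min ab (h := fun t => - h t)); first exact: dfun_opp.
  move=> t /H [r' l']; split; [apply: rgermS r'|apply: lgermS l'] => s; by rewrite ltrN2.
- apply: dec; [apply: rgermS r => t|apply: rgermS l => t].
    by apply: rgermS => s; exact: ltW.
  by apply: lgermS => s; exact: eqw'.
- apply: dec; [apply: rgermS r => t|apply: rgermS l => t].
    by apply: rgermS => s; exact: eqw.
  by apply: lgermS => s; exact: ltW.
- apply: inc; [apply: rgermS r => t|apply: rgermS l => t].
    by apply: rgermS => s; exact: eqw'.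
  by apply: lgermS => s; exact: ltW.
- apply: inc; [apply: rgermS r => t|apply: rgermS l => t].
    by apply: rgermS => s; exact: eqw'.
  by apply: lgermS => s; exact: eqw.
Qed.

End OneVariable.

(** * Differentiability of definable functions *)

Section Derivative.
Context (R : realType) (M : ominimal_structure R).
Implicit Types (a b c d s t x y z l : R) (h : R -> R).
Local Notation dset1 := (dset1 M).
Local Notation dfun1 := (dfun1 M).

Definition rslope_ge h t c := rgerm t (fun s => c * (s - t) <= h s - h t).
Definition lslope_ge h t c := lgerm t (fun s => c * (t - s) <= h t - h s).
(** Differentiability with derivative l, with explicit error terms. *)
Definition has_slope h t l := forall e, 0 < e ->
  exists2 d, 0 < d & forall s, `|s| < d -> `|h (t + s) - h t - l * s| <= e * `|s|.
Definition nondec_on a b h := forall x y, a < x -> x <= y -> y < b -> h x <= h y.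

(** The argument of the previous infimum, for s |-> h s - c s; monotonicity of h
    replaces the condition on the left. *)
Lemma rslope_growth h a b c : nondec_on a b h ->
  (forall t, a < t < b -> rslope_ge h t c) ->
  forall x y, a < x -> x <= y -> y < b -> c * (y - x) <= h y - h x.
Proof.
move=> mh hr x y ax xy yb.
pose k s := h s - c * s.
suff : k x <= k y by rewrite /k mulrBr; lra.
have [c0|c0] := leP c 0.
  by have := mh _ _ ax xy yb; have := ler_wnM2l c0 xy; rewrite /k; lra.
rewrite leNgt; apply/negP => kyx.
pose B := [set w | x <= w <= y /\ k w < k x].
have iB : has_inf B.
  by split; [exists y; split => //; rewrite xy lexx|exists x => w [/andP[]]].
pose i := inf B.
have xi : x <= i by apply: lb_le_inf; [case: iB|move=> w [/andP[]]].
have iy : i <= y by apply: ge_inf; [case: iB|split; rewrite ?xy ?lexx].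
have iab : a < i < b by lra.
have noB w : x <= w -> w < i -> k x <= k w.
  move=> xw wi; rewrite leNgt; apply/negP => hw.
  have : i <= w by apply: ge_inf; [case: iB|split => //; lra].
  by lra.
have kxi : k x <= k i.
  move: xi; rewrite le_eqVlt => /orP[/eqP <- //|xi].
  apply/ler_addgt0Pr => e e0.
  pose w := Num.max x (i - e / c).
  have wi : w < i by rewrite gt_max xi /= ltrBlDr ltrDl divr_gt0.
  have xw : x <= w by rewrite le_max lexx.
  have := noB w xw wi; have := mh w i; rewrite /k.
  have : c * (i - w) <= e.
    rewrite -ler_pdivlMl // mulrC; have : i - e / c <= w by rewrite le_max lexx orbT.
    by lra.
  rewrite mulrBr => cw /(_ (ltac:(lra)) (ltW wi) (ltac:(lra))) hw.
  by lra.
have [d id hd] := hr _ iab.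
have [w Bw wc] := @inf_adherent _ B (d - i) (ltac:(lra)) iB.
have iw : i <= w by apply: ge_inf; [case: iB|].
case: Bw => _; rewrite ltNge => /negP; apply; apply: le_trans kxi _.
move: iw; rewrite le_eqVlt => /orP[/eqP <- //|iw].
have /hd : i < w < d by rewrite -/i in wc; lra.
by rewrite /k mulrBr; lra.
Qed.

Lemma lslope_growth h a b c : nondec_on a b h ->
  (forall t, a < t < b -> lslope_ge h t c) ->
  forall x y, a < x -> x <= y -> y < b -> c * (y - x) <= h y - h x.
Proof.
move=> mh hl x y ax xy yb.
have := @rslope_growth (fun s => - h (- s)) (- b) (- a) c _ _ (- y) (- x).
rewrite !opprK => H.
have -> : y - x = - x + y by lra.
have -> : h y - h x = - h x + h y by lra.
apply: H; try lra.
  by move=> u v bu uv va; rewrite lerN2; apply: mh; lra.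
move=> t tab; have [d dt hd] := hl (- t) (ltac:(lra)).
by exists (- d); [lra|move=> s st; have := hd (- s) (ltac:(lra)); lra].
Qed.

Lemma rslope_def h (F G : env R -> R) : dfun1 h -> dfun M F -> dfun M G ->
  dpred M (fun e => rslope_ge h (F e) (G e)).
Proof.
move=> dh dF dG; have dv := dfun_var M.
apply: (dpred_rgerm (P := fun s e => G e * (s - F e) <= h s - h (F e))) => //.
have dF1 := dfun_ren succn dF; have dG1 := dfun_ren succn dG.
apply: dpred_le; first by apply: dfun_mul => //; exact: dfun_sub.
by apply: dfun_sub; apply: dfun1_comp.
Qed.

Lemma lslope_def h (F G : env R -> R) : dfun1 h -> dfun M F -> dfun M G ->
  dpred M (fun e => lslope_ge h (F e) (G e)).
Proof.
move=> dh dF dG; have dv := dfun_var M.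
apply: (dpred_lgerm (P := fun s e => G e * (F e - s) <= h (F e) - h s)) => //.
have dF1 := dfun_ren succn dF; have dG1 := dfun_ren succn dG.
apply: dpred_le; first by apply: dfun_mul => //; exact: dfun_sub.
by apply: dfun_sub; apply: dfun1_comp.
Qed.

Lemma dfun_abs (F : env R -> R) : dfun M F -> dfun M (fun e => `|F e|).
Proof.
move=> dF; apply: eq_dpred (dpred_or
  (dpred_and (dpred_le (dfun_cst M 0) (dfun_ren succn dF))
     (dpred_eq (dfun_ren succn dF) (dfun_var M 0)))
  (dpred_and (dpred_lt (dfun_ren succn dF) (dfun_cst M 0))
     (dpred_eq (dfun_opp (dfun_ren succn dF)) (dfun_var M 0)))) => e.
split => [[[F0 <-]|[F0 <-]]|<-]; first by rewrite ger0_norm.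
  by rewrite ltr0_norm.
by have [F0|F0] := leP 0 (F (fun i => e i.+1)); [left; rewrite ger0_norm|right; rewrite ltr0_norm].
Qed.

Lemma has_slope_def h (F G : env R -> R) : dfun1 h -> dfun M F -> dfun M G ->
  dpred M (fun e => has_slope h (F e) (G e)).
Proof.
move=> dh dF dG; have dv := dfun_var M; have dc := dfun_cst M.
apply: (dpred_all (P := fun z e => 0 < z -> exists2 d, 0 < d & forall s, `|s| < d ->
  `|h (F e + s) - h (F e) - G e * s| <= z * `|s|)).
apply: dpred_imp; first exact: dpred_lt.
apply: eq_dpred (dpred_ex (P := fun d e => 0 < d /\ forall s, `|s| < d ->
  `|h (F (fun i => e i.+1) + s) - h (F (fun i => e i.+1)) - G (fun i => e i.+1) * s|
     <= e 0%N * `|s|) _).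
  by move=> e; split => [[d [? ?]]|[d ? ?]]; exists d.
apply: dpred_and; first exact: dpred_lt.
apply: (dpred_all (P := fun s e => `|s| < e 0%N ->
  `|h (F (fun i => e i.+2) + s) - h (F (fun i => e i.+2)) - G (fun i => e i.+2) * s|
     <= e 1%N * `|s|)).
have dF3 := dfun_ren (fun i => i.+3) dF; have dG3 := dfun_ren (fun i => i.+3) dG.
apply: dpred_imp; first by apply: dpred_lt => //; exact: dfun_abs.
apply: dpred_le; last by apply: dfun_mul => //; exact: dfun_abs.
apply/dfun_abs/dfun_sub; last exact: dfun_mul.
by apply: dfun_sub; apply: dfun1_comp => //; exact: dfun_add.
Qed.

Lemma slope_ge_downr h t c c' : c' <= c -> rslope_ge h t c -> rslope_ge h t c'.
Proof.
move=> cc' [d td hd]; exists d => // s /[dup] /hd H /andP[ts _].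
by apply: le_trans H; rewrite ler_wpM2r // subr_ge0 ltW.
Qed.

Lemma slope_ge_downl h t c c' : c' <= c -> lslope_ge h t c -> lslope_ge h t c'.
Proof.
move=> cc' [d td hd]; exists d => // s /[dup] /hd H /andP[_ ts].
by apply: le_trans H; rewrite ler_wpM2r // subr_ge0 ltW.
Qed.

Lemma rslopeN h t c : dfun1 h -> ~ rslope_ge h t c ->
  rgerm t (fun s => h s - h t < c * (s - t)).
Proof.
move=> dh; have dv := dfun_var M; have dc := dfun_cst M.
case: (@germ_dichotomy _ M (fun s => c * (s - t) <= h s - h t) t).
- apply: dpred_le; first by apply: dfun_mul => //; exact: dfun_sub.
  exact: dfun_sub.
- by [].
- by move=> g _; apply: rgermS g => s /negP; rewrite -ltNge.
Qed.

Lemma lslopeN h t c : dfun1 h -> ~ lslope_ge h t c ->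
  lgerm t (fun s => h t - h s < c * (t - s)).
Proof.
move=> dh; have dv := dfun_var M; have dc := dfun_cst M.
case: (@lgerm_dichotomy _ M (fun s => c * (t - s) <= h t - h s) t).
- apply: dpred_le; first by apply: dfun_mul => //; exact: dfun_sub.
  exact: dfun_sub.
- by [].
- by move=> g _; apply: lgermS g => s /negP; rewrite -ltNge.
Qed.

(** The dichotomy turns the failure of a lower bound for difference quotients
    into an upper bound near t. *)
Lemma lslope_rslope_slope h t l : dfun1 h ->
  (forall c, c < l -> rslope_ge h t c /\ lslope_ge h t c) ->
  (forall c, l < c -> ~ rslope_ge h t c /\ ~ lslope_ge h t c) -> has_slope h t l.
Proof.
move=> dh lo up e e0.
have [[p1 tp1 hp1] [q1 tq1 hq1]] := lo (l - e) (ltac:(lra)).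
have [/(rslopeN dh) [p2 tp2 hp2] /(lslopeN dh) [q2 tq2 hq2]] := up (l + e) (ltac:(lra)).
exists (Num.min (Num.min (p1 - t) (p2 - t)) (Num.min (t - q1) (t - q2))).
  by rewrite !lt_min !subr_gt0 tp1 tp2 tq1.
move=> s; rewrite !lt_min => /andP[/andP[s1 s2] /andP[s3 s4]].
have [s0|s0|->] := ltgtP s 0; last by rewrite addr0 subrr sub0r mulr0 normrN normr0 mulr0.
  rewrite ltr0_norm // in s3 s4 *.
  have := hq1 (t + s) (ltac:(lra)); have := hq2 (t + s) (ltac:(lra)).
  by move=> u1 u2; rewrite ler_norml; lra.
rewrite gtr0_norm // in s1 s2 *.
have := hp1 (t + s) (ltac:(lra)); have := hp2 (t + s) (ltac:(lra)).
by move=> u1 u2; rewrite ler_norml; lra.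
Qed.

(** If h had no derivative on the interval, then either one of the one-sided slopes
    would be infinite on an interval, or, by the covering lemma, two rational
    numbers would separate the one-sided slopes on an interval. Growth estimates
    exclude both. *)
Lemma slope_exists_nondec h a b : dfun1 h -> a < b -> nondec_on a b h ->
  exists t, a < t < b /\ exists l, has_slope h t l.
Proof.
move=> dh ab mh; apply: contrapT => nosl.
have dv := dfun_var M; have dc := dfun_cst M.
have rs0 t : a < t < b -> rslope_ge h t 0.
  move=> tab; exists b; first lra.
  by move=> s ts; rewrite mul0r subr_ge0; apply: mh; lra.
have ls0 t : a < t < b -> lslope_ge h t 0.
  move=> tab; exists a; first lra.
  by move=> s ts; rewrite mul0r subr_ge0; apply: mh; lra.
have grow_inf x y : a < x -> x < y -> y < b -> ~ (forall c, c * (y - x) <= h y - h x).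
  move=> ax xy yb /(_ ((h y - h x + 1) / (y - x))).
  by rewrite mulfVK ?subr_eq0 ?gt_eqF //; lra.
have [b1 ab1 rfin] : rgerm a (fun t => ~ forall c, rslope_ge h t c).
  have d : dset1 (fun t => forall c, rslope_ge h t c).
    apply: (dpred_all (P := fun c e => rslope_ge h (e 0%N) c)).
    exact: rslope_def.
  case: (germ_dichotomy a d) => // -[b1 ab1 h1]; exfalso.
  pose m := Num.min b b1; have [mb mb1 am] : [/\ m <= b, m <= b1 & a < m].
    by rewrite /m !ge_min !lexx orbT lt_min ab.
  apply: (@grow_inf ((a + a + m) / 3) ((a + m + m) / 3)); try lra.
  move=> c; apply: (@rslope_growth h a m c); try lra.
    by move=> x y ax xy ym; apply: mh => //; lra.
  by move=> t tam; apply: h1; lra.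
have [b2 ab2 lfin] : rgerm a (fun t => ~ forall c, lslope_ge h t c).
  have d : dset1 (fun t => forall c, lslope_ge h t c).
    apply: (dpred_all (P := fun c e => lslope_ge h (e 0%N) c)).
    exact: lslope_def.
  case: (germ_dichotomy a d) => // -[b2 ab2 h1]; exfalso.
  pose m := Num.min b b2; have [mb mb1 am] : [/\ m <= b, m <= b2 & a < m].
    by rewrite /m !ge_min !lexx orbT lt_min ab.
  apply: (@grow_inf ((a + a + m) / 3) ((a + m + m) / 3)); try lra.
  move=> c; apply: (@lslope_growth h a m c); try lra.
    by move=> x y ax xy ym; apply: mh => //; lra.
  by move=> t tam; apply: h1; lra.
pose m := Num.min b (Num.min b1 b2).
have [mb mb1 mb2 am] : [/\ m <= b, m <= b1, m <= b2 & a < m].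
  by rewrite /m !ge_min !lexx !orbT !lt_min ab ab1.
(* rational numbers p < q between the two one-sided slopes at t; the flag tells
   which of the slopes is the larger one *)
pose A (i : bool * (rat * rat)) t :=
  if i.1 then rslope_ge h t (ratr i.2.2) /\ ~ lslope_ge h t (ratr i.2.1)
  else lslope_ge h t (ratr i.2.2) /\ ~ rslope_ge h t (ratr i.2.1).
pose A' i t := ((ratr i.2.1 : R) < ratr i.2.2) /\ A i t.
have dA i : dset1 (A' i).
  apply: dpred_and; first exact: dpred_cst.
  case: i => -[] [p q]; apply: dpred_and; try exact: rslope_def; try exact: lslope_def.
    by apply: dpred_not; exact: lslope_def.
  by apply: dpred_not; exact: rslope_def.
have cov t : a < t < m -> exists i, A' i t.
  move=> tam; apply: contrapT => nA; apply: nosl.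
  have tab : a < t < b by lra.
  exists t; split => //.
  have : ~ forall c, rslope_ge h t c by apply: rfin; lra.
  move/existsNP => [u nu].
  pose C := [set c | rslope_ge h t c].
  have uC : ubound C u.
    move=> c Cc; rewrite leNgt; apply/negP => uc; apply: nu; exact: slope_ge_downr (ltW uc) Cc.
  have sC : has_sup C by split; [exists 0; exact: rs0|exists u].
  exists (sup C).
  have rlo c : c < sup C -> rslope_ge h t c.
    move=> cs; have [c' Cc' cc'] := sup_gt (proj1 sC) cs.
    exact: slope_ge_downr (ltW cc') Cc'.
  have rup c : sup C < c -> ~ rslope_ge h t c.
    by move=> sc Cc; have := ub_le_sup (proj2 sC) Cc; lra.
  apply: lslope_rslope_slope => // c cl; split.
  - exact: rlo.
  - apply: contrapT => nl; apply: nA.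
    have [p /[!in_itv] /= /andP[cp pl]] := rat_in_itvoo cl.
    have [q /[!in_itv] /= /andP[pq ql]] := rat_in_itvoo pl.
    exists (true, (p, q)); split => //=; split; first exact: rlo.
    by move=> l; apply: nl; exact: slope_ge_downl (ltW cp) l.
  - exact: rup.
  - move=> l; apply: nA.
    have [p /[!in_itv] /= /andP[cp pl]] := rat_in_itvoo cl.
    have [q /[!in_itv] /= /andP[pq ql]] := rat_in_itvoo pl.
    exists (false, (p, q)); split => //=; split; last exact: rup.
    exact: slope_ge_downl (ltW ql) l.
have [[bb [p q]] [c [d [ac cd dm Acd]]]] := countable_cover am dA cov.
have md : nondec_on c d h by move=> x y cx xy yd; apply: mh => //; lra.
have mid : c < (c + d) / 2 < d by lra.
have [/= pq _] := Acd _ mid.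
case: bb Acd => Acd.
  have g := @rslope_growth h c d (ratr q) md (fun t tcd => proj1 (proj2 (Acd t tcd))).
  have [_ [_ /=]] := Acd _ mid; apply; apply: (slope_ge_downl (ltW pq)).
  exists c; first lra.
  by move=> s sc; apply: g; lra.
have g := @lslope_growth h c d (ratr q) md (fun t tcd => proj1 (proj2 (Acd t tcd))).
have [_ [_ /=]] := Acd _ mid; apply; apply: (slope_ge_downr (ltW pq)).
exists d; first lra.
by move=> s sc; apply: g; lra.
Qed.

Lemma has_slopeN h t l : has_slope h t l -> has_slope (fun s => - h s) t (- l).
Proof.
move=> hl e /hl [d d0 H]; exists d => // s /H; rewrite -normrN.
by congr (`|_| <= _); lra.
Qed.

Lemma slope_exists h a b : dfun1 h -> a < b ->
  exists t, a < t < b /\ exists l, has_slope h t l.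
Proof.
move=> dh ab; have [c ac [mh|mh]] := monotonicity_germ a dh.
  have am : a < Num.min b c by rewrite lt_min ab.
  have [|t [+ hl]] := @slope_exists_nondec h a (Num.min b c) dh am.
    by move=> x y ax xy; rewrite lt_min => /andP[_]; exact: mh.
  by rewrite lt_min => /andP[at_ /andP[tb _]]; exists t; rewrite at_.
have am : a < Num.min b c by rewrite lt_min ab.
have [|t [+ [l hl]]] := @slope_exists_nondec (fun s => - h s) a (Num.min b c) (dfun_opp dh) am.
  by move=> x y ax xy; rewrite lt_min lerN2 => /andP[_]; exact: mh.
rewrite lt_min => /andP[at_ /andP[tb _]]; exists t; rewrite at_ tb; split => //.
exists (- l); have := has_slopeN hl; congr has_slope.
by apply: funext => s; rewrite opprK.
Qed.

Lemma has_slope_unique h t l l' : has_slope h t l -> has_slope h t l' -> l = l'.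
Proof.
move=> hl hl'; apply: contrapT => /eqP; rewrite -subr_eq0 -normr_gt0 => n0.
pose e := `|l - l'| / 4; have e0 : 0 < e by rewrite divr_gt0.
have [d d0 hd] := hl e e0; have [d' d'0 hd'] := hl' e e0.
pose s := Num.min d d' / 2.
have m0 : 0 < Num.min d d' by rewrite lt_min d0.
have s0 : 0 < s by rewrite divr_gt0.
have sd : `|s| < d.
  have mm : Num.min d d' <= d by rewrite ge_min lexx.
  by rewrite gtr0_norm // /s; lra.
have sd' : `|s| < d'.
  have mm : Num.min d d' <= d' by rewrite ge_min lexx orbT.
  by rewrite gtr0_norm // /s; lra.
have := ler_normD (h (t + s) - h t - l' * s) (- (h (t + s) - h t - l * s)).
have -> : h (t + s) - h t - l' * s - (h (t + s) - h t - l * s) = (l - l') * s by ring.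
rewrite normrN normrM.
move: (hd s sd) (hd' s sd') => u v w.
have : `|l - l'| * `|s| <= 2 * e * `|s| by lra.
rewrite ler_pM2r ?normr_gt0 ?gt_eqF // /e; lra.
Qed.

Definition slope h t := if pselect (exists l, has_slope h t l) is left hl
  then projT1 (cid hl) else 0.

Lemma slopeP h t l : has_slope h t l -> has_slope h t (slope h t).
Proof.
by move=> hl; rewrite /slope; case: pselect => [h'|[]]; [case: cid|exists l].
Qed.

Lemma slope_def h : dfun1 h -> dfun1 (slope h).
Proof.
move=> dh; have dv := dfun_var M.
apply: (@eq_dpred _ _ (fun e => has_slope h (e 1%N) (e 0%N) \/
   (~ (exists l, has_slope h (e 1%N) l) /\ e 0%N = 0))).
  move=> e; rewrite /slope; case: pselect => [hl|nl]; split.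
  - case=> [H|[/(_ hl) []]]; case: cid => l H' /=; exact: has_slope_unique H' H.
  - by case: cid => l H' /= <-; left.
  - by case=> [H|[_ ->]//]; case: nl; exists (e 0%N).
  - by move=> <-; right.
apply: dpred_or; first exact: has_slope_def.
apply: dpred_and; last by apply: dpred_eq => //; exact: dfun_cst.
apply: dpred_not; apply: (dpred_ex (P := fun l e => has_slope h (e 1%N) l)).
exact: has_slope_def.
Qed.

Lemma slope_germ h a : dfun1 h -> rgerm a (fun t => has_slope h t (slope h t)).
Proof.
move=> dh; have dv := dfun_var M.
have d : dset1 (fun t => has_slope h t (slope h t)).
  by apply: has_slope_def => //; exact: slope_def.
case: (germ_dichotomy a d) => // -[b ab H].
by have [t [tab [l hl]]] := slope_exists dh ab; case: (H t tab); exact: slopeP hl.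
Qed.

Lemma has_slope_rslope_ge h t l c : has_slope h t l -> c < l -> rslope_ge h t c.
Proof.
move=> hl cl; have [d d0 hd] := hl (l - c) (ltac:(lra)).
exists (t + d); first lra.
move=> s st; have := hd (s - t); rewrite gtr0_norm; last lra.
have -> : t + (s - t) = s by ring.
by move=> /(_ (ltac:(lra))); rewrite ler_norml => /andP[+ _]; lra.
Qed.

(** A mean value inequality, from the growth estimate for all smaller rates. *)
Lemma slope_growth h a b c : nondec_on a b h ->
  (forall t, a < t < b -> exists2 l, has_slope h t l & c <= l) ->
  forall x y, a < x -> x <= y -> y < b -> c * (y - x) <= h y - h x.
Proof.
move=> mh hl x y ax xy yb; apply/ler_addgt0Pr => e e0.
move: xy; rewrite le_eqVlt => /orP[/eqP <-|xy]; first by rewrite !subrr mulr0; lra.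
have yx0 : 0 < y - x by lra.
have := @rslope_growth h a b (c - e / (y - x)) mh _ x y ax (ltW xy) yb.
have -> : (c - e / (y - x)) * (y - x) = c * (y - x) - e by field; lra.
move=> H; rewrite -lerBlDr; apply: H => t /hl [l h1 cl].
have e1 : 0 < e / (y - x) by rewrite divr_gt0.
by apply: has_slope_rslope_ge h1 _; lra.
Qed.

Lemma nondec_slope_ge0 h a b t l : nondec_on a b h -> a < t < b ->
  has_slope h t l -> 0 <= l.
Proof.
move=> mh tab hl; rewrite leNgt; apply/negP => l0.
have [d d0 hd] := hl (- l / 2) (ltac:(lra)).
pose s := Num.min d (b - t) / 2.
have m0 : 0 < Num.min d (b - t) by rewrite lt_min d0 /=; lra.
have s0 : 0 < s by rewrite divr_gt0.
have [sd sb] : s < d /\ s < b - t.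
  have : Num.min d (b - t) <= d by rewrite ge_min lexx.
  have : Num.min d (b - t) <= b - t by rewrite ge_min lexx orbT.
  by rewrite /s; lra.
have := hd s; rewrite gtr0_norm // => /(_ sd); rewrite ler_norml => /andP[_ H].
have := mh t (t + s) (ltac:(lra)) (ltac:(lra)) (ltac:(lra)).
have ls : l * s < 0 by rewrite pmulr_llt0.
by lra.
Qed.

(** Up to a constant, the sums bound the integral on (0, 1] of a function that is
    bounded by w k on the dyadic band of index k. *)
Definition dyadic_summable (w : nat -> R) :=
  exists B, forall n, \sum_(k < n) w k / 2 ^+ k <= B.

Definition on_band A (k : nat) t := A / 2 ^+ k.+2 <= t <= A / 2 ^+ k.

(** Integrability at 0 of the derivative of a bounded monotone function, in
    the discrete form that dyadic bands require. *)
Lemma band_slope_nondec h b C : nondec_on 0 b h -> monotone_on 0 b (slope h) ->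
  (forall t, 0 < t < b -> has_slope h t (slope h t)) ->
  (forall t, 0 < t < b -> `|h t| <= C) ->
  forall A, 0 < A < b -> exists w, [/\ forall k, 0 <= w k, dyadic_summable w &
    forall k t, on_band A k t -> `|slope h t| <= w k].
Proof.
move=> mh ms sl hC A A0b.
have p2 k : 0 < (2 : R) ^+ k by rewrite exprn_gt0.
have p2i k : 0 < ((2 : R) ^+ k)^-1 by rewrite invr_gt0.
have p2S k : ((2 : R) ^+ k.+1)^-1 = (2 ^+ k)^-1 / 2 by rewrite exprS invfM mulrC.
have p2le k : ((2 : R) ^+ k)^-1 <= 1 by rewrite invf_le1 // exprn_ege1 // ler1n.
have band0 k : 0 < A / 2 ^+ k <= A.
  by rewrite mulr_gt0 //= ?ler_piMr //; lra.
have s0 t : 0 < t < b -> 0 <= slope h t.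
  by move=> tb; apply: nondec_slope_ge0 mh tb (sl t tb).
have inb k t : on_band A k t -> 0 < t <= A.
  move=> /andP[t1 t2]; have := band0 k; have := band0 k.+2; lra.
case: ms => ms.
  exists (fun=> slope h A); split.
  - by move=> k; apply: s0; lra.
  - exists (2 * slope h A) => n.
    have -> : \sum_(k < n) slope h A / 2 ^+ k = slope h A * (2 - 2 / 2 ^+ n).
      elim: n => [|n IH]; first by rewrite big_ord0 expr0 divr1 subrr mulr0.
      by rewrite big_ord_recr /= IH p2S; field; exact: lt0r_neq0.
    rewrite mulrC ler_wpM2r //; first by apply: s0; lra.
    by have := p2i n; lra.
  - move=> k t /inb tA; rewrite ger0_norm; last by apply: s0; lra.
    by apply: ms; lra.
exists (fun k => slope h (A / 2 ^+ k.+2)); split.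
- by move=> k; apply: s0; have := band0 k.+2; lra.
- exists (8 / A * (C + C)) => n.
  have step k : slope h (A / 2 ^+ k.+2) / 2 ^+ k <=
     8 / A * (h (A / 2 ^+ k.+2) - h (A / 2 ^+ k.+3)).
    have bk := band0 k.+2; have bk' := band0 k.+3.
    have e3 : A / 2 ^+ k.+3 = (A / 2 ^+ k.+2) / 2 by rewrite p2S; lra.
    have := @slope_growth h 0 (A / 2 ^+ k.+2) (slope h (A / 2 ^+ k.+2)) _ _.
    have g : forall y, A / 2 ^+ k.+3 <= y -> y < A / 2 ^+ k.+2 ->
       slope h (A / 2 ^+ k.+2) * (y - A / 2 ^+ k.+3) <= h y - h (A / 2 ^+ k.+3).
      move=> y y1 y2.
      apply: (@slope_growth h 0 (A / 2 ^+ k.+2)); try lra.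
        by move=> u v u0 uv v0; apply: mh; lra.
      move=> t t1; exists (slope h t); first by apply: sl; lra.
      by apply: ms; lra.
    move=> _.
    have H : slope h (A / 2 ^+ k.+2) * (A / 2 ^+ k.+2 - A / 2 ^+ k.+3) <=
        h (A / 2 ^+ k.+2) - h (A / 2 ^+ k.+3).
      have [sz|s1] := eqVneq (slope h (A / 2 ^+ k.+2)) 0.
        by rewrite sz mul0r subr_ge0; apply: mh; lra.
      have s2 : 0 < slope h (A / 2 ^+ k.+2) by rewrite lt_neqAle eq_sym s1 s0 //; lra.
      apply/ler_addgt0Pr => e e1.
      pose y := Num.max (A / 2 ^+ k.+3) (A / 2 ^+ k.+2 - e / slope h (A / 2 ^+ k.+2)).
      have e2 : 0 < e / slope h (A / 2 ^+ k.+2) by rewrite divr_gt0.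
      have y1 : A / 2 ^+ k.+3 <= y by rewrite le_max lexx.
      have y2 : y < A / 2 ^+ k.+2 by rewrite gt_max; lra.
      have y3 : A / 2 ^+ k.+2 - e / slope h (A / 2 ^+ k.+2) <= y by rewrite le_max lexx orbT.
      have := g y y1 y2; have := mh y (A / 2 ^+ k.+2) (ltac:(lra)) (ltac:(lra)) (ltac:(lra)).
      have : slope h (A / 2 ^+ k.+2) * (A / 2 ^+ k.+2 - y) <= e.
        by rewrite -ler_pdivlMl // [_^-1 * e]mulrC; lra.
      by rewrite !mulrBr; lra.
    have A0 : 0 < A by lra.
    have -> : slope h (A / 2 ^+ k.+2) / 2 ^+ k =
        8 / A * (slope h (A / 2 ^+ k.+2) * (A / 2 ^+ k.+2 - A / 2 ^+ k.+3)).
      by rewrite e3 !p2S; field; rewrite !lt0r_neq0.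
    by rewrite ler_wpM2l // divr_ge0 // ltW.
  apply: (@le_trans _ _ (\sum_(k < n) 8 / A * (h (A / 2 ^+ k.+2) - h (A / 2 ^+ k.+3)))).
    by apply: ler_sum => k _; exact: step.
  rewrite -mulr_sumr ler_wpM2l //; first by rewrite divr_ge0 //; lra.
  have -> : \sum_(k < n) (h (A / 2 ^+ k.+2) - h (A / 2 ^+ k.+3)) = h (A / 2 ^+ 2) - h (A / 2 ^+ n.+2).
    elim: n => [|n IH]; first by rewrite big_ord0 subrr.
    by rewrite big_ord_recr /= IH; lra.
  have := hC (A / 2 ^+ 2); have := hC (A / 2 ^+ n.+2).
  have := band0 2%N; have := band0 n.+2.
  move=> ? ? /(_ (ltac:(lra))) + /(_ (ltac:(lra))).
  by rewrite !ler_norml => /andP[? ?] /andP[? ?]; lra.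
- move=> k t kt; have tA := inb k t kt; rewrite ger0_norm; last by apply: s0; lra.
  by case/andP: kt => t1 t2; apply: ms => //; have := band0 k.+2; lra.
Qed.

Lemma slopeN h t l : has_slope h t l -> slope (fun s => - h s) t = - slope h t.
Proof.
move=> /slopeP hl; apply: has_slope_unique (has_slopeN hl).
exact: slopeP (has_slopeN hl).
Qed.

(** The function and its derivative are both monotone near 0, so the previous
    estimate applies after a change of sign. *)
Lemma band_slope h b C : dfun1 h -> 0 < b -> (forall t, 0 < t < b -> `|h t| <= C) ->
  exists2 b', 0 < b' & 
  (forall t, 0 < t < b' -> has_slope h t (slope h t)) /\
  forall A, 0 < A < b' -> exists w, [/\ forall k, 0 <= w k, dyadic_summable w &
    forall k t, on_band A k t -> `|slope h t| <= w k].
Proof.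
move=> dh b0 hC.
have [b1 b10 m1] := monotonicity_germ 0 dh.
have [b2 b20 m2] := monotonicity_germ 0 (slope_def dh).
have [b3 b30 m3] := slope_germ 0 dh.
pose m := Num.min (Num.min b b1) (Num.min b2 b3).
have [mb mb1 mb2 mb3] : [/\ m <= b, m <= b1, m <= b2 & m <= b3].
  by rewrite /m !ge_min !lexx !orbT.
have m0 : 0 < m by rewrite /m !lt_min b0 b10 b20.
exists m => //; split => [t tm|]; first by apply: m3; lra.
have sl t : 0 < t < m -> has_slope h t (slope h t) by move=> tm; apply: m3; lra.
have hC' t : 0 < t < m -> `|h t| <= C by move=> tm; apply: hC; lra.
have ms : monotone_on 0 m (slope h).
  by case: m2 => m2; [left|right] => x y x0 xy ym; apply: m2 => //; lra.
case: m1 => m1.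
  apply: band_slope_nondec hC' => // x y x0 xy ym; apply: m1 => //; lra.
move=> A Am.
have slN t : 0 < t < m -> slope (fun s => - h s) t = - slope h t.
  by move=> tm; exact: slopeN (sl t tm).
have [||||w [w0 ws wk]] := @band_slope_nondec (fun s => - h s) m C _ _ _ _ A Am.
- by move=> x y x0 xy ym; rewrite lerN2; apply: m1 => //; lra.
- case: ms => ms; [right|left] => x y x0 xy ym; rewrite !slN ?lerN2; try lra; exact: ms.
- by move=> t tm; rewrite slN //; exact/has_slopeN/sl.
- by move=> t tm; rewrite normrN; exact: hC'.
exists w; split => // k t kt; rewrite -normrN -slN; first exact: wk.
have p2 j : 0 < (2 : R) ^+ j by rewrite exprn_gt0.
case/andP: kt => t1 t2.
have : 0 < A / 2 ^+ k.+2 by rewrite divr_gt0 //; lra.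
have : A / 2 ^+ k <= A by rewrite ler_pdivrMr // ler_peMr ?exprn_ege1 ?ler1n //; lra.
lra.
Qed.

End Derivative.

(** * Definable choice *)

Section Choice.
Context (R : realType) (M : ominimal_structure R).
Implicit Types (a b c d s t x y z l : R) (P : R -> R -> Prop).
Local Notation dset1 := (dset1 M).
Local Notation dfun1 := (dfun1 M).

Definition drel P := dpred M (fun e => P (e 1%N) (e 0%N)).

Lemma drel_app P (F G : env R -> R) : drel P -> dfun M F -> dfun M G ->
  dpred M (fun e => P (F e) (G e)).
Proof.
move=> dP dF dG.
apply: (dpred_subst (P := fun y e => P y (G e)) _ dF).
apply: (dpred_subst (P := fun y e => P (e 0%N) y) _ (dfun_ren succn dG)).
exact: dP.
Qed.

Definition is_min P t y := P t y /\ forall z, P t z -> y <= z.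
Definition first_gap P t a c := a < c /\ (forall z, z <= a -> ~ P t z) /\
  (forall z, a < z -> z < c -> P t z) /\
  forall c', c < c' -> ~ forall z, a < z -> z < c' -> P t z.
(** A least element if there is one, else the middle of the first interval; this
    rule can be expressed by a formula. *)
Definition selected P t y := is_min P t y \/
  (~ (exists m, is_min P t m) /\ exists a c, y + y = a + c /\ first_gap P t a c).

Lemma selected_def P : drel P -> drel (selected P).
Proof.
move=> dP; have dv := dfun_var M.
have dm (i j : nat) : dpred M (fun e => is_min P (e i) (e j)).
  apply: dpred_and; first exact: drel_app.
  apply: (dpred_all (P := fun z e => P (e i) z -> e j <= z)).
  by apply: dpred_imp; [exact: drel_app|exact: dpred_le].
apply: dpred_or; first exact: dm.
apply: dpred_and.
  by apply: dpred_not; apply: (dpred_ex (P := fun m e => is_min P (e 1%N) m)); exact: dm.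
apply: (dpred_ex (P := fun a e => exists c, e 0%N + e 0%N = a + c /\ first_gap P (e 1%N) a c)).
apply: (dpred_ex (P := fun c e => e 1%N + e 1%N = e 0%N + c /\ first_gap P (e 2%N) (e 0%N) c)).
apply: dpred_and; first by apply: dpred_eq; exact: dfun_add.
apply: dpred_and; first exact: dpred_lt.
apply: dpred_and.
  apply: (dpred_all (P := fun z e => z <= e 1%N -> ~ P (e 3%N) z)).
  by apply: dpred_imp; [exact: dpred_le|apply: dpred_not; exact: drel_app].
apply: dpred_and.
  apply: (dpred_all (P := fun z e => e 1%N < z -> z < e 0%N -> P (e 3%N) z)).
  apply: dpred_imp; first exact: dpred_lt.
  by apply: dpred_imp; [exact: dpred_lt|exact: drel_app].
apply: (dpred_all (P := fun c e => e 0%N < c -> ~ forall z, e 1%N < z -> z < c -> P (e 3%N) z)).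
apply: dpred_imp; first exact: dpred_lt.
apply: dpred_not; apply: (dpred_all (P := fun z e => e 2%N < z -> z < e 0%N -> P (e 4%N) z)).
apply: dpred_imp; first exact: dpred_lt.
by apply: dpred_imp; [exact: dpred_lt|exact: drel_app].
Qed.

Lemma selected_sub P t y : selected P t y -> P t y.
Proof.
move=> [[] //|[_ [a [c [yac [ac [_ [h _]]]]]]]]; apply: h; lra.
Qed.

Lemma selected_unique P t y y' : selected P t y -> selected P t y' -> y = y'.
Proof.
move=> [[Py my]|[nm [a [c [yac [ac [an [acP cm]]]]]]]].
  move=> [[Py' my']|[nm _]]; last by case: nm; exists y.
  by apply: le_anti; rewrite my //= my'.
move=> [h|[_ [a' [c' [yac' [ac' [an' [acP' cm']]]]]]]]; first by case: nm; exists y'.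
have aa u v w : (forall z, z <= u -> ~ P t z) -> v < w ->
    (forall z, v < z -> z < w -> P t z) -> u <= v.
  move=> nu vw Pvw; rewrite leNgt; apply/negP => vu.
  pose m := Num.min u ((v + w) / 2).
  have [mu mw vm] : [/\ m <= u, m <= (v + w) / 2 & v < m].
    by rewrite /m !ge_min !lexx orbT lt_min vu; split => //; lra.
  by apply: nu mu _; apply: Pvw => //; lra.
have ea : a = a' by apply: le_anti; rewrite (aa _ _ _ an ac' acP') (aa _ _ _ an' ac acP).
subst a'; suff : c = c' by move=> ec; subst c'; lra.
apply: contrapT => /eqP; rewrite neq_lt => /orP[cc|cc]; first exact: cm cc acP'.
exact: cm' cc acP.
Qed.

(** Next to the infimum of the values, the dichotomy leaves either a least value or
    an interval of values that starts there. *)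
Lemma selected_exists P t : drel P -> (exists B, forall y, P t y -> `|y| <= B) ->
  (exists y, P t y) -> exists y, selected P t y.
Proof.
move=> dP [B PB] [y0 Py0]; have [hm|nm] := pselect (exists m, is_min P t m).
  by have [m hm'] := hm; exists m; left.
pose A := [set z | P t z].
have iA : has_inf A.
  split; first by exists y0.
  by exists (- B) => z /PB; rewrite ler_norml => /andP[].
pose a := inf A.
have lba z : P t z -> a <= z by move=> Pz; apply: ge_inf => //; case: iA.
have nPa : ~ P t a by move=> Pa; apply: nm; exists a.
have an z : z <= a -> ~ P t z.
  move=> za Pz; apply: nPa; suff -> : a = z by [].
  by apply: le_anti; rewrite za lba.
have dA : dset1 (P t).
  by apply: drel_app => //; [exact: dfun_cst|exact: dfun_var].
have [c0 ac0 Pc0] : rgerm a (P t).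
  case: (germ_dichotomy a dA) => // -[b ab nP]; exfalso.
  have [w Pw wb] := @inf_adherent _ A (b - a) (ltac:(lra)) iA.
  have := lba w Pw; rewrite le_eqVlt => /orP[/eqP e|aw]; first by apply: nPa; rewrite e.
  by apply: nP Pw; rewrite -/a in wb; lra.
pose C := [set c | a < c /\ forall z, a < z -> z < c -> P t z].
have sC : has_sup C.
  split; first by exists c0; split => // z az zc; apply: Pc0; rewrite az.
  exists B => c [ac hc]; rewrite leNgt; apply/negP => Bc.
  pose m := Num.max ((a + c) / 2) ((B + c) / 2).
  have [ma mB mc] : [/\ (a + c) / 2 <= m, (B + c) / 2 <= m & m < c].
    by rewrite /m !le_max !lexx orbT gt_max; split => //; apply/andP; lra.
  have Pm : P t m by apply: hc; lra.
  have := PB _ Pm; rewrite ler_norml => /andP[_]; lra.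
pose c := sup C.
have c0c : c0 <= c by apply: ub_le_sup; [case: sC|split => // z az zc; apply: Pc0; rewrite az].
exists ((a + c) / 2); right; split => //; exists a, c; split; first by lra.
split; first exact: lt_le_trans ac0 c0c.
split => //; split.
  move=> z az zc; have [c' [ac' hc'] zc'] := sup_gt (proj1 sC) zc.
  exact: hc'.
move=> c' cc' h; have := ub_le_sup (proj2 sC) (conj (lt_trans (lt_le_trans ac0 c0c) cc') h).
by rewrite -/c; lra.
Qed.

Lemma definable_choice1 P : drel P -> (forall t, exists B, forall y, P t y -> `|y| <= B) ->
  exists2 y, dfun1 y & forall t, (exists z, P t z) -> P t (y t).
Proof.
move=> dP bP; pose y t := if pselect (exists y, selected P t y) is left h
  then projT1 (cid h) else 0.
have yP t : (exists z, P t z) -> selected P t (y t).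
  move=> /(selected_exists dP (bP t)) h; rewrite /y; case: pselect => // h'.
  by case: cid.
exists y; last by move=> t /yP /selected_sub.
apply: (@eq_dpred _ _ (fun e => selected P (e 1%N) (e 0%N) \/
   (~ (exists z, P (e 1%N) z) /\ e 0%N = 0))).
  move=> e; have [h|n] := pselect (exists z, P (e 1%N) z).
    split => [[s|[]//]|<-]; first exact: selected_unique (yP _ h) s.
    by left; exact: yP.
  have y0 : y (e 1%N) = 0.
    by rewrite /y; case: pselect => // h'; exfalso; apply: n; case: h' => z /selected_sub Pz; exists z.
  split => [[/selected_sub Pz|[_ ->]//]|<-]; first by case: n; exists (e 0%N).
  by right.
apply: dpred_or; first exact: selected_def.
apply: dpred_and; last by apply: dpred_eq; [exact: dfun_var|exact: dfun_cst].
by apply: dpred_not; apply: (dpred_ex (P := fun z e => P (e 1%N) z)); apply: drel_app => //;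
  exact: dfun_var.
Qed.

Definition dcurve N (x : R -> 'rV[R]_N) := forall i, dfun1 (fun t => x t 0 i).

Lemma dcurve_vec N (x : R -> 'rV[R]_N) F : dcurve x -> dfun M F -> dvec M (fun e => x (F e)).
Proof. by move=> dx dF i; exact: (dfun1_comp (dx i) dF). Qed.

(** Coordinates are selected one after the other, shrinking the family so that
    its members agree on the coordinates already chosen. *)
Lemma definable_choice N (P : R -> set 'rV[R]_N) :
  dset M (fun e => P (e 0%N)) ->
  (forall t, exists B, forall v, P t v -> forall i, `|v 0 i| <= B) ->
  exists2 x, dcurve x & forall t, (exists v, P t v) -> P t (x t).
Proof.
move=> dP bP.
have claim k : (k <= N)%N -> exists2 Q : R -> set 'rV[R]_N, dset M (fun e => Q (e 0%N)) &
    [/\ forall t, Q t `<=` P t, forall t, (exists v, P t v) -> exists v, Q t v &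
    exists c : 'I_N -> R -> R, forall i : 'I_N, (i < k)%N ->
      dfun1 (c i) /\ forall t v, Q t v -> v 0 i = c i t].
  elim: k => [|k IH] kN.
    by exists P => //; split => [t v //|t //|]; exists (fun _ _ => 0).
  have [Q dQ [QP QN [c cP]]] := IH (ltnW kN).
  pose j := Ordinal kN.
  pose P1 t y := exists v, Q t v /\ v 0 j = y.
  have dP1 : drel P1.
    apply: (dpred_exv (P := fun v e => Q (e 1%N) v /\ v 0 j = e 0%N)).
    apply: dpred_and; first exact: (dset_mem (fun=> N + 1)%N (K := fun e => Q (e 0%N)) dQ (@dvec_row_of0 R M N)).
    by apply: dpred_eq; [exact: dvec_row_of0|exact: dfun_var].
  have bP1 t : exists B, forall y, P1 t y -> `|y| <= B.
    by have [B hB] := bP t; exists B => y [v [/QP /hB Qv <-]].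
  have [y dy yP] := definable_choice1 dP1 bP1.
  exists (fun t => [set v | Q t v /\ v 0 j = y t]).
    apply: dpred_and; first exact: dQ.
    by apply: dpred_eq; [exact: dvec_row_of0|exact: (dfun1_comp dy (dfun_var M _))].
  split; first by move=> t v [/QP].
    move=> t /QN [v Qv].
    by have [|w [Qw wj]] := yP t; [exists (v 0 j), v|exists w].
  exists (fun i => if i == j then y else c i) => i; rewrite ltnS leq_eqVlt => /orP[/eqP ik|ik].
    have -> : i = j by exact: val_inj.
    by rewrite eqxx; split => // t v [].
  have [dci ci] := cP i ik.
  case: eqP => [ij|_]; first by rewrite ij ltnn in ik.
  by split => // t v [Qv _]; exact: ci.
have [Q dQ [QP QN [c cP]]] := claim N (leqnn N).
exists (fun t => \row_i c i t).
  move=> i; have [dci _] := cP i (ltn_ord i).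
  by apply: eq_dpred dci => e; rewrite mxE.
move=> t /QN [v Qv]; suff -> : \row_i c i t = v by exact: QP.
by apply/rowP => i; rewrite mxE; have [_ h] := cP i (ltn_ord i); rewrite (h t v).
Qed.

End Choice.

(** * Euclidean distances *)
Section Euclid.
Context (R : realType) (N : nat).
Notation V := 'rV[R]_N.
Implicit Types (x y z : V) (K : set V).

Definition dot x y : R := \sum_i x 0 i * y 0 i.

Lemma dotC x y : dot x y = dot y x.
Proof. by apply: eq_bigr => i _; rewrite mulrC. Qed.

Lemma dotDl x y z : dot (x + y) z = dot x z + dot y z.
Proof. by rewrite -big_split; apply: eq_bigr => i _; rewrite mxE mulrDl. Qed.

Lemma dotZl (a : R) x y : dot (a *: x) y = a * dot x y.
Proof. by rewrite mulr_sumr; apply: eq_bigr => i _; rewrite mxE mulrA. Qed.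

Lemma dotDr x y z : dot z (x + y) = dot z x + dot z y.
Proof. by rewrite dotC dotDl !(dotC z). Qed.

Lemma dotZr (a : R) x y : dot x (a *: y) = a * dot x y.
Proof. by rewrite dotC dotZl dotC. Qed.

Lemma dotNl x y : dot (- x) y = - dot x y.
Proof. by rewrite -scaleN1r dotZl mulN1r. Qed.

Lemma dotNr x y : dot y (- x) = - dot y x.
Proof. by rewrite dotC dotNl dotC. Qed.

Lemma dot0l x : dot 0 x = 0.
Proof. by rewrite -(scale0r 0) dotZl mul0r. Qed.

Lemma dot_ge0 x : 0 <= dot x x.
Proof. by apply: sumr_ge0 => i _; rewrite -expr2 sqr_ge0. Qed.

Lemma enormE x : enorm x = Num.sqrt (dot x x).
Proof. by congr Num.sqrt; apply: eq_bigr => i _; rewrite expr2. Qed.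

Lemma enorm_ge0 x : 0 <= enorm x.
Proof. exact: sqrtr_ge0. Qed.

Lemma enorm_sqr x : enorm x ^+ 2 = dot x x.
Proof. by rewrite enormE sqr_sqrtr // dot_ge0. Qed.

Lemma enormN x : enorm (- x) = enorm x.
Proof. by rewrite !enormE dotNl dotNr opprK. Qed.

Lemma enormB x y : enorm (x - y) = enorm (y - x).
Proof. by rewrite -enormN opprB. Qed.

Lemma enormZ (a : R) x : enorm (a *: x) = `|a| * enorm x.
Proof.
by rewrite !enormE dotZl dotZr mulrA -expr2 sqrtrM ?sqr_ge0 // sqrtr_sqr.
Qed.

Lemma enorm0 : enorm (0 : V) = 0.
Proof. by rewrite enormE dot0l sqrtr0. Qed.

Lemma le_enorm_sqr x (r : R) : 0 <= r -> (enorm x <= r) = (dot x x <= r ^+ 2).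
Proof. by move=> r0; rewrite -enorm_sqr ler_sqr // ?nnegrE // enorm_ge0. Qed.

Lemma dot_eq0 x : dot x x = 0 -> x = 0.
Proof.
move=> /eqP; rewrite psumr_eq0; last by move=> i _; rewrite -expr2 sqr_ge0.
move=> /allP h; apply/rowP => i; rewrite mxE.
by have := h i (mem_index_enum _); rewrite -expr2 sqrf_eq0 => /eqP.
Qed.

Lemma enorm_eq0 x : enorm x = 0 -> x = 0.
Proof. by move=> h; apply: dot_eq0; rewrite -enorm_sqr h expr0n. Qed.

Lemma cauchy_schwarz x y : dot x y <= enorm x * enorm y.
Proof.
have [/enorm_eq0 ->|y0] := eqVneq (enorm y) 0.
  by rewrite dotC dot0l enorm0 mulr0.
have yp : 0 < enorm y by rewrite lt_neqAle eq_sym y0 enorm_ge0.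
have := dot_ge0 (enorm y ^+ 2 *: x - dot x y *: y).
have -> : dot (enorm y ^+ 2 *: x - dot x y *: y) (enorm y ^+ 2 *: x - dot x y *: y) =
    enorm y ^+ 2 * (enorm x ^+ 2 * enorm y ^+ 2 - dot x y ^+ 2).
  rewrite dotDl !dotDr !(dotNl, dotNr, dotZl, dotZr) -!enorm_sqr (dotC y x).
  by ring.
rewrite pmulr_rge0 ?exprn_gt0 // subr_ge0 -exprMn => h.
have [d0|/ltW d0] := leP 0 (dot x y).
  by rewrite -(ler_sqr (R := R)) // nnegrE mulr_ge0 ?enorm_ge0.
by apply: le_trans d0 _; rewrite mulr_ge0 ?enorm_ge0.
Qed.

Lemma enormD x y : enorm (x + y) <= enorm x + enorm y.
Proof.
rewrite le_enorm_sqr ?addr_ge0 ?enorm_ge0 // dotDl !dotDr sqrrD -!enorm_sqr (dotC y x).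
by have := cauchy_schwarz x y; lra.
Qed.

Lemma enorm_tri y x z : enorm (x - z) <= enorm (x - y) + enorm (y - z).
Proof. by rewrite -[x - z](subrKA y) enormD. Qed.

Lemma coord_enorm x i : `|x 0 i| <= enorm x.
Proof.
rewrite -[`|_|]ger0_norm // -sqrtr_sqr real_normK ?num_real // enormE.
rewrite ler_sqrt; last exact: dot_ge0.
by rewrite /dot (bigD1 i) //= -expr2 lerDl sumr_ge0 // => j _; rewrite -expr2 sqr_ge0.
Qed.

Lemma enorm_sum x : enorm x <= \sum_i `|x 0 i|.
Proof.
have s0 : 0 <= \sum_i `|x 0 i| by apply: sumr_ge0.
rewrite le_enorm_sqr // expr2 mulr_suml; apply: ler_sum => i _.
rewrite -normr_id -expr2 -[X in X <= _]ger0_norm ?sqr_ge0 // normrX normr_id expr2.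
rewrite ler_wpM2l // (bigD1 i) //= lerDl sumr_ge0 //.
Qed.

Lemma coord_mxnorm x i : `|x 0 i| <= `|x|.
Proof.
rewrite [leRHS]/Num.Def.normr /= mx_normrE.
exact: (le_bigmax 0 (fun ij : 'I_1 * 'I_N => `|x ij.1 ij.2|) (0, i)).
Qed.

Lemma enorm_mxnorm x : enorm x <= N%:R * `|x|.
Proof.
apply: le_trans (enorm_sum x) _.
apply: (@le_trans _ _ (\sum_(i < N) `|x|)).
  by apply: ler_sum => i _; exact: coord_mxnorm.
by rewrite sumr_const card_ord mulr_natl.
Qed.

Lemma mxnorm_enorm x : `|x| <= enorm x.
Proof.
rewrite [leLHS]/Num.Def.normr /= mx_normrE; apply/bigmax_leP; split.
  exact: enorm_ge0.
by case=> i j _ /=; rewrite (ord1 i); exact: coord_enorm.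
Qed.

Lemma lipschitz_continuous (f : V -> R) :
  (forall x y, f x <= f y + enorm (x - y)) -> continuous f.
Proof.
move=> hf x; apply/(cvgrPdist_le (FF := nbhs_filter x)) => e e0; apply/nbhs_ballP.
exists (e / (N%:R + 1)); first by rewrite /= divr_gt0 // ltr_wpDl.
move=> y; rewrite -ball_normE /= => /ltW.
rewrite ler_pdivlMr ?ltr_wpDl // mulrDr mulr1 mulrC => h.
have exy : enorm (x - y) <= e.
  by apply: le_trans (enorm_mxnorm _) _; have := normr_ge0 (x - y); lra.
have := hf x y; have := hf y x; rewrite enormB => h1 h2.
by rewrite ler_norml; lra.
Qed.

Lemma enorm_continuous : continuous (@enorm R N).
Proof.
by apply: lipschitz_continuous => x y; have := enormD (x - y) y; rewrite subrK addrC.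
Qed.

Lemma enormB_continuous x : continuous (fun y => enorm (x - y)).
Proof.
apply: lipschitz_continuous => y z; rewrite (enormB y z).
exact: enorm_tri.
Qed.

Lemma nbhs_enorm x (P : V -> Prop) :
  nbhs x P <-> exists2 d : R, 0 < d & forall y, enorm (y - x) < d -> P y.
Proof.
split => [/nbhs_ballP [d d0 h]|[d d0 h]].
  exists d => // y yd; apply: h; rewrite -ball_normE /=.
  by apply: le_lt_trans (mxnorm_enorm _) _; rewrite enormB.
have : \forall y \near x, enorm (y - x) < d.
  have /(cvgrPdist_lt (FF := nbhs_filter x)) /(_ d d0) := @enormB_continuous x x.
  by apply: filterS => y; rewrite subrr enorm0 sub0r normrN enormB ger0_norm // enorm_ge0.
by apply: filterS => y; exact: h.
Qed.

Lemma enorm_compact (A : set V) (B : R) : closed A -> (forall x, A x -> enorm x <= B) ->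
  compact A.
Proof.
move=> cA bA; apply: bounded_closed_compact => //.
exists B; split; first exact: num_real.
by move=> r Br x /bA xB; apply: le_trans (mxnorm_enorm x) _; lra.
Qed.

Lemma compact_enorm (A : set V) : compact A -> exists B, forall x, A x -> enorm x <= B.
Proof.
move=> cA; have [[x0 Ax0]|nA] := pselect (exists x, A x); last first.
  by exists 0 => x Ax; case: nA; exists x.
have [||c cA' hc] := @compact_EVT_max _ _ (@enorm R N) A _ cA.
- by exists x0.
- by apply: continuous_subspaceT => x; exact: enorm_continuous.
by exists (enorm c) => x Ax; apply: hc; rewrite inE.
Qed.

(** The distance to K, truncated so as to be real-valued (and equal to 2) when K is
    empty. Only values below 2 are used as distances. *)
Definition dd K x : R := inf ([set 2] `|` [set enorm (x - y) | y in K]).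
Definition proj K x y := K y /\ enorm (x - y) = dd K x.

Lemma dd_has_inf K x : has_inf ([set 2] `|` [set enorm (x - y) | y in K]).
Proof.
split; first by exists 2; left.
by exists 0 => r [->|[y _ <-]]; [|exact: enorm_ge0].
Qed.

Lemma dd_le2 K x : dd K x <= 2.
Proof. by apply: ge_inf; [case: (dd_has_inf K x)|left]. Qed.

Lemma dd_le K x y : K y -> dd K x <= enorm (x - y).
Proof. by move=> Ky; apply: ge_inf; [case: (dd_has_inf K x)|right; exists y]. Qed.

Lemma dd_ge K x (r : R) : r <= 2 -> (forall y, K y -> r <= enorm (x - y)) -> r <= dd K x.
Proof.
move=> r2 h; apply: lb_le_inf; first by case: (dd_has_inf K x).
by move=> _ [->|[y Ky <-]] //; exact: h.
Qed.

Lemma dd_ge0 K x : 0 <= dd K x.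
Proof. by apply: dd_ge => // y _; exact: enorm_ge0. Qed.

Lemma dd_lt K x (r : R) : dd K x < r -> r <= 2 -> exists2 y, K y & enorm (x - y) < r.
Proof.
move=> dr r2; apply: contrapT => n; move: dr; rewrite ltNge => /negP; apply.
apply: dd_ge => // y Ky; rewrite leNgt; apply/negP => h; apply: n; by exists y.
Qed.

Lemma dd_lip K x y : dd K x <= dd K y + enorm (x - y).
Proof.
rewrite -lerBlDr; apply: dd_ge.
  by have := dd_le2 K x; have := enorm_ge0 (x - y); lra.
move=> z Kz; have := dd_le x Kz; have := enorm_tri y x z; lra.
Qed.

Lemma dd_continuous K : continuous (dd K).
Proof. by apply: lipschitz_continuous; exact: dd_lip. Qed.

Lemma dd_attained K x : closed K -> dd K x < 2 -> exists p, proj K x p.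
Proof.
move=> cK d2; have [y0 Ky0 y0x] := dd_lt d2 (lexx 2).
have clos : closed (K `&` [set y | enorm (x - y) <= 2]).
  apply: closedI => //.
  apply: (preimage_closed (f := fun y => enorm (x - y)) (D := [set r | r <= 2])); last exact: closed_le.
  by move=> y _; exact: enormB_continuous.
have cpt : compact (K `&` [set y | enorm (x - y) <= 2]).
  apply: (enorm_compact (B := enorm x + 2)) clos _ => y [_ /= h].
  by have := enormD (y - x) x; rewrite subrK enormB; lra.
have [||p pK hp] := @compact_EVT_min _ _ (fun y => enorm (x - y)) _ _ cpt.
- by exists y0; split => //=; exact: ltW.
- by apply: continuous_subspaceT => y; exact: enormB_continuous.
move: pK; rewrite inE => -[Kp px2].
exists p; split => //; apply: le_anti; rewrite dd_le // andbT.
apply: dd_ge => // y Ky; have [yx|/ltW yx] := leP (enorm (x - y)) 2; last exact: le_trans px2 yx.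
by apply: hp; rewrite inE.
Qed.

Lemma dd_in K x : K x -> dd K x = 0.
Proof.
by move=> Kx; apply: le_anti; rewrite dd_ge0 andbT; have := dd_le x Kx; rewrite subrr enorm0.
Qed.

Lemma dd_eq0 K x : closed K -> dd K x = 0 -> K x.
Proof.
move=> cK d0; have [|p [Kp]] := @dd_attained K x cK; first by rewrite d0.
by rewrite d0 => /enorm_eq0 /eqP; rewrite subr_eq0 => /eqP ->.
Qed.

Lemma dd_gt0 K x : closed K -> ~ K x -> 0 < dd K x.
Proof.
move=> cK nK; rewrite lt_neqAle dd_ge0 andbT eq_sym; apply/eqP => /dd_eq0 h.
by apply: nK; exact: h.
Qed.

Lemma dd_sub K K' x : K `<=` K' -> dd K' x <= dd K x.
Proof. by move=> KK'; apply: dd_ge (dd_le2 _ _) _ => y /KK'; exact: dd_le. Qed.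

Lemma dd_setT x : dd setT x = 0.
Proof. exact: dd_in. Qed.

End Euclid.

(** * The chain rule for distance functions *)

Section GoodDirections.
Context (R : realType) (N : nat).
Notation V := 'rV[R]_N.
Implicit Types (x y z p v : V) (K X S : set V) (sg t r : R).

(** All the nearest points p are tested because the one-sided derivatives of the
    distance along v are given by extreme ones. Divided by d_S x, the first
    inequality says that the distance to S increases (sg = 1) or decreases
    (sg = -1) along v at rate more than 1; the second one says that the distance
    to X does not increase to first order. *)
Definition good sg X S x v :=
  (forall p, proj S x p -> dd S x < sg * dot v (x - p)) /\
  (0 < dd X x -> forall p, proj X x p -> dot v (x - p) <= 0).

Lemma has_slope_cst (c t : R) : has_slope (fun=> c) t 0.
Proof.
move=> e e0; exists 1 => // s _.
by rewrite subrr mul0r subr0 normr0 mulr_ge0 // ltW.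
Qed.

Lemma has_slope_id t : has_slope id t 1.
Proof.
move=> e e0; exists 1 => // s _ /=.
have -> : t + s - t - 1 * s = 0 by ring.
by rewrite normr0 mulr_ge0 // ltW.
Qed.

Lemma has_slopeD (f g : R -> R) t a b :
  has_slope f t a -> has_slope g t b -> has_slope (fun s => f s + g s) t (a + b).
Proof.
move=> hf hg e e0; have e2 : 0 < e / 2 by rewrite divr_gt0.
have [d d0 fd] := hf _ e2; have [d' d'0 gd] := hg _ e2.
exists (Num.min d d'); first by rewrite lt_min d0.
move=> s; rewrite lt_min => /andP[/fd h1 /gd h2].
have -> : f (t + s) + g (t + s) - (f t + g t) - (a + b) * s =
  (f (t + s) - f t - a * s) + (g (t + s) - g t - b * s) by ring.
by apply: le_trans (ler_normD _ _) _; lra.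
Qed.

Lemma has_slopeM (f g : R -> R) t a b :
  has_slope f t a -> has_slope g t b ->
  has_slope (fun s => f s * g s) t (a * g t + f t * b).
Proof.
move=> hf hg e e0.
pose C := `|f t| + `|g t| + (`|a| + 1) * (`|b| + 1) + 1.
have C1 : 1 <= C by rewrite /C lerDr !addr_ge0 // mulr_ge0 // addr_ge0.
have C0 : 0 < C by exact: lt_le_trans C1.
have e1 : 0 < e / C by rewrite divr_gt0.
pose e2 := Num.min 1 (e / C); have e20 : 0 < e2 by rewrite lt_min ltr01.
have [e2a e2b] : e2 <= 1 /\ e2 <= e / C by rewrite /e2 !ge_min !lexx orbT.
have [d d0 fd] := hf _ e20; have [d' d'0 gd] := hg _ e20.
exists (Num.min (Num.min d d') (e / C)); first by rewrite !lt_min d0 d'0.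
move=> s; rewrite !lt_min => /andP[/andP[/fd h1 /gd h2] sC].
have s0 := normr_ge0 s.
have f1 : `|f (t + s) - f t| <= (`|a| + 1) * `|s|.
  rewrite -[f (t + s) - f t](subrK (a * s)); apply: le_trans (ler_normD _ _) _.
  by rewrite normrM mulrDl mul1r addrC lerD2l (le_trans h1) // ler_piMl.
have g1 : `|g (t + s) - g t| <= (`|b| + 1) * `|s|.
  rewrite -[g (t + s) - g t](subrK (b * s)); apply: le_trans (ler_normD _ _) _.
  by rewrite normrM mulrDl mul1r addrC lerD2l (le_trans h2) // ler_piMl.
have -> : f (t + s) * g (t + s) - f t * g t - (a * g t + f t * b) * s =
  (f (t + s) - f t - a * s) * g t + f t * (g (t + s) - g t - b * s)
  + (f (t + s) - f t) * (g (t + s) - g t) by ring.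
apply: le_trans (ler_normD _ _) _.
apply: (@le_trans _ _ ((e / C * `|g t| + `|f t| * (e / C)) * `|s| +
   (`|a| + 1) * (`|b| + 1) * (e / C) * `|s|)).
  apply: lerD.
    apply: le_trans (ler_normD _ _) _; rewrite !normrM mulrDl; apply: lerD.
      rewrite -mulrA [`|g t| * _]mulrC mulrA ler_wpM2r //.
      by apply: le_trans h1 _; rewrite ler_wpM2r.
    rewrite -mulrA ler_wpM2l //.
    by apply: le_trans h2 _; rewrite ler_wpM2r.
  rewrite normrM; apply: le_trans (ler_pM _ _ f1 g1) _ => //.
  have -> : (`|a| + 1) * `|s| * ((`|b| + 1) * `|s|) =
    (`|a| + 1) * (`|b| + 1) * `|s| * `|s| by ring.
  rewrite ler_wpM2r // ler_wpM2l ?mulr_ge0 ?addr_ge0 //; exact: ltW.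
rewrite -mulrDl ler_wpM2r //.
have -> : e / C * `|g t| + `|f t| * (e / C) + (`|a| + 1) * (`|b| + 1) * (e / C) =
  e / C * (C - 1) by rewrite /C; ring.
have -> : e / C * (C - 1) = e - e / C by field; rewrite gt_eqF.
by lra.
Qed.

Lemma has_slope_sum n (f : 'I_n -> R -> R) t (a : 'I_n -> R) :
  (forall i, has_slope (f i) t (a i)) ->
  has_slope (fun s => \sum_i f i s) t (\sum_i a i).
Proof.
elim: n f a => [|n IH] f a h.
  have := @has_slope_cst 0 t; rewrite big_ord0; congr has_slope.
  by apply: funext => s; rewrite big_ord0.
have := has_slopeD (h ord0) (IH _ _ (fun i => h (lift ord0 i))).
rewrite big_ord_recl; congr has_slope.
by apply: funext => s; rewrite big_ord_recl.
Qed.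

Lemma has_slope_near (f g : R -> R) (a b t l : R) : a < t < b ->
  (forall s, a < s < b -> f s = g s) -> has_slope f t l -> has_slope g t l.
Proof.
move=> tab fg hf e /hf [d d0 fd].
exists (Num.min d (Num.min (t - a) (b - t))); first by rewrite !lt_min d0 /=; lra.
move=> s; rewrite !lt_min => /and3P[sd s1 s2].
rewrite -!fg; [exact: fd|exact: tab|].
by move: s1 s2; rewrite !ltr_norml; lra.
Qed.

(** Fermat's rule. *)
Lemma has_slope_min (f : R -> R) t l : (forall s, f t <= f s) -> has_slope f t l -> l = 0.
Proof.
move=> fm hf; apply: contrapT => /eqP l0.
have l1 : 0 < `|l| by rewrite normr_gt0.
have [d d0 fd] := hf (`|l| / 2) (ltac:(lra)).
have [lp|lm|le] := ltgtP l 0; last by rewrite le eqxx in l0.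
  have nl : `|l| = - l by rewrite ltr0_norm.
  have := fd (d / 2); rewrite nl (@gtr0_norm _ (d / 2)); last lra.
  move=> /(_ (ltac:(lra))); rewrite ler_norml => /andP[_ h].
  have := fm (t + d / 2); have : l * d < 0 by rewrite pmulr_llt0.
  by lra.
have nl : `|l| = l by rewrite gtr0_norm.
have := fd (- (d / 2)); rewrite nl normrN (@gtr0_norm _ (d / 2)); last lra.
move=> /(_ (ltac:(lra))); rewrite ler_norml => /andP[_ h].
have := fm (t + - (d / 2)); have : 0 < l * d by rewrite pmulr_lgt0.
by lra.
Qed.

(** Whatever the nearest point p, the squared distance from a moving point to p
    dominates the squared distance to K, with equality at the time considered,
    so the two have the same derivative. *)
Lemma dd_chain K (c : R -> V) t (c' : V) l p :
  (forall i, has_slope (fun s => c s 0 i) t (c' 0 i)) ->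
  has_slope (fun s => dd K (c s)) t l -> proj K (c t) p ->
  dot c' (c t - p) = dd K (c t) * l.
Proof.
move=> hc hd [Kp pd].
pose f s := dot (c s - p) (c s - p) + (-1) * (dd K (c s) * dd K (c s)).
have ft : f t = 0 by rewrite /f -enorm_sqr pd; ring.
have fm s : f t <= f s.
  rewrite ft /f -enorm_sqr mulN1r subr_ge0 -expr2.
  by rewrite ler_sqr ?nnegrE ?dd_ge0 ?enorm_ge0 // dd_le.
have hci i : has_slope (fun s => (c s - p) 0 i) t (c' 0 i).
  have := has_slopeD (hc i) (has_slope_cst (- p 0 i) t); rewrite addr0.
  by congr has_slope; apply: funext => s; rewrite !mxE.
have h1 := has_slope_sum (fun i => has_slopeM (hci i) (hci i)).
have h2 := has_slopeM (has_slope_cst (-1) t) (has_slopeM hd hd).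
have := has_slope_min fm (has_slopeD h1 h2).
rewrite big_split /=.
have -> : \sum_i (c t - p) 0 i * c' 0 i = dot c' (c t - p).
  by apply: eq_bigr => i _; rewrite mulrC.
rewrite -/(dot c' (c t - p)); lra.
Qed.

(** The factor 2 makes the rate, which is 1 along the curve, larger than 1. *)
Lemma good_curve sg X S (c : R -> V) t (c' : V) l : sg = 1 \/ sg = -1 ->
  (forall i, has_slope (fun s => c s 0 i) t (c' 0 i)) ->
  has_slope (fun s => dd S (c s)) t 1 -> has_slope (fun s => dd X (c s)) t l ->
  sg * l <= 0 -> 0 < dd S (c t) -> good sg X S (c t) ((2 * sg) *: c').
Proof.
move=> hsg hc hS hX sl S0; split => [p pS|X0 p pX]; rewrite dotZl.
  rewrite (dd_chain hc hS pS); case: hsg => ->; lra.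
rewrite (dd_chain hc hX pX).
have -> : 2 * sg * (dd X (c t) * l) = 2 * (dd X (c t) * (sg * l)) by ring.
by rewrite pmulr_rle0 // pmulr_rle0.
Qed.

Lemma compact_uniform (T : topologicalType) (A : set T) (P : R -> T -> Prop) :
  compact A -> (forall r r' (u : T), 0 < r' -> r' <= r -> P r u -> P r' u) ->
  (forall u : T, A u -> exists2 r, 0 < r & \forall w \near u, P r w) ->
  exists2 r, 0 < r & forall u : T, A u -> P r u.
Proof.
move=> cA dP lP.
have : \forall r \near (0 : R)^'+, A `<=` P r.
  move/compact_near_coveringP/near_covering_withinP : cA; apply => x Ax.
  have [r r0 hr] := lP x Ax.
  exists ([set y | P r y], [set s | 0 < s <= r]).
    split => //=; near=> s; apply/andP; split; near: s.
      exact: nbhs_right_gt.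
    exact: nbhs_right_le.
  by move=> [y s] /= [Py /andP[s0 sr]] _; exact: dP Py.
move=> h; have : \forall r \near (0 : R)^'+, A `<=` P r /\ 0 < r.
  by apply: filterI h _; exact: nbhs_right_gt.
move=> h2; have := @filter_ex _ _ (at_right_proper_filter (0 : R)) _ h2.
by case=> r [Ar r0]; exists r.
Unshelve. all: by end_near. Qed.

End GoodDirections.

(** ** Definability of distances *)
Section DefinableDistance.
Context (R : realType) (M : ominimal_structure R) (N : nat).
Notation V := 'rV[R]_N.
Implicit Types (F G : env R -> V) (K X S : env R -> set V).

Lemma dfun_dot F G : dvec M F -> dvec M G -> dfun M (fun e => dot (F e) (G e)).
Proof. by move=> dF dG; apply: dfun_sum => i; exact: dfun_mul. Qed.

Lemma dfun_enorm F : dvec M F -> dfun M (fun e => enorm (F e)).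
Proof.
move=> dF; have dF1 := dvec_ren succn dF; have dv := dfun_var M.
apply: eq_dpred (dpred_and (dpred_le (dfun_cst M 0) (dv 0%N))
  (dpred_eq (dfun_dot dF1 dF1) (dfun_mul (dv 0%N) (dv 0%N)))) => e.
split => [[e0 h]|<-].
  by rewrite enormE h -expr2 sqrtr_sqr ger0_norm.
by rewrite enorm_ge0 -expr2 enorm_sqr.
Qed.

Lemma dfun_dd K F : dset M K -> dvec M F -> dfun M (fun e => dd (K e) (F e)).
Proof.
move=> dK dF; have dv := dfun_var M.
pose low (A : set V) x (r : R) := r <= 2 /\ forall y, A y -> r <= enorm (x - y).
have lowE A x r : low A x r <-> r <= dd A x.
  split => [[r2 h]|h]; first exact: dd_ge.
  split; first exact: le_trans h (dd_le2 _ _).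
  by move=> y Ay; exact: le_trans h (dd_le _ Ay).
have dlow (s : nat -> nat) j : dpred M (fun e => low (K (fun i => e (s i))) (F (fun i => e (s i))) (e j)).
  apply: dpred_and; first by apply: dpred_le; [exact: dv|exact: dfun_cst].
  apply: (dpred_allv (P := fun y e => K (fun i => e (s i)) y -> e j <= enorm (F (fun i => e (s i)) - y))).
  apply: dpred_imp; first exact: (dset_mem (fun i => N + s i)%N dK (@dvec_row_of0 _ _ _)).
  apply: dpred_le; first exact: dv.
  apply/dfun_enorm/dvec_sub; last exact: dvec_row_of0.
  exact: (dvec_ren (fun i => N + s i)%N dF).
apply: eq_dpred (dpred_and (dlow succn 0%N) (dpred_all
  (P := fun r e => low (K (fun i => e i.+1)) (F (fun i => e i.+1)) r -> r <= e 0%N)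
  (dpred_imp (dlow (fun i => i.+2) 0%N) (dpred_le (dv 0%N) (dv 1%N))))) => e.
split => [[/lowE h1 h2]|<-].
  by apply: le_anti; rewrite h1 andbT; apply: h2; exact/lowE.
by split; [exact/lowE|move=> r /lowE].
Qed.

Lemma dpred_proj K F G : dset M K -> dvec M F -> dvec M G ->
  dpred M (fun e => proj (K e) (F e) (G e)).
Proof.
move=> dK dF dG; apply: dpred_and; first exact: dset_mem0.
by apply: dpred_eq; [apply/dfun_enorm/dvec_sub|exact: dfun_dd].
Qed.

Lemma dpred_good sg X S F G : dset M X -> dset M S -> dvec M F -> dvec M G ->
  dpred M (fun e => good sg (X e) (S e) (F e) (G e)).
Proof.
move=> dX dS dF dG.
have sh (H : env R -> V) : dvec M H -> dvec M (fun e => H (fun i => e (N + i)%N)).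
  exact: dvec_ren.
have dX' := dset_ren (fun i => N + i)%N dX; have dS' := dset_ren (fun i => N + i)%N dS.
have d0 : dvec M (row_of N) := @dvec_row_of0 R M N.
apply: dpred_and.
  apply: (dpred_allv (P := fun p e => proj (S e) (F e) p -> dd (S e) (F e) < sg * dot (G e) (F e - p))).
  apply: dpred_imp; first exact: (dpred_proj dS' (sh _ dF) d0).
  apply: dpred_lt; first exact: (dfun_dd dS' (sh _ dF)).
  apply: dfun_mul; first exact: dfun_cst.
  apply: dfun_dot; first exact: sh.
  by apply: dvec_sub => //; exact: sh.
apply: dpred_imp; first by apply: dpred_lt; [exact: dfun_cst|exact: dfun_dd].
apply: (dpred_allv (P := fun p e => proj (X e) (F e) p -> dot (G e) (F e - p) <= 0)).
apply: dpred_imp; first exact: (dpred_proj dX' (sh _ dF) d0).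
apply: dpred_le; last exact: dfun_cst.
apply: dfun_dot; first exact: sh.
by apply: dvec_sub => //; exact: sh.
Qed.

Lemma dpred_ex_good sg X S F : dset M X -> dset M S -> dvec M F ->
  dpred M (fun e => exists v, good sg (X e) (S e) (F e) v).
Proof.
move=> dX dS dF; apply: (dpred_exv (P := fun v e => good sg (X e) (S e) (F e) v)).
exact: (dpred_good sg (dset_ren (fun i => N + i)%N dX) (dset_ren (fun i => N + i)%N dS)
  (dvec_ren (fun i => N + i)%N dF) (@dvec_row_of0 R M N)).
Qed.

Lemma dpred_ex_good_le sg X S F w : dset M X -> dset M S -> dvec M F -> dfun M w ->
  dpred M (fun e => exists v, enorm v <= w e /\ good sg (X e) (S e) (F e) v).
Proof.
move=> dX dS dF dw.
apply: (dpred_exv (P := fun v e => enorm v <= w e /\ good sg (X e) (S e) (F e) v)).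
apply: dpred_and.
  apply: dpred_le; first exact/dfun_enorm/dvec_row_of0.
  exact: (dfun_ren (fun i => N + i)%N dw).
exact: (dpred_good sg (dset_ren (fun i => N + i)%N dX) (dset_ren (fun i => N + i)%N dS)
  (dvec_ren (fun i => N + i)%N dF) (@dvec_row_of0 R M N)).
Qed.

(** If uniformity failed at all small t, then the sets of t for which the radius
    1 / (n + 1) is admissible would cover an interval, and by the covering lemma
    one of them would contain an interval. *)
Lemma near_uniform_germ (P : R -> R -> Prop) : drel M P ->
  (forall t r r', 0 < r' -> r' <= r -> P t r -> P t r') ->
  rgerm 0 (fun t => exists2 r, 0 < r & P t r) ->
  rgerm 0 (fun t => exists2 r, 0 < r & forall t', `|t' - t| < r -> P t' r).
Proof.
move=> dP Pdown [b b0 hb]; have dv := dfun_var M; have dc := dfun_cst M.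
pose LU t := exists r, 0 < r /\ forall t', `|t' - t| < r -> P t' r.
have dLU : dset1 M LU.
  apply: (dpred_ex (P := fun r e => 0 < r /\ forall t', `|t' - e 0%N| < r -> P t' r)).
  apply: dpred_and; first exact: dpred_lt.
  apply: (dpred_all (P := fun t' e => `|t' - e 1%N| < e 0%N -> P t' (e 0%N))).
  apply: dpred_imp; last exact: drel_app.
  by apply: dpred_lt => //; apply: dfun_abs; exact: dfun_sub.
case: (germ_dichotomy 0 dLU).
  by apply: rgermS => t [r [r0 h]]; exists r.
move=> [b' b'0 nLU]; exfalso.
have m0 : 0 < Num.min b b' by rewrite lt_min b0.
have [m1 m2] : Num.min b b' <= b /\ Num.min b b' <= b' by rewrite !ge_min !lexx orbT.
pose A (n : nat) t := P t (n.+1%:R^-1).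
have dA n : dset1 M (A n) by apply: drel_app.
have cov t : 0 < t < Num.min b b' -> exists n, A n t.
  move=> tb; have [|r r0 Pr] := hb t; first lra.
  exists (Num.truncn r^-1); apply: Pdown Pr; first by rewrite invr_gt0.
  rewrite invf_ple ?posrE // ltW //.
  by apply: Num.Theory.truncnS_gt.
have [n [c [d [ac cd db Ad]]]] := countable_cover m0 dA cov.
case: (nLU ((c + d) / 2)); first lra.
exists (Num.min ((d - c) / 2) n.+1%:R^-1); split.
  by rewrite lt_min invr_gt0 ltr0n andbT; lra.
move=> t'; rewrite lt_min => /andP[t1 _].
apply: (Pdown t' n.+1%:R^-1).
- by rewrite lt_min invr_gt0 ltr0n andbT; lra.
- by rewrite ge_min lexx orbT.
- by apply: Ad; move: t1; rewrite ltr_norml; lra.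
Qed.

End DefinableDistance.

(** * Absence of small critical values *)

Section RegularGerms.
Context (R : realType) (M : ominimal_structure R) (N : nat).
Notation V := 'rV[R]_N.
Implicit Types (x y z p v : V) (K X S : set V) (sg t r w : R).

Definition regular_at sg X S t r := forall x, dd S x = t -> dd X x <= r ->
  exists v, good sg X S x v.
(** Regularity also at points near X but off it, since approximate flows do not
    stay in X. *)
Definition regular sg X S t := exists2 r, 0 < r &
  forall x, `|dd S x - t| < r -> dd X x < r -> exists v, good sg X S x v.

Lemma dd_lt_bounded S B x : (forall y, S y -> enorm y <= B) -> dd S x < 2 ->
  enorm x <= B + 2.
Proof.
move=> bS /dd_lt [//|y Sy xy]; have := enormD (x - y) y; rewrite subrK.
by have := bS y Sy; lra.
Qed.

(** Points at distance less than 2 of a compact set are bounded, as definable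
    choice requires. *)
Lemma level_curve S (P : R -> set V) : compact S ->
  dset M (fun e => P (e 0%N)) -> (forall t v, P t v -> dd S v = t /\ t < 2) ->
  exists B, exists2 x : R -> V, dcurve M x & forall t, (exists v, P t v) ->
    P t (x t) /\ forall i, `|x t 0 i| <= B.
Proof.
move=> /compact_enorm [B bS] dP hP.
have bP t v : P t v -> forall i, `|v 0 i| <= B + 2.
  move=> /hP [vt t2] i; apply: le_trans (coord_enorm _ _) _.
  by apply: dd_lt_bounded bS _; rewrite vt.
have [|x dx xP] := definable_choice dP; first by move=> t; exists (B + 2) => v; exact: bP.
exists (B + 2); exists x => // t /xP Px; split => // i; exact: bP Px i.
Qed.

Lemma rgerm_all n (P : 'I_n -> R -> Prop) a : (forall i, rgerm a (P i)) ->
  rgerm a (fun t => forall i, P i t).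
Proof.
elim: n P => [|n IH] P h; first by exists (a + 1); [lra|move=> t _ []].
have := rgermI (h ord0) (IH _ (fun i => h (lift ord0 i))).
apply: rgermS => t [h0 h1] i; case: (unliftP ord0 i) => [j ->|->] //; exact: h1.
Qed.

Lemma curve_slope_germ (x : R -> V) a : dcurve M x ->
  rgerm a (fun t => forall i, has_slope (fun s => x s 0 i) t (slope (fun s => x s 0 i) t)).
Proof. by move=> dx; apply: rgerm_all => i; exact: slope_germ (dx i). Qed.

Lemma drel_regular_at sg X S : M N X -> M N S -> drel M (regular_at sg X S).
Proof.
move=> dX dS; have d0 : dvec M (row_of N) := @dvec_row_of0 R M N.
have dv := dfun_var M; have cX := dset_cst dX; have cS := dset_cst dS.
apply: (dpred_allv (P := fun x e => dd S x = e 1%N -> dd X x <= e 0%N ->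
  exists v, good sg X S x v)).
apply: dpred_imp; first by apply: dpred_eq => //; exact: (dfun_dd cS d0).
apply: dpred_imp; first by apply: dpred_le => //; exact: (dfun_dd cX d0).
exact: (dpred_ex_good sg cX cS d0).
Qed.

(** A definable Sard theorem: if the levels at which no good direction exists
    filled an interval, then a definable curve of such bad points at a constant
    distance from X would have a velocity, which is a good direction. *)
Lemma regular_at_germ sg X S : sg = 1 \/ sg = -1 -> M N X -> M N S -> compact S ->
  rgerm 0 (fun t => exists2 r, 0 < r & regular_at sg X S t r).
Proof.
move=> hsg dX dS cS; have d0 : dvec M (row_of N) := @dvec_row_of0 R M N.
have dv := dfun_var M; have cX := dset_cst dX; have cS' := dset_cst dS.
have dc := dfun_cst M.
pose bad t r := exists x, [/\ dd S x = t, dd X x = r & ~ exists v, good sg X S x v].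
have dbad0 (i j : nat) : dpred M (fun e => exists x, [/\ dd S x = e i, dd X x = e j & ~ exists v, good sg X S x v]).
  apply: eq_dpred (dpred_exv (P := fun x e => dd S x = e i /\ (dd X x = e j /\
     ~ exists v, good sg X S x v)) _).
    by move=> e; split => -[x]; [move=> [? [? ?]]|move=> [? ? ?]]; exists x.
  apply: dpred_and; first by apply: dpred_eq => //; exact: (dfun_dd cS' d0).
  apply: dpred_and; first by apply: dpred_eq => //; exact: (dfun_dd cX d0).
  by apply: dpred_not; exact: (dpred_ex_good sg cX cS' d0).
have dbad : drel M bad := dbad0 1%N 0%N.
have dG : dset1 M (fun t => exists r, 0 < r /\ regular_at sg X S t r).
  apply: (dpred_ex (P := fun r e => 0 < r /\ regular_at sg X S (e 0%N) r)).
  apply: dpred_and; first exact: dpred_lt.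
  exact: (drel_regular_at sg dX dS).
case: (germ_dichotomy 0 dG); first by apply: rgermS => t [r [r0 h]]; exists r.
move=> [b b0 nreg]; exfalso.
have m0 : 0 < Num.min b 2 by rewrite lt_min b0 ltr0n.
have [mb m2] : Num.min b 2 <= b /\ Num.min b 2 <= 2 by rewrite !ge_min !lexx orbT.
(* a bad level t has bad points on X, or, by the dichotomy, at all small positive
   distances from X; in both cases a covering by countably many definable sets *)
pose A (n : nat) t := if n is n'.+1 then forall r, 0 < r -> r < n'.+1%:R^-1 -> bad t r
  else bad t 0.
have dA n : dset1 M (A n).
  case: n => [|n]; first by apply: (drel_app dbad).
  apply: (dpred_all (P := fun r e => 0 < r -> r < n.+1%:R^-1 -> bad (e 0%N) r)).
  apply: dpred_imp; first exact: dpred_lt.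
  by apply: dpred_imp; [exact: dpred_lt|exact: (drel_app dbad)].
have cov t : 0 < t < Num.min b 2 -> exists n, A n t.
  move=> tb; have [bt0|nb0] := pselect (bad t 0); first by exists 0%N.
  case: (@germ_dichotomy _ M (bad t) 0); first by apply: (drel_app dbad).
    move=> [c c0 hc]; exists (Num.truncn c^-1).+1 => r r0 rc; apply: hc.
    rewrite r0 /=; apply: lt_trans rc _.
    by rewrite invf_plt ?posrE // Num.Theory.truncnS_gt.
  move=> [c c0 hc]; exfalso; apply: (nreg t); first by lra.
  exists (c / 2); split; first lra.
  move=> x xt xc; apply: contrapT => ng.
  have : bad t (dd X x) by exists x.
  have := dd_ge0 X x; rewrite le_eqVlt => /orP[/eqP <- //|x0].
  by apply: hc; lra.
have [n [c [d [c0 cd db Acd]]]] := countable_cover m0 dA cov.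
have [r0 badr] : exists r0, forall t, c < t < d -> bad t r0.
  case: n Acd => [|n] Acd; first by exists 0.
  exists (n.+1%:R^-1 / 2) => t /Acd; apply.
    by rewrite divr_gt0 // invr_gt0 ltr0n.
  by rewrite ltr_pdivrMr // ltr_pMr ?invr_gt0 ?ltr0n // ltr1n.
pose P t := [set x | dd S x = t /\ (dd X x = r0 /\ (t < 2 /\ ~ exists v, good sg X S x v))].
have dP : dset M (fun e => P (e 0%N)).
  apply: dpred_and; first by apply: dpred_eq => //; exact: (dfun_dd cS' d0).
  apply: dpred_and; first by apply: dpred_eq => //; exact: (dfun_dd cX d0).
  apply: dpred_and; first exact: dpred_lt.
  by apply: dpred_not; exact: (dpred_ex_good sg cX cS' d0).
have [B [x dx xP]] := level_curve cS dP (fun t v h => conj h.1 h.2.2.1).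
have Px t : c < t < d -> P t (x t).
  move=> tcd; have [|//] := xP t; have [v [v1 v2 v3]] := badr t tcd.
  by exists v; do !split => //; lra.
have [t [ct ht]] : exists t, c < t < d /\
    forall i, has_slope (fun s => x s 0 i) t (slope (fun s => x s 0 i) t).
  have [e ce he] := curve_slope_germ c dx.
  have [m1 m3] : Num.min d e <= d /\ Num.min d e <= e by rewrite !ge_min !lexx orbT.
  have m4 : c < Num.min d e by rewrite lt_min cd.
  by exists ((c + Num.min d e) / 2); split; [lra|apply: he; lra].
have [xt [xr [t2 nb]]] := Px t ct; apply: nb.
exists ((2 * sg) *: \row_i slope (fun s => x s 0 i) t).
apply: (good_curve (t := t) (l := 0)) => //.
- by move=> i; rewrite mxE.
- apply: has_slope_near ct _ (has_slope_id t) => s scd.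
  by have [-> _] := Px s scd.
- apply: has_slope_near ct _ (has_slope_cst r0 t) => s scd.
  by have [_ [-> _]] := Px s scd.
- by rewrite mulr0.
- by rewrite xt; lra.
Qed.

(** Regularity of single levels becomes uniform in the level because the set of
    bad points is definable. *)
Lemma regular_germ sg X S : sg = 1 \/ sg = -1 -> M N X -> M N S -> compact S ->
  rgerm 0 (regular sg X S).
Proof.
move=> hsg dX dS cS.
have down t r r' : 0 < r' -> r' <= r -> regular_at sg X S t r -> regular_at sg X S t r'.
  by move=> _ r'r h x xt xr; apply: h => //; exact: le_trans xr r'r.
apply: rgermS (near_uniform_germ (drel_regular_at sg dX dS) down (regular_at_germ hsg dX dS cS)).
by move=> t [r r0 h]; exists r => // x xt xr; exact: (h (dd S x) xt x erefl (ltW xr)).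
Qed.

(** The only obstacle is K u itself: the other set is the whole space, for which
    the second condition of goodness is void. *)
Definition family_regular (K : R -> set V) u r := forall x, 0 < dd (K u) x <= r ->
  exists v, good (-1) setT (K u) x v.

(** For each u, regularity holds at all small distances from K u by the Sard
    theorem; it is uniform near u for small u, since the admissible distances are
    definable in u. *)
Lemma family_regular_germ (K : R -> set V) : dset M (fun e => K (e 0%N)) ->
  (forall u, compact (K u)) ->
  rgerm 0 (fun u => exists2 r, 0 < r & forall u', `|u' - u| < r -> family_regular K u' r).
Proof.
move=> dK cK; have d0 : dvec M (row_of N) := @dvec_row_of0 R M N.
have dv := dfun_var M; have dc := dfun_cst M.
have cT : dset M (fun=> setT : set V).
  apply: dset_cst; have := definableC (definable0 M N); by rewrite setC0.
apply: near_uniform_germ.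
- apply: (dpred_allv (P := fun x e => 0 < dd (K (e 1%N)) x <= e 0%N -> exists v, good (-1) setT (K (e 1%N)) x v)).
  have dK' : dset M (fun e => K (e (N + 1)%N)) := dset_ren (fun=> (N + 1)%N) dK.
  apply: dpred_imp.
    apply: eq_dpred (dpred_and (dpred_lt (dc 0) (dfun_dd dK' d0))
      (dpred_le (dfun_dd dK' d0) (dv (N + 0)%N))) => e.
    by split => [[? ?]|/andP[]] //; apply/andP.
  exact: (dpred_ex_good (-1) cT dK' d0).
- move=> u r r' _ r'r h x /andP[x0 xr]; apply: h; rewrite x0; exact: le_trans xr r'r.
exists 1 => // u _.
have MK : M N (K u).
  apply: dsetP; apply: (dpred_subst (P := fun s e => K s (row_of N e)) _ (dc u)).
  exact: (dset_mem (fun=> 0%N) (F := fun e => row_of N (fun i => e i.+1)) dK (dvec_ren succn d0)).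
have [b b0 h] := @regular_at_germ (-1) setT (K u) (or_intror erefl)
  (dsetP cT) MK (cK u).
exists (b / 2); first lra.
move=> x xb; have [|r r0 hr] := h (dd (K u) x); first lra.
by apply: (hr x) => //; rewrite dd_setT ltW.
Qed.

End RegularGerms.

(** * The Kurdyka-Lojasiewicz inequality *)

Section Integrability.
Context (R : realType) (M : ominimal_structure R) (N : nat).
Notation V := 'rV[R]_N.
Implicit Types (x p v : V) (K X S : set V) (sg t r w : R).

Lemma dyadic_summableZ (w : nat -> R) c : 0 <= c -> dyadic_summable w ->
  dyadic_summable (fun k => c * w k).
Proof.
move=> c0 [B hB]; exists (c * B) => n.
have -> : \sum_(k < n) c * w k / 2 ^+ k = c * \sum_(k < n) w k / 2 ^+ k.
  by rewrite mulr_sumr; apply: eq_bigr => k _; rewrite mulrA.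
by rewrite ler_wpM2l.
Qed.

Lemma dyadic_summable_sum n (w : 'I_n -> nat -> R) :
  (forall i, dyadic_summable (w i)) -> dyadic_summable (fun k => \sum_i w i k).
Proof.
move=> h; pose B i := projT1 (cid (h i)); exists (\sum_i B i) => m.
have -> : \sum_(k < m) (\sum_i w i k) / 2 ^+ k = \sum_i \sum_(k < m) w i k / 2 ^+ k.
  by rewrite exchange_big; apply: eq_bigr => k _; rewrite mulr_suml.
by apply: ler_sum => i _; rewrite /B; case: cid.
Qed.

Lemma dyadic_summable1 : dyadic_summable (fun=> 1 : R).
Proof.
exists 2 => n; have -> : \sum_(k < n) 1 / 2 ^+ k = 2 - 2 / 2 ^+ n :> R.
  elim: n => [|n IH]; first by rewrite big_ord0 expr0 divr1 subrr.
  by rewrite big_ord_recr /= IH exprS; field; rewrite expf_neq0.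
by rewrite lerBlDr lerDl divr_ge0 // exprn_ge0.
Qed.

Definition controlled X S t w r := forall x, dd S x = t -> dd X x <= r ->
  exists v, enorm v <= w /\ good (-1) X S x v.

Lemma dpred_controlled X S (Ft Fw Fr : env R -> R) : M N X -> M N S ->
  dfun M Ft -> dfun M Fw -> dfun M Fr ->
  dpred M (fun e => controlled X S (Ft e) (Fw e) (Fr e)).
Proof.
move=> dX dS dt dw dr; have d0 : dvec M (row_of N) := @dvec_row_of0 R M N.
have sh (F : env R -> R) : dfun M F -> dfun M (fun e => F (fun i => e (N + i)%N)).
  exact: dfun_ren.
have cX := dset_cst dX; have cS := dset_cst dS.
apply: (dpred_allv (P := fun x e => dd S x = Ft e -> dd X x <= Fr e ->
  exists v, enorm v <= Fw e /\ good (-1) X S x v)).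
apply: dpred_imp; first by apply: dpred_eq; [exact: (dfun_dd cS d0)|exact: sh].
apply: dpred_imp; first by apply: dpred_le; [exact: (dfun_dd cX d0)|exact: sh].
exact: (dpred_ex_good_le (-1) cX cS d0 (sh _ dw)).
Qed.

Definition uncontrolled X S t w := 0 < w /\ ~ exists r, 0 < r /\ controlled X S t w r.

Lemma dpred_uncontrolled X S (Ft Fw : env R -> R) : M N X -> M N S ->
  dfun M Ft -> dfun M Fw -> dpred M (fun e => uncontrolled X S (Ft e) (Fw e)).
Proof.
move=> dX dS dt dw; have dv := dfun_var M; have dc := dfun_cst M.
apply: dpred_and; first exact: dpred_lt.
apply: dpred_not.
apply: (dpred_ex (P := fun r e => 0 < r /\ controlled X S (Ft e) (Fw e) r)).
apply: dpred_and; first exact: dpred_lt.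
by apply: dpred_controlled => //; [exact: (dfun_ren succn dt)|exact: (dfun_ren succn dw)].
Qed.

Lemma uncontrolled_down X S t w w' : 0 < w' -> w' <= w ->
  uncontrolled X S t w -> uncontrolled X S t w'.
Proof.
move=> w'0 w'w [_ n]; split => // -[r [r0 h]]; apply: n; exists r; split => //.
move=> x xt xr; have [v [vw' gv]] := h x xt xr; exists v; split => //.
exact: le_trans vw' w'w.
Qed.

(** A threshold within a factor 2 of the least speed that cannot be avoided;
    it is cut off at 1/t, where integrability will already be violated. *)
Definition threshold X S t w := 0 < t /\ (uncontrolled X S t w /\ (t * w <= 1 /\
  (~ uncontrolled X S t (2 * w) \/ t * w = 1))).

(** Double w until it can be avoided or reaches the cut off. *)
Lemma threshold_exists X S t w : 0 < t -> uncontrolled X S t w ->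
  exists w, threshold X S t w.
Proof.
move=> t0 uw; have ti0 : 0 < t^-1 by rewrite invr_gt0.
have tti : t * t^-1 = 1 by rewrite mulfV // gt_eqF.
have [ut|nut] := pselect (uncontrolled X S t t^-1).
  by exists t^-1; do !split => //; [rewrite tti|right].
have w0 : 0 < w by case: uw.
have p2 n : 0 < 2 ^+ n * w by rewrite mulr_gt0 // exprn_gt0.
have bnd w' : uncontrolled X S t w' -> t * w' <= 1.
  move=> u; have w'0 : 0 < w' by case: u.
  rewrite leNgt; apply/negP => h; apply: nut; apply: uncontrolled_down u => //.
  by rewrite -div1r ler_pdivrMr // mulrC ltW.
have [n [un nun]] : exists n, uncontrolled X S t (2 ^+ n * w) /\
    ~ uncontrolled X S t (2 ^+ n.+1 * w).
  apply: contrapT => h.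
  have all_n n : uncontrolled X S t (2 ^+ n * w).
    elim: n => [|n IH]; first by rewrite expr0 mul1r.
    by apply: contrapT => nu; apply: h; exists n.
  have := bnd _ (all_n (Num.truncn (t * w)^-1).+1).
  rewrite mulrCA -ler_pdivlMr ?mulr_gt0 // mul1r leNgt => /negP; apply.
  have h1 := Num.Theory.truncnS_gt (t * w)^-1.
  apply: lt_trans h1 _; set m := (Num.truncn _).+1.
  by rewrite -natrX ltr_nat ltn_expl.
exists (2 ^+ n * w); split => //; split => //; split; first exact: bnd.
by left; rewrite mulrA -exprS.
Qed.

Lemma dpred_threshold X S (Ft Fw : env R -> R) : M N X -> M N S ->
  dfun M Ft -> dfun M Fw -> dpred M (fun e => threshold X S (Ft e) (Fw e)).
Proof.
move=> dX dS dt dw; have dc := dfun_cst M; have dtw := dfun_mul dt dw.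
apply: dpred_and; first exact: dpred_lt.
apply: dpred_and; first exact: dpred_uncontrolled.
apply: dpred_and; first exact: dpred_le.
apply: dpred_or; last exact: dpred_eq.
by apply: dpred_not; apply: dpred_uncontrolled => //; exact: dfun_mul.
Qed.

Definition small_majorant (W : R -> R) := rgerm 0 (fun A => exists w : nat -> R,
  [/\ forall k, 0 <= w k, dyadic_summable w & forall k t, on_band A k t -> W t <= w k]).

Lemma band_pos A k t : 0 < A -> on_band A k t -> 0 < t <= A.
Proof.
move=> A0 /andP[t1 t2]; apply/andP; split.
  by apply: lt_le_trans t1; rewrite divr_gt0 // exprn_gt0.
apply: le_trans t2 _; rewrite ler_pdivrMr ?exprn_gt0 // ler_peMr ?exprn_ege1 ?ler1n //.
exact: ltW.
Qed.

(** The o-minimal Kurdyka-Lojasiewicz inequality. A definable curve of points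
    where only large speeds are good has velocities at least as large, and a
    bounded definable curve has finite length. *)
Lemma controlled_germ X S : M N X -> M N S -> compact S ->
  exists2 W : R -> R, dfun1 M W & small_majorant W /\
    rgerm 0 (fun t => exists2 r, 0 < r & controlled X S t (W t) r).
Proof.
move=> dX dS cS; have d0 : dvec M (row_of N) := @dvec_row_of0 R M N.
have dv := dfun_var M; have cX := dset_cst dX; have cS' := dset_cst dS.
have dc := dfun_cst M.
have dE : dset1 M (fun t => exists w, threshold X S t w).
  by apply: (dpred_ex (P := fun w e => threshold X S (e 0%N) w)); exact: dpred_threshold.
(* if no threshold exists near 0, then the bound 1 on speeds can be imposed *)
case: (germ_dichotomy 0 dE); last first.
  move=> [b b0 nE]; exists (fun=> 1); first exact: dfun_cst.
  split; first by exists 1 => // A _; exists (fun=> 1); split => //; exact: dyadic_summable1.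
  exists b => // t tb; apply: contrapT => n; apply: (nE t tb).
  apply: (@threshold_exists X S t 1); first by case/andP: tb.
  by split => // -[r [r0 h]]; apply: n; exists r.
move=> [b b0 hE].
have dT : drel M (threshold X S) by apply: dpred_threshold.
have [|om dom omP] := definable_choice1 dT.
  move=> t; exists t^-1 => w [t0 [[w0 _] [tw _]]].
  by rewrite (ger0_norm (ltW w0)) -div1r ler_pdivlMr // mulrC.
have omT t : 0 < t < b -> threshold X S t (om t) by move=> /hE /omP.
pose P t := [set x | dd S x = t /\ (t < 2 /\ (dd X x <= t /\
  ~ exists v, enorm v <= om t /\ good (-1) X S x v))].
have dP : dset M (fun e => P (e 0%N)).
  apply: dpred_and; first by apply: dpred_eq => //; exact: (dfun_dd cS' d0).
  apply: dpred_and; first exact: dpred_lt.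
  apply: dpred_and; first by apply: dpred_le => //; exact: (dfun_dd cX d0).
  apply: dpred_not; exact: (dpred_ex_good_le (-1) cX cS' d0 (dfun1_comp dom (dv _))).
have [B [x dx xP]] := level_curve cS dP (fun t v h => conj h.1 h.2.1).
have xPt t : 0 < t < b -> t < 2 -> P t (x t) /\ forall i, `|x t 0 i| <= B.
  move=> tb t2; apply: xP; have [t0 [[w0 nc] _]] := omT t tb.
  apply: contrapT => n; apply: nc; exists t; split => // y yt yr.
  by apply: contrapT => ny; apply: n; exists y.
pose f t := dd X (x t).
have df : dfun1 M f by apply: (dfun_dd cX); exact: dcurve_vec dx (dv _).
have dsl i : rgerm 0 (fun b' => (forall t, 0 < t < b' ->
      has_slope (fun s => x s 0 i) t (slope (fun s => x s 0 i) t)) /\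
    forall A, 0 < A < b' -> exists w : nat -> R, [/\ forall k, 0 <= w k, dyadic_summable w &
      forall k t, on_band A k t -> `|slope (fun s => x s 0 i) t| <= w k]).
  have m0 : 0 < Num.min b 2 by rewrite lt_min b0 ltr0n.
  have [b' b'0 [h1 h2]] := @band_slope _ M (fun s => x s 0 i) _ B (dx i) m0
    (fun t => ltac:(rewrite lt_min => /and3P[t0 tb t2]; have [_ h] := xPt t (introT andP (conj t0 tb)) t2; exact: h)).
  by exists b' => // c cb; split => [t tc|A Ac]; [apply: h1; lra|apply: h2; lra].
have [b1 b10 m1] := monotonicity_germ 0 df.
have [b2 b20 m2] := slope_germ 0 df.
have [b3 b30 hb3] := rgermI (rgerm_itv b10) (rgermI (rgerm_itv b20)
  (rgermI (rgerm_itv b0) (rgermI (rgerm_itv (ltr0n R 2)) (rgerm_all dsl)))).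
pose m := b3 / 2.
have [mb1 [mb2 [mb [m2' hm]]]] := hb3 m (ltac:(rewrite /m; lra)).
have fle t : 0 < t < m -> 0 <= f t <= t.
  move=> tm; have [||[_ [_ [h _]]] _] := xPt t; [lra|lra|].
  by rewrite dd_ge0.
have mf : nondec_on 0 m f.
  case: m1 => m1 s t s0 st tm; first by apply: m1 => //; lra.
  have fu0 u : 0 < u < m -> f u <= 0.
    move=> um; apply/ler_addgt0Pr => e e0; rewrite add0r.
    have [ue|eu] := leP u e.
      by have /andP[_ h] := fle u um; lra.
    have h1 := m1 e u e0 (ltac:(lra)) (ltac:(lra)).
    by have /andP[_ h] := fle e (ltac:(lra)); lra.
  have h1 := fu0 s (ltac:(lra)).
  by have /andP[h _] := fle t (ltac:(lra)); lra.
have om_bound t : 0 < t < m -> om t <= 2 * \sum_i `|slope (fun s => x s 0 i) t|.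
  move=> tm; have [||[xt [_ [_ ng]]] _] := xPt t; [lra|lra|].
  pose x' : V := \row_i slope (fun s => x s 0 i) t.
  have gx : good (-1) X S (x t) ((2 * -1) *: x').
    apply: (good_curve (t := t) (l := slope f t)); first by right.
    - by move=> i; rewrite mxE; apply: (proj1 (hm i)).
    - apply: has_slope_near tm _ (has_slope_id t) => s sm.
      by have [||[-> _] _] := xPt s; [lra|lra|].
    - by apply: m2; lra.
    - by rewrite mulN1r oppr_le0; apply: (nondec_slope_ge0 mf tm); apply: m2; lra.
    - by rewrite xt; lra.
  have : om t < enorm ((2 * -1) *: x').
    by rewrite ltNge; apply/negP => h; apply: ng; exists ((2 * -1) *: x').
  rewrite enormZ mulrN1 normrN ger0_norm // => /ltW h.
  apply: le_trans h _; rewrite ler_wpM2l //; apply: le_trans (enorm_sum _) _.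
  by apply: ler_sum => i _; rewrite mxE.
have maj A : 0 < A < m -> exists w : nat -> R, [/\ forall k, 0 <= w k, dyadic_summable w &
    forall k t, on_band A k t -> om t <= w k].
  move=> Am; pose w i := projT1 (cid ((hm i).2 A Am)).
  have wP i : [/\ forall k, 0 <= w i k, dyadic_summable (w i) &
      forall k t, on_band A k t -> `|slope (fun s => x s 0 i) t| <= w i k].
    by rewrite /w; case: cid.
  exists (fun k => 2 * \sum_i w i k); split.
  - by move=> k; rewrite mulr_ge0 // sumr_ge0 // => i _; case: (wP i).
  - by apply: dyadic_summableZ => //; apply: dyadic_summable_sum => i; case: (wP i).
  - move=> k t kt; have /andP[? ?] : 0 < t <= A by apply: band_pos kt; lra.
    apply: le_trans (om_bound t _) _; first lra.
    rewrite ler_wpM2l //; apply: ler_sum => i _.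
    by have [_ _ h] := wP i; exact: h.
exists (fun t => 2 * om t); first by apply: dfun_mul => //; exact: dfun1_comp.
split.
  exists m; first by rewrite /m; lra.
  move=> A /maj [w [w0 ws wk]]; exists (fun k => 2 * w k); split.
  - by move=> k; rewrite mulr_ge0.
  - exact: dyadic_summableZ.
  - by move=> k t /wk; rewrite ler_pM2l.
(* The cut off is inactive near 0: the function 1 / t has infinite integral. *)
have dU : dset1 M (fun t => t * om t = 1).
  by apply: dpred_eq => //; apply: dfun_mul => //.
have [c c0 hc] : rgerm 0 (fun t => ~ t * om t = 1).
  case: (germ_dichotomy 0 dU) => // -[c c0 hc]; exfalso.
  pose A := Num.min m c / 2.
  have A0 : 0 < Num.min m c by rewrite lt_min c0 andbT /m; lra.
  have [Am Ac] : Num.min m c <= m /\ Num.min m c <= c by rewrite !ge_min !lexx orbT.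
  have Apos : 0 < A by rewrite /A; lra.
  have [w [w0 [B' hB'] wk]] := maj A (ltac:(rewrite /A; lra)).
  have term k : A^-1 <= w k / 2 ^+ k.
    have kt : on_band A k (A / 2 ^+ k).
      rewrite /on_band lexx andbT ler_wpM2l ?(ltW Apos) // lef_pV2 ?posrE ?exprn_gt0 //.
      by apply: ler_weXn2l; rewrite ?ler1n // leqW.
    have /andP[t1 t2] := band_pos Apos kt.
    have e1 : A / 2 ^+ k * om (A / 2 ^+ k) = 1 by apply: hc; rewrite /A in t1 t2 *; lra.
    have := wk _ _ kt => h.
    have -> : A^-1 = om (A / 2 ^+ k) / 2 ^+ k.
      apply: (@mulfI _ A); first by rewrite gt_eqF.
      by rewrite mulfV ?gt_eqF // -[LHS]e1 mulrAC mulrA.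
    by rewrite ler_pM2r // invr_gt0 exprn_gt0.
  pose n := (Num.truncn (B' * A)).+1.
  have := hB' n; rewrite leNgt => /negP; apply.
  apply: (@lt_le_trans _ _ (\sum_(k < n) A^-1)); last by apply: ler_sum => k _; exact: term.
  rewrite sumr_const card_ord -mulr_natl -ltr_pdivrMr ?invr_gt0 // invrK.
  exact: Num.Theory.truncnS_gt.
exists (Num.min b c); first by rewrite lt_min b0.
move=> t; rewrite lt_min => /and3P[t0 tb tc].
have [_ [[om0 _] [_ [nu|/hc]]]] := omT t (introT andP (conj t0 tb)); last by rewrite t0 tc => /(_ isT).
apply: contrapT => n; apply: nu; split; first by rewrite mulr_gt0.
by move=> [r [r0 h]]; apply: n; exists r.
Qed.

Lemma compact_itv_uniform (P : R -> R -> Prop) c d :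
  (forall t r r', 0 < r' -> r' <= r -> P t r -> P t r') ->
  (forall t, c <= t <= d -> exists2 r, 0 < r & forall t', `|t' - t| < r -> P t' r) ->
  exists2 r, 0 < r & forall t, c <= t <= d -> P t r.
Proof.
move=> dP lP.
have [r r0 h] := @compact_uniform R R `[c, d]%classic (fun r t => P t r) (@segment_compact _ c d)
  (fun r r' u => dP u r r') (fun t => ltac:(rewrite /= in_itv /= => tcd;
     have [r r0 h] := lP t tcd; exists r => //;
     apply/nbhs_ballP; exists r => //= u; rewrite /ball /= distrC; exact: h)).
by exists r => // t tcd; apply: h; rewrite /= in_itv.
Qed.

(** The discrete form of an integrable bound: the motion across the k-th band has
    length at most 2 W k times the width of the band, and these lengths are
    summable. *)
Definition band_controlled X S A (W : nat -> R) :=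
  [/\ forall k, 0 <= W k, dyadic_summable W & forall k, exists2 r, 0 < r &
    forall x, on_band A k (dd S x) -> dd X x <= r ->
      exists v, enorm v <= W k /\ good (-1) X S x v].

(** The bound of the previous lemma is uniform on each closed band because a band
    is compact. *)
Lemma band_controlled_germ X S : M N X -> M N S -> compact S ->
  rgerm 0 (fun A => exists W, band_controlled X S A W).
Proof.
move=> dX dS cS; have [W dW [maj ctr]] := controlled_germ dX dS cS.
have dv := dfun_var M.
have down t r r' : 0 < r' -> r' <= r -> controlled X S t (W t) r -> controlled X S t (W t) r'.
  by move=> _ r'r h x xt xr; apply: h => //; exact: le_trans r'r.
have dP : drel M (fun t r => controlled X S t (W t) r).
  by apply: dpred_controlled => //; exact: dfun1_comp.
have [b b0 hb] := near_uniform_germ dP down ctr.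
apply: rgermS (rgermI maj (rgerm_itv b0)) => A [[w [w0 ws wk]] Ab].
exists w; split => // k.
have [|r r0 hr] := @compact_itv_uniform (fun t r => controlled X S t (W t) r)
  (A / 2 ^+ k.+2) (A / 2 ^+ k) down.
  move=> t kt; apply: hb; have /andP[] : 0 < t <= A by apply: band_pos kt; lra.
  by lra.
exists r => // x kx xr; have [v [vW gv]] := hr (dd S x) kx x erefl xr.
by exists v; split => //; apply: le_trans vW _; exact: wk.
Qed.

End Integrability.

(** * Continuous selection of directions *)

Section ContinuityOn.
Context {T U W : topologicalType}.
Implicit Types (A B : set T).

(** The maps below are only meaningful on a subset, and their values elsewhere
    are junk; this form avoids subspace topologies. *)
Definition cont_on A (f : T -> U) := forall x, A x -> forall O, nbhs (f x) O ->
  \forall y \near x, A y -> O (f y).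

Lemma cont_on_sub A B f : A `<=` B -> cont_on B f -> cont_on A f.
Proof.
by move=> AB cf x Ax O fO; apply: filterS (cf x (AB _ Ax) O fO) => y h /AB.
Qed.

Lemma continuous_cont_on A f : continuous f -> cont_on A f.
Proof.
by move=> cf x _ O fO; apply: filterS (cf x O fO : nbhs x _) => y h _; exact: h.
Qed.

Lemma cont_onT f : cont_on setT f -> continuous f.
Proof.
by move=> cf x O fO; apply: filterS (cf x I O fO) => y; exact.
Qed.

Lemma eq_cont_on A f g : (forall x, A x -> f x = g x) -> cont_on A f -> cont_on A g.
Proof.
move=> fg cf x Ax O; rewrite -fg // => gO.
by apply: filterS (cf x Ax O gO) => y h Ay; rewrite -fg //; exact: h.
Qed.

Lemma cont_on_pair A f (g : T -> W) : cont_on A f ->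
  (forall x, A x -> forall O, nbhs (g x) O -> \forall y \near x, A y -> O (g y)) ->
  forall x, A x -> forall O, nbhs (f x, g x) O -> \forall y \near x, A y -> O (f y, g y).
Proof.
move=> cf cg x Ax O [[P1 P2] [fO gO] sO].
by apply: filterS2 (cf x Ax P1 fO) (cg x Ax P2 gO) => y h1 h2 Ay; apply: sO; split; [exact: h1|exact: h2].
Qed.

End ContinuityOn.

Lemma cont_on_comp {T U W : topologicalType} (A : set T) (B : set U) (f : T -> U) (g : U -> W) :
  cont_on B g -> cont_on A f -> (forall x, A x -> B (f x)) -> cont_on A (g \o f).
Proof.
move=> cg cf AB x Ax O gO.
by apply: filterS (cf x Ax _ (cg _ (AB _ Ax) O gO)) => y h Ay; exact: h Ay (AB _ Ay).
Qed.

Lemma cont_on_comp_pair {T U1 U2 W : topologicalType} (A : set T) (B : set (U1 * U2))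
  (f : T -> U1) (g : T -> U2) (h : U1 * U2 -> W) :
  cont_on B h -> cont_on A f -> cont_on A g -> (forall x, A x -> B (f x, g x)) ->
  cont_on A (fun x => h (f x, g x)).
Proof.
move=> ch cf cg AB; apply: (cont_on_comp (f := fun x => (f x, g x)) ch _ AB).
exact: cont_on_pair.
Qed.

Lemma cont_on_compT {T U W : topologicalType} (A : set T) (f : T -> U) (g : U -> W) :
  continuous g -> cont_on A f -> cont_on A (fun x => g (f x)).
Proof.
move=> cg cf; apply: (cont_on_comp (B := setT) _ cf) => //; exact: continuous_cont_on.
Qed.

Section EuclidTopology.
Context (R : realType) (N : nat).
Notation V := 'rV[R]_N.
Implicit Types (x y z p v : V) (K X S : set V) (sg t r : R).

Lemma cont_on_enorm (T : topologicalType) (A : set T) (f : T -> V) :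
  cont_on A f <-> forall u, A u -> forall e : R, 0 < e ->
    \forall w \near u, A w -> enorm (f w - f u) < e.
Proof.
split => [cf u Au e e0|h u Au O /nbhs_enorm [d d0 hd]].
  by apply: (cf u Au [set v | enorm (v - f u) < e]); apply/nbhs_enorm; exists e.
by apply: filterS (h u Au d d0) => w hw Aw; apply: hd; exact: hw.
Qed.

Lemma cont_on_dist (T : topologicalType) (A : set T) (f : T -> R) :
  cont_on A f <-> forall u, A u -> forall e : R, 0 < e ->
    \forall w \near u, A w -> `|f w - f u| < e.
Proof.
split => [cf u Au e e0|h u Au O /nbhs_ballP [d /= d0 hd]].
  apply: (cf u Au [set v : R | `|v - f u| < e]); apply/nbhs_ballP.
  by exists e => // w; rewrite /ball /= distrC.
by apply: filterS (h u Au d d0) => w hw Aw; apply: hd; rewrite /ball /= distrC; exact: hw.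
Qed.

Lemma cont_onD (T : topologicalType) (A : set T) (f g : T -> V) :
  cont_on A f -> cont_on A g -> cont_on A (fun u => f u + g u).
Proof.
move=> /cont_on_enorm cf /cont_on_enorm cg; apply/cont_on_enorm => u Au e e0.
have e2 : 0 < e / 2 by rewrite divr_gt0.
apply: filterS2 (cf u Au _ e2) (cg u Au _ e2) => w h1 h2 Aw.
have := h1 Aw; have := h2 Aw; have := enormD (f w - f u) (g w - g u).
by rewrite addrACA -opprD; lra.
Qed.

Lemma cont_onZ (T : topologicalType) (A : set T) (a : T -> R) (f : T -> V) :
  cont_on A a -> cont_on A f -> cont_on A (fun u => a u *: f u).
Proof.
move=> /cont_on_dist ca /cont_on_enorm cf; apply/cont_on_enorm => u Au e e0.
pose C := `|a u| + enorm (f u) + 1.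
have C0 : 1 <= C by rewrite /C lerDr addr_ge0 // enorm_ge0.
have e2 : 0 < Num.min 1 (e / (2 * C)).
  by rewrite lt_min ltr01 divr_gt0 // mulr_gt0 // (lt_le_trans _ C0).
apply: filterS2 (ca u Au _ e2) (cf u Au _ e2) => w h1 h2 Aw.
have := h1 Aw; have := h2 Aw; rewrite !lt_min => /andP[f1 fe] /andP[a1 ae].
have -> : a w *: f w - a u *: f u = (a w - a u) *: (f w - f u) + ((a w - a u) *: f u + a u *: (f w - f u)).
  by rewrite scalerBl !scalerBr scalerBl; apply/rowP => i; rewrite !mxE; ring.
apply: le_lt_trans (enormD _ _) _.
apply: le_lt_trans (lerD (lexx _) (enormD _ _)) _; rewrite !enormZ.
set b := `|a w - a u| in a1 ae *; set c := enorm (f w - f u) in f1 fe *.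
have b0 : 0 <= b by exact: normr_ge0.
have c0 : 0 <= c by exact: enorm_ge0.
have f0 := enorm_ge0 (f u); have a0 := normr_ge0 (a u).
apply: (@le_lt_trans _ _ (c + b * enorm (f u) + `|a u| * c)).
  by rewrite addrA !lerD2r ler_piMl // ltW.
have eC : e / (2 * C) * C = e / 2 by field; rewrite gt_eqF // (lt_le_trans _ C0).
have : c * (1 + `|a u|) <= e / (2 * C) * (1 + `|a u|) by rewrite ler_wpM2r ?addr_ge0 // ltW.
have : b * enorm (f u) <= e / (2 * C) * enorm (f u) by rewrite ler_wpM2r // ltW.
move: eC; rewrite /C !mulrDr; lra.
Qed.

(** By compactness, the points where g >= e keep f away from 0. *)
Lemma compact_thin (T : topologicalType) (A : set T) (f g : T -> R) (e : R) :
  compact A -> cont_on A f -> cont_on A g ->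
  (forall u, A u -> f u <= 0 -> g u < e) ->
  exists2 r : R, 0 < r & forall u, A u -> f u <= r -> g u < e.
Proof.
move=> cA /cont_on_dist cf /cont_on_dist cg h.
have [||r r0 H] := @compact_uniform R T A (fun r u => A u -> f u <= r -> g u < e) cA.
- by move=> r r' u _ r'r Q Au fu; apply: Q => //; exact: le_trans fu r'r.
- move=> u Au; have [fu0|fu0] := leP (f u) 0.
    have gu := h u Au fu0.
    exists 1 => //; have ge : 0 < e - g u by lra.
    apply: filterS (cg u Au _ ge) => w hw Aw _.
    by have := hw Aw; rewrite ltr_norml; lra.
  exists (f u / 2); first lra.
  have f2 : 0 < f u / 2 by lra.
  apply: filterS (cf u Au _ f2) => w hw Aw fw.
  by have := hw Aw; rewrite ltr_norml; lra.
by exists r => // u Au; exact: H.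
Qed.

(** Nearest points to points near x0 accumulate at nearest points to x0, by
    compactness; a strict inequality on the latter thus persists. *)
Lemma proj_usc K x0 (Phi : V -> V -> R) (C : R) : closed K ->
  (forall y p q, Phi x0 p - C * (enorm (y - x0) + enorm (q - p)) <= Phi y q) ->
  (forall p, proj K x0 p -> 0 < Phi x0 p) ->
  exists2 d : R, 0 < d & forall y, enorm (y - x0) < d -> forall p, proj K y p -> 0 < Phi y p.
Proof.
move=> cK lip pos.
pose A := K `&` [set p | enorm (x0 - p) <= 3].
have clA : closed A.
  apply: closedI => //.
  apply: (preimage_closed (f := fun p => enorm (x0 - p)) (D := [set r | r <= 3])); last exact: closed_le.
  by move=> y _; exact: enormB_continuous.
have cA : compact A.
  apply: (enorm_compact (B := enorm x0 + 3)) clA _ => p [_ /= h].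
  by have := enormD (p - x0) x0; rewrite subrK enormB; lra.
have C1 : 0 < `|C| + 1 by rewrite ltr_wpDl.
have [||r r0 hr] := @compact_uniform R V A (fun r p => forall y, enorm (y - x0) < r ->
    enorm (y - p) = dd K y -> 0 < Phi y p) cA.
- by move=> s s' p _ s's h y ys; apply: h; exact: lt_le_trans ys s's.
- move=> p [Kp _]; have := dd_le x0 Kp; rewrite le_eqVlt => /orP[/eqP e|lt].
    have P0 : 0 < Phi x0 p by apply: pos.
    pose d := Phi x0 p / (2 * (`|C| + 1)).
    have d0 : 0 < d by rewrite divr_gt0 // mulr_gt0.
    exists d => //; apply/nbhs_enorm; exists d => // q qp y yx _.
    apply: lt_le_trans (lip y p q).
    have : C * (enorm (y - x0) + enorm (q - p)) <= `|C| * (enorm (y - x0) + enorm (q - p)).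
      by rewrite ler_wpM2r ?addr_ge0 ?enorm_ge0 // ler_norm.
    have : `|C| * (enorm (y - x0) + enorm (q - p)) <= `|C| * (2 * d).
      by rewrite ler_wpM2l //; lra.
    have dE : (`|C| + 1) * (2 * d) = Phi x0 p by rewrite /d; field; rewrite gt_eqF.
    lra.
  pose d := (enorm (x0 - p) - dd K x0) / 4.
  have d0 : 0 < d by rewrite /d; lra.
  exists d => //; apply/nbhs_enorm; exists d => // q qp y yx yq.
  have := dd_lip K y x0; have := enorm_tri y x0 p; have := enorm_tri q y p.
  by rewrite (enormB x0 y) /d in d0 qp yx *; lra.
exists (Num.min r 1); first by rewrite lt_min r0 ltr01.
move=> y; rewrite lt_min => /andP[yr y1] p [Kp yp]; apply: hr => //.
split => //=; have := enorm_tri y x0 p; have := dd_le2 K y.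
by rewrite (enormB x0 y) yp; lra.
Qed.

Lemma dot_lip v y p q x0 :
  `|dot v (y - q) - dot v (x0 - p)| <= enorm v * (enorm (y - x0) + enorm (q - p)).
Proof.
have -> : dot v (y - q) - dot v (x0 - p) = dot v ((y - x0) - (q - p)).
  by rewrite !(dotDr, dotNr); ring.
have b u : `|dot v u| <= enorm v * enorm u.
  by rewrite ler_norml cauchy_schwarz andbT -lerN2 opprK -dotNr -(enormN u) cauchy_schwarz.
apply: le_trans (b _) _; rewrite ler_wpM2l ?enorm_ge0 //.
by apply: le_trans (enormD _ _) _; rewrite enormN.
Qed.

Lemma convex_sum (I : eqType) (G : V -> Prop) (s : seq I) (a : I -> R) (f : I -> V) :
  (forall u v t, 0 <= t <= 1 -> G u -> G v -> G (t *: u + (1 - t) *: v)) ->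
  (forall i, i \in s -> 0 <= a i) -> (forall i, i \in s -> 0 < a i -> G (f i)) ->
  0 < \sum_(i <- s) a i -> G ((\sum_(i <- s) a i)^-1 *: \sum_(i <- s) a i *: f i).
Proof.
move=> cG; elim: s => [|i s IH] a0 Gf; first by rewrite big_nil ltxx.
rewrite !big_cons => ap.
have ai0 : 0 <= a i by apply: a0; exact: mem_head.
have s0 : 0 <= \sum_(j <- s) a j.
  by rewrite big_seq; apply: sumr_ge0 => j js; apply: a0; rewrite inE js orbT.
have IH' : 0 < \sum_(j <- s) a j -> G ((\sum_(j <- s) a j)^-1 *: \sum_(j <- s) a j *: f j).
  by apply: IH => j js; [apply: a0|apply: Gf]; rewrite inE js orbT.
move: ai0; rewrite le_eqVlt => /orP[/eqP ai0|ai0].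
  by rewrite -ai0 scale0r !add0r; apply: IH'; rewrite -ai0 add0r in ap.
have Gi : G (f i) by apply: Gf => //; exact: mem_head.
move: s0; rewrite le_eqVlt => /orP[/eqP s0|s0].
  have -> : \sum_(j <- s) a j *: f j = 0.
    rewrite big_seq big1 // => j js.
    have : a j == 0.
      move: (esym s0) => /eqP; rewrite big_seq psumr_eq0.
        by move=> /allP /(_ j js) /implyP /(_ js).
      by move=> k ks; apply: a0; rewrite inE ks orbT.
    by move=> /eqP ->; rewrite scale0r.
  by rewrite -s0 !addr0 scalerA mulVf ?gt_eqF // scale1r.
set A := \sum_(j <- s) a j in s0 ap IH' *.
have := cG _ _ (a i / (a i + A)) _ Gi (IH' s0); rewrite scalerA.
have -> : (1 - a i / (a i + A)) * A^-1 = (a i + A)^-1.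
  by field; rewrite !gt_eqF.
have -> : (a i / (a i + A)) *: f i + (a i + A)^-1 *: \sum_(j <- s) a j *: f j =
    (a i + A)^-1 *: (a i *: f i + \sum_(j <- s) a j *: f j).
  by rewrite scalerDr scalerA mulrC.
apply; rewrite divr_ge0 ?(ltW ai0) ?(ltW ap) //=.
by rewrite ler_pdivrMr // mul1r lerDl ltW.
Qed.

Lemma cont_on_sum (I : Type) (s : seq I) (T : topologicalType) (A : set T) (f : I -> T -> V) :
  (forall i, cont_on A (f i)) -> cont_on A (fun u => \sum_(i <- s) f i u).
Proof.
move=> cf; elim: s => [|i s IH].
  apply: (@eq_cont_on T V A (fun=> 0)); first by move=> u _; rewrite big_nil.
  by apply: continuous_cont_on => u; exact: cvg_cst.
apply: (@eq_cont_on T V A (fun u => f i u + \sum_(j <- s) f j u)).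
  by move=> u _; rewrite big_cons.
exact: cont_onD.
Qed.

Lemma continuous_sumR (I : Type) (s : seq I) (T : topologicalType) (f : I -> T -> R) :
  (forall i, continuous (f i)) -> continuous (fun u => \sum_(i <- s) f i u).
Proof.
move=> cf; elim: s => [|i s IH].
  have -> : (fun u => \sum_(i <- [::]) f i u) = (fun=> 0).
    by apply: funext => u; rewrite big_nil.
  by move=> u; exact: cvg_cst.
have -> : (fun u => \sum_(j <- i :: s) f j u) = (fun u => f i u + \sum_(j <- s) f j u).
  by apply: funext => u; rewrite big_cons.
by move=> u; apply: cvgD; [exact: cf|exact: IH].
Qed.

(** Good directions are selected locally by constants; a partition of unity takes
    convex combinations of them, and convexity keeps these good. *)
Lemma continuous_selection (Z : set V) (G : V -> V -> Prop) : compact Z ->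
  (forall y u v t, 0 <= t <= 1 -> G y u -> G y v -> G y (t *: u + (1 - t) *: v)) ->
  (forall x, Z x -> exists v, exists2 d : R, 0 < d & forall y, enorm (y - x) < d -> G y v) ->
  exists F : V -> V, continuous F /\ exists2 d : R, 0 < d &
    forall x, Z x -> forall y, enorm (y - x) < d -> G y (F x).
Proof.
move=> cZ cG hZ.
have [[z0 Zz0]|nZ] := pselect (exists z, Z z); last first.
  exists (fun=> 0); split; first exact: (@cst_continuous V V 0).
  by exists 1 => // x Zx; case: nZ; exists x.
pose vd x : V * R := if pselect (Z x) is left Zx then
   (projT1 (cid (hZ x Zx)), projT1 (cid2 (projT2 (cid (hZ x Zx))))) else (0, 1).
have vdP x : Z x -> 0 < (vd x).2 /\ forall y, enorm (y - x) < (vd x).2 -> G y (vd x).1.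
  move=> Zx; rewrite /vd; case: pselect => // Zx'.
  by case: cid => v /= h; case: cid2 => d /= d0 hd.
pose a c x : R := Num.max 0 ((vd c).2 / 2 - enorm (x - c)).
have ca c : continuous (a c).
  apply: lipschitz_continuous => x y; rewrite /a ge_max; apply/andP; split.
    by rewrite addr_ge0 ?enorm_ge0 // le_max lexx.
  apply: (@le_trans _ _ ((vd c).2 / 2 - enorm (y - c) + enorm (x - y))).
    by have := enorm_tri x y c; rewrite (enormB y x); lra.
  by rewrite lerD2r le_max lexx orbT.
have := cZ; rewrite compact_cover => /(_ V Z (fun c => [set x | 0 < a c x])) [].
- move=> c _; apply: (open_comp (f := a c) (D := [set r | 0 < r])); last exact: open_gt.
  by move=> x _; exact: ca.
- move=> x Zx; exists x => //=; rewrite /a subrr enorm0 subr0 lt_max.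
  by have [d0 _] := vdP x Zx; rewrite divr_gt0 // orbT.
move=> D DZ cov.
pose s : seq V := finmap.enum_fset D.
have sZ c : c \in s -> Z c.
  by move=> cs; have := DZ c cs; rewrite inE.
pose L x := \sum_(c <- s) a c x.
have cL : continuous L by exact: continuous_sumR.
have a0 c x : 0 <= a c x by rewrite le_max lexx.
have L0 x : Z x -> 0 < L x.
  move=> /cov [c /= cD ac].
  rewrite /L (big_rem c) //=; apply: lt_le_trans ac _; rewrite lerDl.
  by apply: sumr_ge0.
have [||m] := @compact_EVT_min _ _ L Z _ cZ.
- by exists z0.
- exact: continuous_subspaceT.
rewrite inE => Zm mL.
have Lm0 := L0 _ Zm.
pose F x := (Num.max (L x) (L m))^-1 *: \sum_(c <- s) a c x *: (vd c).1.
exists F; split.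
  apply: cont_onT; apply: cont_onZ.
    apply: (cont_on_comp (f := fun x => Num.max (L x) (L m)) (B := [set r | r != 0])).
    - move=> r r0 O /(inv_continuous r0) h.
      by apply: filterS (h : nbhs r _) => u hu _; exact: hu.
    - apply: (cont_on_comp_pair (B := setT) (f := L) (g := fun=> L m)
        (h := fun p : R * R => Num.max p.1 p.2)) => //.
      + by apply: continuous_cont_on; exact: max_continuous.
      + exact: continuous_cont_on.
      + by apply: continuous_cont_on; exact: cst_continuous.
    - by move=> x _; rewrite /= gt_eqF // lt_max Lm0 orbT.
  apply: cont_on_sum => c; apply: cont_onZ; first exact: continuous_cont_on.
  by apply: continuous_cont_on; exact: cst_continuous.
have [d d0 ds] : exists2 d : R, 0 < d & forall c, c \in s -> d <= (vd c).2 / 2.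
  elim: (s) sZ => [|c s' IH] sZ; first by exists 1.
  have [|d d0 ds] := IH; first by move=> c' c's; apply: sZ; rewrite inE c's orbT.
  have [vc _] := vdP c (sZ c (mem_head _ _)).
  exists (Num.min d ((vd c).2 / 2)); first by rewrite lt_min d0 divr_gt0.
  move=> c'; rewrite inE => /orP[/eqP ->|/ds c's]; first by rewrite ge_min lexx orbT.
  by rewrite ge_min c's.
exists d => // x Zx y yx; rewrite /F.
have -> : Num.max (L x) (L m) = L x by apply/max_idPl; apply: mL; rewrite inE.
apply: convex_sum => //; [exact: cG| |exact: L0].
move=> c cs; rewrite lt_max ltxx /= subr_gt0 => xc.
have [_ h] := vdP c (sZ c cs); apply: h.
by have := enorm_tri x y c; have := ds c cs; lra.
Qed.

End EuclidTopology.

(** * Motion by Euler polygons *)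

Lemma continuous_pair {T U W : topologicalType} (f : T -> U) (g : T -> W) :
  continuous f -> continuous g -> continuous (fun x => (f x, g x)).
Proof.
move=> cf cg; apply: cont_onT; apply: cont_on_pair; first exact: continuous_cont_on.
by move=> x _ P gP; apply: filterS (cg x P gP : nbhs x _) => y h _; exact: h.
Qed.

Section Euler.
Context (R : realType) (N : nat).
Notation V := 'rV[R]_N.
Implicit Types (x y z p v : V) (K X S : set V) (sg t r : R).

(** Being good is not an open condition at points of X, where it does not control
    the nearest points of X at all; this form, with a margin eps and disregarding
    points at distance less than rho from X, is open. *)
Definition pushing sg X S (rho eps : R) y v :=
  (forall p, proj S y p -> dd S y < sg * dot v (y - p)) /\
  (rho <= dd X y -> forall p, proj X y p -> dot v (y - p) < eps).

Lemma pushing_convex sg X S rho eps y u v t : 0 <= t <= 1 ->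
  pushing sg X S rho eps y u -> pushing sg X S rho eps y v ->
  pushing sg X S rho eps y (t *: u + (1 - t) *: v).
Proof.
move=> /andP[t0 t1] [u1 u2] [v1 v2]; split => [p pS|yr p pX]; rewrite dotDl !dotZl.
  have h1 := u1 p pS; have h2 := v1 p pS.
  have [->|tn] := eqVneq t 0; first by rewrite mul0r subr0 mul1r add0r.
  have tp : 0 < t by rewrite lt_neqAle eq_sym tn.
  have := h1; rewrite -(ltr_pM2l tp) => h1'.
  have : (1 - t) * dd S y <= (1 - t) * (sg * dot v (y - p)).
    by apply: ler_wpM2l; [rewrite subr_ge0|exact: ltW].
  lra.
have h1 := u2 yr p pX; have h2 := v2 yr p pX.
have [->|tn] := eqVneq t 0; first by rewrite mul0r subr0 mul1r add0r.
have tp : 0 < t by rewrite lt_neqAle eq_sym tn.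
have := h1; rewrite -(ltr_pM2l tp) => h1'.
have : (1 - t) * dot v (y - p) <= (1 - t) * eps.
  by apply: ler_wpM2l; [rewrite subr_ge0|exact: ltW].
lra.
Qed.

(** The nearest points to y accumulate at those of x, and the inequalities for x
    are strict, or have the margin eps. *)
Lemma good_pushing_near sg X S rho eps x v : closed X -> closed S ->
  sg = 1 \/ sg = -1 -> 0 < rho -> 0 < eps -> good sg X S x v ->
  exists2 d : R, 0 < d & forall y, enorm (y - x) < d -> pushing sg X S rho eps y v.
Proof.
move=> cX cS hsg rho0 eps0 [g1 g2].
have [d1 d10 h1] : exists2 d : R, 0 < d & forall y, enorm (y - x) < d ->
    forall p, proj S y p -> 0 < sg * dot v (y - p) - dd S y.
  apply: (proj_usc (C := enorm v + 1) cS) => [y p q|p /g1]; last by rewrite subr_gt0.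
  have := dot_lip v y p q x; rewrite ler_norml => /andP[a1 a2].
  have := dd_lip S y x; have := enorm_ge0 (q - p); rewrite mulrDl mul1r.
  by case: hsg => ->; lra.
have [d2 d20 h2] : exists2 d : R, 0 < d & forall y, enorm (y - x) < d ->
    rho <= dd X y -> forall p, proj X y p -> 0 < eps - dot v (y - p).
  have [x0|x0] := leP (dd X x) 0.
    exists rho => // y yx yr; exfalso.
    by have := dd_lip X y x; lra.
  have [d d0 h] : exists2 d : R, 0 < d & forall y, enorm (y - x) < d ->
      forall p, proj X y p -> 0 < eps - dot v (y - p).
    apply: (proj_usc (C := enorm v) cX) => [y p q|p /(g2 x0)]; last by lra.
    by have := dot_lip v y p q x; rewrite ler_norml => /andP[a1 a2]; lra.
  by exists d => // y yx _; exact: h.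
exists (Num.min d1 d2); first by rewrite lt_min d10.
move=> y; rewrite lt_min => /andP[y1 y2]; split => [p pS|yr p pX].
  by rewrite -subr_gt0; exact: h1.
by rewrite -subr_gt0; exact: h2.
Qed.

Lemma dot_sqrD (a b : V) : dot (a + b) (a + b) = dot a a + 2 * dot b a + dot b b.
Proof. by rewrite dotDl !dotDr (dotC a b); ring. Qed.

(** The first order gain s is at least halved by the quadratic error, which the
    smallness of s W^2 controls. For sg = 1 the estimate is made backwards from
    the end of the step, because nearest points bound distances from above only. *)
Lemma step_S sg S x v (s W c : R) : sg = 1 \/ sg = -1 -> closed S ->
  enorm v <= W -> 0 <= s -> s * W ^+ 2 <= c / 2 -> s * W <= c / 2 -> s <= c -> c <= dd S x ->
  dd S x + s * W < 2 ->
  (forall p, proj S x p -> dd S x < sg * dot v (x - p)) ->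
  (forall p, proj S (x + s *: v) p -> dd S (x + s *: v) < sg * dot v (x + s *: v - p)) ->
  sg * dd S x + s / 2 <= sg * dd S (x + s *: v).
Proof.
move=> hsg cS vW s0 sW2 sW sc cx x2 hx hy.
have W0 : 0 <= W by exact: le_trans (enorm_ge0 v) vW.
have vv : dot v v <= W ^+ 2 by rewrite -le_enorm_sqr.
have sW0 : 0 <= s * W by rewrite mulr_ge0.
have sv : enorm (s *: v) <= s * W by rewrite enormZ ger0_norm // ler_wpM2l.
have ssvv : s * s * dot v v <= s * (c / 2).
  rewrite -mulrA ler_wpM2l // (le_trans _ sW2) // ler_wpM2l //.
have ss : 0 <= s * s by rewrite mulr_ge0.
case: hsg => sgE; rewrite sgE !(mul1r, mulN1r) in hx hy *; last first.
  have [|p pS] := dd_attained cS (x := x); first by lra.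
  have := hx p pS; rewrite mulN1r => hp.
  have [Sp xp] := pS.
  suff : dd S (x + s *: v) <= dd S x - s / 2 by lra.
  apply: le_trans (dd_le _ Sp) _; rewrite le_enorm_sqr; last lra.
  rewrite addrAC dot_sqrD !dotZl dotZr -(enorm_sqr (x - p)) xp.
  have : s * dot v (x - p) <= - (s * dd S x) by rewrite -mulrN ler_wpM2l //; lra.
  have : s * (c / 2) <= s * dd S x by rewrite ler_wpM2l //; lra.
  by rewrite sqrrB; lra.
set y := x + s *: v in hy *.
have yx : dd S x <= dd S y + s * W.
  apply: le_trans (dd_lip S x y) _; rewrite lerD2l /y opprD addNKr enormN //.
have xy : dd S y <= dd S x + s * W.
  by apply: le_trans (dd_lip S y x) _; rewrite lerD2l /y addrC addKr.
have [|p pS] := dd_attained cS (x := y); first by lra.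
have := hy p pS; rewrite mul1r => hp.
have [Sp yp] := pS.
suff : dd S x <= dd S y - s / 2 by lra.
apply: le_trans (dd_le _ Sp) _; rewrite le_enorm_sqr; last lra.
have -> : x - p = (y - p) + (- s) *: v by rewrite /y scaleNr addrAC addrK.
rewrite dot_sqrD !dotZl dotZr -(enorm_sqr (y - p)) yp.
have : s * dd S y <= s * dot v (y - p) by rewrite ler_wpM2l //; lra.
have : s * (c / 2) <= s * dd S y by rewrite ler_wpM2l //; lra.
by rewrite sqrrB; lra.
Qed.

(** Distances to X are bounded from above through a nearest point to x, so only
    the direction at the start matters. *)
Lemma step_X X x v (s W rho kap : R) : closed X -> enorm v <= W -> 0 <= s ->
  0 <= kap -> s * W ^+ 2 <= kap * rho -> 0 < rho -> rho <= dd X x -> dd X x < 2 ->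
  (forall p, proj X x p -> dot v (x - p) < kap * rho / 2) ->
  dd X (x + s *: v) <= dd X x + kap * s.
Proof.
move=> cX vW s0 kap0 sW2 rho0 rx x2 hx.
have W0 : 0 <= W by exact: le_trans (enorm_ge0 v) vW.
have vv : dot v v <= W ^+ 2 by rewrite -le_enorm_sqr.
have ssvv : s * s * dot v v <= s * (kap * rho).
  by rewrite -mulrA ler_wpM2l // (le_trans _ sW2) // ler_wpM2l.
have [p pX] := dd_attained cX x2; have [Xp xp] := pX.
have h := hx p pX; have ks : 0 <= kap * s by rewrite mulr_ge0.
apply: le_trans (dd_le _ Xp) _; rewrite le_enorm_sqr; last lra.
rewrite addrAC dot_sqrD !dotZl dotZr -(enorm_sqr (x - p)) xp sqrrD.
have : s * dot v (x - p) <= s * (kap * rho / 2) by rewrite ler_wpM2l // ltW.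
have : kap * s * rho <= kap * s * dd X x by rewrite ler_wpM2l.
have : 0 <= (kap * s) ^+ 2 by rewrite sqr_ge0.
lra.
Qed.

Definition cutoff (c d eta u : R) : R :=
  Num.max 0 (Num.min 1 (Num.min ((u - c) / eta) ((d - u) / eta))).

Lemma cutoff_ge0 c d eta u : 0 <= cutoff c d eta u.
Proof. by rewrite le_max lexx. Qed.

Lemma cutoff_le1 c d eta u : cutoff c d eta u <= 1.
Proof. by rewrite ge_max ler01 /= ge_min lexx. Qed.

Lemma cutoff_gt0 c d eta u : 0 < eta -> 0 < cutoff c d eta u -> c < u < d.
Proof.
move=> e0; rewrite /cutoff lt_max ltxx /= !lt_min => /and3P[_].
by rewrite !pmulr_lgt0 ?invr_gt0 // !subr_gt0 => -> ->.
Qed.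

Lemma cutoff_eq1 c d eta u : 0 < eta -> c + eta <= u <= d - eta -> cutoff c d eta u = 1.
Proof.
move=> e0 /andP[u1 u2]; apply: le_anti; rewrite cutoff_le1 /= le_max !le_min lexx /=.
by rewrite !ler_pdivlMr // !mul1r; apply/orP; right; apply/andP; lra.
Qed.

Lemma cutoff_continuous c d eta : continuous (cutoff c d eta).
Proof.
have mx (f g : R -> R) : continuous f -> continuous g -> continuous (fun u => Num.max (f u) (g u)).
  by move=> cf cg u; apply: (@continuous_max _ _ f g); [exact: cf|exact: cg].
have mn (f g : R -> R) : continuous f -> continuous g -> continuous (fun u => Num.min (f u) (g u)).
  by move=> cf cg u; apply: (@continuous_min _ _ f g); [exact: cf|exact: cg].
apply: mx; first exact: cst_continuous.
apply: (mn); first exact: cst_continuous.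
apply: mn => u.
  by apply: cvgM; [apply: cvgB; [exact: cvg_id|exact: cvg_cst]|exact: cvg_cst].
by apply: cvgM; [apply: cvgB; [exact: cvg_cst|exact: cvg_id]|exact: cvg_cst].
Qed.

Lemma in01_mulle (s t : R) : 0 <= s <= 1 -> 0 <= t -> 0 <= s * t <= t.
Proof. by move=> /andP[s0 s1] t0; rewrite mulr_ge0 //= ler_piMl. Qed.

Lemma euler_step sg X S z v (u tau W c d kap r del : R) :
  sg = 1 \/ sg = -1 -> closed X -> closed S -> 0 <= u <= tau ->
  tau * W ^+ 2 <= c / 2 -> tau * W <= c / 2 -> tau <= c -> d + tau * W < 2 ->
  tau * W ^+ 2 <= kap * (r / 2) -> tau * W < del -> 0 <= kap -> 0 < r -> r < 2 ->
  c <= dd S z <= d -> dd X z <= r -> enorm v <= W ->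
  (forall y, enorm (y - z) < del -> pushing sg X S (r / 2) (kap * (r / 2) / 2) y v) ->
  [/\ sg * dd S z + u / 2 <= sg * dd S (z + u *: v), enorm (z + u *: v - z) <= tau * W &
      r / 2 <= dd X z -> dd X (z + u *: v) <= dd X z + kap * tau].
Proof.
move=> hsg cX cS /andP[u0 ut] tW2 tWc tc dW tWk tdel kap0 r0 r2 /andP[cz zd] zr vW hp.
have W0 : 0 <= W := le_trans (enorm_ge0 v) vW.
have uW : u * W <= tau * W by rewrite ler_wpM2r.
have uW2 : u * W ^+ 2 <= tau * W ^+ 2 by rewrite ler_wpM2r // sqr_ge0.
have dist : enorm (z + u *: v - z) <= tau * W.
  by rewrite addrC addKr enormZ ger0_norm //; apply: le_trans uW; rewrite ler_wpM2l.
have rh : 0 < r / 2 by rewrite divr_gt0.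
have [d0 pz1] : 0 < del /\ pushing sg X S (r / 2) (kap * (r / 2) / 2) z v.
  have d0 : 0 < del by apply: le_lt_trans tdel; rewrite mulr_ge0 // (le_trans u0).
  by split => //; apply: hp; rewrite subrr enorm0.
have [pz2 pz3] := pz1.
have [py _] := hp _ (le_lt_trans dist tdel).
clear hp pz1; split => //.
  apply: (step_S hsg cS vW u0 (le_trans uW2 tW2) (le_trans uW tWc) (le_trans ut tc) cz) => //.
  by apply: le_lt_trans dW; exact: lerD.
move=> rz; apply: le_trans (step_X cX vW u0 kap0 (le_trans uW2 tWk) rh rz (le_lt_trans zr r2) (pz3 rz)) _.
by rewrite lerD2l ler_wpM2l.
Qed.

(** The distance to X can grow only while it is at least r / 2, and by kt at each
    of the n steps, so it stays below r. *)
Lemma euler_invariants sg X S (phi : V -> V) (c d e r w kt : R) n x :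
  0 < r -> 0 <= w -> w <= e -> w <= r / 8 -> 0 <= kt -> kt * n%:R = r / 8 ->
  (forall z, ~ (c < dd S z < d) -> phi z = z) ->
  (forall z, dd X z <= r -> c < dd S z < d ->
    [/\ sg * dd S z <= sg * dd S (phi z), enorm (phi z - z) <= w &
        r / 2 <= dd X z -> dd X (phi z) <= dd X z + kt]) ->
  dd X x <= r / 2 -> forall k, (k <= n)%N ->
  [/\ dd X (iter k phi x) <= r,
      sg * dd S x <= sg * dd S (iter k phi x),
      c <= dd S x -> c - e <= dd S (iter k phi x),
      dd S x <= d -> dd S (iter k phi x) <= d + e &
      enorm (iter k phi x - x) <= w * k%:R].
Proof.
move=> r0 w0 we wr kt0 ktn fixed step xr k kn.
have lin (j : nat) : (j <= n)%N -> kt * j%:R <= r / 8.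
  by move=> jn; rewrite -ktn ler_wpM2l // ler_nat.
suff [i1 i2 i3 i4 i5] : [/\ dd X (iter k phi x) <= r / 2 + r / 8 + kt * k%:R,
      sg * dd S x <= sg * dd S (iter k phi x),
      c <= dd S x -> c - e <= dd S (iter k phi x),
      dd S x <= d -> dd S (iter k phi x) <= d + e &
      enorm (iter k phi x - x) <= w * k%:R].
  split => //; apply: le_trans i1 _; have := lin k kn; clear -r0; lra.
elim: k kn => [|k IH] kn.
  rewrite /= !mulr0 addr0 subrr enorm0; split => //.
  - by clear -r0 xr; lra.
  - by have := le_trans w0 we; clear; lra.
  - by have := le_trans w0 we; clear; lra.
have [i1 i2 i3 i4 i5] := IH (ltnW kn); rewrite iterS {IH}.
set z := iter k phi x in i1 i2 i3 i4 i5 *.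
have zr : dd X z <= r by apply: le_trans i1 _; have := lin k (ltnW kn); clear -r0; lra.
rewrite -[k.+1%:R]natr1 !mulrDr !mulr1.
have [zb|/fixed ->] := pselect (c < dd S z < d); last first.
  split => //; first by apply: le_trans i1 _; clear -kt0; lra.
  by apply: le_trans i5 _; clear -w0; lra.
have [s1 s2 s3] := step z zr zb.
have l1 := dd_lip S (phi z) z; have l2 := dd_lip S z (phi z).
rewrite enormB in l2; have l3 := dd_lip X (phi z) z.
split.
- have [rz|rz] := leP (r / 2) (dd X z).
    by apply: le_trans (s3 rz) _; move: i1; clear; lra.
  have kk : 0 <= kt * k%:R by rewrite mulr_ge0.
  by move: l3 s2 rz kk wr; clear -kt0; lra.
- exact: le_trans i2 s1.
- by move=> _; case/andP: zb; move: l2 s2 we; clear; lra.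
- by move=> _; case/andP: zb; move: l1 s2 we; clear; lra.
- by apply: le_trans (enorm_tri z _ _) _; rewrite addrC; exact: lerD.
Qed.

(** Each step gains tau / 2, and there are enough steps to cross the band. *)
Lemma euler_reaches sg X S (phi : V -> V) (c d eta r tau : R) n x :
  sg = 1 \/ sg = -1 -> 0 <= tau -> 0 < eta -> tau * n%:R = 2 * (d - c) ->
  (forall k, (k <= n)%N -> dd X (iter k phi x) <= r /\ sg * dd S x <= sg * dd S (iter k phi x)) ->
  (forall z, ~ (c < dd S z < d) -> phi z = z) ->
  (forall z, dd X z <= r -> c < dd S z < d -> sg * dd S z <= sg * dd S (phi z)) ->
  (forall z, dd X z <= r -> c + eta <= dd S z <= d - eta ->
    sg * dd S z + tau / 2 <= sg * dd S (phi z)) ->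
  c + eta <= dd S x <= d - eta ->
  sg * (if sg == 1 then d - eta else c + eta) <= sg * dd S (iter n phi x).
Proof.
move=> hsg tau0 eta0 taun inv fixed mono full xb.
set tgt := if sg == 1 then _ else _.
have tgtE : (sg = 1 /\ tgt = d - eta) \/ (sg = -1 /\ tgt = c + eta).
  rewrite /tgt; case: hsg => ->; first by rewrite eqxx; left.
  by rewrite ifF; [right|apply/eqP; clear; lra].
have H k : (k <= n)%N -> sg * tgt <= sg * dd S (iter k phi x) \/
    sg * dd S x + tau / 2 * k%:R <= sg * dd S (iter k phi x).
  elim: k => [|k IH] kn; first by right; rewrite mulr0 addr0.
  have [zr zx] := inv k (ltnW kn).
  rewrite iterS; set z := iter k phi x in IH zr zx *.
  have mz : sg * dd S z <= sg * dd S (phi z).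
    by have [zb|/fixed -> //] := pselect (c < dd S z < d); exact: mono.
  have [tz|zt] := leP (sg * tgt) (sg * dd S z); first by left; exact: le_trans mz.
  case: (IH (ltnW kn)) => [h|h]; first by rewrite leNgt zt in h.
  right; rewrite -[k.+1%:R]natr1 mulrDr mulr1 addrA.
  apply: le_trans (full z zr _); first by rewrite lerD2r.
  by case: tgtE zt zx => -[-> ->]; move: xb; clear; lra.
case: (H n (leqnn n)) => // h; apply: le_trans h.
have -> : tau / 2 * n%:R = d - c by rewrite mulrAC taun; field.
by case: tgtE => -[-> ->]; move: xb eta0; clear; lra.
Qed.

(** Euler's method for the field F, cut off outside the band c < dd S < d. The
    polygons have n equal steps, and the homotopy parameter scales all the steps
    at once, so that it is an iterate of one continuous map. *)
Lemma euler_push sg X S (F : V -> V) (c d W r del e eta : R) :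
  sg = 1 \/ sg = -1 -> closed X -> closed S -> continuous F ->
  0 < c -> c < d -> d < 2 -> 0 < r -> r < 2 -> 0 < del -> 0 <= W -> 0 < e -> 0 < eta ->
  (forall x, c <= dd S x <= d -> dd X x <= r -> enorm (F x) <= W /\
     forall y, enorm (y - x) < del ->
       pushing sg X S (r / 2) (r / (16 * (d - c)) * (r / 2) / 2) y (F x)) ->
  exists E : R -> V -> V, continuous (fun p : R * V => E p.1 p.2) /\
    forall t x, 0 <= t <= 1 -> dd X x <= r / 2 ->
    [/\ E 0 x = x, ~ (c < dd S x < d) -> E t x = x,
      dd X (E t x) <= r, sg * dd S x <= sg * dd S (E t x) &
      [/\ c <= dd S x -> c - e <= dd S (E t x), dd S x <= d -> dd S (E t x) <= d + e,
      enorm (E t x - x) <= 2 * (d - c) * W &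
      c + eta <= dd S x <= d - eta ->
        sg * (if sg == 1 then d - eta else c + eta) <= sg * dd S (E 1 x)]].
Proof.
move=> hsg cX cS cF c0 cd d2 r0 r2 del0 W0 e0 eta0 hF.
have [T TE] : exists T, T = 2 * (d - c) by exists (2 * (d - c)).
have T0 : 0 < T by rewrite TE; clear -cd; lra.
(* during the total time T the distance to X grows at rate at most kap *)
move: hF; have [kap [kap0 kapT ->]] : exists kap,
    [/\ 0 < kap, kap * T = r / 8 & r / (16 * (d - c)) = kap].
  exists (r / (16 * (d - c))); split => //.
    by rewrite divr_gt0 // mulr_gt0 // subr_gt0.
  by rewrite TE; field; rewrite gt_eqF // subr_gt0.
move=> hF.
have W20 : 0 <= W ^+ 2 by rewrite sqr_ge0.
have [m [m0 [m1 m2 m3 [m4 m5 m6]]]] : exists m : R, 0 < m /\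
   [/\ m <= del / 2, m <= c / 2, m <= kap * (r / 2) &
   [/\ m <= (2 - d) / 2, m <= e & m <= r / 8]].
  exists (Num.min (Num.min (del / 2) (c / 2)) (Num.min (Num.min (kap * (r / 2)) ((2 - d) / 2)) (Num.min e (r / 8)))).
  rewrite !ge_min !lexx !orbT; split => //.
  have h1 : 0 < kap * (r / 2) by rewrite mulr_gt0 // divr_gt0.
  have h2 : 0 < (2 - d) / 2 by rewrite divr_gt0 // subr_gt0.
  by rewrite !lt_min e0 h1 h2 !divr_gt0.
have [n [n0 [tau [tau0 tauT tauW]]]] : exists n : nat, 0 < n%:R :> R /\
    exists tau : R, [/\ 0 < tau, tau * n%:R = T & tau * (W ^+ 2 + W + 1) <= m].
  pose n := (Num.truncn (T * (W ^+ 2 + W + 1) / m)).+1.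
  have n0 : 0 < n%:R :> R by rewrite ltr0n.
  exists n; split => //; exists (T / n%:R); split.
  - by rewrite divr_gt0.
  - by rewrite mulfVK // gt_eqF.
  - have : T * (W ^+ 2 + W + 1) / m < n%:R by exact: Num.Theory.truncnS_gt.
    rewrite ltr_pdivrMr // => /ltW h.
    by rewrite mulrAC ler_pdivrMr // [m * _]mulrC.
have tW20 : 0 <= tau * W ^+ 2 by rewrite mulr_ge0 // ltW.
have tW0 : 0 <= tau * W by rewrite mulr_ge0 // ltW.
have [tm1 tm2 tm3] : [/\ tau * W ^+ 2 <= m, tau * W <= m & tau <= m].
  move: tauW tW20 tW0 tau0; rewrite !mulrDr mulr1; clear.
  by move=> *; split; lra.
have [th [th01 th0 th1 thc]] : exists th : V -> R, [/\ forall x, 0 <= th x <= 1,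
    forall x, ~ (c < dd S x < d) -> th x = 0,
    forall x, c + eta <= dd S x <= d - eta -> th x = 1 & continuous th].
  exists (fun x => cutoff c d eta (dd S x)); split.
  - by move=> x; rewrite cutoff_ge0 cutoff_le1.
  - move=> x nb; apply: le_anti; rewrite cutoff_ge0 andbT leNgt; apply/negP => h.
    by apply: nb; exact: cutoff_gt0 h.
  - by move=> x; exact: cutoff_eq1.
  - move=> x; apply: (@continuous_comp _ _ _ (dd S) (cutoff c d eta)); first exact: dd_continuous.
    exact: cutoff_continuous.
have [phi phiE] : exists phi : R -> V -> V, forall s x, phi s x = x + (s * th x) *: F x.
  by exists (fun s x => x + (s * th x) *: F x).
have phi_cont : continuous (fun p : R * V => phi p.1 p.2).
  apply: cont_onT; apply: (@eq_cont_on _ _ _ (fun p : R * V => p.2 + (p.1 * th p.2) *: F p.2)).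
    by move=> p _; rewrite phiE.
  apply: cont_onD; first by apply: continuous_cont_on => p; exact: cvg_snd.
  apply: cont_onZ; last first.
    apply: (cont_on_compT (g := F) cF).
    by apply: continuous_cont_on => p; exact: cvg_snd.
  apply: continuous_cont_on => p.
  apply: (@cvgM _ _ _ _ (fun q : R * V => q.1) (fun q : R * V => th q.2)).
    exact: cvg_fst.
  apply: (@continuous_comp _ _ _ (fun q : R * V => q.2) th); first exact: cvg_snd.
  exact: thc.
have fixed s z : ~ (c < dd S z < d) -> phi s z = z.
  by move=> /th0 h; rewrite phiE h mulr0 scale0r addr0.
have step s z : 0 <= s <= tau -> dd X z <= r -> c < dd S z < d ->
   [/\ sg * dd S z + (s * th z) / 2 <= sg * dd S (phi s z),
       enorm (phi s z - z) <= tau * W &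
       (r / 2 <= dd X z -> dd X (phi s z) <= dd X z + kap * tau)].
  move=> /andP[s0 st] zr /andP[cz zd].
  have zb : c <= dd S z <= d by rewrite !ltW.
  have [FW hp] := hF z zb zr; rewrite phiE.
  apply: (euler_step hsg cX cS _ _ _ _ _ _ _ (ltW kap0) r0 r2 zb zr FW hp).
  - case/andP: (th01 z) => t0 t1; rewrite mulr_ge0 //=.
    by apply: le_trans st; rewrite ler_piMr.
  - exact: le_trans tm1 m2.
  - exact: le_trans tm2 m2.
  - by move: tm3 m2 c0; clear; lra.
  - by move: tm2 m4 d2; clear; lra.
  - exact: le_trans tm1 m3.
  - by move: tm2 m1 del0; clear; lra.
pose E t x := iter n (phi (t * tau)) x.
exists E; split.
  suff H k : continuous (fun p : R * V => iter k (phi (p.1 * tau)) p.2) by exact: H.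
  elim: k => [|k IH]; first by move=> p; exact: cvg_snd.
  have -> : (fun p : R * V => iter k.+1 (phi (p.1 * tau)) p.2) =
     (fun p : R * V => phi p.1 p.2) \o (fun p : R * V => (p.1 * tau, iter k (phi (p.1 * tau)) p.2)).
    by [].
  move=> p; apply: continuous_comp; last exact: phi_cont.
  move: p; apply: continuous_pair; last exact: IH.
  by move=> p; apply: cvgM; [exact: cvg_fst|exact: cvg_cst].
move=> t x t01 xr.
have invs s : 0 <= s <= tau -> forall k, (k <= n)%N ->
    [/\ dd X (iter k (phi s) x) <= r, sg * dd S x <= sg * dd S (iter k (phi s) x),
      c <= dd S x -> c - e <= dd S (iter k (phi s) x),
      dd S x <= d -> dd S (iter k (phi s) x) <= d + e &
      enorm (iter k (phi s) x - x) <= tau * W * k%:R].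
  move=> st; apply: (euler_invariants (kt := kap * tau) r0 tW0 (le_trans tm2 m5)
    (le_trans tm2 m6) _ _ (fixed s) _ xr).
  - by rewrite mulr_ge0 // ltW.
  - by rewrite -mulrA tauT.
  move=> z zr zb; have [h1 h2 h3] := step s z st zr zb; split => //.
  apply: le_trans h1; rewrite lerDl divr_ge0 // mulr_ge0 //; first by case/andP: st.
  by case/andP: (th01 z).
have s01 : 0 <= t * tau <= tau by apply: in01_mulle => //; exact: ltW.
have [i1 i2 i3 i4 i5] := invs _ s01 n (leqnn n).
have Ex : E t x = iter n (phi (t * tau)) x by [].
rewrite Ex; split; [| |exact: i1|exact: i2|split; [exact: i3|exact: i4| |]].
- rewrite /E mul0r; elim: (n) => [//|k IH].
  by rewrite iterS IH phiE mul0r scale0r addr0.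
- by move=> nb; elim: (n) => [//|k IH]; rewrite iterS IH; exact: fixed.
- by apply: le_trans i5 _; rewrite mulrAC tauT TE.
have tt : 0 <= tau <= tau by rewrite ltW //=.
have iv := invs tau tt.
rewrite /E mul1r; apply: (euler_reaches (X := X) (r := r) (tau := tau)) => //.
- exact: ltW.
- by rewrite tauT TE.
- by move=> k kn; have [j1 j2 _ _ _] := iv k kn; split.
- exact: fixed.
- move=> z zr zb; have [h _ _] := step tau z tt zr zb; apply: le_trans h.
  by rewrite lerDl divr_ge0 // mulr_ge0 //; [exact: ltW|case/andP: (th01 z)].
- move=> z zr zb; have [|h _ _] := step tau z tt zr; last by rewrite th1 // mulr1 in h.
  by move: zb eta0; clear; lra.
Qed.

End Euler.

(** * Collars as infinite concatenations *)

Section Collars.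
Context (R : realType) (N : nat).
Notation V := 'rV[R]_N.
Implicit Types (x y z p v : V) (K X S : set V) (sg t r : R).

Definition sublevel X S (b : R) : set V := [set x | X x /\ dd S x <= b].

Lemma closed_dd_le S (b : R) : closed [set x | dd S x <= b].
Proof.
apply: (preimage_closed (f := dd S) (D := [set r | r <= b])); last exact: closed_le.
by move=> x _; exact: dd_continuous.
Qed.

Lemma closed_dd_ge S (b : R) : closed [set x | b <= dd S x].
Proof.
apply: (preimage_closed (f := dd S) (D := [set r | b <= r])); last exact: closed_ge.
by move=> x _; exact: dd_continuous.
Qed.

Lemma compactV_closed K : compact K -> closed K.
Proof. by apply: compact_closed; exact: norm_hausdorff. Qed.

Lemma sublevel_closed X S b : closed X -> closed (sublevel X S b).
Proof. by move=> cX; apply: closedI => //; exact: closed_dd_le. Qed.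

Lemma compact_near K (A : set V) b : compact K -> b < 2 -> closed A ->
  (forall x, A x -> dd K x <= b) -> compact A.
Proof.
move=> /compact_enorm [B hB] b2 cA h; apply: (enorm_compact (B := B + 2)) cA _ => x /h xb.
by apply: dd_lt_bounded hB _; lra.
Qed.

(** A germ of retraction near X, with junk elsewhere. Composing with it corrects
    polygons that left X slightly, and smallness of its displacement keeps the
    estimates about distances. *)
Definition retraction_near X S (b : R) (rho : V -> V) :=
  [/\ forall x, sublevel X S b x -> rho x = x,
      exists2 r : R, 0 < r & cont_on [set x | dd X x <= r /\ dd S x <= b] rho &
      forall e : R, 0 < e -> exists2 r : R, 0 < r & forall x, dd X x <= r -> dd S x <= b ->
        sublevel X S b (rho x) /\ enorm (rho x - x) <= e].

(** One motion across a band of levels; e bounds the overshoot that polygons and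
    retractions cause. *)
Definition stage sg X S (b c d e l : R) (h : R -> V -> V) :=
  cont_on [set p : R * V | 0 <= p.1 <= 1 /\ sublevel X S b p.2] (fun w : R * V => h w.1 w.2) /\
  forall t x, 0 <= t <= 1 -> sublevel X S b x ->
  [/\ sublevel X S b (h t x), h 0 x = x, ~ (c < dd S x < d) -> h t x = x,
      sg * dd S x - e <= sg * dd S (h t x) &
  [/\ c <= dd S x -> c - e <= dd S (h t x), dd S x <= d -> dd S (h t x) <= d + e,
      enorm (h t x - x) <= l &
      c + e <= dd S x <= d - e ->
        sg * (if sg == 1 then d - e else c + e) <= sg * dd S (h 1 x)]].

(** Good directions near X are selected continuously, followed along polygons, and
    the result is retracted to the sublevel. The flag says whether the bound W on
    directions is available and wanted as a bound on the length. *)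
Lemma stage_exists sg X S (b c d W e : R) (bounded : bool) rho :
  sg = 1 \/ sg = -1 -> closed X -> compact S -> retraction_near X S b rho ->
  0 < c -> c < d -> d < 2 -> (sg = 1 -> d < b \/ 2 <= b) -> 0 < e -> 0 <= W ->
  (exists2 r : R, 0 < r & forall x, c <= dd S x <= d -> dd X x <= r ->
     exists v, (bounded -> enorm v <= W) /\ good sg X S x v) ->
  exists l h, [/\ 0 <= l, bounded -> l <= 2 * (d - c) * W + e & stage sg X S b c d e l h].
Proof.
move=> hsg cX kS [rho1 [r0 r00 rho2] rho3] c0 cd d2 hb e0 W0 [r1 r10 hv].
have cS := compactV_closed kS.
pose e1 := if d < b then Num.min (e / 2) (b - d) else e / 2.
have e20 : 0 < e / 2 by rewrite divr_gt0.
have e10 : 0 < e1.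
  by rewrite /e1; case: (ltP d b) => h //; rewrite lt_min e20 subr_gt0.
have e1e : e1 <= e / 2.
  by rewrite /e1; case: (ltP d b) => h //; rewrite ge_min lexx.
have e1b : d < b -> d + e1 <= b.
  move=> db; rewrite /e1 db -lerBrDl ge_min lexx orbT //.
have [r2 r20 hrho] := rho3 _ e20.
pose r := Num.min (Num.min r0 r1) (Num.min r2 1).
have rpos : 0 < r by rewrite /r !lt_min r00 r10 r20 ltr01.
have [rr0 rr1 rr2 rr3] : [/\ r <= r0, r <= r1, r <= r2 & r <= 1].
  by rewrite /r !ge_min !lexx !orbT.
pose rh := r / 2; have rh0 : 0 < rh by rewrite divr_gt0.
pose ep := r / (16 * (d - c)) * (r / 2) / 2.
have ep0 : 0 < ep by rewrite divr_gt0 // mulr_gt0 // divr_gt0 // mulr_gt0 // subr_gt0.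
pose Z := [set x | dd X x <= r] `&` ([set x | dd S x <= d] `&` [set x | c <= dd S x]).
have cZ : compact Z.
  apply: (compact_near kS d2); last by move=> x [_ []].
  by apply: closedI; [|apply: closedI]; [exact: closed_dd_le|exact: closed_dd_le|exact: closed_dd_ge].
pose G y v := (bounded -> enorm v <= W) /\ pushing sg X S rh ep y v.
have Gconvex y u v t : 0 <= t <= 1 -> G y u -> G y v -> G y (t *: u + (1 - t) *: v).
  move=> t01 [bu pu] [bv pv]; split; last exact: pushing_convex.
  move=> bd; case/andP: t01 => t0 t1; have t1' : 0 <= 1 - t by rewrite subr_ge0.
  apply: le_trans (enormD _ _) _; rewrite !enormZ !ger0_norm //.
  have h1 := ler_wpM2l t0 (bu bd); have h2 := ler_wpM2l t1' (bv bd).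
  by clear -h1 h2; lra.
have Glocal x : Z x -> exists v, exists2 d' : R, 0 < d' & forall y, enorm (y - x) < d' -> G y v.
  move=> [xr [xd xc]]; have [||v [bv gv]] := hv x.
  - by apply/andP.
  - exact: le_trans xr rr1.
  have [d' d'0 hd'] := good_pushing_near cX cS hsg rh0 ep0 gv.
  by exists v; exists d' => // y /hd'.
have [F [cF [del del0 hF]]] := continuous_selection cZ Gconvex Glocal.
have [W' [W'0 W'F W'W]] : exists W', [/\ 0 <= W', forall x, Z x -> enorm (F x) <= W' & bounded -> W' <= W].
  case: (boolP bounded) => [bd|nb].
    exists W; split => // x Zx; have [h _] := hF x Zx x (ltac:(by rewrite subrr enorm0)).
    exact: h.
  have /compact_enorm [B hB] : compact (F @` Z).
    by apply: continuous_compact => //; exact: continuous_subspaceT.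
  exists (Num.max B 0); split => //; first by rewrite le_max lexx orbT.
  by move=> x Zx; rewrite le_max; apply/orP; left; apply: hB; exists x.
have [|E [cE hE]] := @euler_push R N sg X S F c d W' r del e1 (e / 2) hsg cX cS cF
  c0 cd d2 rpos (ltac:(lra)) del0 W'0 e10 e20.
  move=> x /andP[xc xd] xr; split; first exact: W'F.
  by move=> y yx; have [] := hF x (conj xr (conj xd xc)) y yx.
have inY t x : 0 <= t <= 1 -> sublevel X S b x -> dd X (E t x) <= r /\ dd S (E t x) <= b.
  move=> t01 [Xx xb].
  have [|_ fx er mono [_ up _ _]] := hE t x t01; first by rewrite (dd_in Xx) ltW.
  split => //; case: hsg => sgE; rewrite sgE in mono; last by clear -mono xb; lra.
  have [xd|dx] := leP (dd S x) d; last by rewrite fx //; clear -dx; lra.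
  case: (hb sgE) => [/e1b h|b2]; last exact: le_trans (dd_le2 _ _) b2.
  by apply: le_trans (up xd) h.
exists (2 * (d - c) * W' + e), (fun t x => rho (E t x)); split.
- by rewrite addr_ge0 ?mulr_ge0 ?subr_ge0 // ltW.
- by move=> /W'W h; rewrite lerD2r ler_wpM2l // mulr_ge0 // subr_ge0 ltW.
split.
  apply: (cont_on_comp (f := fun p : R * V => E p.1 p.2) (B := [set x | dd X x <= r0 /\ dd S x <= b])) => //.
    exact: continuous_cont_on.
  by move=> [t x] /= [t01 /inY h]; have [h1 h2] := h t t01; split => //; exact: le_trans rr0.
move=> t x t01 Yx; have [Xx xb] := Yx.
have xr : dd X x <= r / 2 by rewrite (dd_in Xx) ltW.
have [E0 fx er mono [lo up disp full]] := hE t x t01 xr.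
have [er' eb] := inY t x t01 Yx.
have [Yr mr] := hrho (E t x) (le_trans er rr2) eb.
have l1 := dd_lip S (rho (E t x)) (E t x); have l2 := dd_lip S (E t x) (rho (E t x)).
rewrite enormB in l2.
split => //.
- by rewrite E0 rho1.
- by move=> /fx ->; rewrite rho1.
- by clear -hsg mono l1 l2 mr e0; case: hsg mono => ->; lra.
split.
- by move=> /lo; clear -l2 mr e1e; lra.
- by move=> /up; clear -l1 mr e1e; lra.
- by have := enorm_tri (E t x) (rho (E t x)) x; clear -disp mr e0; lra.
- move=> xband.
  have one : 0 <= (1 : R) <= 1 by rewrite ler01 lexx.
  have [er1 eb1] := inY 1 x one Yx.
  have [_ mr1] := hrho (E 1 x) (le_trans er1 rr2) eb1.
  have l3 := dd_lip S (rho (E 1 x)) (E 1 x); have l4 := dd_lip S (E 1 x) (rho (E 1 x)).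
  rewrite enormB in l4.
  have xb' : c + e / 2 <= dd S x <= d - e / 2 by clear -xband e0; lra.
  have := full xb'; clear -hsg l3 l4 mr1; case: hsg => ->; first by rewrite eqxx; lra.
  have -> : (-1 == 1 :> R) = false by apply/eqP; lra.
  lra.
Qed.

(** ** Infinite concatenation *)

(** The bound tl is the tail of the series of the lengths l, up to a factor N that
    comes from working with coordinates. *)
Lemma uniform_limit (T : topologicalType) (A : set T) (u : nat -> T -> V) (l : nat -> R) (B : R) :
  (forall n, 0 <= l n) -> (forall n, \sum_(k < n) l k <= B) ->
  (forall n w, A w -> enorm (u n.+1 w - u n w) <= l n) ->
  exists (L : T -> V) (tl : nat -> R),
   [/\ forall e, 0 < e -> exists n, forall m, (n <= m)%N -> tl m < e,
    forall w n, A w -> enorm (L w - u n w) <= tl n,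
    forall w n, A w -> (forall m, (n <= m)%N -> u m.+1 w = u m w) -> L w = u n w &
    (forall n, cont_on A (u n)) -> cont_on A L].
Proof.
move=> l0 lB hu.
pose s n := \sum_(k < n) l k.
have sS n : s n.+1 = s n + l n by rewrite /s big_ord_recr.
have smono n m : (n <= m)%N -> s n <= s m.
  by move=> /subnK <-; elim: (m - n)%N => [//|k IH]; rewrite addSn sS; have := l0 (k + n)%N; lra.
pose E := [set s n | n in setT].
have supE : has_sup E.
  by split; [exists (s 0%N), 0%N|exists B => _ [n _ <-]; exact: lB].
pose tl n := sup E - s n.
have tl0 n : 0 <= tl n by rewrite subr_ge0; apply: ub_le_sup; [case: supE|exists n].
have tle e : 0 < e -> exists n, tl n < e.
  move=> e0; have [_ [n _ <-] h] := sup_adherent e0 supE; exists n; rewrite /tl; lra.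
have duS n m w : A w -> (n <= m)%N -> enorm (u m w - u n w) <= s m - s n.
  move=> Aw /subnK <-; elim: (m - n)%N => [|k IH]; first by rewrite !subrr enorm0.
  rewrite addSn sS; have := enorm_tri (u (k + n)%N w) (u (k + n).+1 w) (u n w).
  have := hu (k + n)%N w Aw; lra.
have co n m w i : A w -> u n w 0 i - tl n <= u m w 0 i + tl m.
  move=> Aw.
  have key n' m' : (n' <= m')%N -> `|u m' w 0 i - u n' w 0 i| <= s m' - s n'.
    move=> nm; apply: le_trans (duS _ _ _ Aw nm).
    by have := coord_enorm (u m' w - u n' w) i; rewrite !mxE.
  have t1 := tl0 n; have t2 := tl0 m; rewrite /tl in t1 t2 *.
  by case/orP: (leq_total n m) => /[dup] /smono h /key; rewrite ler_norml => /andP[h1 h2]; lra.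
pose L w : V := \row_i sup [set u n w 0 i - tl n | n in setT].
have LP w n i : A w -> `|L w 0 i - u n w 0 i| <= tl n.
  move=> Aw; rewrite mxE.
  have hs : has_sup [set u n w 0 i - tl n | n in setT].
    by split; [exists (u 0%N w 0 i - tl 0%N), 0%N|exists (u 0%N w 0 i + tl 0%N) => _ [m _ <-]; exact: co].
  have h1 : u n w 0 i - tl n <= sup [set u n w 0 i - tl n | n in setT].
    by apply: ub_le_sup; [case: hs|exists n].
  have h2 : sup [set u n w 0 i - tl n | n in setT] <= u n w 0 i + tl n.
    by apply: ge_sup; [case: hs|move=> _ [m _ <-]; exact: co].
  by rewrite ler_norml; lra.
have LE w n : A w -> enorm (L w - u n w) <= N%:R * tl n.
  move=> Aw; apply: le_trans (enorm_sum _) _.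
  apply: (@le_trans _ _ (\sum_(i < N) tl n)).
    by apply: ler_sum => i _; have := LP w n i Aw; rewrite !mxE.
  by rewrite sumr_const card_ord mulr_natl.
exists L, (fun n => N%:R * tl n); split => //.
- move=> e e0; have [|n hn] := tle (e / (N%:R + 1)); first by rewrite divr_gt0 // ltr_wpDl.
  exists n => m nm; rewrite ltr_pdivlMr ?ltr_wpDl // mulrC mulrDl mul1r in hn.
  have hm : tl m <= tl n by rewrite /tl lerD2l lerN2 smono.
  have : N%:R * tl m <= N%:R * tl n by rewrite ler_wpM2l.
  by have := tl0 n; lra.
- move=> w n Aw st.
  have un m : (n <= m)%N -> u m w = u n w.
    by move=> /subnK <-; elim: (m - n)%N => [//|k IH]; rewrite addSn st ?leq_addl.
  apply/eqP; rewrite -subr_eq0; apply/eqP/enorm_eq0/le_anti; rewrite enorm_ge0 andbT.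
  apply/ler_addgt0Pr => e e0; rewrite add0r.
  have [|m hm] := tle (e / (N%:R + 1)); first by rewrite divr_gt0 // ltr_wpDl.
  have hm' : tl (maxn n m) <= tl m by rewrite /tl lerD2l lerN2 smono // leq_maxr.
  rewrite -(un (maxn n m)) ?leq_maxl //; apply: le_trans (LE _ _ Aw) _.
  rewrite ltr_pdivlMr ?ltr_wpDl // mulrC mulrDl mul1r in hm.
  have := tl0 (maxn n m); have : N%:R * tl (maxn n m) <= N%:R * tl m by rewrite ler_wpM2l.
  by have := tl0 m; lra.
- move=> cu; apply/cont_on_enorm => w Aw e e0.
  have [|n hn] := tle (e / 3 / (N%:R + 1)).
    by rewrite !divr_gt0 // ltr_wpDl.
  have hn' : N%:R * tl n < e / 3.
    rewrite ltr_pdivlMr ?ltr_wpDl // mulrC mulrDl mul1r in hn.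
    by have := tl0 n; lra.
  have e3 : 0 < e / 3 by rewrite divr_gt0.
  have /cont_on_enorm cn := cu n.
  apply: filterS (cn w Aw _ e3) => w' h Aw'.
  have a1 := LE w n Aw; have a2 := LE w' n Aw'; have a3 := h Aw'.
  have := enorm_tri (u n w') (L w') (L w); have := enorm_tri (u n w) (u n w') (L w).
  by rewrite (enormB (u n w) (L w)); lra.
Qed.

(** A deformation retraction of Y onto S whose tracks meet S only at the end: read
    backwards, they are elements of the homotopy link. *)
Definition collar (Y S : set V) (H : R -> V -> V) :=
  cont_on [set p : R * V | 0 <= p.1 <= 1 /\ Y p.2] (fun w : R * V => H w.1 w.2) /\
  forall s x, 0 <= s <= 1 -> Y x ->
    [/\ H 0 x = x, Y (H s x), S (H 1 x), S x -> H s x = x &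
        s < 1 -> ~ S x -> ~ S (H s x)].

(** The n-th stage is slowed down so that only finitely many stages are active
    away from s = 1. *)
Definition ramp (n : nat) (s : R) : R := Num.max 0 (1 - n.+1%:R * (1 - s)).

Lemma ramp01 n s : 0 <= s <= 1 -> 0 <= ramp n s <= 1.
Proof.
move=> /andP[s0 s1]; rewrite le_max lexx /= ge_max ler01 /=.
by rewrite gerBl mulr_ge0 // subr_ge0.
Qed.

Lemma ramp0 n : ramp n 0 = 0.
Proof. by apply/max_idPl; rewrite subr0 mulr1 subr_le0 ler1n. Qed.

Lemma ramp1 n : ramp n 1 = 1.
Proof. by rewrite /ramp subrr mulr0 subr0; apply/max_idPr. Qed.

Lemma ramp_eventually0 s : s < 1 -> exists n, forall m, (n <= m)%N -> ramp m s = 0.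
Proof.
move=> s1; exists (Num.truncn (1 - s)^-1) => m nm; apply/max_idPl.
rewrite subr_le0; have d0 : 0 < 1 - s by lra.
rewrite -ler_pdivrMr // mul1r; apply: le_trans (ltW (Num.Theory.truncnS_gt _)) _.
by rewrite ler_nat.
Qed.

Lemma ramp_continuous n : continuous (ramp n).
Proof.
have mx (f : R -> R) : continuous f -> continuous (fun s => Num.max 0 (f s)).
  move=> cf s; apply: (@continuous_max _ _ (fun=> 0) f); last exact: cf.
  exact: cst_continuous.
apply: mx => s; apply: cvgB; first exact: cvg_cst.
by apply: cvgM; [exact: cvg_cst|apply: cvgB; [exact: cvg_cst|exact: cvg_id]].
Qed.

Fixpoint slowed (h : nat -> R -> V -> V) (n : nat) (w : R * V) {struct n} : V :=
  if n is m.+1 then h m (ramp m w.1) (slowed h m w) else w.2.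

(** The n-th stage acts on the band from A / 2^(n+2) to A / 2^n and pushes it close
    to its lower end, and consecutive bands overlap. The displacements are
    summable, so the composites converge uniformly. For s < 1 only finitely many
    stages are active, none of which reaches S. *)
Lemma collar_of_stages X S (b A B : R) (l : nat -> R) (h : nat -> R -> V -> V) :
  closed X -> closed S -> S `<=` X -> 0 < A -> A < 2 -> 0 <= b -> 16 * b <= 15 * A ->
  (forall n, 0 <= l n) -> (forall n, \sum_(k < n) l k <= B) ->
  (forall k, stage (-1) X S b (A / 2 ^+ k.+2) (A / 2 ^+ k) (A / 2 ^+ k.+4) (l k) (h k)) ->
  exists H, collar (sublevel X S b) S H.
Proof.
move=> cX cS SX A0 A2 b0 bA l0 lB st.
set Y := sublevel X S b.
have p2 k : 0 < A / 2 ^+ k by rewrite divr_gt0 // exprn_gt0.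
have p2S k : A / 2 ^+ k.+1 = A / 2 ^+ k / 2 by rewrite exprS invfM mulrA mulrAC.
pose u := slowed h.
have uS m w : u m.+1 w = h m (ramp m w.1) (u m w) by [].
pose D := [set p : R * V | 0 <= p.1 <= 1 /\ Y p.2].
have uY n w : D w -> Y (u n w).
  move=> [w1 Yw]; elim: n => [//|n IH]; rewrite uS.
  by have [_ hn] := st n; have [] := hn _ _ (ramp01 n w1) IH.
have step n w : D w -> enorm (u n.+1 w - u n w) <= l n.
  move=> Dw; have [_ hn] := st n.
  by have [_ _ _ _ [_ _ ? _]] := hn _ _ (ramp01 n Dw.1) (uY n w Dw).
have [L [tl [tle Ltl Lst Lc]]] := uniform_limit l0 lB step.
have cu n : cont_on D (u n).
  elim: n => [|n IH].
    by apply: continuous_cont_on => p; exact: cvg_snd.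
  have [ch hn] := st n.
  apply: (cont_on_comp_pair (h := fun p : R * V => h n p.1 p.2) (f := fun w : R * V => ramp n w.1) (g := u n) ch).
  - apply: (cont_on_compT (g := ramp n) (@ramp_continuous n)).
    by apply: continuous_cont_on => p; exact: cvg_fst.
  - exact: IH.
  - by move=> w Dw; split; [apply: ramp01; case: Dw|exact: uY].
have YL w : D w -> Y (L w).
  move=> Dw; apply: dd_eq0; first exact: sublevel_closed.
  apply: le_anti; rewrite dd_ge0 andbT; apply/ler_addgt0Pr => e e0; rewrite add0r.
  have [n hn] := tle e e0; apply: le_trans (dd_le _ (uY n w Dw)) _.
  by apply: le_trans (Ltl w n Dw) (ltW (hn n (leqnn n))).
exists (fun s x => L (s, x)); split.
  have := Lc cu; apply: eq_cont_on => -[s x] //.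
move=> s x s01 Yx.
have D0 : D (0, x) by split => //=; rewrite lexx ler01.
have D1 : D (1, x) by split => //=; rewrite lexx ler01.
have Ds : D (s, x) by [].
split.
- apply: (Lst (0, x) 0%N D0) => m _; rewrite uS ramp0.
  by have [_ hm] := st m; have [] := hm 0 (u m (0, x)) (ltac:(by rewrite lexx ler01)) (uY m _ D0).
- exact: YL.
- have ub n : dd S (u n (1, x)) <= A / 2 ^+ n - A / 2 ^+ n.+4.
    elim: n => [|n IH]; first by case: Yx => _ xb; rewrite /= expr0 !p2S expr0; lra.
    have [_ hn] := st n.
    have one : 0 <= (1 : R) <= 1 by rewrite ler01 lexx.
    have [_ _ _ mono [_ _ _ full]] := hn 1 (u n (1, x)) one (uY n _ D1).
    rewrite uS ramp1; have P := p2 n.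
    move: mono full IH; rewrite !p2S.
    have -> : (-1 == 1 :> R) = false by apply/eqP; lra.
    set q := A / 2 ^+ n in P *; move=> mono full IH.
    have [bg|sm] := leP (q / 2 / 2 + q / 2 / 2 / 2 / 2) (dd S (u n (1, x))).
      by have := full (ltac:(rewrite bg; lra)); lra.
    lra.
  apply: dd_eq0 => //; apply: le_anti; rewrite dd_ge0 andbT.
  apply/ler_addgt0Pr => e e0; rewrite add0r.
  have e2 : 0 < e / 2 by rewrite divr_gt0.
  have [n hn] := tle _ e2.
  have [k hk] : exists k, A / 2 ^+ k < e / 2.
    exists (Num.truncn (A / (e / 2))).+1; rewrite ltr_pdivrMr ?exprn_gt0 // mulrC -ltr_pdivrMr //.
    apply: lt_trans (Num.Theory.truncnS_gt _) _.
    by rewrite -natrX ltr_nat ltn_expl.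
  have kn : A / 2 ^+ maxn n k <= A / 2 ^+ k.
    rewrite ler_pM2l // lef_pV2 ?posrE ?exprn_gt0 //.
    by apply: ler_weXn2l; rewrite ?ler1n // leq_maxr.
  have h1 := hn (maxn n k) (leq_maxl _ _); have h2 := Ltl (1, x) (maxn n k) D1.
  have h3 := ub (maxn n k); have h4 := dd_lip S (L (1, x)) (u (maxn n k) (1, x)).
  have h5 := p2 (maxn n k).+4.
  by clear -h1 h2 h3 h4 h5 hk kn; lra.
- move=> Sx; apply: (Lst (s, x) 0%N Ds) => m _.
  have fx k : u k (s, x) = x.
    elim: k => [//|k IH]; rewrite uS IH; have [_ hk] := st k.
    have [_ _ fx _ _] := hk _ _ (ramp01 k s01) Yx.
    by apply: fx; rewrite (dd_in Sx) => /andP[+ _]; have := p2 k.+2; lra.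
  by rewrite !fx.
- move=> s1 nS.
  have [n hn] := ramp_eventually0 s1.
  have -> : L (s, x) = u n (s, x).
    apply: (Lst (s, x) n Ds) => m nm; rewrite uS hn //.
    by have [_ hm] := st m; have [] := hm 0 (u m (s, x)) (ltac:(by rewrite lexx ler01)) (uY m _ Ds).
  have : 0 < dd S (u n (s, x)).
    elim: (n) => [|k IH]; [exact: dd_gt0|rewrite uS].
    have [_ hk] := st k.
    have [_ _ fx _ [lo _ _ _]] := hk _ _ (ramp01 k s01) (uY k _ Ds).
    have [ck|ck] := leP (A / 2 ^+ k.+2) (dd S (u k (s, x))).
      by have := lo ck; have := p2 k.+2; rewrite !p2S; lra.
    by rewrite fx //; lra.
  by move=> + /dd_in h0; rewrite h0 ltxx.
Qed.

End Collars.

(** * Existence of collars and retractions *)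

Section CollarExistence.
Context (R : realType) (M : ominimal_structure R) (N : nat).
Notation V := 'rV[R]_N.
Implicit Types (x y z p v : V) (K X S : set V) (sg t r : R).

Lemma regular_uniform sg X S (c d : R) :
  (forall t, c <= t <= d -> regular sg X S t) ->
  exists2 r, 0 < r & forall x, c <= dd S x <= d -> dd X x <= r ->
    exists v, good sg X S x v.
Proof.
move=> reg.
have [|t tcd|r r0 h] := @compact_itv_uniform R (regular_at sg X S) c d.
- by move=> t r r' _ r'r h x xt xr; apply: h => //; exact: le_trans xr r'r.
- have [r r0 h] := reg t tcd; exists (r / 2); first by rewrite divr_gt0.
  move=> t' tt x xt xr; apply: h; last lra.
  by rewrite xt; apply: lt_trans tt _; lra.
- by exists r => // x xcd; exact: (h (dd S x) xcd x erefl).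
Qed.

Lemma on_band_shift (A : R) k j t : on_band (A / 2 ^+ k) j t <-> on_band A (k + j) t.
Proof.
have h m : A / 2 ^+ k / 2 ^+ m = A / 2 ^+ (k + m) by rewrite exprD invfM mulrA.
by rewrite /on_band !h !addnS.
Qed.

Lemma half_pow_small (A e : R) : 0 < A -> 0 < e -> exists k, A / 2 ^+ k < e.
Proof.
move=> A0 e0; exists (Num.truncn (A / e)).+1.
rewrite ltr_pdivrMr ?exprn_gt0 // mulrC -ltr_pdivrMr //.
apply: lt_trans (Num.Theory.truncnS_gt _) _.
by rewrite -natrX ltr_nat ltn_expl.
Qed.

Lemma half_pow_sum n : \sum_(k < n) 2 ^- k <= 2 :> R.
Proof.
have -> : \sum_(k < n) 2 ^- k = 2 - 2 / 2 ^+ n :> R.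
  elim: n => [|n IH]; first by rewrite big_ord0 expr0 divr1 subrr.
  by rewrite big_ord_recr /= IH exprS; field; rewrite expf_neq0.
by rewrite lerBlDr lerDl divr_ge0 // exprn_ge0.
Qed.

(** Beyond the index k0 where the integrable bound starts to hold, the lengths of
    the stages are summable; finitely many earlier stages only need regularity.
    The constants leave room for the first stage to reach the level b. *)
Lemma collar_exists X S (b A : R) rho : closed X -> compact S -> S `<=` X ->
  retraction_near X S b rho -> 0 < A -> A < 2 -> 0 <= b -> 16 * b <= 15 * A ->
  (forall t, 0 < t <= A -> regular (-1) X S t) ->
  rgerm 0 (fun A' => exists W, band_controlled X S A' W) ->
  exists H, collar (sublevel X S b) S H.
Proof.
move=> cX kS SX rrho A0 A2 b0 bA reg [a a0 ga].
have cS := compactV_closed kS.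
have p2 k : 0 < A / 2 ^+ k by rewrite divr_gt0 // exprn_gt0.
have p2S k : A / 2 ^+ k.+1 = A / 2 ^+ k / 2 by rewrite exprS invfM mulrA mulrAC.
have p2A k : A / 2 ^+ k <= A.
  by rewrite ler_pdivrMr ?exprn_gt0 // ler_peMr ?exprn_ege1 ?ler1n // ltW.
(* from the index k0 on, the bands lie in the range of the integrable bound *)
have [k0 hk0] := half_pow_small A0 a0.
have [W [W0 [BW hBW] hW]] := ga (A / 2 ^+ k0) (introT andP (conj (p2 k0) hk0)).
have st k : exists lh : R * (R -> V -> V), [/\ 0 <= lh.1,
    (k0 <= k)%N -> lh.1 <= 2 * A * (W (k - k0)%N / 2 ^+ k) + A / 2 ^+ k &
    stage (-1) X S b (A / 2 ^+ k.+2) (A / 2 ^+ k) (A / 2 ^+ k.+4) lh.1 lh.2].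
  have e4 : A / 2 ^+ k.+4 <= A / 2 ^+ k by rewrite !p2S; have := p2 k; clear; lra.
  have cd : A / 2 ^+ k.+2 < A / 2 ^+ k by rewrite !p2S; have := p2 k; clear; lra.
  have d2 : A / 2 ^+ k < 2 by apply: le_lt_trans A2.
  have vac : (-1 : R) = 1 -> A / 2 ^+ k < b \/ 2 <= b by clear; lra.
  case: (leqP k0 k) => kk.
    have hv : exists2 r, 0 < r & forall x, A / 2 ^+ k.+2 <= dd S x <= A / 2 ^+ k ->
        dd X x <= r -> exists v, (true -> enorm v <= W (k - k0)%N) /\ good (-1) X S x v.
      have [r r0 hr] := hW (k - k0)%N; exists r => // x xb xr.
      have [|v [vW gv]] := hr x _ xr; first by apply/on_band_shift; rewrite subnKC.
      by exists v; split.
    have [l [h [l0 lb sh]]] := stage_exists (or_intror erefl) cX kS rrho (p2 _) cd d2 vac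
      (p2 k.+4) (W0 _) hv.
    exists (l, h); split => // _.
    apply: le_trans (lb isT) _; rewrite lerD //.
    have -> : 2 * A * (W (k - k0)%N / 2 ^+ k) = 2 * (A / 2 ^+ k) * W (k - k0)%N by ring.
    rewrite ler_wpM2r // ler_wpM2l // lerBlDr lerDl ltW //.
  have [|r r0 hr] := @regular_uniform (-1) X S (A / 2 ^+ k.+2) (A / 2 ^+ k).
    move=> t /andP[t1 t2]; apply: reg; rewrite (lt_le_trans (p2 _) t1) /=.
    exact: le_trans t2 (p2A _).
  have hv : exists2 r, 0 < r & forall x, A / 2 ^+ k.+2 <= dd S x <= A / 2 ^+ k ->
      dd X x <= r -> exists v, (false -> enorm v <= 0) /\ good (-1) X S x v.
    by exists r => // x xb xr; have [v gv] := hr x xb xr; exists v; split.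
  have [l [h [l0 _ sh]]] := stage_exists (or_intror erefl) cX kS rrho (p2 _) cd d2 vac
      (p2 k.+4) (lexx _) hv.
  by exists (l, h); split => // kk'; move: kk; rewrite ltnNge kk'.
pose l k := (projT1 (cid (st k))).1; pose h k := (projT1 (cid (st k))).2.
have lP k : [/\ 0 <= l k, (k0 <= k)%N -> l k <= 2 * A * (W (k - k0)%N / 2 ^+ k) + A / 2 ^+ k &
    stage (-1) X S b (A / 2 ^+ k.+2) (A / 2 ^+ k) (A / 2 ^+ k.+4) (l k) (h k)].
  by rewrite /l /h; case: cid.
have l0 k : 0 <= l k by case: (lP k).
pose B := \sum_(k < k0) l k + (2 * A * BW + 2 * A).
apply: (collar_of_stages (A := A) (B := B) (l := l) (h := h)) => //; last by move=> k; case: (lP k).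
move=> n.
have mono : \sum_(k < n) l k <= \sum_(k < k0 + n) l k.
  rewrite addnC; clearbody l; clear -l0; elim: k0 => [|k IH]; first by rewrite addn0.
  by rewrite addnS big_ord_recr /=; apply: le_trans IH _; rewrite lerDl.
apply: le_trans mono _; rewrite big_split_ord /= /B lerD2l.
have bound k : l (k0 + k)%N <= 2 * A * (W k / 2 ^+ k) + A * 2 ^- k.
  have [_ lb _] := lP (k0 + k)%N.
  apply: le_trans (lb (leq_addr _ _)) _; rewrite addKn.
  have i : ((2 : R) ^+ (k0 + k))^-1 <= (2 ^+ k)^-1.
    rewrite lef_pV2 ?posrE ?exprn_gt0 //.
    by apply: ler_weXn2l; rewrite ?ler1n // leq_addl.
  apply: lerD; last by rewrite ler_pM2l.
  by rewrite ler_pM2l ?mulr_gt0 // ler_wpM2l.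
apply: le_trans (ler_sum _ (fun (k : 'I_n) _ => bound k)) _.
rewrite big_split /= -!mulr_sumr; apply: lerD; first by rewrite ler_pM2l ?mulr_gt0 //; exact: hBW.
by rewrite [leRHS]mulrC ler_pM2l //; exact: half_pow_sum.
Qed.

Lemma definable_setT : M N (setT : set V).
Proof. by have := definableC (definable0 M N); rewrite setC0. Qed.

(** In the ambient space nothing has to be corrected. *)
Lemma retraction_near_id K (b : R) : retraction_near setT K b id.
Proof.
split => //.
  by exists 1 => //; apply: continuous_cont_on => x; exact: cvg_id.
by move=> e e0; exists 1 => // x _ xb; rewrite subrr enorm0 ltW.
Qed.

Lemma neighbourhood_collar K (b A : R) : M N K -> compact K -> 0 < A -> A < 2 ->
  0 <= b -> 16 * b <= 15 * A -> (forall t, 0 < t <= A -> regular (-1) setT K t) ->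
  exists H, collar (sublevel setT K b) K H.
Proof.
move=> dK kK A0 A2 b0 bA reg.
apply: (collar_exists _ kK _ (@retraction_near_id K b) A0 A2 b0 bA reg).
- exact: closedT.
- by [].
- exact: band_controlled_germ definable_setT dK kK.
Qed.

Lemma small_neighbourhood_collar K : M N K -> compact K ->
  exists2 b, 0 < b < 1 & exists H, collar (sublevel setT K b) K H.
Proof.
move=> dK kK.
have [a a0 h] := regular_germ (or_intror erefl) definable_setT dK kK.
have m0 : 0 < Num.min a 1 by rewrite lt_min a0 ltr01.
have [ma m1] : Num.min a 1 <= a /\ Num.min a 1 <= 1 by rewrite !ge_min !lexx orbT.
exists (Num.min a 1 / 4); first by clear -m0 m1; lra.
apply: (neighbourhood_collar (A := Num.min a 1 / 2)) => //; try by clear -m0 m1; lra.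
by move=> t tA; apply: h; clear -m0 ma tA; lra.
Qed.

Lemma collar_sub_fixed (Y S : set V) H s x : S `<=` Y -> collar Y S H ->
  0 <= s <= 1 -> S x -> H s x = x.
Proof. by move=> SY [_ h] s01 Sx; have [_ _ _ + _] := h s x s01 (SY _ Sx); exact. Qed.

Lemma sub_sublevel K (b : R) : 0 <= b -> K `<=` sublevel setT K b.
Proof. by move=> b0 x Kx; split => //; rewrite dd_in. Qed.

Lemma itv01_compact_prod (A : set V) : compact A ->
  compact [set w : R * V | 0 <= w.1 <= 1 /\ A w.2].
Proof.
move=> cA; have := compact_setX (@segment_compact R 0 1) cA.
by congr compact; apply/seteqP; split => -[s x]; rewrite /= in_itv.
Qed.

(** The collar fixes K, so by compactness it moves little the points near K. *)
Lemma collar_small K (b : R) H : compact K -> 0 <= b -> b < 2 ->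
  collar (sublevel setT K b) K H -> forall e, 0 < e ->
  exists2 r, 0 < r <= b \/ b = 0 & forall s x, 0 <= s <= 1 -> dd K x <= r -> dd K x <= b ->
    enorm (H s x - x) <= e.
Proof.
move=> kK b0 b2 hH e e0; have [cH _] := hH.
have cY : compact (sublevel setT K b).
  by apply: (compact_near kK b2); [apply: sublevel_closed; exact: closedT|move=> x []].
have [||u uY u0|r r0 h] := @compact_thin R _ _ (fun w : R * V => dd K w.2)
   (fun w => enorm (H w.1 w.2 - w.2)) e (itv01_compact_prod cY).
- apply: continuous_cont_on => w.
  by apply: (@continuous_comp _ _ _ snd (dd K)); [exact: cvg_snd|exact: dd_continuous].
- apply: (cont_on_compT (g := @enorm R N) (@enorm_continuous R N)).
  apply: cont_onD => //.
  apply: (@eq_cont_on _ _ _ (fun w : R * V => (-1) *: w.2)); first by move=> w _; rewrite scaleN1r.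
  apply: cont_onZ; first by apply: continuous_cont_on; exact: cst_continuous.
  by apply: continuous_cont_on => w; exact: cvg_snd.
- have Ku : K u.2.
    apply: dd_eq0; first exact: compactV_closed.
    by apply: le_anti; rewrite u0 dd_ge0.
  by rewrite (collar_sub_fixed (sub_sublevel b0) hH uY.1 Ku) subrr enorm0.
have [bz|bp] := eqVneq b 0.
  exists r; first by right.
  by move=> s x s01 xr xb; apply: ltW; apply: (h (s, x)).
have bp' : 0 < b by rewrite lt_neqAle eq_sym bp.
exists (Num.min r b); first by left; rewrite lt_min r0 bp' ge_min lexx orbT.
move=> s x s01; rewrite le_min => /andP[xr _] xb; apply: ltW; exact: (h (s, x)).
Qed.

(** A point of X at level at most b lies in the sublevel, and compactness makes
    this stable. *)
Lemma near_sublevel X S (b e : R) : compact X -> 0 < e ->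
  exists2 r, 0 < r & forall x, dd X x <= r -> dd S x <= b -> dd (sublevel X S b) x < e.
Proof.
move=> kX e0; have cX := compactV_closed kX.
have cC : compact ([set x | dd X x <= 1] `&` [set x | dd S x <= b]).
  apply: (compact_near (K := X) (b := 1) kX); first by lra.
    by apply: closedI; exact: closed_dd_le.
  by move=> x [].
have [|||r r0 h] := compact_thin (f := dd X) (g := dd (sublevel X S b)) (e := e) cC.
- by apply: continuous_cont_on; exact: dd_continuous.
- by apply: continuous_cont_on; exact: dd_continuous.
- move=> x [_ xb] x0; rewrite dd_in //; split => //; apply: dd_eq0 => //.
  by apply: le_anti; rewrite x0 dd_ge0.
exists (Num.min r 1); first by rewrite lt_min r0 ltr01.
by move=> x; rewrite le_min => /andP[xr x1] xb; apply: h.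
Qed.

(** The sublevel is itself a compact definable set, and the end of a collar of its
    neighbourhood in the ambient space is a retraction. *)
Lemma retraction_near_exists X S (b : R) : compact X -> M N (sublevel X S b) ->
  exists rho, retraction_near X S b rho.
Proof.
move=> kX dY; have cX := compactV_closed kX.
set Y := sublevel X S b in dY *.
have cY : closed Y by exact: sublevel_closed.
have kY : compact Y by apply: subclosed_compact kX _ => // x [].
have [a /andP[a0 a1] [H hH]] := small_neighbourhood_collar dY kY.
have [cH pH] := hH.
have one : 0 <= (1 : R) <= 1 by rewrite ler01 lexx.
have a2 : a < 2 by clear -a1; lra.
exists (H 1); split.
- by move=> x Yx; apply: (collar_sub_fixed (sub_sublevel (ltW a0)) hH).
- have [r r0 hr] := near_sublevel S b kX a0.
  exists r => //.
  apply: (cont_on_comp (f := fun x : V => (1 : R, x)) (g := fun w : R * V => H w.1 w.2) cH).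
    apply: continuous_cont_on; apply: continuous_pair; first exact: cst_continuous.
    by move=> x; exact: cvg_id.
  by move=> x /= [xr xb]; split => //; split => //; apply/ltW/hr.
- move=> e e0.
  have [r hr0 hr] := collar_small kY (ltW a0) a2 hH e0.
  have r0 : 0 < r by case: hr0 => [/andP[]//|az]; rewrite az ltxx in a0.
  have m0 : 0 < Num.min r a by rewrite lt_min r0.
  have [r' r'0 hr'] := near_sublevel S b kX m0.
  exists r' => // x xr xb; have := hr' x xr xb; rewrite lt_min => /andP[x1 x2].
  have xY : sublevel setT Y a x by split => //; exact: ltW.
  by have [_ _ Y1 _ _] := pH 1 x one xY; split => //; apply: hr => //; exact: ltW.
Qed.

End CollarExistence.

(** ** Behaviour under magnification *)
Section Scaling.
Context (R : realType) (N : nat).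
Notation V := 'rV[R]_N.
Implicit Types (x y z p v : V) (K X S : set V) (sg t r lam : R).

(** The truncation of the distance at 2 is not homogeneous, which restricts the
    comparison to lam >= 1 and t <= 2. *)
Lemma dd_scale lam K x t : 1 <= lam -> t <= 2 ->
  (t <= dd (scale lam K) (lam *: x)) = (t / lam <= dd K x).
Proof.
move=> l1 t2; have l0 : 0 < lam by exact: lt_le_trans l1.
apply/idP/idP => h.
  apply: dd_ge.
    rewrite ler_pdivrMr //; apply: le_trans t2 _.
    by rewrite -[leLHS]mulr1 ler_pM2l.
  move=> y Ky; rewrite ler_pdivrMr // mulrC -{1}(gtr0_norm l0) -enormZ scalerBr.
  by apply: le_trans h _; apply: dd_le; exists y.
apply: dd_ge => // _ [y Ky <-]; rewrite -scalerBr enormZ gtr0_norm // mulrC -ler_pdivrMr //.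
by apply: le_trans h _; exact: dd_le.
Qed.

Lemma dd_scale_eq lam K x : 1 <= lam -> dd (scale lam K) (lam *: x) < 2 ->
  dd K x = dd (scale lam K) (lam *: x) / lam.
Proof.
move=> l1 d2; have l0 : 0 < lam by exact: lt_le_trans l1.
apply: le_anti; rewrite -dd_scale ?lexx ?(ltW d2) // andbT.
rewrite leNgt; apply/negP => h.
pose t := Num.min 2 (lam * dd K x).
have t1 : dd (scale lam K) (lam *: x) < t.
  by rewrite lt_min d2 mulrC -ltr_pdivrMr.
move: t1; rewrite ltNge => /negP; apply.
by rewrite dd_scale ?ge_min ?lexx // ler_pdivrMr // mulrC ge_min lexx orbT.
Qed.

Lemma proj_scale lam K x p : 1 <= lam -> dd (scale lam K) (lam *: x) < 2 ->
  proj (scale lam K) (lam *: x) p -> exists2 q, proj K x q & p = lam *: q.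
Proof.
move=> l1 d2 [[q Kq <-] e]; have l0 : 0 < lam by exact: lt_le_trans l1.
exists q => //; split => //; rewrite (dd_scale_eq l1 d2) -e -scalerBr enormZ gtr0_norm //.
by rewrite mulrAC mulfV ?mul1r // gt_eqF.
Qed.

Lemma good_scale sg lam X S x v : 1 <= lam ->
  dd (scale lam S) (lam *: x) < 2 -> dd (scale lam X) (lam *: x) < 2 ->
  good sg X S x v -> good sg (scale lam X) (scale lam S) (lam *: x) v.
Proof.
move=> l1 S2 X2 [g1 g2]; have l0 : 0 < lam by exact: lt_le_trans l1.
split => [p /(proj_scale l1 S2) [q qS ->]|X0 p /(proj_scale l1 X2) [q qX ->]];
    rewrite -scalerBr dotZr.
  have := g1 q qS; rewrite (dd_scale_eq l1 S2) ltr_pdivrMr //; lra.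
rewrite pmulr_rle0 //; apply: g2 qX.
by rewrite (dd_scale_eq l1 X2) divr_gt0.
Qed.

Lemma scaleK lam x : 0 < lam -> x = lam *: (lam^-1 *: x).
Proof. by move=> l0; rewrite scalerA mulfV ?scale1r // gt_eqF. Qed.

Lemma regular_scale sg lam X S t : 1 <= lam -> t < 2 -> regular sg X S (t / lam) ->
  regular sg (scale lam X) (scale lam S) t.
Proof.
move=> l1 t2 [r r0 h]; have l0 : 0 < lam by exact: lt_le_trans l1.
have m0 : 0 < Num.min (Num.min r (2 - t)) 1 by rewrite !lt_min r0 ltr01 subr_gt0 t2.
exists (Num.min (Num.min r (2 - t)) 1) => // x.
rewrite !lt_min -andbA => /and3P[x1 x2 _] /andP[/andP[y1 _] y2].
rewrite (scaleK x l0) in x1 x2 y1 y2 *; set y := lam^-1 *: x in x1 x2 y1 y2 *.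
have S2 : dd (scale lam S) (lam *: y) < 2 by move: x2; rewrite ltr_norml; lra.
have X2 : dd (scale lam X) (lam *: y) < 2 by lra.
have [||v gv] := h y.
- rewrite (dd_scale_eq l1 S2) -mulrBl normrM [`|lam^-1|]gtr0_norm ?invr_gt0 //.
  rewrite ltr_pdivrMr //; apply: lt_le_trans x1 _; rewrite ler_peMr //; exact: ltW.
- rewrite (dd_scale_eq l1 X2) ltr_pdivrMr //; apply: lt_le_trans y1 _.
  by rewrite ler_peMr // ltW.
by exists v; exact: good_scale.
Qed.

Definition superlevel X S (a : R) : set V := [set x | X x /\ a <= dd S x].

Lemma superlevel_scale lam X S a : 1 <= lam -> a <= 2 ->
  superlevel (scale lam X) (scale lam S) a = scale lam (superlevel X S (a / lam)).
Proof.
move=> l1 a2; apply/seteqP; split => x.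
  by move=> [[y Xy <-]]; rewrite dd_scale // => h; exists y.
by move=> [y [Xy h] <-]; split; [exists y|rewrite dd_scale].
Qed.

Lemma sublevel_scale lam X S b : 1 <= lam -> b < 2 ->
  sublevel (scale lam X) (scale lam S) b = scale lam (sublevel X S (b / lam)).
Proof.
move=> l1 b2; have l0 : 0 < lam by exact: lt_le_trans l1.
apply/seteqP; split => x.
  move=> [[y Xy <-]] h; exists y => //; split => //.
  by rewrite (dd_scale_eq l1 (le_lt_trans h b2)) ler_pM2r // invr_gt0.
move=> [y [Xy h] <-]; split; first by exists y.
rewrite leNgt; apply/negP => bx.
have [t tb t2] : exists2 t, b < t & t <= 2 /\ t <= dd (scale lam S) (lam *: y).
  exists (Num.min 2 (dd (scale lam S) (lam *: y))); first by rewrite lt_min b2.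
  by rewrite !ge_min !lexx orbT.
move: (t2.2); rewrite dd_scale ?t2.1 // ler_pdivrMr // => h2.
by move: h; rewrite ler_pdivlMr // => h; have := le_trans h2 h; rewrite leNgt tb.
Qed.

Lemma family_regular_scale (K : R -> set V) lam u r : 1 <= lam -> r < 2 ->
  family_regular K (u / lam) r ->
  forall x, 0 < dd (scale lam (K (u / lam))) x <= r ->
    exists v, good (-1) setT (scale lam (K (u / lam))) x v.
Proof.
move=> l1 r2 h x /andP[x0 xr]; have l0 : 0 < lam by exact: lt_le_trans l1.
rewrite (scaleK x l0) in x0 xr *; set y := lam^-1 *: x in x0 xr *.
have d2 := le_lt_trans xr r2.
have r0 : 0 <= r by exact: le_trans (ltW x0) xr.
have [|v [gv _]] := h y.
  rewrite (dd_scale_eq l1 d2) divr_gt0 //= ler_pdivrMr //.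
  apply: le_trans xr _; by rewrite ler_peMr.
exists v; split; last by rewrite dd_setT ltxx.
move=> p /(proj_scale l1 d2) [q qS ->]; rewrite -scalerBr dotZr.
have := gv q qS; rewrite (dd_scale_eq l1 d2) ltr_pdivrMr //; lra.
Qed.

End Scaling.

(** * Compression into shells *)

(** The gluing lemma. *)
Lemma cont_onU {T U : topologicalType} (A B : set T) (f : T -> U) : closed A -> closed B ->
  cont_on A f -> cont_on B f -> cont_on (A `|` B) f.
Proof.
move=> cA cB fA fB x _ O fO.
have piece (C : set T) : closed C -> cont_on C f -> \forall y \near x, C y -> O (f y).
  move=> cC fC; have [Cx|nCx] := pselect (C x); first exact: fC.
  have : nbhs x (~` C) by apply: open_nbhs_nbhs; split => //; exact: closed_openC.
  by apply: filterS => y nC /nC.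
by apply: filterS2 (piece A cA fA) (piece B cB fB) => y h1 h2 [/h1|/h2].
Qed.

Section Compression.
Context (R : realType) (M : ominimal_structure R) (N : nat).
Notation V := 'rV[R]_N.
Implicit Types (x y z p v : V) (K X S Q : set V) (sg t r : R).

Definition shell X S (a b : R) : set V := [set x | X x /\ a <= dd S x <= b].

(** A point near the shell but not in it is closer to one of the two walls, and
    near a wall the shell coincides with a superlevel or a sublevel. *)
Lemma shell_good X S (a b r : R) x :
  r <= (b - a) / 2 ->
  (0 < dd (superlevel X S a) x <= r -> exists v, good (-1) setT (superlevel X S a) x v) ->
  (0 < dd (sublevel X S b) x <= r -> exists v, good (-1) setT (sublevel X S b) x v) ->
  0 < dd (shell X S a b) x <= r -> dd (shell X S a b) x < 2 -> exists v, good (-1) setT (shell X S a b) x v.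
Proof.
move=> rab hL hM /andP[x0 xr] x2.
have wall K : shell X S a b `<=` K ->
    (forall y, K y -> enorm (x - y) < dd (shell X S a b) x -> shell X S a b y) ->
    (0 < dd K x <= r -> exists v, good (-1) setT K x v) ->
    exists v, good (-1) setT (shell X S a b) x v.
  move=> sK Ks hK.
  have e : dd K x = dd (shell X S a b) x.
    apply: le_anti; rewrite dd_sub //=; apply: dd_ge (dd_le2 _ _) _ => y Ky.
    rewrite leNgt; apply/negP => h; have := dd_le x (Ks y Ky h); lra.
  have [|v [gv _]] := hK; first by rewrite e x0.
  exists v; split; last by rewrite dd_setT ltxx.
  by move=> p [Kp pe]; rewrite -e; apply: gv; split; [exact: sK|rewrite pe].
have l1 y := dd_lip S y x; have l2 y := dd_lip S x y.
have [xm|xm] := leP (dd S x) ((a + b) / 2).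
  apply: wall hL => [y [Xy /andP[]] //|y [Xy ya] yx]; split => //; rewrite ya /=.
  by have := l1 y; rewrite enormB; lra.
apply: wall hM => [y [Xy /andP[]] //|y [Xy ya] yx]; split => //; rewrite ya andbT.
by have := l2 y; lra.
Qed.

(** The time of the collar is multiplied by a function of the distance to K that
    vanishes away from K, so that the motion extends by the identity. *)
Lemma cut_collar K (a0 a1 : R) H : collar (sublevel setT K a0) K H -> 0 < a1 -> a1 <= a0 ->
  exists C : R -> V -> V,
  [/\ cont_on [set w : R * V | 0 <= w.1 <= 1] (fun w : R * V => C w.1 w.2),
      forall s x, 0 <= s <= 1 -> K x -> C s x = x,
      forall x, dd K x <= a1 / 2 -> K (C 1 x),
      forall x, C 0 x = x &
      forall s x, 0 <= s <= 1 -> C s x = x \/ dd K x <= a1 /\ exists2 s', 0 <= s' <= 1 & C s x = H s' x].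
Proof.
move=> [cH hH] a10 a1a0.
pose chi x : R := Num.min 1 (Num.max 0 (2 - 2 / a1 * dd K x)).
have chi01 x : 0 <= chi x <= 1.
  by rewrite /chi le_min ler01 le_max lexx /= ge_min lexx.
have chi_far x : a1 <= dd K x -> chi x = 0.
  move=> h; rewrite /chi; have -> : Num.max 0 (2 - 2 / a1 * dd K x) = 0.
    by apply/max_idPl; rewrite subr_le0 mulrAC -mulrA ler_peMr // ler_pdivlMr // mul1r.
  by apply/min_idPr.
have chi_near x : dd K x <= a1 / 2 -> chi x = 1.
  move=> h; apply/min_idPl; rewrite le_max; apply/orP; right.
  have : 2 / a1 * dd K x <= 2 / a1 * (a1 / 2) by rewrite ler_wpM2l // divr_ge0 // ltW.
  have -> : 2 / a1 * (a1 / 2) = 1 by field; rewrite gt_eqF.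
  by lra.
have chi_cont : continuous chi.
  have mn (f : V -> R) : continuous f -> continuous (fun x => Num.min 1 (f x)).
    move=> cf x; apply: (@continuous_min _ _ (fun=> 1) f); last exact: cf.
    exact: cst_continuous.
  have mx (f : V -> R) : continuous f -> continuous (fun x => Num.max 0 (f x)).
    move=> cf x; apply: (@continuous_max _ _ (fun=> 0) f); last exact: cf.
    exact: cst_continuous.
  apply: mn; apply: mx => x.
  apply: (@continuous_comp _ _ _ (dd K) (fun d => 2 - 2 / a1 * d)); first exact: dd_continuous.
  apply: cvgB; first exact: cvg_cst.
  by apply: cvgM; [exact: cvg_cst|exact: cvg_id].
have s01M s x : 0 <= s <= 1 -> 0 <= s * chi x <= 1.
  move=> /andP[s0 s1]; have /andP[c0 c1] := chi01 x; rewrite mulr_ge0 //=.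
  by rewrite -[leRHS]mulr1 ler_pM.
have Y x : dd K x <= a1 -> sublevel setT K a0 x by move=> h; split => //; exact: le_trans a1a0.
pose C s x := if dd K x <= a1 then H (s * chi x) x else x.
exists C; split.
- set D := (D in cont_on D _).
  have cD : closed D.
    have -> : D = [set w : R * V | 0 <= w.1] `&` [set w | w.1 <= 1].
      by apply/seteqP; split => w; [move=> /andP[]|move=> [h1 h2]; apply/andP].
    apply: closedI.
      apply: (@preimage_closed _ _ fst [set r : R | 0 <= r]); last exact: closed_ge.
      by move=> w _; exact: cvg_fst.
    apply: (@preimage_closed _ _ fst [set r : R | r <= 1]); last exact: closed_le.
    by move=> w _; exact: cvg_fst.
  have csnd : continuous (fun w : R * V => dd K w.2).
    move=> w; apply: (@continuous_comp _ _ _ snd (dd K)); [exact: cvg_snd|exact: dd_continuous].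
  have cle : closed [set w : R * V | dd K w.2 <= a1].
    by apply: (@preimage_closed _ _ (fun w : R * V => dd K w.2) [set r : R | r <= a1]);
      [move=> w _; exact: csnd|exact: closed_le].
  have cge : closed [set w : R * V | a1 <= dd K w.2].
    by apply: (@preimage_closed _ _ (fun w : R * V => dd K w.2) [set r : R | a1 <= r]);
      [move=> w _; exact: csnd|exact: closed_ge].
  have -> : D = (D `&` [set w : R * V | dd K w.2 <= a1]) `|` (D `&` [set w : R * V | a1 <= dd K w.2]).
    apply/seteqP; split => [w Dw|w [[]|[]] //].
    by have [h|h] := leP (dd K w.2) a1; [left|right; split => //; exact: ltW].
  apply: cont_onU; [exact: closedI|exact: closedI| |].
    apply: (@eq_cont_on _ _ _ (fun w : R * V => H (w.1 * chi w.2) w.2)).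
      by move=> [s x] /= [_ h]; rewrite /C h.
    apply: (cont_on_comp_pair (h := fun w : R * V => H w.1 w.2) (f := fun w : R * V => w.1 * chi w.2) (g := snd) cH).
    - apply: continuous_cont_on => w; apply: cvgM; first exact: cvg_fst.
      by apply: (@continuous_comp _ _ _ snd chi); [exact: cvg_snd|exact: chi_cont].
    - by apply: continuous_cont_on => w; exact: cvg_snd.
    - by move=> [s x] /= [s01 h]; split; [exact: s01M|exact: Y].
  apply: (@eq_cont_on _ _ _ snd); last by apply: continuous_cont_on => w; exact: cvg_snd.
  move=> [s x] /= [s01 h]; rewrite /C; case: ifP => // h'.
  rewrite chi_far // mulr0.
  by have [-> _ _ _] := hH 0 x (ltac:(by rewrite lexx ler01)) (Y _ h').
- move=> s x s01 Kx; rewrite /C (dd_in Kx) ltW //.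
  have [_ _ _ + _] := hH _ x (s01M s x s01) (Y x (ltac:(by rewrite (dd_in Kx) ltW))); exact.
- move=> x h; rewrite /C; have h1 : dd K x <= a1 by lra.
  by rewrite h1 chi_near // mulr1; have [_ _ + _ _] := hH 1 x (ltac:(by rewrite lexx ler01)) (Y x h1).
- move=> x; rewrite /C mul0r; case: ifP => // h.
  by have [-> _ _ _ _] := hH 0 x (ltac:(by rewrite lexx ler01)) (Y x h).
- move=> s x s01; rewrite /C; case: ifP => h; last by left.
  by right; split => //; exists (s * chi x) => //; exact: s01M.
Qed.

End Compression.

Section Compression2.
Context (R : realType) (M : ominimal_structure R) (N : nat).
Notation V := 'rV[R]_N.
Implicit Types (x y z p v : V) (K X S Q : set V) (sg t r : R).

Lemma good_collar K (r al : R) : M N K -> compact K -> 0 < r -> r < 2 ->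
  (forall x, 0 < dd K x <= r -> exists v, good (-1) setT K x v) ->
  0 <= al -> al <= r / 2 -> exists H, collar (sublevel setT K al) K H.
Proof.
move=> dK kK r0 r2 h al0 alr.
apply: (neighbourhood_collar (A := r * 3 / 4) dK kK) => //; try by lra.
move=> t /andP[t0 tr]; exists (Num.min t (r - t)); first by rewrite lt_min t0 /=; lra.
move=> x; rewrite lt_min ltr_norml => /andP[/andP[h1 _] h2] _; apply: h.
by move: h2; rewrite ltr_norml => /andP[_ h2]; apply/andP; split; lra.
Qed.

(** Levels up to 1 occur in the diagrams; the margin is used by the motions that
    start at level 1. *)
Definition levels_regular X S := forall sg t, sg = 1 \/ sg = -1 -> 0 < t <= 3 / 2 -> regular sg X S t.

Lemma regular_stage sg X S (b c d e : R) rho : sg = 1 \/ sg = -1 -> closed X -> compact S ->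
  retraction_near X S b rho -> levels_regular X S -> 0 < c -> c < d -> d <= 3 / 2 ->
  (sg = 1 -> d < b \/ 2 <= b) -> 0 < e -> exists l h, stage sg X S b c d e l h.
Proof.
move=> hsg cX kS hrho reg c0 cd d2 hb e0.
have hv : exists2 r, 0 < r & forall x, c <= dd S x <= d ->
      dd X x <= r -> exists v, (false -> enorm v <= 0) /\ good sg X S x v.
  have [|r r0 hr] := @regular_uniform R N sg X S c d.
    by move=> t /andP[ct td]; apply: reg => //; apply/andP; split; lra.
  by exists r => // x xb xr; have [v gv] := hr x xb xr; exists v; split.
have [|l [h [_ _ sh]]] := stage_exists hsg cX kS hrho c0 cd _ hb e0 (lexx 0) hv; first by lra.
by exists l, h.
Qed.

Definition motion X S (be : R) (h : R -> V -> V) :=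
  cont_on [set w : R * V | 0 <= w.1 <= 1 /\ sublevel X S be w.2] (fun w : R * V => h w.1 w.2) /\
  forall t x, 0 <= t <= 1 -> sublevel X S be x -> sublevel X S be (h t x) /\ h 0 x = x.

Lemma motion_comp X S (be : R) h k : motion X S be h -> motion X S be k ->
  motion X S be (fun t x => k t (h t x)).
Proof.
move=> [ch hh] [ck hk]; split.
  apply: (cont_on_comp_pair (h := fun w : R * V => k w.1 w.2) (f := fst) (g := fun w : R * V => h w.1 w.2) ck) => //.
    by apply: continuous_cont_on => w; exact: cvg_fst.
  by move=> [t x] /= [t01 Yx]; split => //; have [] := hh t x t01 Yx.
move=> t x t01 Yx; have [Yh h0] := hh t x t01 Yx; have [Yk k0] := hk t _ t01 Yh.
split => //; rewrite h0; have [] := hk 0 x (ltac:(by rewrite lexx ler01)) Yx; by [].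
Qed.

Lemma motion_id X S (be : R) : motion X S be (fun _ x => x).
Proof. by split => //; apply: continuous_cont_on => w; exact: cvg_snd. Qed.

(** When b < 1, only levels between b and 5/4 move, so points below b stay, and
    what remains above b is arbitrarily close to b. *)
Lemma push_down X S (b be th : R) rho : closed X -> compact S ->
  retraction_near X S be rho -> levels_regular X S -> 0 < th -> 0 < b ->
  b < 1 /\ be = 1 \/ b = 2 /\ be = 2 ->
  exists2 h, motion X S be h & forall t x, 0 <= t <= 1 -> sublevel X S be x ->
    [/\ dd S x <= b -> h t x = x, 0 < dd S x -> 0 < dd S (h t x),
        dd S (h 1 x) <= b + th & dd S x <= dd S (h 1 x) \/ b <= dd S (h 1 x)].
Proof.
move=> cX kS hrho reg th0 b0 [[b1 be1]|[b2 be2]]; last first.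
  exists (fun _ x => x); first exact: motion_id.
  by move=> t x t01 Yx; split => //; [have := dd_le2 S x; lra|left].
rewrite be1 in hrho *.
pose th' := Num.min th (1 / 8).
have [th'0 [th'1 th'2]] : 0 < th' /\ th' <= th /\ th' <= 1 / 8.
  by rewrite lt_min th0 !ge_min !lexx orbT divr_gt0.
have c0 : 0 < b + th' / 2 by lra.
have cd : b + th' / 2 < 5 / 4 by lra.
have d2 : (5 / 4 : R) <= 3 / 2 by lra.
have e0 : 0 < th' / 8 by lra.
have vac : (-1 : R) = 1 -> 5 / 4 < (1 : R) \/ 2 <= (1 : R) by lra.
have [l [h [ch hh]]] := regular_stage (or_intror erefl) cX kS hrho reg c0 cd d2 vac e0.
exists h.
  by split => // t x t01 Yx; have [] := hh t x t01 Yx.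
move=> t x t01 Yx; have [_ _ fx mono [lo _ _ _]] := hh t x t01 Yx.
have [_ _ fx1 mono1 [lo1 _ _ full]] := hh 1 x (ltac:(by rewrite lexx ler01)) Yx.
have x1 := Yx.2.
split.
- by move=> xb; apply: fx => /andP[+ _]; clear -xb th'0; lra.
- have [h1|h1] := leP (b + th' / 2) (dd S x); first by move: (lo h1); clear -th'0 b0; lra.
  by rewrite fx // => /andP[+ _]; clear -h1; lra.
- have ne : (-1 == 1 :> R) = false by apply/eqP; lra.
  rewrite ne in full.
  have [h1|h1] := leP (b + th' / 2 + th' / 8) (dd S x); last by clear -mono1 h1 th'1 th'0; lra.
  have : b + th' / 2 + th' / 8 <= dd S x <= 5 / 4 - th' / 8 by rewrite h1 /=; clear -x1 th'2; lra.
  by move/full; clear -th'0 th'1; lra.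
- have [h1|h1] := leP (b + th' / 2) (dd S x); first by right; move: (lo1 h1); clear -th'0; lra.
  by left; rewrite fx1 // => /andP[+ _]; clear -h1; lra.
Qed.

(** The lower end of the band is at most q / 2: only the points at distance at
    least q from S are guaranteed to cross it, while all points stay off S. *)
Lemma push_up X S (a be q th : R) rho : closed X -> compact S ->
  retraction_near X S be rho -> levels_regular X S -> 0 < th -> 0 < q -> 0 <= a < 1 ->
  1 <= be -> exists2 h, motion X S be h & forall t x, 0 <= t <= 1 -> sublevel X S be x ->
    [/\ a <= dd S x -> h t x = x, 0 < dd S x -> 0 < dd S (h t x),
        a = 0 \/ q <= dd S x -> a - th <= dd S (h 1 x) &
        dd S (h 1 x) <= dd S x \/ dd S (h 1 x) <= a].
Proof.
move=> cX kS hrho reg th0 q0 /andP[a0 a1] be1.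
have [az|anz] := eqVneq a 0.
  exists (fun _ x => x); first exact: motion_id.
  by move=> t x t01 Yx; split => //; [move=> _; have := dd_ge0 S x; lra|left].
have ap : 0 < a by rewrite lt_neqAle eq_sym anz.
pose th' := Num.min th (a / 4).
have [th'0 [th'1 th'2]] : 0 < th' /\ th' <= th /\ th' <= a / 4.
  by rewrite lt_min th0 !ge_min !lexx orbT divr_gt0.
pose q' := Num.min q (a / 4).
have [q'0 [q'1 q'2]] : 0 < q' /\ q' <= q /\ q' <= a / 4.
  by rewrite lt_min q0 !ge_min !lexx orbT divr_gt0.
pose c := q' / 2; pose d := a - th' / 2; pose e := Num.min (th' / 8) (q' / 8).
have [e0 [e1 e2]] : 0 < e /\ e <= th' / 8 /\ e <= q' / 8.
  by rewrite lt_min !ge_min !lexx orbT !divr_gt0.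
have c0 : 0 < c by rewrite divr_gt0.
have cd : c < d by rewrite /c /d; lra.
have d2 : d <= 3 / 2 by rewrite /d; lra.
have hb : (1 : R) = 1 -> d < be \/ 2 <= be by move=> _; left; rewrite /d; lra.
have [l [h [ch hh]]] := regular_stage (or_introl erefl) cX kS hrho reg c0 cd d2 hb e0.
exists h.
  by split => // t x t01 Yx; have [] := hh t x t01 Yx.
move=> t x t01 Yx; have [_ _ fx mono [lo _ _ _]] := hh t x t01 Yx.
have [_ _ fx1 mono1 [lo1 up1 _ full]] := hh 1 x (ltac:(by rewrite lexx ler01)) Yx.
rewrite eqxx !mul1r in full mono mono1; rewrite /c /d in fx lo fx1 up1 full.
split.
- by move=> xb; apply: fx => /andP[_ +]; clear -xb th'0; lra.
- have [h1|h1] := leP c (dd S x); first by move: (lo h1) => h2 _; clear -h2 q'0 e2; lra.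
  by rewrite fx // => /andP[+ _]; clear -h1; rewrite /c in h1; lra.
- case=> [az|qx]; first by clear -ap az; lra.
  have [h1|h1] := leP (dd S x) (d - e); last by rewrite /d in h1; clear -h1 mono1 e1 th'1 th'0; lra.
  have : c + e <= dd S x <= d - e by rewrite h1 andbT; clear -qx q'1 e2 q'0; rewrite /c; lra.
  rewrite /c /d => /full; clear -e1 th'1 th'0; lra.
- have [h1|h1] := leP (dd S x) d; first by right; move: (up1 h1); clear -e1 th'0; lra.
  by left; rewrite fx1 // => /andP[_ +]; rewrite /d in h1; clear -h1; lra.
Qed.

End Compression2.

Section Compression3.
Context (R : realType) (M : ominimal_structure R) (N : nat).
Notation V := 'rV[R]_N.
Implicit Types (x y z p v : V) (K X S Q : set V) (sg t r : R).

Lemma shell_closed X S (a b : R) : closed X -> closed (shell X S a b).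
Proof.
move=> cX; have -> : shell X S a b = X `&` ([set x | a <= dd S x] `&` [set x | dd S x <= b]).
  by apply/seteqP; split => x; [move=> [? /andP[]]|move=> [? [? ?]]; split => //; apply/andP].
by apply: closedI => //; apply: closedI; [exact: closed_dd_ge|exact: closed_dd_le].
Qed.

Lemma shell_near X S (a b r : R) x : closed X -> r < 2 -> dd (shell X S a b) x <= r ->
  a - r <= dd S x <= b + r.
Proof.
move=> cX r2 xr; have [||p [[Xp /andP[ap pb]] e]] := @dd_attained R N (shell X S a b) x.
- exact: shell_closed.
- by lra.
by have := dd_lip S x p; have := dd_lip S p x; rewrite (enormB p x) e; lra.
Qed.

(** The thin collar of the shell in the ambient space does the last step, which
    approximate flows cannot do without moving the shell itself; the retraction
    brings its tracks back into X. *)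
Lemma snap X S (a b be : R) rho : compact X -> M N (shell X S a b) ->
  retraction_near X S be rho -> 0 <= a -> b < 1 /\ be = 1 \/ b = 2 /\ be = 2 ->
  exists2 h, motion X S be h & exists2 th, 0 < th & forall t x, 0 <= t <= 1 -> sublevel X S be x ->
    [/\ 0 < a -> 0 < dd S x -> 0 < dd S (h t x), shell X S a b x -> h t x = x &
        a - th <= dd S x <= b + th -> shell X S a b (h 1 x)].
Proof.
move=> kX dK [rho1 [r2 r20 rho2] rho3] a0 bbe; have cX := compactV_closed kX.
set K := shell X S a b in dK *.
have cK : closed K by exact: shell_closed.
have kK : compact K by apply: subclosed_compact cK kX _ => x [].
have KY x : K x -> sublevel X S be x.
  by move=> [Xx /andP[_ xb]]; split => //; have := dd_le2 S x; lra.
have [a0' /andP[a00 a01] [H hH]] := small_neighbourhood_collar dK kK.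
(* eS keeps the motion off S, and eb keeps it below the level be *)
pose eS : R := if 0 < a then a / 8 else 1.
pose eb : R := if b < 1 then (1 - b) / 4 else 1.
have eS0 : 0 < eS by rewrite /eS; case: ifP => // h; rewrite divr_gt0.
have eb0 : 0 < eb by rewrite /eb; case: ifP => // h; rewrite divr_gt0 // subr_gt0.
have [r3 r30 hr3] := rho3 _ eS0.
pose ep := Num.min (Num.min r2 r3) (Num.min eS eb).
have [ep0 [epr2 [epr3 [epS epb]]]] : 0 < ep /\ ep <= r2 /\ ep <= r3 /\ ep <= eS /\ ep <= eb.
  by rewrite /ep !lt_min r20 r30 eS0 eb0 !ge_min !lexx !orbT.
have a02 : a0' < 2 by lra.
have [rK rK0' hrK] := collar_small kK (ltW a00) a02 hH ep0.
have rK0 : 0 < rK by case: rK0' => [/andP[]//|az]; rewrite az ltxx in a00.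
pose a1 := Num.min (Num.min rK a0') (Num.min eS eb).
have [a10 [a1K [a1a0 [a1S a1b]]]] : 0 < a1 /\ a1 <= rK /\ a1 <= a0' /\ a1 <= eS /\ a1 <= eb.
  by rewrite /a1 !lt_min rK0 a00 eS0 eb0 !ge_min !lexx !orbT.
have [C [cC CK C1 C0 Cs]] := cut_collar hH a10 a1a0.
have a12 : a1 < 2 by lra.
have Cnear s x : 0 <= s <= 1 -> enorm (C s x - x) <= ep.
  move=> s01; case: (Cs s x s01) => [->|[xa [s' s'01 ->]]].
    by rewrite subrr enorm0 ltW.
  by apply: hrK => //; exact: le_trans xa _.
have inY s x : 0 <= s <= 1 -> sublevel X S be x -> dd X (C s x) <= ep /\ dd S (C s x) <= be.
  move=> s01 [Xx xb]; split; first exact: le_trans (dd_le _ Xx) (Cnear s x s01).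
  case: (Cs s x s01) => [->//|[xa _]].
  have /andP[_ h1] := shell_near cX a12 xa.
  have h2 := dd_lip S (C s x) x; have h3 := Cnear s x s01.
  case: bbe => [[b1 be1]|[_ ->]]; last exact: dd_le2.
  by rewrite be1; move: a1b epb; rewrite /eb b1; clear -b1 h1 h2 h3; lra.
have rhoP s x (s01 : 0 <= s <= 1) (Yx : sublevel X S be x) :
    sublevel X S be (rho (C s x)) /\ enorm (rho (C s x) - C s x) <= eS.
  by have [h1 h2] := inY s x s01 Yx; apply: hr3 => //; exact: le_trans epr3.
exists (fun s x => rho (C s x)).
  split.
    apply: (cont_on_comp (f := fun w : R * V => C w.1 w.2) rho2).
      by apply: cont_on_sub cC => w [].
    move=> [s x] /= [s01 Yx]; have [h1 h2] := inY s x s01 Yx.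
    by split => //; exact: le_trans epr2.
  move=> s x s01 Yx; split; first by have [] := rhoP s x s01 Yx.
  by rewrite C0 rho1.
have [|||th th0 hth] := @compact_thin R _ X (fun u => Num.max (a - dd S u) (dd S u - b)) (dd K) (a1 / 2) kX.
- have cdd := @dd_continuous R N S.
  apply: (cont_on_compT (g := fun d => Num.max (a - d) (d - b)) (f := dd S)).
    move=> d; apply: (@continuous_max _ _ (fun d => a - d) (fun d => d - b)).
      by apply: cvgB; [exact: cvg_cst|exact: cvg_id].
    by apply: cvgB; [exact: cvg_id|exact: cvg_cst].
  exact: continuous_cont_on.
- by apply: continuous_cont_on; exact: dd_continuous.
- move=> u Xu; rewrite ge_max => /andP[u1 u2]; rewrite dd_in ?divr_gt0 //; split => //.
  by apply/andP; split; lra.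
exists th => // t x t01 Yx; split.
- move=> ap x0; case: (Cs t x t01) => [->|[xa _]]; first by rewrite rho1.
  have /andP[h1 _] := shell_near cX a12 xa.
  have h2 := dd_lip S x (C t x); have h3 := Cnear t x t01; rewrite enormB in h2.
  have [_ h4] := rhoP t x t01 Yx.
  have h5 := dd_lip S (C t x) (rho (C t x)); rewrite enormB in h5.
  by move: a1S epS h4; rewrite /eS ap; clear -h1 h2 h3 h5 ap; lra.
- by move=> Kx; rewrite CK // rho1 //; exact: KY.
- move=> /andP[x1 x2].
  have K1 : K (C 1 x).
    apply: C1; apply: ltW; apply: hth; first by case: Yx.
    by rewrite ge_max; apply/andP; split; lra.
  by rewrite rho1 //; exact: KY.
Qed.

(** The three motions fix the shell and are composed at equal times, not one after
    the other, so that no concatenation of homotopies occurs. *)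
Lemma compression X S (a b be q : R) : compact X -> compact S ->
  M N (sublevel X S be) -> M N (shell X S a b) -> levels_regular X S ->
  0 <= a < 1 -> a < b -> b < 1 /\ be = 1 \/ b = 2 /\ be = 2 -> 0 < q ->
  exists2 h, motion X S be h & forall t x, 0 <= t <= 1 -> sublevel X S be x ->
    [/\ 0 < a -> 0 < dd S x -> 0 < dd S (h t x), shell X S a b x -> h t x = x &
        a = 0 \/ q <= dd S x -> shell X S a b (h 1 x)].
Proof.
move=> kX kS dY dK reg a01 ab bbe q0; have cX := compactV_closed kX.
have /andP[a0 a1] := a01; have b0 : 0 < b := le_lt_trans a0 ab.
have [rho hrho] := retraction_near_exists kX dY.
have [h3 m3 [th th0 hh3]] := snap kX dK hrho a0 bbe.
have [h1 m1 hh1] := push_down cX kS hrho reg th0 b0 bbe.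
have q'0 : 0 < Num.min q b by rewrite lt_min q0.
have be1 : 1 <= be by lra.
have [h2 m2 hh2] := push_up cX kS hrho reg th0 q'0 a01 be1.
exists (fun t x => h3 t (h2 t (h1 t x))); first exact: motion_comp (motion_comp m1 m2) m3.
have one : 0 <= (1 : R) <= 1 by rewrite ler01 lexx.
move=> t x t01 Yx.
have [Yx1 _] := m1.2 t x t01 Yx; have [Yx2 _] := m2.2 t _ t01 Yx1.
have [f1 p1 _ _] := hh1 t x t01 Yx; have [f2 p2 _ _] := hh2 t _ t01 Yx1.
have [p3 f3 _] := hh3 t _ t01 Yx2.
split.
- by move=> ap x0; apply: p3 => //; apply: p2; exact: p1.
- move=> Kx; have [Xx /andP[xa xb]] := Kx.
  have e1 := f1 xb; rewrite e1 in f2 f3 *.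
  by have e2 := f2 xa; rewrite e2 in f3 *; exact: f3.
- move=> xq.
  have [Y1 _] := m1.2 1 x one Yx; have [Y2 _] := m2.2 1 _ one Y1.
  have [_ _ d1 e1] := hh1 1 x one Yx; have [_ _ d2 e2] := hh2 1 _ one Y1.
  have [_ _ d3] := hh3 1 _ one Y2; apply: d3; apply/andP; split.
    apply: d2; case: xq => [|qx]; [by left|right].
    by rewrite ge_min; apply/orP; case: e1 => h; [left|right] => //; exact: le_trans h.
  by case: e2 => h; [exact: le_trans h d1|clear -h ab th0; lra].
Qed.

End Compression3.

(** * Cubes, simplices and the Delta-generated topology *)

Section MappingIntoSubspaces.
Context (R : realType).

Lemma continuous_into (T X : topologicalType) (A : set X) (f : T -> A) :
  continuous (fun t => val (f t)) -> continuous f.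
Proof. by move=> cf; apply: continuous_comp_initial. Qed.

Lemma continuous_val (X : topologicalType) (A : set X) : continuous (val : A -> X).
Proof. exact: initial_continuous. Qed.

Lemma compact_subtype (X : topologicalType) (A : set X) : compact A -> compact [set: A].
Proof.
move=> cA F FF _.
have [x [Ax xF]] := cA (val @ F) _ (filterS (fun t _ => set_valP t) filterT).
exists (SigSub (mem_set Ax)); split => // B C FB [D [[D' oD' <-] Dx] DC].
have h1 : (val @ F) ((val : A -> X) @` B) by apply: (@filterS _ F _ B) FB => b Bb; exists b.
have [y [[b Bb <-] Db]] := xF _ D' h1 (open_nbhs_nbhs (conj oD' Dx)).
by exists b; split => //; exact: DC.
Qed.

Lemma continuous_after (T U W : topologicalType) (f : T -> U) (g : U -> W) :
  continuous g -> continuous f -> continuous (fun t => g (f t)).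
Proof. by move=> cg cf t; apply: continuous_comp; [exact: cf|exact: cg]. Qed.

Lemma continuous_mulr (T : topologicalType) (f : T -> R) (c : R) :
  continuous f -> continuous (fun t => c * f t).
Proof.
move=> cf; apply: (@continuous_after _ _ _ f (fun r : R => c * r)) => // r; apply: cvgM; first exact: cvg_cst.
exact: cvg_id.
Qed.

Lemma continuous_subl (T : topologicalType) (f : T -> R) (c : R) :
  continuous f -> continuous (fun t => c - f t).
Proof.
move=> cf; apply: (@continuous_after _ _ _ f (fun r : R => c - r)) => // r; apply: cvgB; first exact: cvg_cst.
exact: cvg_id.
Qed.

Lemma continuous_rV (T : topologicalType) n (f : T -> 'rV[R]_n) :
  (forall j, continuous (fun t => f t 0 j : R)) -> continuous f.
Proof.
move=> cf t; apply/cvg_ballP => e e0.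
have h : \forall u \near t, forall j, ball (f t 0 j) e (f u 0 j).
  apply: filter_forall => j.
  by move: (cf j t) => /cvg_ballP /(_ e e0).
by apply: filterS h => u h; split => // i j; rewrite ord1.
Qed.

Lemma continuous_coord (T : topologicalType) n (f : T -> 'rV[R]_n) j :
  continuous f -> continuous (fun t => f t 0 j : R).
Proof.
move=> cf t; apply: (@continuous_comp _ _ _ f (fun M : 'rV[R]_n => M 0 j)); first exact: cf.
exact: coord_continuous.
Qed.

Definition clamp (r : R) : R := Num.max 0 (Num.min 1 r).

Lemma clamp01 r : 0 <= clamp r <= 1.
Proof. by rewrite /clamp le_max lexx ge_max ler01 ge_min lexx. Qed.

Lemma clamp_id r : 0 <= r <= 1 -> clamp r = r.
Proof. by move=> /andP[r0 r1]; rewrite /clamp min_r // max_r. Qed.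

Lemma clamp_ge1 r : 1 <= r -> clamp r = 1.
Proof. by move=> r1; rewrite /clamp min_l // max_r. Qed.

Lemma clamp_le0 r : r <= 0 -> clamp r = 0.
Proof. by move=> r0; rewrite /clamp max_l // ge_min r0 orbT. Qed.

Lemma clamp_continuous : continuous clamp.
Proof.
have mn (f : R -> R) : continuous f -> continuous (fun x => Num.min 1 (f x)).
  move=> cf x; apply: (@continuous_min _ _ (fun=> 1) f); last exact: cf.
  exact: cst_continuous.
have mx (f : R -> R) : continuous f -> continuous (fun x => Num.max 0 (f x)).
  move=> cf x; apply: (@continuous_max _ _ (fun=> 0) f); last exact: cf.
  exact: cst_continuous.
by apply: mx; apply: mn => x; exact: cvg_id.
Qed.

Definition clampI (r : R) : unit_itv R := SigSub (mem_set (clamp01 r : unit_itv R (clamp r))).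

Lemma val_clampI r : val (clampI r) = clamp r. Proof. by []. Qed.

Lemma clampI_continuous : continuous clampI.
Proof. by apply: continuous_into; exact: clamp_continuous. Qed.

Lemma itvP (t : unit_itv R) : 0 <= val t <= 1.
Proof. exact: (set_valP t). Qed.

Lemma clampIK (t : unit_itv R) : clampI (val t) = t.
Proof. by apply: val_inj; rewrite val_clampI clamp_id // itvP. Qed.

Lemma clampI0 r : r <= 0 -> clampI r = I0 R.
Proof. by move=> r0; apply: val_inj; rewrite val_clampI clamp_le0. Qed.

Lemma clampI1 r : 1 <= r -> clampI r = I1 R.
Proof. by move=> r0; apply: val_inj; rewrite val_clampI clamp_ge1. Qed.

Lemma continuous_clampI (T : topologicalType) (f : T -> R) :
  continuous f -> continuous (fun t => clampI (f t)).
Proof. by move=> cf t; apply: (@continuous_comp _ _ _ f clampI); [exact: cf|exact: clampI_continuous]. Qed.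

Lemma compact_itv : compact [set: unit_itv R].
Proof.
by apply: compact_subtype; have := @segment_compact R 0 1; rewrite set_itvcc.
Qed.

Lemma compact_cube n : compact [set: cube R n].
Proof.
apply: compact_subtype.
have := @rV_compact R n (fun=> [set r : R | 0 <= r <= 1]).
by apply=> i; have := @segment_compact R 0 1; rewrite set_itvcc.
Qed.

Lemma compact_itv_cube n : compact [set: unit_itv R * cube R n].
Proof. by have := compact_setX compact_itv (@compact_cube n); congr compact; apply/seteqP; split. Qed.

Lemma clamp_cube_subproof n (y : 'rV[R]_n) : cube R n (\row_j clamp (y 0 j)).
Proof. by move=> j; rewrite mxE clamp01. Qed.

Definition clamp_cube n (y : 'rV[R]_n) : cube R n := SigSub (mem_set (@clamp_cube_subproof n y)).

Lemma clamp_cubeK n (s : cube R n) : clamp_cube (val s) = s.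
Proof.
apply: val_inj; apply/rowP => j; rewrite mxE clamp_id //; exact: (set_valP s).
Qed.

Lemma continuous_clamp_cube (T : topologicalType) n (f : T -> 'rV[R]_n) :
  (forall j, continuous (fun t => f t 0 j : R)) -> continuous (fun t => clamp_cube (f t)).
Proof.
move=> cf; apply: continuous_into; apply: continuous_rV => j.
have -> : (fun t => val (clamp_cube (f t)) 0 j) = (fun t => clamp (f t 0 j)).
  by apply/funext => t; rewrite mxE.
move=> t; apply: (@continuous_comp _ _ _ (fun t => f t 0 j) clamp); first exact: cf.
exact: clamp_continuous.
Qed.

End MappingIntoSubspaces.

Section Simplicial.
Context (R : realType).

(** Continuity of a map into the coreflection is tested on simplices, hence on
    their retracts, such as cubes and cylinders over cubes. *)
Definition simplicial (T : topologicalType) := exists n (i : T -> simplex R n) (r : simplex R n -> T),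
  [/\ continuous i, continuous r & cancel i r].

Lemma simplicial_deltaify (T X : topologicalType) (q : T -> X) : simplicial T ->
  continuous q -> continuous (q : T -> deltaify R X).
Proof.
move=> [n [i [r [ci cr ir]]]] cq.
have cqr : continuous (q \o r : simplex R n -> X).
  by move=> s; apply: continuous_comp; [exact: cr|exact: cq].
have -> : q = (q \o r) \o i by apply/funext => t /=; rewrite ir.
by move=> t; apply: continuous_comp; [exact: ci|exact: continuous_deltaify].
Qed.

Lemma deltaify_id (T X : topologicalType) (q : T -> deltaify R X) :
  continuous q -> continuous (q : T -> X).
Proof.
move=> /continuousP cq; apply/continuousP => U oU; apply: cq.
by rewrite deltaify_openE => n f /continuousP; exact.
Qed.

(** The cube, shrunk by the factor n + 1, fits in the simplex as the last n
    barycentric coordinates; clamping is the retraction. *)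
Lemma simplicial_cube n : simplicial (cube R n).
Proof.
have n1 : 0 < n.+1%:R :> R by rewrite ltr0n.
pose i0 (y : 'rV[R]_n) : 'rV[R]_n.+1 :=
  \row_j (if unlift ord0 j is Some k then n.+1%:R^-1 * y 0 k else 1 - \sum_k n.+1%:R^-1 * y 0 k).
have iP (s : cube R n) : simplex R n (i0 (val s)).
  have sP j : 0 <= val s 0 j <= 1 := set_valP s j.
  split => [j|].
    rewrite mxE; case: unlift => [k|].
      by have /andP[h _] := sP k; rewrite mulr_ge0 // invr_ge0 ltW.
    rewrite subr_ge0 -mulr_sumr mulrC ler_pdivrMr // mul1r.
    apply: (@le_trans _ _ (\sum_(k < n) 1)); first by apply: ler_sum => k _; case/andP: (sP k).
    by rewrite sumr_const card_ord ler_nat.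
  rewrite big_ord_recl mxE unlift_none.
  rewrite [X in _ + X](eq_bigr (fun k => n.+1%:R^-1 * val s 0 k)); last first.
    by move=> k _; rewrite mxE liftK.
  by rewrite subrK.
pose i (s : cube R n) : simplex R n := SigSub (mem_set (iP s)).
pose r0 (x : 'rV[R]_n.+1) : 'rV[R]_n := \row_k (n.+1%:R * x 0 (lift ord0 k)).
exists n, i, (fun x => clamp_cube (r0 (val x))); split.
- apply: continuous_into; apply: continuous_rV => j.
  have cc k : continuous (fun t : cube R n => n.+1%:R^-1 * val t 0 k).
    apply: continuous_mulr.
    exact: (@continuous_coord R _ _ (val : cube R n -> _) k (@continuous_val _ _)).
  case E : (unlift ord0 j) => [k|].
    have -> : (fun t => val (i t) 0 j) = (fun t : cube R n => n.+1%:R^-1 * val t 0 k); last exact: cc.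
    by apply/funext => t; rewrite mxE E.
  have -> : (fun t => val (i t) 0 j) = (fun t : cube R n => 1 - \sum_k n.+1%:R^-1 * val t 0 k).
    by apply/funext => t; rewrite mxE E.
  apply: continuous_subl; apply: continuous_big; last by move=> k _; exact: cc.
  exact: add_continuous.
- apply: continuous_clamp_cube => j.
  have -> : (fun t : simplex R n => r0 (val t) 0 j) = (fun t => n.+1%:R * val t 0 (lift ord0 j)).
    by apply/funext => t; rewrite mxE.
  apply: continuous_mulr.
  exact: (@continuous_coord R _ _ (val : simplex R n -> _) _ (@continuous_val _ _)).
- move=> s /=; rewrite -[RHS]clamp_cubeK; congr clamp_cube.
  by apply/rowP => k; rewrite !mxE liftK mulVKf // gt_eqF.
Qed.

Lemma simplicial_retract (T T' : topologicalType) (i : T' -> T) (r : T -> T') :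
  continuous i -> continuous r -> cancel i r -> simplicial T -> simplicial T'.
Proof.
move=> ci cr ir [n [i' [r' [ci' cr' ir']]]]; exists n, (i' \o i), (r \o r'); split.
- by move=> t; apply: continuous_comp; [exact: ci|exact: ci'].
- by move=> t; apply: continuous_comp; [exact: cr'|exact: cr].
- by move=> t /=; rewrite ir' ir.
Qed.

Lemma continuous_pairT (T U W : topologicalType) (f : T -> U) (g : T -> W) :
  continuous f -> continuous g -> continuous (fun t => (f t, g t)).
Proof. by move=> cf cg t; apply: cvg_pair; [exact: cf|exact: cg]. Qed.

Lemma continuous_fst (U W : topologicalType) : continuous (@fst U W).
Proof. by move=> t; exact: cvg_fst. Qed.

Lemma continuous_snd (U W : topologicalType) : continuous (@snd U W).
Proof. by move=> t; exact: cvg_snd. Qed.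

Lemma simplicial_itv_cube n : simplicial (unit_itv R * cube R n)%type.
Proof.
pose i0 (w : unit_itv R * cube R n) : 'rV[R]_n.+1 :=
  \row_j (if unlift ord0 j is Some k then val w.2 0 k else val w.1).
pose r (x : cube R n.+1) := (clampI (val x 0 ord0), clamp_cube (\row_k val x 0 (lift ord0 k))).
apply: (simplicial_retract (i := fun w => clamp_cube (i0 w)) (r := r)) (simplicial_cube n.+1).
- apply: continuous_clamp_cube => j; case E : (unlift ord0 j) => [k|].
    have -> : (fun t => i0 t 0 j) = (fun t : unit_itv R * cube R n => val t.2 0 k).
      by apply/funext => t; rewrite mxE E.
    apply: (@continuous_coord R _ _ (fun t : unit_itv R * cube R n => val t.2)).
    exact: (@continuous_after _ _ _ snd (val : cube R n -> _) (@continuous_val _ _) (@continuous_snd _ _)).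
  have -> : (fun t => i0 t 0 j) = (fun t : unit_itv R * cube R n => val t.1).
    by apply/funext => t; rewrite mxE E.
  exact: (@continuous_after _ _ _ fst (val : unit_itv R -> _) (@continuous_val _ _) (@continuous_fst _ _)).
- have cc j : continuous (fun t : cube R n.+1 => val t 0 j).
    exact: (@continuous_coord R _ _ (val : cube R n.+1 -> _) j (@continuous_val _ _)).
  apply: continuous_pairT; first exact: continuous_clampI.
  apply: continuous_clamp_cube => j.
  have -> : (fun t : cube R n.+1 => (\row_k val t 0 (lift ord0 k)) 0 j) = (fun t => val t 0 (lift ord0 j)).
    by apply/funext => t; rewrite mxE.
  exact: cc.
- move=> [t s]; rewrite /r /i0; congr (_, _).
    by rewrite -[RHS]clampIK !mxE unlift_none /= clamp_id ?itvP.
  rewrite -[RHS]clamp_cubeK; congr clamp_cube; apply/rowP => k; rewrite !mxE liftK /=.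
  by rewrite clamp_id //; exact: (set_valP s).
Qed.

End Simplicial.

(** * Weak homotopy equivalences *)

Lemma continuous_if (R : realType) (T U : topologicalType) (d : T -> R) (c : R) (f g : T -> U) :
  continuous d -> continuous f -> continuous g -> (forall t, d t = c -> f t = g t) ->
  continuous (fun t => if d t <= c then f t else g t).
Proof.
move=> cd cf cg fg; apply: cont_onT.
have -> : [set: T] = (d @^-1` [set r | r <= c]) `|` (d @^-1` [set r | c <= r]).
  by apply/seteqP; split => // t _; have [h|/ltW h] := leP (d t) c; [left|right].
apply: cont_onU.
- by apply: preimage_closed; [move=> t _; exact: cd|exact: closed_le].
- by apply: preimage_closed; [move=> t _; exact: cd|exact: closed_ge].
- by apply: eq_cont_on (continuous_cont_on cf) => t /= ->.
- apply: eq_cont_on (continuous_cont_on cg) => t /= h.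
  by case: ifP => // h'; rewrite fg //; apply: le_anti; rewrite h h'.
Qed.

Section Homotopies.
Context (R : realType).

Lemma val_I0 : val (I0 R) = 0. Proof. by []. Qed.
Lemma val_I1 : val (I1 R) = 1. Proof. by []. Qed.

Section SpheroidHomotopies.
Context (n : nat) (X : topologicalType) (x : X).
Implicit Types a b c : spheroid R n x.

Lemma spheroid_homotopic_refl a : spheroid_homotopic a a.
Proof.
exists (fun w => a w.2); split => //; last by move=> t s bs /=; exact: spheroid_base.
exact: (@continuous_after _ _ _ snd a (@spheroid_cont _ _ _ _ a) (@continuous_snd _ _)).
Qed.

Lemma spheroid_homotopic_sym a b : spheroid_homotopic a b -> spheroid_homotopic b a.
Proof.
move=> [H [cH H0 H1 Hb]]; exists (fun w => H (clampI (1 - val w.1), w.2)); split.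
- apply: (@continuous_after _ _ _ (fun w : unit_itv R * cube R n => (clampI (1 - val w.1), w.2)) H) => //.
  apply: continuous_pairT; last exact: continuous_snd.
  apply: continuous_clampI; apply: continuous_subl.
  exact: (@continuous_after _ _ _ fst (val : unit_itv R -> _) (@continuous_val _ _) (@continuous_fst _ _)).
- by move=> s; rewrite /= ?val_I0 subr0 clampI1.
- by move=> s; rewrite /= ?val_I1 subrr clampI0.
- by move=> t s bs; exact: Hb.
Qed.

Lemma spheroid_homotopic_trans a b c :
  spheroid_homotopic a b -> spheroid_homotopic b c -> spheroid_homotopic a c.
Proof.
move=> [H [cH H0 H1 Hb]] [K [cK K0 K1 Kb]].
have cv : continuous (fun w : unit_itv R * cube R n => val w.1).
  exact: (@continuous_after _ _ _ fst (val : unit_itv R -> _) (@continuous_val _ _) (@continuous_fst _ _)).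
exists (fun w => if val w.1 <= 1 / 2 then H (clampI (2 * val w.1), w.2)
                 else K (clampI (2 * val w.1 - 1), w.2)); split.
- apply: continuous_if => //.
  + apply: (@continuous_after _ _ _ (fun w : unit_itv R * cube R n => (clampI (2 * val w.1), w.2)) H) => //.
    apply: continuous_pairT; last exact: continuous_snd.
    by apply: continuous_clampI; exact: continuous_mulr.
  + apply: (@continuous_after _ _ _ (fun w : unit_itv R * cube R n => (clampI (2 * val w.1 - 1), w.2)) K) => //.
    apply: continuous_pairT; last exact: continuous_snd.
    apply: continuous_clampI.
    apply: (@continuous_after _ _ _ (fun w : unit_itv R * cube R n => val w.1) (fun r : R => 2 * r - 1)) => // r.
    by apply: cvgB; [apply: cvgM; [exact: cvg_cst|exact: cvg_id]|exact: cvg_cst].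
  + by move=> w ->; rewrite mul1r divff // subrr clampI1 // clampI0 // H1 K0.
- by move=> s; rewrite /= ?val_I0 mulr0 clampI0 // divr_ge0.
- move=> s; rewrite /= ?val_I1 mulr1; have -> : (1 <= 1 / 2 :> R) = false by apply/negbTE; rewrite -ltNge; lra.
  by rewrite clampI1 //; lra.
- by move=> t s bs /=; case: ifP => _; [exact: Hb|exact: Kb].
Qed.

End SpheroidHomotopies.

Lemma no_boundary (s : cube R 0) : ~ cube_boundary s.
Proof. by case=> -[]. Qed.

Definition point_spheroid (X : topologicalType) (x y : X) : spheroid R 0 x.
Proof.
exists (fun _ => y); first exact: (@cst_continuous _ X y).
by move=> s /no_boundary.
Defined.

(** The cube of dimension 0 is a point without boundary, so statements about path
    components are the case n = 0 of statements about spheroids. *)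
Lemma joined_spheroids (X : topologicalType) (x y z : X) :
  joined_by_path R y z <-> spheroid_homotopic (point_spheroid x y) (point_spheroid x z).
Proof.
split.
  move=> [g [cg g0 g1]]; exists (fun w => g w.1); split => //; last by move=> t s /no_boundary.
  exact: (@continuous_after _ _ _ fst g cg (@continuous_fst _ _)).
move=> [H [cH H0 H1 _]]; pose s0 := clamp_cube (0 : 'rV[R]_0).
exists (fun t => H (t, s0)); split; [|by rewrite H0|by rewrite H1].
apply: (@continuous_after _ _ _ (fun t => (t, s0)) H) => //.
by apply: continuous_pairT; [move=> t; exact: cvg_id|exact: (@cst_continuous _ _ s0)].
Qed.

Lemma joined_refl (X : topologicalType) (x : X) : joined_by_path R x x.
Proof. by apply/(joined_spheroids x); exact: spheroid_homotopic_refl. Qed.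

Lemma joined_trans (X : topologicalType) (x y z : X) :
  joined_by_path R x y -> joined_by_path R y z -> joined_by_path R x z.
Proof.
move=> /(joined_spheroids x) h /(joined_spheroids x) k; apply/(joined_spheroids x).
exact: spheroid_homotopic_trans h k.
Qed.

End Homotopies.

Section QuotientBijections.
Context (A B C : Type) (EA : A -> A -> Prop) (EB : B -> B -> Prop) (EC : C -> C -> Prop).
Context (F : A -> B) (G : B -> C).

Lemma quotient_bijective_comp : (forall x y z, EC x y -> EC y z -> EC x z) ->
  quotient_bijective EA EB F -> quotient_bijective EB EC G ->
  quotient_bijective EA EC (G \o F).
Proof.
move=> tr [F1 F2 F3] [G1 G2 G3]; split => [a a' /F1/G1//|a a' /G2/F2//|c].
have [b bc] := G3 c; have [a ab] := F3 b; exists a.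
by apply: tr bc; exact: G1.
Qed.

(** Two out of three, in the case used to pass from a retraction to its section. *)
Lemma quotient_bijective_cancel :
  quotient_bijective EB EC G -> quotient_bijective EA EC (G \o F) -> quotient_bijective EA EB F.
Proof.
move=> [G1 G2 G3] [H1 H2 H3]; split => [a a' /H1/G2//|a a' /G1/H2//|b].
by have [a /G2 ab] := H3 (G b); exists a.
Qed.

End QuotientBijections.

Section WeakEquivalences.
Context (R : realType).

Lemma weq_comp (X Y Z : Top R) (f : Defs.Hom X Y) (g : Defs.Hom Y Z) :
  weak_homotopy_equivalence f -> weak_homotopy_equivalence g ->
  weak_homotopy_equivalence (compC g f).
Proof.
move=> [f0 fn] [g0 gn]; split; first by apply: quotient_bijective_comp f0 g0 => x y z; exact: joined_trans.
move=> n x n0; apply: quotient_bijective_comp (fn n x n0) (gn n _ n0) => a b c.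
exact: spheroid_homotopic_trans.
Qed.

Lemma weq_cancel (X Y Z : Top R) (f : Defs.Hom X Y) (g : Defs.Hom Y Z) :
  weak_homotopy_equivalence g -> weak_homotopy_equivalence (compC g f) ->
  weak_homotopy_equivalence f.
Proof.
move=> [g0 gn] [h0 hn]; split.
  exact: (quotient_bijective_cancel (F := f) (G := g)) g0 h0.
move=> n x n0; exact: (quotient_bijective_cancel (F := @spheroid_push R n _ _ f x)
  (G := @spheroid_push R n _ _ g (f x))) (gn n _ n0) (hn n x n0).
Qed.

Lemma weq_id (X : Top R) : weak_homotopy_equivalence (idC X).
Proof.
split; first by split => // x; exists x; exact: joined_refl.
move=> n x n0; split => // b; exists b; exact: spheroid_homotopic_refl.
Qed.

End WeakEquivalences.

(** ** Blowing up the inner half of the cube *)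
Section CubeGeometry.
Context (R : realType) (n : nat).
Notation c := (const_mx (1 / 2) : 'rV[R]_n).
Implicit Types s : cube R n.

Lemma mx_norm_le (v : 'rV[R]_n) (e : R) : 0 <= e -> (`|v| <= e) <-> (forall j, `|v 0 j| <= e).
Proof.
move=> e0; rewrite /Num.norm /= mx_normrE; split=> [h j|h].
  by apply: le_trans h; apply: (le_bigmax _ (fun ij : 'I_1 * 'I_n => `|v ij.1 ij.2|) (0, j)).
by apply/bigmax_leP; split => // -[i j] _; rewrite [i]ord1; exact: h.
Qed.

Definition rad s : R := `|val s - c|.

Lemma rad_le s : rad s <= 1 / 2.
Proof.
apply/mx_norm_le => [|j]; first by rewrite divr_ge0.
by rewrite !mxE; have /andP[h1 h2] := set_valP s j; rewrite ler_norml; apply/andP; split; lra.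
Qed.

Lemma rad_boundary s : cube_boundary s -> rad s = 1 / 2.
Proof.
move=> [j hj]; apply: le_anti; rewrite rad_le /=.
have h := (mx_norm_le (val s - c) (normr_ge0 (val s - c))).1 (lexx _) j.
apply: le_trans h; rewrite !mxE.
case: hj => ->; first by rewrite sub0r normrN ger0_norm // divr_ge0.
by rewrite ger0_norm //; lra.
Qed.

Lemma rad_continuous : continuous rad.
Proof.
have cj j : continuous (fun s : cube R n => val s 0 j).
  exact: (@continuous_coord R _ _ (val : cube R n -> _) j (@continuous_val _ _)).
apply: (@continuous_after _ _ _ (fun s : cube R n => val s - c) (fun v : 'rV[R]_n => `|v|)).
  by move=> v; exact: norm_continuous.
apply: continuous_rV => j.
have -> : (fun s : cube R n => (val s - c) 0 j) = (fun s => val s 0 j - 1 / 2).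
  by apply/funext => s; rewrite !mxE.
apply: (@continuous_after _ _ _ (fun s : cube R n => val s 0 j) (fun r : R => r - 1 / 2)) => // r.
by apply: cvgB; [exact: cvg_id|exact: cvg_cst].
Qed.

(** The inner half of the cube has time 1, and time runs down to 0 at the boundary. *)
Definition tau s : unit_itv R := clampI (2 - 4 * rad s).

(** For u = 1 the inner half of the cube is expanded onto the whole cube and its
    complement is pushed radially to the boundary; clamping makes the formula
    total. *)
Definition blow (u : R) s : cube R n :=
  clamp_cube (c + (1 - u + u / Num.max (1 / 2) (2 * rad s)) *: (val s - c)).

Lemma tau_inner s : rad s <= 1 / 4 -> tau s = I1 R.
Proof. by move=> h; apply: clampI1; lra. Qed.

Lemma tau_boundary s : cube_boundary s -> tau s = I0 R.
Proof. by move=> /rad_boundary h; apply: clampI0; rewrite h; lra. Qed.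

Lemma blow0 s : blow 0 s = s.
Proof. by rewrite /blow mul0r subr0 addr0 scale1r addrC subrK clamp_cubeK. Qed.

Lemma blow_boundary u s : cube_boundary s -> blow u s = s.
Proof.
move=> /rad_boundary h; rewrite /blow h.
have -> : Num.max (1 / 2) (2 * (1 / 2)) = 1 :> R by rewrite max_r; lra.
by rewrite divr1 subrK scale1r addrC subrK clamp_cubeK.
Qed.

Lemma blow1_outer s : 1 / 4 <= rad s -> cube_boundary (blow 1 s).
Proof.
move=> h; rewrite /blow subrr add0r max_r; last lra.
have r0 : rad s != 0 by apply/eqP => r0; rewrite r0 in h; lra.
have [[i j] hij] := mx_norm_neq0 r0.
have hj : rad s = `|val s 0 j - 1 / 2| by move: hij; rewrite /= ord1 !mxE.
exists j; rewrite !mxE.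
have e : (1 / (2 * rad s)) * `|val s 0 j - 1 / 2| = 1 / 2.
  by rewrite -hj; field.
have [h1|h1] := leP 0 (val s 0 j - 1 / 2); [right|left].
  by rewrite ger0_norm // in e; rewrite e clamp_ge1 //; lra.
by rewrite ltr0_norm // mulrN in e; rewrite clamp_le0 //; lra.
Qed.

Lemma tau_continuous : continuous tau.
Proof. by apply: continuous_clampI; apply: continuous_subl; apply: continuous_mulr; exact: rad_continuous. Qed.

Lemma continuous_blow (T : topologicalType) (u : T -> R) (s : T -> cube R n) :
  continuous u -> continuous s -> continuous (fun t => blow (u t) (s t)).
Proof.
move=> cu cs; apply: continuous_clamp_cube => j.
have -> : (fun t => (c + (1 - u t + u t / Num.max (1 / 2) (2 * rad (s t))) *: (val (s t) - c)) 0 j) =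
    (fun t => 1 / 2 + (1 - u t + u t * (Num.max (1 / 2) (2 * rad (s t)))^-1) * (val (s t) 0 j - 1 / 2)).
  by apply/funext => t; rewrite !mxE.
pose k (r : R) := (Num.max (1 / 2) (2 * r))^-1.
have ck : continuous k.
  have mx (f : R -> R) : continuous f -> continuous (fun x => Num.max (1 / 2) (f x)).
    move=> cf x; apply: (@continuous_max _ _ (fun=> 1 / 2) f); last exact: cf.
    exact: cst_continuous.
  move=> r; apply: cvgV; first by rewrite gt_eqF // lt_max; apply/orP; left; lra.
  by apply: mx => r'; apply: cvgM; [exact: cvg_cst|exact: cvg_id].
have crad : continuous (fun t => k (rad (s t))).
  by apply: (@continuous_after _ _ _ (fun t => rad (s t)) k) => //; apply: continuous_after cs; exact: rad_continuous.
have cj : continuous (fun t => val (s t) 0 j).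
  apply: (@continuous_coord R _ _ (fun t => val (s t))).
  by apply: (@continuous_after _ _ _ s val) => //; exact: continuous_val.
pose P (w : R * R * R) := 1 / 2 + (1 - w.1.1 + w.1.1 * w.1.2) * (w.2 - 1 / 2).
have cP : continuous P.
  have c1 : continuous (fun w : R * R * R => w.1.1) by exact: (@continuous_after _ _ _ fst fst (@continuous_fst _ _) (@continuous_fst _ _)).
  have c2 : continuous (fun w : R * R * R => w.1.2) by exact: (@continuous_after _ _ _ fst snd (@continuous_snd _ _) (@continuous_fst _ _)).
  have c3 : continuous (fun w : R * R * R => w.2) by exact: continuous_snd.
  have cc (x : R) : continuous (fun w : R * R * R => x) by exact: cst_continuous.
  move=> w; apply: cvgD; first exact: cc.
  apply: cvgM; last by apply: cvgB; [exact: c3|exact: cc].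
  by apply: cvgD; [apply: cvgB; [exact: cc|exact: c1]|apply: cvgM; [exact: c1|exact: c2]].
apply: (@continuous_after _ _ _ (fun t => (u t, k (rad (s t)), val (s t) 0 j)) P) => //.
by apply: continuous_pairT => //; exact: continuous_pairT.
Qed.

End CubeGeometry.

(** ** Lifting motions *)
Section Tracking.
Context (R : realType).

(** Here eta is a motion in B of the compact part q, ending in the image of f, and
    kap is a motion in A that f carries to eta over points of q. As kap may move
    base points, deformations of inclusions and fibrewise deformations are both
    instances. *)
Definition tracking (A B : topologicalType) (f : A -> B) :=
  forall (T : topologicalType) (q : T -> B), compact [set: T] -> continuous q ->
  exists (G : T -> A) (eta : unit_itv R * T -> B) (kap : unit_itv R * A -> A),
  [/\ continuous G, continuous eta, continuous kap,
      forall x, eta (I0 R, x) = q x /\ eta (I1 R, x) = f (G x)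
    & forall a x, f a = q x ->
        [/\ kap (I0 R, a) = a, kap (I1 R, a) = G x & forall t, f (kap (t, a)) = eta (t, x)]].

Context (A B : topologicalType) (f : A -> B) (cf : continuous f) (tf : tracking f).
Context (n : nat).

Notation df := (delta_map R cf).
Notation IQ := (unit_itv R * cube R n)%type.

Lemma cv1 : continuous (fun w : IQ => val w.1).
Proof. exact: (@continuous_after _ _ _ fst (val : unit_itv R -> _) (@continuous_val _ _) (@continuous_fst _ _)). Qed.

(** The inner half of the cube carries the lifted end of the motion, and the rest
    carries the track of the base point. *)
Lemma tracked_spheroid (a : A) (q : IQ -> B) (G : IQ -> A) eta (kap : unit_itv R * A -> A) :
  continuous G -> continuous kap ->
  (forall x, eta (I0 R, x) = q x /\ eta (I1 R, x) = f (G x)) ->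
  (forall a x, f a = q x ->
     [/\ kap (I0 R, a) = a, kap (I1 R, a) = G x & forall t, f (kap (t, a)) = eta (t, x)]) ->
  (forall t s, cube_boundary s -> q (t, s) = f a) ->
  exists2 Z : IQ -> A, continuous Z &
    [/\ forall t s, cube_boundary s -> Z (t, s) = a,
        forall t s, f (Z (t, s)) = eta (tau s, (t, blow 1 s)) &
        forall t s b, f b = q (t, blow 1 s) -> (cube_boundary (blow 1 s) -> b = a) -> kap (tau s, b) = Z (t, s)].
Proof.
move=> cG ck eP kP bq.
exists (fun w => if rad w.2 <= 1 / 4 then G (w.1, blow 1 w.2) else kap (tau w.2, a)).
- apply: continuous_if.
  + by apply: (@continuous_after _ _ _ snd (@rad R n)); [exact: rad_continuous|exact: continuous_snd].
  + apply: (@continuous_after _ _ _ (fun w : IQ => (w.1, blow 1 w.2)) G) => //.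
    apply: continuous_pairT; first exact: continuous_fst.
    by apply: continuous_blow; [exact: (@cst_continuous _ R 1)|exact: continuous_snd].
  + apply: (@continuous_after _ _ _ (fun w : IQ => (tau w.2, a)) kap) => //.
    apply: continuous_pairT; last exact: (@cst_continuous _ A a).
    by apply: (@continuous_after _ _ _ snd (@tau R n)); [exact: tau_continuous|exact: continuous_snd].
  + move=> [t s] /= h; rewrite tau_inner ?h //.
    have [|_ -> _] // := kP a (t, blow 1 s).
    by rewrite bq //; apply: blow1_outer; rewrite h.
split=> [t s bs|t s|t s b fb bb] /=.
- rewrite rad_boundary //; have -> : (1 / 2 <= 1 / 4 :> R) = false by apply/negbTE; rewrite -ltNge; lra.
  rewrite tau_boundary //; have [|-> _ _] // := kP a (t, s).
  by rewrite bq.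
- case: leP => h; first by rewrite tau_inner //; have [_ ->] := eP (t, blow 1 s).
  have [|_ _ ->] // := kP a (t, blow 1 s).
  by rewrite bq //; apply: blow1_outer; exact: ltW.
- case: leP => h; first by rewrite tau_inner //; have [_ -> _] := kP b _ fb.
  by rewrite bb //; apply: blow1_outer; exact: ltW.
Qed.

(** Time is damped by tau, so that boundary points do not move, while the cube is
    blown up to make room for the track of the base point. *)
Lemma tracking_spheroids (a : A) :
  quotient_bijective (@spheroid_homotopic R n (delta_obj R A) a)
    (@spheroid_homotopic R n (delta_obj R B) (f a)) (@spheroid_push R n _ _ df a).
Proof.
have dA (q : IQ -> A) : continuous q -> continuous (q : IQ -> delta_obj R A).
  exact: (simplicial_deltaify (@simplicial_itv_cube R n)).
have dB (q : IQ -> B) : continuous q -> continuous (q : IQ -> delta_obj R B).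
  exact: (simplicial_deltaify (@simplicial_itv_cube R n)).
have ctau : continuous (fun w : IQ => tau w.2).
  by apply: (@continuous_after _ _ _ snd (@tau R n)); [exact: tau_continuous|exact: continuous_snd].
have cblow : continuous (fun w : IQ => blow (val w.1) w.2).
  by apply: continuous_blow; [exact: cv1|exact: continuous_snd].
have cut : continuous (fun w : IQ => clampI (val w.1 * val (tau w.2))).
  apply: continuous_clampI.
  pose P (w : R * R) := w.1 * w.2.
  apply: (@continuous_after _ _ _ (fun w : IQ => (val w.1, val (tau w.2))) P).
    by move=> w; apply: cvgM; [exact: cvg_fst|exact: cvg_snd].
  apply: continuous_pairT; first exact: cv1.
  by apply: (@continuous_after _ _ _ (fun w : IQ => tau w.2) val); [exact: continuous_val|].
split.
- move=> a1 a2 [H [cH H0 H1 Hb]]; exists (f \o H); split.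
  + by apply: (@continuous_after _ _ _ H df) cH; exact: cts_fun.
  + by move=> s /=; rewrite H0.
  + by move=> s /=; rewrite H1.
  + by move=> t s bs /=; rewrite Hb.
- move=> a1 a2 [H [cH H0 H1 Hb]].
  have [G [eta [kap [cG ce ck eP kP]]]] := tf (@compact_itv_cube R n) (deltaify_id cH).
  have [Z cZ [Zb _ Zk]] := tracked_spheroid cG ck eP kP Hb.
  have cZs t : continuous (fun s => Z (t, s) : delta_obj R A).
    apply: (simplicial_deltaify (@simplicial_cube R n)).
    apply: (@continuous_after _ _ _ (fun s => (t, s)) Z) => //.
    by apply: continuous_pairT; [exact: (@cst_continuous _ _ t)|move=> s; exact: cvg_id].
  pose Zs t : spheroid R n (a : delta_obj R A) := @Spheroid R n (delta_obj R A) a _ (cZs t) (Zb t).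
  have side (b : spheroid R n (a : delta_obj R A)) t : (forall s, H (t, s) = f (b s)) ->
      spheroid_homotopic b (Zs t).
    move=> hb.
    have kb u s : kap (I0 R, b (blow u s)) = b (blow u s).
      by have [|->] // := kP (b (blow u s)) (t, blow u s).
    exists (fun w => kap (clampI (val w.1 * val (tau w.2)), b (blow (val w.1) w.2))); split.
    + apply: dA; apply: (@continuous_after _ _ _ (fun w : IQ => (clampI (val w.1 * val (tau w.2)), b (blow (val w.1) w.2) : A)) kap) => //.
      apply: continuous_pairT => //.
      apply: (@continuous_after _ _ _ (fun w : IQ => blow (val w.1) w.2) (b : cube R n -> A)) => //.
      exact: (deltaify_id (@spheroid_cont _ _ _ _ b)).
    + by move=> s; rewrite /= mul0r clampI0 // kb blow0.
    + move=> s; change (kap (clampI (1 * val (tau s)), b (blow 1 s)) = Z (t, s)).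
      rewrite mul1r clampIK; apply: Zk; first by rewrite hb.
      by move=> bs; exact: (@spheroid_base _ _ _ _ b).
    + move=> u s bs; change (kap (clampI (val u * val (tau s)), b (blow (val u) s)) = a).
      rewrite tau_boundary // val_I0 mulr0 clampI0 // kb blow_boundary //.
      exact: (@spheroid_base _ _ _ _ b).
  apply: (@spheroid_homotopic_trans _ _ _ _ _ (Zs (I0 R))); first exact: side.
  apply: (@spheroid_homotopic_trans _ _ _ _ _ (Zs (I1 R))); last by apply/spheroid_homotopic_sym/side.
  by exists Z; split => //; exact: dA.
- move=> b; pose q (w : IQ) : B := b w.2.
  have cb : continuous (b : cube R n -> B) := deltaify_id (@spheroid_cont _ _ _ _ b).
  have cq : continuous q by exact: (@continuous_after _ _ _ snd (b : cube R n -> B) cb (@continuous_snd _ _)).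
  have [G [eta [kap [cG ce ck eP kP]]]] := tf (@compact_itv_cube R n) cq.
  have bq t s : cube_boundary s -> q (t, s) = f a by move=> bs; exact: (@spheroid_base _ _ _ _ b).
  have [Z cZ [Zb Ze _]] := tracked_spheroid cG ck eP kP bq.
  have cZs : continuous (fun s => Z (I0 R, s) : delta_obj R A).
    apply: (simplicial_deltaify (@simplicial_cube R n)).
    apply: (@continuous_after _ _ _ (fun s => (I0 R, s)) Z) => //.
    by apply: continuous_pairT; [exact: (@cst_continuous _ _ (I0 R))|move=> s; exact: cvg_id].
  exists (@Spheroid R n (delta_obj R A) a _ cZs (Zb (I0 R))).
  apply: spheroid_homotopic_sym.
  exists (fun w => eta (clampI (val w.1 * val (tau w.2)), (I0 R, blow (val w.1) w.2))); split.
  + apply: dB; apply: (@continuous_after _ _ _ (fun w : IQ => (clampI (val w.1 * val (tau w.2)), (I0 R, blow (val w.1) w.2))) eta) => //.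
    apply: continuous_pairT => //; apply: continuous_pairT => //.
    exact: (@cst_continuous _ _ (I0 R)).
  + by move=> s; rewrite /= mul0r clampI0 // blow0; have [-> _] := eP (I0 R, s).
  + move=> s; change (eta (clampI (1 * val (tau s)), (I0 R, blow 1 s)) = f (Z (I0 R, s))).
    by rewrite mul1r clampIK Ze.
  + move=> u s bs; change (eta (clampI (val u * val (tau s)), (I0 R, blow (val u) s)) = f a).
    rewrite tau_boundary // val_I0 mulr0 clampI0 // blow_boundary //.
    by have [-> _] := eP (I0 R, s); exact: bq.
Qed.

End Tracking.

(** Path components are the case n = 0; a base point exists as soon as the target
    has a point, because the motion ends in the image of f. *)
Lemma tracking_weq (R : realType) (A B : topologicalType) (f : A -> B) (cf : continuous f) :
  tracking R f -> weak_homotopy_equivalence (delta_map R cf).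
Proof.
move=> tf; split; last by move=> n x _; exact: tracking_spheroids.
have qb a := @tracking_spheroids R A B f cf tf 0 a.
have push a x y : joined_by_path R (f x : delta_obj R B) (f y) <->
    spheroid_homotopic (@spheroid_push R 0 _ _ (delta_map R cf) a (point_spheroid R (a : delta_obj R A) x))
      (@spheroid_push R 0 _ _ (delta_map R cf) a (point_spheroid R (a : delta_obj R A) y)).
  exact: (joined_spheroids R (X := delta_obj R B) (f a)).
split.
- move=> x y /(joined_spheroids R x) h; have [h1 _ _] := qb x; apply/(push x).
  exact: h1.
- move=> x y /(push x) h; have [_ h1 _] := qb x; apply/(joined_spheroids R x).
  exact: h1.
- move=> b.
  have cq : continuous (fun _ : unit_itv R => b : B) by exact: (@cst_continuous _ B b).
  have [G _] := tf _ _ (@compact_itv R) cq; pose a := G (I0 R).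
  have [_ _ /(_ (point_spheroid R (f a : delta_obj R B) b)) [s sb]] := qb a.
  pose s0 := clamp_cube (0 : 'rV[R]_0).
  exists (s s0); apply/(joined_spheroids R (f a : delta_obj R B)).
  apply: spheroid_homotopic_trans sb.
  have ss t : t = s0 :> cube R 0 by apply: val_inj; apply/rowP => -[].
  exists (fun w => f (s s0)); split => // [|t|t]; last 2 first.
  - by rewrite [t]ss.
  - by move=> ? /no_boundary.
  exact: (@cst_continuous _ (delta_obj R B) (f (s s0))).
Qed.

(** * Inclusions and cylinders *)

Lemma continuous_idfun (T : topologicalType) : continuous (fun t : T => t).
Proof. by move=> t; exact: cvg_id. Qed.

Section InclusionEquivalences.
Context (R : realType) (N : nat).
Notation V := 'rV[R]_N.
Notation I := (unit_itv R).

Lemma continuous_cont_on_comp (T : topologicalType) (B : set V) (h : R -> V -> V) (u : T -> I) (p : T -> V) :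
  cont_on [set w : R * V | 0 <= w.1 <= 1 /\ B w.2] (fun w : R * V => h w.1 w.2) ->
  continuous u -> continuous p -> (forall t, B (p t)) -> continuous (fun t => h (val (u t)) (p t)).
Proof.
move=> ch cu cp Bp; apply: cont_onT.
apply: (cont_on_comp_pair (h := fun w : R * V => h w.1 w.2) (f := fun t => val (u t)) (g := p) ch).
- apply: continuous_cont_on.
  by apply: (@continuous_after _ _ _ u (val : I -> R)) => //; exact: continuous_val.
- exact: continuous_cont_on.
- by move=> t _; split; [exact: itvP|exact: Bp].
Qed.

(** Compact parts of the larger set are moved into the smaller one by motions that
    fix the latter. *)
Lemma incl_weq (A B : set V) (AB : A `<=` B) :
  (forall Q, compact Q -> Q `<=` B -> exists h : R -> V -> V,
     cont_on [set w : R * V | 0 <= w.1 <= 1 /\ B w.2] (fun w : R * V => h w.1 w.2) /\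
     forall t x, 0 <= t <= 1 -> B x ->
       [/\ h 0 x = x, B (h t x), A x -> h t x = x & Q x -> A (h 1 x)]) ->
  weak_homotopy_equivalence (Defs.incl AB).
Proof.
move=> hyp; apply: tracking_weq => T q cT cq.
have cvq : continuous (fun x => val (q x)).
  by apply: (@continuous_after _ _ _ q (val : B -> V)) => //; exact: continuous_val.
have [||h [ch hh]] := hyp ((fun x => val (q x)) @` setT).
- by apply: continuous_compact => //; exact: continuous_subspaceT.
- by move=> _ [x _ <-]; exact: (set_valP (q x)).
have Bq x : B (val (q x)) := set_valP (q x).
have one : 0 <= (1 : R) <= 1 by rewrite ler01 lexx.
have Qq x : ((fun x => val (q x)) @` setT) (val (q x)) by exists x.
have GA x : A (h 1 (val (q x))) by have [_ _ _ + ] := hh 1 _ one (Bq x); exact.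
have EB (w : I * T) : B (h (val w.1) (val (q w.2))) by have [] := hh _ _ (itvP w.1) (Bq w.2).
exists (fun x => SigSub (mem_set (GA x))), (fun w => SigSub (mem_set (EB w))), snd; split.
- apply: continuous_into.
  apply: (@continuous_cont_on_comp _ B h (fun=> I1 R) (fun x => val (q x)) ch) => //.
  exact: (@cst_continuous _ _ (I1 R)).
- apply: continuous_into.
  apply: (@continuous_cont_on_comp _ B h fst (fun w : I * T => val (q w.2)) ch) => //.
    exact: continuous_fst.
  by apply: (@continuous_after _ _ _ snd (fun x => val (q x))) => //; exact: continuous_snd.
- exact: continuous_snd.
- by move=> x; split; apply: val_inj => //=; have [] := hh 1 _ one (Bq x).
- move=> a x fa.
  have va : val (q x) = val a by rewrite -fa.
  have fx t : 0 <= t <= 1 -> h t (val (q x)) = val a.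
    move=> t01; have [_ _ + _] := hh t _ t01 (Bq x); rewrite va; apply; exact: (set_valP a).
  split => //; first by apply: val_inj; rewrite /= fx.
  by move=> t; apply: val_inj; rewrite /= fx //; exact: itvP.
Qed.

End InclusionEquivalences.

Section Cylinder.
Context (R : realType) (A : topologicalType).
Notation I := (unit_itv R).

Lemma cylinder_end_continuous (e : I) : continuous (fun a : A => (e, a)).
Proof. by apply: continuous_pairT; [exact: (@cst_continuous _ _ e)|move=> a; exact: cvg_id]. Qed.

Lemma cylinder_end_weq (e : I) : weak_homotopy_equivalence (delta_map R (@cylinder_end_continuous e)).
Proof.
apply: tracking_weq => T q cT cq.
have c2 : continuous (fun x => (q x).2) by apply: (@continuous_after _ _ _ q snd) => //; exact: continuous_snd.
have c1 : continuous (fun x => (q x).1) by apply: (@continuous_after _ _ _ q fst) => //; exact: continuous_fst.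
exists (fun x => (q x).2),
  (fun w => (clampI (val (q w.2).1 + val w.1 * (val e - val (q w.2).1)), (q w.2).2)), snd; split.
- exact: c2.
- apply: continuous_pairT.
    apply: continuous_clampI.
    pose P (w : R * R) := w.2 + w.1 * (val e - w.2).
    apply: (@continuous_after _ _ _ (fun w : I * T => (val w.1, val (q w.2).1)) P).
      move=> w; apply: cvgD; first exact: continuous_snd.
      apply: cvgM; first exact: continuous_fst.
      by apply: cvgB; [exact: (@cst_continuous _ R (val e))|exact: continuous_snd].
    apply: continuous_pairT.
      by apply: (@continuous_after _ _ _ fst (val : I -> R)); [exact: continuous_val|exact: continuous_fst].
    apply: (@continuous_after _ _ _ snd (fun x => val (q x).1)); last exact: continuous_snd.
    by apply: (@continuous_after _ _ _ (fun x => (q x).1) (val : I -> R)) => //; exact: continuous_val.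
  by apply: (@continuous_after _ _ _ snd (fun x => (q x).2)) => //; exact: continuous_snd.
- exact: continuous_snd.
- move=> x; split; last by rewrite /= mul1r addrC subrK clampIK.
  by rewrite /= mul0r addr0 clampIK -surjective_pairing.
- by move=> a x <-; split => // t; rewrite /= subrr mulr0 addr0 clampIK.
Qed.

End Cylinder.

Lemma mul_lt1 (R : realType) (s u : R) : 0 <= s <= 1 -> 0 < u <= 1 -> s * (1 - u) < 1.
Proof.
move=> /andP[s0 s1] /andP[u0 u1].
have : s * (1 - u) <= 1 * (1 - u) by rewrite ler_wpM2r // subr_ge0.
by lra.
Qed.

(** * Homotopy links *)
Section HomotopyLinks.
Context (R : realType) (N : nat) (S : sample R N).
Notation V := 'rV[R]_N.
Notation I := (unit_itv R).
Notation C := (carrier S).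
Notation Sp := (stratum_p S).

Lemma itv_locally_compact : locally_compact [set: I].
Proof.
move=> x _; rewrite withinET; exists setT; first exact: filterT.
by split; [exact: compact_itv|exact: closedT].
Qed.

Lemma itv_regular : @regular_space I.
Proof. exact: uniform_regular. Qed.

(** The unit interval is compact and regular, so evaluation is continuous. *)
Lemma eval_continuous_co (T : topologicalType) (m : T -> {compact-open, I -> C}) :
  continuous m -> (forall t, continuous (m t : I -> C)) ->
  continuous (fun w : T * I => val (m w.1 w.2)).
Proof.
move=> cm cmt.
have h := continuous_uncurry_regular itv_locally_compact itv_regular cm cmt.
apply: (@continuous_after _ _ _ (fun w : T * I => m w.1 w.2) (val : C -> V)); first exact: continuous_val.
suff -> : (fun w : T * I => m w.1 w.2) = uncurry m by [].
by apply/funext => -[].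
Qed.

Lemma curry_co (T : topologicalType) (F : T * I -> V) (CF : forall w, C (F w)) : continuous F ->
  exists2 m : T -> {compact-open, I -> C}, continuous m &
    (forall t, continuous (m t : I -> C)) /\ forall t u, val (m t u) = F (t, u).
Proof.
move=> cF; pose F' w : C := SigSub (mem_set (CF w)).
have cF' : continuous F' by exact: continuous_into.
have [c1 c2] := continuous_curry cF'.
by exists (curry F').
Qed.

Definition link_in (Z : set V) : set {compact-open, I -> C} :=
  [set g | holink g /\ forall t, Z (val (g t))].

Lemma link_in_sub Z : link_in Z `<=` @holink R N S.
Proof. by move=> g []. Qed.

(** Families of paths in the homotopy link are built from maps on a product. *)
Lemma mk_link (T : topologicalType) (Z : set V) (F : T * I -> V) : continuous F ->
  Z `<=` C -> (forall w, Z (F w)) -> (forall t, Sp (F (t, I0 R))) ->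
  (forall t u, 0 < val u -> ~ Sp (F (t, u))) ->
  exists2 m : T -> link_in Z, continuous m & forall t u, val (val (m t) u) = F (t, u).
Proof.
move=> cF ZC ZF F0 F1.
have [m cm [cmt mE]] := curry_co (fun w => ZC _ (ZF w)) cF.
have mP t : link_in Z (m t).
  split; last by move=> u; rewrite mE.
  split; [exact: cmt|by rewrite mE|move=> u u0].
  by split; [exact: (set_valP (m t u))|rewrite mE; exact: F1].
exists (fun t => SigSub (mem_set (mP t))) => //.
exact: continuous_into.
Qed.

Lemma link_eq (E : set {compact-open, I -> C}) (g k : E) :
  (forall u, val (val g u) = val (val k u)) -> g = k.
Proof. by move=> h; apply: val_inj; apply/funext => u; apply: val_inj. Qed.

Lemma link_eval_continuous (T : topologicalType) (E : set {compact-open, I -> C}) (m : T -> E) :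
  E `<=` @holink R N S -> continuous m ->
  continuous (fun w : T * I => val (val (m w.1) w.2) : V).
Proof.
move=> EH cm; apply: (@eval_continuous_co T (fun t => val (m t))).
  by apply: (@continuous_after _ _ _ m (val : E -> _)) => //; exact: continuous_val.
by move=> t; have [+ _ _] := EH _ (set_valP (m t)).
Qed.

Context (Y : set V) (H : R -> V -> V) (cH : collar Y Sp H) (YC : Y `<=` C).
Notation A := (Y `\` Sp).

Lemma link_end_subproof (g : link_in Y) : A (val (val g (I1 R))).
Proof.
by have [[_ _ h] hY] := set_valP g; split => //; have [] := h (I1 R) ltr01.
Qed.

Definition link_end (g : link_in Y) : A := SigSub (mem_set (link_end_subproof g)).

Lemma link_end_continuous : continuous link_end.
Proof.
apply: continuous_into.
have h := @link_eval_continuous _ (link_in Y) idfun (@link_in_sub Y) (@continuous_idfun _).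
apply: (@continuous_after _ _ _ (fun g : link_in Y => (g, I1 R)) (fun w => val (val w.1 w.2))) => //.
by apply: continuous_pairT; [move=> g; exact: cvg_id|exact: (@cst_continuous _ _ (I1 R))].
Qed.

Lemma continuous_collar (T : topologicalType) (s : T -> R) (p : T -> V) :
  continuous s -> continuous p -> (forall t, 0 <= s t <= 1) -> (forall t, Y (p t)) ->
  continuous (fun t => H (s t) (p t)).
Proof.
move=> cs cp s01 Yp; have [ch _] := cH.
have -> : (fun t => H (s t) (p t)) = (fun t => H (val (clampI (s t))) (p t)).
  by apply/funext => t; rewrite val_clampI clamp_id.
exact: continuous_cont_on_comp ch (continuous_clampI cs) cp Yp.
Qed.

(** The tracks of the collar, read from S outwards. *)
Lemma collar_paths : exists2 m : A -> link_in Y, continuous m &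
  forall x u, val (val (m x) u) = H (1 - val u) (val x).
Proof.
have [_ hH] := cH.
have t01 (u : I) : 0 <= 1 - val u <= 1 by have /andP[? ?] := itvP u; apply/andP; split; lra.
have AY (x : A) : Y (val x) by have [] := set_valP x.
have [||w|x|x u u0|m cm mE] := @mk_link A Y (fun w : A * I => H (1 - val w.2) (val w.1)).
- apply: continuous_collar => //.
    apply: continuous_subl.
    by apply: (@continuous_after _ _ _ snd (val : I -> R)); [exact: continuous_val|exact: continuous_snd].
  by apply: (@continuous_after _ _ _ fst (val : A -> V)); [exact: continuous_val|exact: continuous_fst].
- exact: YC.
- by have [] := hH _ _ (t01 w.2) (AY w.1).
- by rewrite /= subr0; have [] := hH _ _ (t01 (I0 R)) (AY x).
- have [_ _ _ _ +] := hH _ _ (t01 u) (AY x); apply; first by rewrite gtrBl.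
  by have [] := set_valP x.
- by exists m.
Qed.

(** The tracks of the collar define a section of the evaluation at the end, and a
    path g is deformed into the track of its end in two phases. First each point
    g u runs along its track up to time 1 - u; then the point from which the track
    is followed slides from g u to the end of g. In both phases the value at
    u = 0 is in S, since either the point is g 0 or the time is 1, and the end of
    the path does not move. *)
Lemma link_end_weq : weak_homotopy_equivalence (delta_map R link_end_continuous).
Proof.
apply: tracking_weq => T q cT cq.
have [_ hH] := cH.
have [m cm mE] := collar_paths.
pose s1 (t : I) := clamp (2 * val t); pose s2 (t : I) := clamp (2 * val t - 1).
pose tm (w : I * link_in Y * I) := s1 w.1.1 * (1 - val w.2).
pose pt (w : I * link_in Y * I) := clampI (val w.2 + s2 w.1.1 * (1 - val w.2)).
have EY (g : link_in Y) u : Y (val (val g u)) by have [_] := set_valP g; exact.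
have s101 t : 0 <= s1 t <= 1 by exact: clamp01.
have s201 t : 0 <= s2 t <= 1 by exact: clamp01.
have tm01 w : 0 <= tm w <= 1.
  have /andP[? ?] := itvP w.2; have /andP[? ?] := s101 w.1.1; rewrite /tm mulr_ge0 ?subr_ge0 //=.
  by rewrite mulr_ile1 // ?subr_ge0 // gerBl.
have cu : continuous (fun w : I * link_in Y * I => val w.2).
  by apply: (@continuous_after _ _ _ snd (val : I -> R)); [exact: continuous_val|exact: continuous_snd].
have ct : continuous (fun w : I * link_in Y * I => val w.1.1).
  apply: (@continuous_after _ _ _ (fun w : I * link_in Y * I => w.1.1) (val : I -> R)); first exact: continuous_val.
  exact: (@continuous_after _ _ _ fst fst (@continuous_fst _ _) (@continuous_fst _ _)).
have cs1 : continuous (fun w : I * link_in Y * I => s1 w.1.1).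
  apply: (@continuous_after _ _ _ (fun w : I * link_in Y * I => 2 * val w.1.1) (@clamp R)); first exact: clamp_continuous.
  exact: continuous_mulr.
have cs2 : continuous (fun w : I * link_in Y * I => s2 w.1.1).
  apply: (@continuous_after _ _ _ (fun w : I * link_in Y * I => val w.1.1) (fun r => clamp (2 * r - 1))) => //.
  apply: (@continuous_after R R R (fun r => 2 * r - 1) (@clamp R)); first exact: clamp_continuous.
  by move=> r; apply: cvgB; [apply: cvgM; [exact: cvg_cst|exact: cvg_id]|exact: cvg_cst].
have ctm : continuous tm.
  pose P (w : R * R) := w.1 * (1 - w.2).
  apply: (@continuous_after _ _ _ (fun w : I * link_in Y * I => (s1 w.1.1, val w.2)) P); last exact: continuous_pairT.
  move=> w; apply: cvgM; first exact: continuous_fst.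
  by apply: cvgB; [exact: (@cst_continuous _ R 1)|exact: continuous_snd].
have cpt : continuous pt.
  apply: continuous_clampI; pose P (w : R * R) := w.2 + w.1 * (1 - w.2).
  apply: (@continuous_after _ _ _ (fun w : I * link_in Y * I => (s2 w.1.1, val w.2)) P); last exact: continuous_pairT.
  move=> w; apply: cvgD; first exact: continuous_snd.
  apply: cvgM; first exact: continuous_fst.
  by apply: cvgB; [exact: (@cst_continuous _ R 1)|exact: continuous_snd].
have ptE w : val (pt w) = val w.2 + s2 w.1.1 * (1 - val w.2).
  rewrite val_clampI clamp_id //.
  have /andP[? ?] := itvP w.2; have /andP[? ?] := s201 w.1.1; apply/andP; split.
    by rewrite addr_ge0 // mulr_ge0 // subr_ge0.
  have : s2 w.1.1 * (1 - val w.2) <= 1 * (1 - val w.2) by rewrite ler_wpM2r // subr_ge0.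
  by lra.
have [||w|w|w u u0|kap ckap kapE] := @mk_link (I * link_in Y)%type Y (fun w : I * link_in Y * I => H (tm w) (val (val w.1.2 (pt w)))).
- apply: continuous_collar => //.
  have h := @link_eval_continuous _ (link_in Y) idfun (@link_in_sub Y) (@continuous_idfun _).
  apply: (@continuous_after _ _ _ (fun w : I * link_in Y * I => (w.1.2, pt w)) (fun w => val (val w.1 w.2))) => //.
  apply: continuous_pairT => //.
  exact: (@continuous_after _ _ _ fst snd (@continuous_snd _ _) (@continuous_fst _ _)).
- exact: YC.
- by have [] := hH _ _ (tm01 w) (EY w.1.2 (pt w)).
- (* at the start of the path, either the time is 1 or the point is in S *)
  have [h|h] := leP (2 * val w.1) 1.
    have e : pt (w, I0 R) = I0 R.
      apply: val_inj; rewrite ptE /= add0r subr0 mulr1 /s2 clamp_le0 //; lra.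
    have Sg : Sp (val (val w.2 (I0 R))) by have [[_ h' _] _] := set_valP w.2; exact: h'.
    have [_ _ _ fx _] := hH _ _ (tm01 (w, I0 R)) (EY w.2 (I0 R)).
    by rewrite e fx.
  have -> : tm (w, I0 R) = 1.
    rewrite /tm /= subr0 mulr1 /s1 clamp_ge1 // ltW //.
  by have [] := hH 1 _ (ltac:(by rewrite ler01 lexx)) (EY w.2 (pt (w, I0 R))).
- have [_ _ _ _ +] := hH _ _ (tm01 (w, u)) (EY w.2 (pt (w, u))); apply.
    by apply: mul_lt1; [exact: s101|rewrite u0 /=; case/andP: (itvP u)].
  have [[_ _ h] _] := set_valP w.2; have [] // := h (pt (w, u)) _.
  rewrite ptE ltr_wpDr // mulr_ge0 //; first by case/andP: (s201 w.1).
  by rewrite subr_ge0; case/andP: (itvP u).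
have kap1 t g : link_end (kap (t, g)) = link_end g.
  apply: val_inj; rewrite /= kapE.
  have -> : pt (t, g, I1 R) = I1 R by apply: val_inj; rewrite ptE /= subrr mulr0 addr0.
  by rewrite /tm /= subrr mulr0; have [] := hH 0 _ (ltac:(by rewrite ler01 lexx)) (EY g (I1 R)).
exists (fun x => m (q x)), (fun w => q w.2), kap; split => //.
- exact: (@continuous_after _ _ _ q m).
- by apply: (@continuous_after _ _ _ snd q) => //; exact: continuous_snd.
- move=> x; split => //; apply: val_inj; rewrite /= mE /= subrr.
  have Yq : Y (val (q x)) by have [] := set_valP (q x).
  by have [-> ] := hH 0 _ (ltac:(by rewrite ler01 lexx)) Yq.
- move=> g x gx; split.
  + apply: link_eq => u; rewrite kapE.
    have -> : pt (I0 R, g, u) = u.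
      apply: val_inj; rewrite ptE /= /s2 clamp_le0 ?mul0r ?addr0 //= mulr0; lra.
    have -> : tm (I0 R, g, u) = 0 by rewrite /tm /= /s1 clamp_le0 ?mul0r //= mulr0.
    by have [] := hH 0 _ (ltac:(by rewrite ler01 lexx)) (EY g u).
  + apply: link_eq => u; rewrite kapE mE -gx /=.
    have -> : pt (I1 R, g, u) = I1 R.
      by apply: val_inj; rewrite ptE /= /s2 clamp_ge1 /=; lra.
    by rewrite /tm /= /s1 clamp_ge1 ?mul1r //=; lra.
  + by move=> t; rewrite kap1.
Qed.

End HomotopyLinks.

(** ** Paths near the closed stratum *)
Section ShorteningLinks.
Context (R : realType) (N : nat) (S : sample R N).
Notation V := 'rV[R]_N.
Notation I := (unit_itv R).
Notation C := (carrier S).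
Notation Sp := (stratum_p S).
Notation Y := (sublevel C Sp 1).

Lemma shorten_links (Z : set V) (T : topologicalType) (q : T -> @holink R N S) (a : T -> R) :
  continuous q -> continuous a -> Z `<=` C -> (forall t, 0 < a t <= 1) ->
  (forall t (u : I), val u <= a t -> Z (val (val (q t) u))) ->
  exists2 m : T -> link_in (S := S) Z, continuous m &
    forall t u, val (val (m t) u) = val (val (q t) (clampI (a t * val u))).
Proof.
move=> cq ca ZC a01 qZ.
have le_a t (u : I) : a t * val u <= a t.
  have /andP[u0 u1] := itvP u; have /andP[/ltW a0 _] := a01 t.
  by rewrite -[leRHS]mulr1; apply: ler_wpM2l.
have au t (u : I) : val (clampI (a t * val u)) = a t * val u.
  have /andP[u0 u1] := itvP u; have /andP[a0 a1] := a01 t.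
  rewrite val_clampI clamp_id //; apply/andP; split; last exact: le_trans (le_a t u) a1.
  by apply: mulr_ge0 => //; exact: ltW.
have [||w|t|t u u0|m cm mE] := @mk_link R N S T Z (fun w : T * I => val (val (q w.1) (clampI (a w.1 * val w.2)))).
- have h := @link_eval_continuous R N S T (@holink R N S) q (fun g hg => hg) cq.
  apply: (@continuous_after _ _ _ (fun w : T * I => (w.1, clampI (a w.1 * val w.2))) (fun w => val (val (q w.1) w.2))) => //.
  apply: continuous_pairT; first exact: continuous_fst.
  apply: continuous_clampI; pose P (w : R * R) := w.1 * w.2.
  apply: (@continuous_after _ _ _ (fun w : T * I => (a w.1, val w.2)) P).
    by move=> w; apply: cvgM; [exact: continuous_fst|exact: continuous_snd].
  apply: continuous_pairT; first by apply: (@continuous_after _ _ _ fst a) => //; exact: continuous_fst.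
  by apply: (@continuous_after _ _ _ snd (val : I -> R)); [exact: continuous_val|exact: continuous_snd].
- exact: ZC.
- by apply: qZ; rewrite au.
- have [_ h _] := set_valP (q t); have -> : clampI (a (t, I0 R).1 * val (t, I0 R).2) = I0 R.
    by rewrite /= mulr0 clampI0.
  exact: h.
- have [_ _ h] := set_valP (q t); have [] // := h (clampI (a t * val u)) _.
  by rewrite au mulr_gt0 //; case/andP: (a01 t).
by exists m.
Qed.

(** The paths of a compact family all stay near S up to a common positive time, and
    they are shortened to that time. Base points move in this deformation. *)
Lemma link_incl_weq : weak_homotopy_equivalence (delta_map R (@subfun_continuous _ _ _ (@link_in_sub R N S Y))).
Proof.
apply: tracking_weq => T q cT cq.
set j := subfun _.
have YC : Y `<=` C by move=> x [].
have qc := @link_eval_continuous R N S T (@holink R N S) q (fun g hg => hg) cq.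
have cTI : compact [set: T * I].
  by have := compact_setX cT (@compact_itv R); congr compact; apply/seteqP; split.
have [||w _ w0|r r0 hr] := @compact_thin R _ [set: T * I] (fun w => val w.2)
   (fun w => dd Sp (val (val (q w.1) w.2))) 1 cTI.
- apply: continuous_cont_on.
  by apply: (@continuous_after _ _ _ snd (val : I -> R)); [exact: continuous_val|exact: continuous_snd].
- by apply: continuous_cont_on; apply: (@continuous_after _ _ _ _ (dd Sp)) qc; exact: dd_continuous.
- have -> : w.2 = I0 R by apply: val_inj; apply: le_anti; rewrite w0 /=; case/andP: (itvP w.2).
  by have [_ h _] := set_valP (q w.1); rewrite dd_in.
pose c := Num.min r 1.
have [c0 [cr c1]] : 0 < c /\ c <= r /\ c <= 1 by rewrite lt_min r0 ltr01 !ge_min !lexx orbT.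
have c01 : 0 <= 1 - c by rewrite subr_ge0.
pose b (t : I) := 1 - val t * (1 - c).
have b01 t : 0 < b t <= 1.
  have /andP[t0 t1] := itvP t; rewrite gerBl mulr_ge0 // andbT subr_gt0.
  have h1 : val t * (1 - c) <= 1 * (1 - c) by rewrite ler_wpM2r.
  by apply: le_lt_trans h1 _; rewrite mul1r gtrBl.
have cb : continuous b.
  apply: (@continuous_after _ _ _ (val : I -> R) (fun r => 1 - r * (1 - c))); last exact: continuous_val.
  move=> x; apply: cvgB; first exact: cvg_cst.
  by apply: cvgM; [exact: cvg_id|exact: cvg_cst].
have inC (g : @holink R N S) u : C (val (val g u)) := set_valP (val g u).
have [|||t u uc|G cG GE] := @shorten_links Y T q (fun=> c) cq.
- exact: (@cst_continuous _ R c).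
- by [].
- by move=> t; rewrite c0.
- by split; [exact: inC|apply/ltW/(hr (t, u)) => //; exact: le_trans cr].
have cbq (W : topologicalType) : continuous (fun w : I * W => b w.1).
  by apply: (@continuous_after _ _ _ fst b) => //; exact: continuous_fst.
have cq2 : continuous (fun w : I * T => q w.2).
  by apply: (@continuous_after _ _ _ snd q) => //; exact: continuous_snd.
have [|t|t u _|e ce eE] := @shorten_links C (I * T)%type (fun w => q w.2) (fun w => b w.1) cq2 (cbq _).
- by [].
- exact: b01.
- exact: inC.
have cj : continuous (fun w : I * link_in (S := S) Y => j w.2).
  apply: (@continuous_after _ _ _ snd j); last exact: continuous_snd.
  exact: subfun_continuous.
have [|t|t u _|k ck kE] := @shorten_links Y (I * link_in (S := S) Y)%type (fun w => j w.2) (fun w => b w.1) cj (cbq _).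
- exact: YC.
- exact: b01.
- by have [_ ] := set_valP t.2; exact.
have c0E (E : set {compact-open, I -> C}) (g : E) u : val (val g (clampI (b (I0 R) * val u))) = val (val g u).
  by rewrite /b val_I0 mul0r subr0 mul1r clampIK.
have c1E (E : set {compact-open, I -> C}) (g : E) (u : I) : val (val g (clampI (b (I1 R) * val u))) = val (val g (clampI (c * val u))).
  by rewrite /b val_I1 mul1r opprB addrC subrK.
exists G, (fun w => subfun (@link_in_sub R N S C) (e w)), k; split => //.
- by apply: (@continuous_after _ _ _ e) => //; exact: subfun_continuous.
- move=> x; split; apply: link_eq => u.
    by rewrite [LHS]eE c0E.
  by rewrite [LHS]eE c1E -GE.
- move=> g x gx; split => [||t]; apply: link_eq => u.
  + by rewrite kE c0E.
  + by rewrite kE GE -gx c1E.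
  + by rewrite [LHS]kE [RHS]eE gx.
Qed.

(** The tracks of the collar are a section of the evaluation at the end, which is
    a weak equivalence on paths that stay near S. *)
Lemma collar_link (H : R -> V -> V) : collar Y Sp H ->
  exists (m : (Y `\` Sp) -> @holink R N S) (cm : continuous m),
    weak_homotopy_equivalence (delta_map R cm) /\
    forall x u, val (val (m x) u) = H (1 - val u) (val x).
Proof.
move=> hH; have YC : Y `<=` C by move=> x [].
have [m cm mE] := collar_paths hH YC.
have wm : weak_homotopy_equivalence (delta_map R cm).
  apply: (weq_cancel (link_end_weq hH YC)).
  have -> : compC (delta_map R (@link_end_continuous R N S Y)) (delta_map R cm) = idC (delta_obj R (Y `\` Sp)).
    apply/continuousEP => x; apply: val_inj => /=; rewrite mE /= subrr.
    have [Yx _] := set_valP x; have [_ hx] := hH.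
    by have [] := hx 0 _ (ltac:(by rewrite lexx ler01)) Yx.
  exact: weq_id.
have cjm : continuous (subfun (@link_in_sub R N S Y) \o m).
  by apply: (@continuous_after _ _ _ m) => //; exact: subfun_continuous.
exists (subfun (@link_in_sub R N S Y) \o m), cjm; split; last by move=> x u; rewrite -mE.
have := weq_comp wm link_incl_weq.
suff -> : compC (delta_map R (@subfun_continuous _ _ _ (@link_in_sub R N S Y))) (delta_map R cm) = delta_map R cjm by [].
exact/continuousEP.
Qed.

End ShorteningLinks.

(** * Magnification of the sample *)

Section StratumSets.
Context (R : realType) (M : ominimal_structure R) (N : nat).
Notation V := 'rV[R]_N.
Implicit Types (x y z p v : V) (X S K : set V).

Lemma dset_superlevel X S : M N X -> M N S -> dset M (fun e => superlevel X S (e 0%N)).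
Proof.
move=> dX dS; have d0 := @dvec_row_of0 R M N.
apply: (@dpred_and R M (fun e => X (row_of N e)) (fun e => e (N + 0)%N <= dd S (row_of N e))).
  exact: dset_mem0 (dset_cst dX) d0.
apply: dpred_le; first exact: dfun_var.
exact: dfun_dd (dset_cst dS) d0.
Qed.

Lemma dset_sublevel X S : M N X -> M N S -> dset M (fun e => sublevel X S (e 0%N)).
Proof.
move=> dX dS; have d0 := @dvec_row_of0 R M N.
apply: (@dpred_and R M (fun e => X (row_of N e)) (fun e => dd S (row_of N e) <= e (N + 0)%N)).
  exact: dset_mem0 (dset_cst dX) d0.
apply: dpred_le; last exact: dfun_var.
exact: dfun_dd (dset_cst dS) d0.
Qed.

Lemma definable_shell X S (a b : R) : M N X -> M N S -> M N (shell X S a b).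
Proof.
move=> dX dS; have d0 := @dvec_row_of0 R M N; apply: dsetP.
have dS' := dfun_dd (dset_cst dS) d0.
apply: eq_dpred (dpred_and (dset_mem0 (dset_cst dX) d0)
   (dpred_and (dpred_le (dfun_cst M a) dS') (dpred_le dS' (dfun_cst M b)))) => e.
by split => [[? [? ?]]|[? /andP[]]]; split => //; apply/andP.
Qed.

Lemma shell0 X S b : shell X S 0 b = sublevel X S b.
Proof.
by apply/seteqP; split => x [Xx]; [move=> /andP[]|move=> h]; split => //; rewrite dd_ge0.
Qed.

Lemma shell2 X S a : shell X S a 2 = superlevel X S a.
Proof.
by apply/seteqP; split => x [Xx]; [move=> /andP[]|move=> h]; split => //; rewrite h dd_le2.
Qed.

Lemma definable_scale (lam : R) X : 0 < lam -> M N X -> M N (scale lam X).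
Proof.
move=> l0 dX; apply: dsetP.
have d0 := @dvec_row_of0 R M N.
apply: eq_dpred (dset_mem0 (dset_cst dX) (dvec_scale (dfun_cst M lam^-1) d0)) => e.
split => [h|[x Xx <-]]; first by exists (lam^-1 *: row_of N e) => //; rewrite -scaleK.
by rewrite scalerA mulVf ?scale1r // gt_eqF.
Qed.

Lemma compact_scale (lam : R) X : compact X -> compact (scale lam X).
Proof.
move=> kX; apply: (continuous_compact _ kX); apply: continuous_subspaceT.
apply: cont_onT; apply: cont_onZ; apply: continuous_cont_on; last exact: continuous_idfun.
exact: (@cst_continuous _ R lam).
Qed.

Definition walls_regular X S (u r : R) := forall x,
  (0 < dd (sublevel X S u) x <= r -> exists v, good (-1) setT (sublevel X S u) x v) /\
  (0 < dd (superlevel X S u) x <= r -> exists v, good (-1) setT (superlevel X S u) x v).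

Lemma walls_regular_sub X S u r r' : r' <= r -> walls_regular X S u r -> walls_regular X S u r'.
Proof.
move=> rr h x; have [h1 h2] := h x.
by split=> /andP[a b]; [apply: h1|apply: h2]; rewrite a (le_trans b).
Qed.

Lemma sublevel_compact X S b : compact X -> compact (sublevel X S b).
Proof.
move=> kX; apply: subclosed_compact (kX) _; last by move=> x [].
by apply: sublevel_closed; exact: compactV_closed.
Qed.

Lemma shell_compact X S a b : compact X -> compact (shell X S a b).
Proof.
move=> kX; apply: subclosed_compact (kX) _; last by move=> x [].
by apply: shell_closed; exact: compactV_closed.
Qed.

(** Finitely many properties hold for all small distances; a magnification takes
    small distances to distances up to 3/2, and the parameter ranges of the
    families to (0, 1). *)
Lemma magnify X S : M N X -> M N S -> compact X -> compact S ->
  exists2 lam : R, 0 < lam & levels_regular (scale lam X) (scale lam S) /\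
    forall u, 0 < u < 1 -> exists2 r : R, 0 < r & forall u', `|u' - u| < r ->
      walls_regular (scale lam X) (scale lam S) u' r.
Proof.
move=> dX dS kX kS.
have kM u : compact (sublevel X S u) := sublevel_compact kX.
have kL u : compact (superlevel X S u) by rewrite -shell2; exact: shell_compact.
have [b b0 hb] := rgermI (rgermI (regular_germ (or_introl erefl) dX dS kS) (regular_germ (or_intror erefl) dX dS kS))
  (rgermI (family_regular_germ (dset_sublevel dX dS) kM) (family_regular_germ (dset_superlevel dX dS) kL)).
pose be := Num.min b 2.
have [be0 [beb be2]] : 0 < be /\ be <= b /\ be <= 2 by rewrite lt_min b0 ltr0n !ge_min !lexx orbT.
pose lam := 2 / be.
have l1 : 1 <= lam by rewrite ler_pdivlMr // mul1r.
have l0 : 0 < lam by exact: lt_le_trans l1.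
have small t : 0 < t < 2 -> 0 < t / lam < b.
  move=> /andP[t0 t2]; rewrite divr_gt0 //= /lam invf_div mulrA ltr_pdivrMr //.
  have h1 : t * be < 2 * be by rewrite ltr_pM2r.
  by apply: lt_le_trans h1 _; rewrite mulrC ler_pM2r.
exists lam => //; split => [sg t hsg /andP[t0 t1]|u /andP[u0 u1]].
  have t2 : t < 2 by lra.
  apply: regular_scale => //.
  have [[h1 h2] _] := hb (t / lam) (small t (introT andP (conj t0 t2))).
  by case: hsg => ->.
have u2 : u < 2 by lra.
have [_ [[r1 r10 h1] [r2 r20 h2]]] := hb (u / lam) (small u (introT andP (conj u0 u2))).
pose r := Num.min (Num.min r1 r2) (Num.min 1 (1 - u)).
have [r0 [rr1 [rr2 [rl ru]]]] : 0 < r /\ r <= r1 /\ r <= r2 /\ r <= 1 /\ r <= 1 - u.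
  by rewrite /r !lt_min r10 r20 ltr01 subr_gt0 u1 !ge_min !lexx !orbT.
have r2' : r < 2 by lra.
exists r => // u' uu' x.
have uu : `|u' / lam - u / lam| < r.
  rewrite -mulrBl normrM [`|lam^-1|]gtr0_norm ?invr_gt0 // ltr_pdivrMr //.
  by apply: lt_le_trans uu' _; rewrite ler_peMr // ltW.
have u'1 : u' < 1 by move: uu'; rewrite ltr_norml => /andP[_ h]; lra.
have fam (K : R -> set V) r3 : r <= r3 -> (forall u'', `|u'' - u / lam| < r3 -> family_regular K u'' r3) ->
    family_regular K (u' / lam) r.
  move=> rr3 h y /andP[y0 yr]; apply: h; first exact: lt_le_trans uu rr3.
  by rewrite y0 (le_trans yr).
split => hx.
  have u'2 : u' < 2 by lra.
  rewrite sublevel_scale // in hx *.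
  exact: (family_regular_scale l1 r2' (fam (sublevel X S) r1 rr1 h1) hx).
have u'2 : u' <= 2 by lra.
rewrite superlevel_scale // in hx *.
exact: (family_regular_scale l1 r2' (fam (superlevel X S) r2 rr2 h2) hx).
Qed.

End StratumSets.

(** ** The sets of the persistent diagram *)
Section DistanceSets.
Context (R : realType) (N : nat) (S : sample R N).
Notation V := 'rV[R]_N.
Notation C := (carrier S).
Notation Sp := (stratum_p S).
Context (kS : compact Sp).

(** The infimum is attained when it is less than 1, because the stratum is compact. *)
Lemma strat_distE x : strat_dist S x = (Num.min (dd Sp x) 1)%:E.
Proof.
rewrite /strat_dist EFin_min.
have lo : ((dd Sp x)%:E <= dist x Sp)%E.
  by apply/ereal_infP => _ [y Sy <-]; rewrite lee_fin; exact: dd_le.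
apply: le_anti; rewrite !le_min !ge_min lexx lo !orbT /= andbT.
have [d1|d1] := leP 1 (dd Sp x); first by rewrite !lee_fin d1 orbT.
have d2 : dd Sp x < 2 by lra.
have [p [Spp e]] := dd_attained (compactV_closed kS) d2.
by rewrite andbT -e; apply/orP; left; apply: ereal_inf_lbound; exists p.
Qed.

Lemma D_pE v : v.2 < 1 -> D_p S v = shell C Sp 0 v.2.
Proof.
move=> v1; rewrite shell0; apply/seteqP; split => x [Cx]; rewrite ?strat_distE ?lee_fin.
  by rewrite ge_min [1 <= _]leNgt v1 orbF => /andP[].
by move=> h; split => //; rewrite strat_distE !lee_fin le_min dd_ge0 ler01 ge_min h.
Qed.

Lemma D_pqE v : v.2 < 1 -> v.1 < 1 -> D_pq S v = shell C Sp v.1 v.2.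
Proof.
move=> v1 v11; apply/seteqP; split => x [Cx]; rewrite ?strat_distE ?lee_fin.
  by rewrite ge_min le_min [1 <= _]leNgt v1 orbF => /andP[/andP[h1 _] h2]; split => //; rewrite h1.
by move=> /andP[h1 h2]; split => //; rewrite strat_distE !lee_fin le_min h1 ge_min h2 (ltW v11).
Qed.

Lemma D_qE v : v.1 < 1 -> D_q S v = shell C Sp v.1 2.
Proof.
move=> v11; rewrite shell2; apply/seteqP; split => x [Cx]; rewrite ?strat_distE ?lee_fin.
  by rewrite le_min => /andP[/andP[h1 _] _].
by move=> h1; split => //; rewrite strat_distE !lee_fin le_min h1 ge_min lexx orbT (ltW v11).
Qed.

(** Thickenings are defined by existence of a near point, sublevels by the infimum
    of the distance; for compact K the infimum is attained. *)
Lemma thickeningE (K : set V) (al : R) : compact K -> al < 2 -> thickening K al = sublevel setT K al.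
Proof.
move=> kK a2; apply/seteqP; split => y.
  by move=> [x Kx h]; split => //; apply: le_trans (dd_le y Kx) _; rewrite enormB.
move=> [_ h]; have [|p [Kp e]] := dd_attained (compactV_closed kK) (x := y); first exact: le_lt_trans h a2.
by exists p => //; rewrite enormB e.
Qed.

Lemma thickening0 (K : set V) : thickening K 0 = K.
Proof.
apply/seteqP; split => y; last by move=> Ky; exists y => //; rewrite subrr enorm0.
move=> [x Kx h]; have /enorm_eq0/eqP : enorm (x - y) = 0 by apply: le_anti; rewrite h enorm_ge0.
by rewrite subr_eq0 => /eqP <-.
Qed.

End DistanceSets.

(** * The zigzag of weak equivalences *)

Section LocalizationIsomorphisms.

Lemma isomorphic_sym (C : category) (x y : C) : isomorphic x y -> isomorphic y x.
Proof. by move=> [f [g [gf fg]]]; exists g, f. Qed.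

Lemma isomorphic_trans (C : category) (x y z : C) : isomorphic x y -> isomorphic y z -> isomorphic x z.
Proof.
move=> [f [g [gf fg]]] [h [k [kh hk]]]; exists (compC h f), (compC g k); split.
  by rewrite -compCA [compC k _]compCA kh comp1C gf.
by rewrite -compCA [compC f _]compCA fg comp1C hk.
Qed.

Lemma localization_iso (C : category) (W : morphism_class C) (x y : C) (w : Defs.Hom x y) :
  W x y w -> @isomorphic (localization W) x y.
Proof.
move=> Ww; exists (loc_class (@loc_arr C W x y w)), (loc_class (loc_inv Ww)); split; apply: loc_class_eq.
  apply: loc_trans (loc_congr (loc_classK _) (loc_classK _)) _; exact: loc_invl.
apply: loc_trans (loc_congr (loc_classK _) (loc_classK _)) _; exact: loc_invr.
Qed.

Definition constant_trans (C D : category) (d e : D) (f : Defs.Hom d e) :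
  nat_trans (constant_functor C d) (constant_functor C e).
Proof. by exists (fun=> f) => x y g; rewrite /= comp1C compC1. Defined.

Lemma constant_weq (R : realType) (U : category) (D E : DiagP R) (f : Defs.Hom D E) :
  DiagP_weq f -> @isomorphic (HoDiagP R U) (constant_functor U D) (constant_functor U E).
Proof.
move=> wf; apply: (@localization_iso (functor_category U (DiagP R))
  (@objectwise U (DiagP R) (@DiagP_weq R)) _ _ (constant_trans U f)).
by move=> x.
Qed.

End LocalizationIsomorphisms.

Section Comparison.
Context (R : realType) (M : ominimal_structure R) (N : nat) (S : sample R N).
Notation V := 'rV[R]_N.
Notation I := (unit_itv R).
Notation C := (carrier S).
Notation Sp := (stratum_p S).
Notation Y := (sublevel C Sp 1).
Notation A := (Y `\` Sp).
Context (kC : compact C) (kS : compact Sp) (dC : M N C) (dS : M N Sp).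
Context (reg : levels_regular C Sp).

(** When a > 0, a compact part of B has a positive distance q to S. *)
Lemma shell_weq (a b be : R) (B : set V) (AB : thickening (shell C Sp a b) 0 `<=` B) :
  0 <= a < 1 -> a < b -> b < 1 /\ be = 1 \/ b = 2 /\ be = 2 ->
  a = 0 /\ B = sublevel C Sp be \/ 0 < a /\ B = sublevel C Sp be `\` Sp ->
  weak_homotopy_equivalence (Defs.incl AB).
Proof.
move=> a01 ab bbe hB; apply: incl_weq => Q kQ QB; rewrite thickening0.
have cS := compactV_closed kS.
have dY : M N (sublevel C Sp be) by rewrite -shell0; exact: definable_shell.
have dK : M N (shell C Sp a b) by exact: definable_shell.
have [q q0 hq] : exists2 q : R, 0 < q & forall x, Q x -> a = 0 \/ q <= dd Sp x.
  case: hB => [[a0 _]|[a0 BE]]; first by exists 1 => // x _; left.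
  have [|||r r0 hr] := @compact_thin R _ Q (dd Sp) (fun=> 1) 0 kQ.
  - by apply: continuous_cont_on; exact: dd_continuous.
  - by apply: continuous_cont_on; exact: (@cst_continuous V R 1).
  - move=> u /QB; rewrite BE => -[_ nS] u0; exfalso; apply: nS; apply: dd_eq0 => //.
    by apply: le_anti; rewrite u0 dd_ge0.
  exists r => // x Qx; right; rewrite leNgt; apply/negP => h.
  by have := hr x Qx (ltW h); rewrite ltNge ler01.
have [h [ch hh] fh] := compression kC kS dY dK reg a01 ab bbe q0.
have BY x : B x -> sublevel C Sp be x by case: hB => [[_ ->]|[_ ->]] // [].
exists h; split; first by apply: cont_on_sub ch => w [w1 /BY].
move=> t x t01 Bx; have [Yh h0] := hh t x t01 (BY x Bx).
have [pos fx _] := fh t x t01 (BY x Bx).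
split => //.
  case: hB => [[_ BE]|[a0 BE]]; rewrite BE //; rewrite BE in Bx; split => //.
  move=> Sh; have := pos a0 (dd_gt0 cS Bx.2); by rewrite (dd_in Sh) ltxx.
move=> /hq; have [_ _] := fh 1 x (ltac:(by rewrite ler01 lexx)) (BY x Bx); exact.
Qed.

Lemma thicken_weq (K : set V) (al : R) (AB : thickening K 0 `<=` thickening K al) :
  compact K -> al < 2 -> (exists H, collar (sublevel setT K al) K H) ->
  weak_homotopy_equivalence (Defs.incl AB).
Proof.
move=> kK a2 [H [cH hH]]; apply: incl_weq => Q kQ QB; rewrite thickening0 thickeningE //.
by exists H; split => // t x t01 Yx; have [h1 h2 h3 h4 _] := hH t x t01 Yx.
Qed.

(** ** The zigzag of constant diagrams *)

Lemma link_space_sub : A `<=` Y. Proof. by move=> x []. Qed.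
Lemma link_space_subq : A `<=` stratum_q S. Proof. by move=> x [[Cx _] nS]. Qed.
Lemma stratum_p_near : Sp `<=` Y.
Proof. by move=> x Sx; split; [exact: stratum_p_sub|rewrite dd_in]. Qed.

Definition collar_diagram : DiagP R :=
  @Span (Top R) (delta_obj R Y) (delta_obj R A) (delta_obj R (stratum_q S))
    (Defs.incl link_space_sub) (Defs.incl link_space_subq).

Context (H : R -> V -> V) (cH : collar Y Sp H).

Lemma cylinder_subproof (w : I * A) : Y (H (val w.1) (val w.2)).
Proof.
have [Yx _] := set_valP w.2; have [_ hH] := cH.
by have [] := hH _ _ (itvP w.1) Yx.
Qed.

Definition cylinder_map (w : I * A) : Y := SigSub (mem_set (cylinder_subproof w)).

Lemma cylinder_map_continuous : continuous cylinder_map.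
Proof.
apply: continuous_into.
apply: (@continuous_cont_on_comp R N (I * A)%type Y H fst (fun w => val w.2)).
- by case: cH.
- exact: continuous_fst.
- by apply: (@continuous_after _ _ _ snd (val : A -> V)); [exact: continuous_val|exact: continuous_snd].
- by move=> w; have [] := set_valP w.2.
Qed.

Lemma cylinder_q_continuous : continuous (fun w : I * A => subfun link_space_subq w.2).
Proof.
by apply: (@continuous_after _ _ _ snd (subfun link_space_subq)); [exact: subfun_continuous|exact: continuous_snd].
Qed.

(** The homotopy H between the inclusion of Y \ S in Y and its end, as a diagram:
    the diagrams with legs the inclusion and the end of H both map to it. *)
Definition cylinder_diagram : DiagP R :=
  @Span (Top R) (delta_obj R Y) (delta_obj R (I * A)%type) (delta_obj R (stratum_q S))
    (delta_map R cylinder_map_continuous) (delta_map R cylinder_q_continuous).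

Lemma retracted_continuous : continuous (fun x : A => cylinder_map (I1 R, x)).
Proof.
apply: (@continuous_after _ _ _ (fun x : A => (I1 R, x)) cylinder_map); first exact: cylinder_map_continuous.
exact: cylinder_end_continuous.
Qed.

Definition retracted_diagram : DiagP R :=
  @Span (Top R) (delta_obj R Y) (delta_obj R A) (delta_obj R (stratum_q S))
    (delta_map R retracted_continuous) (Defs.incl link_space_subq).

Definition link_diagram : DiagP R :=
  @Span (Top R) (delta_obj R Y) (delta_obj R (@holink R N S)) (delta_obj R (stratum_q S))
    (compC (Defs.incl stratum_p_near) (leg_p (stratification_diagram S)))
    (leg_q (stratification_diagram S)).

Lemma collar_cylinder : exists f : Defs.Hom collar_diagram cylinder_diagram, DiagP_weq f.
Proof.
have [_ hH] := cH.
unshelve eexists (@SpanHom (Top R) collar_diagram cylinder_diagram (idC _)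
  (delta_map R (@cylinder_end_continuous R A (I0 R))) (idC _) _ _).
- apply/continuousEP => x; apply: val_inj => /=.
  have [Yx _] := set_valP x.
  by have [->] := hH 0 _ (ltac:(by rewrite lexx ler01)) Yx.
- by apply/continuousEP => x; apply: val_inj.
- by split; [exact: weq_id|exact: cylinder_end_weq|exact: weq_id].
Qed.

Lemma retracted_cylinder : exists f : Defs.Hom retracted_diagram cylinder_diagram, DiagP_weq f.
Proof.
unshelve eexists (@SpanHom (Top R) retracted_diagram cylinder_diagram (idC _)
  (delta_map R (@cylinder_end_continuous R A (I1 R))) (idC _) _ _).
- by apply/continuousEP => x; apply: val_inj.
- by apply/continuousEP => x; apply: val_inj.
- by split; [exact: weq_id|exact: cylinder_end_weq|exact: weq_id].
Qed.

Lemma retracted_link : exists f : Defs.Hom retracted_diagram link_diagram, DiagP_weq f.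
Proof.
have [_ hH] := cH.
have [m [cm [wm mE]]] := collar_link cH.
unshelve eexists (@SpanHom (Top R) retracted_diagram link_diagram (idC _) (delta_map R cm) (idC _) _ _).
- by apply/continuousEP => x; apply: val_inj => /=; rewrite mE /= subr0.
- apply/continuousEP => x; apply: val_inj => /=; rewrite mE /= subrr.
  have [Yx _] := set_valP x.
  by have [->] := hH 0 _ (ltac:(by rewrite lexx ler01)) Yx.
- by split; [exact: weq_id|exact: wm|exact: weq_id].
Qed.

Lemma stratification_link : exists f : Defs.Hom (stratification_diagram S) link_diagram, DiagP_weq f.
Proof.
unshelve eexists (@SpanHom (Top R) (stratification_diagram S) link_diagram
  (Defs.incl stratum_p_near) (idC _) (idC _) _ _).
- by rewrite compC1.
- by rewrite compC1 comp1C.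
- split; [|exact: weq_id|exact: weq_id].
  apply: incl_weq => Q kQ QB; exists H; have [ch hh] := cH; split => // t x t01 Yx.
  by have [] := hh t x t01 Yx.
Qed.

Lemma collar_stratification (U : category) :
  @isomorphic (HoDiagP R U) (constant_functor U collar_diagram)
    (constant_functor U (stratification_diagram S)).
Proof.
have [f1 w1] := collar_cylinder; have [f2 w2] := retracted_cylinder.
have [f3 w3] := retracted_link; have [f4 w4] := stratification_link.
apply: isomorphic_trans (constant_weq U w1) _.
apply: isomorphic_trans (isomorphic_sym (constant_weq U w2)) _.
exact: isomorphic_trans (constant_weq U w3) (isomorphic_sym (constant_weq U w4)).
Qed.

End Comparison.

Section Neighbourhood.
Context (R : realType) (M : ominimal_structure R) (N : nat) (S : sample R N).
Notation V := 'rV[R]_N.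
Notation C := (carrier S).
Notation Sp := (stratum_p S).
Context (kC : compact C) (kS : compact Sp) (dC : M N C) (dS : M N Sp).
Context (reg : levels_regular C Sp).
Context (walls : forall u, 0 < u < 1 -> exists2 r : R, 0 < r &
  forall u', `|u' - u| < r -> walls_regular C Sp u' r).

(** ** Forgetting the thickening *)
Section Flat.
Context (U : set (OmegaR R)).

Lemma flat_subproof (x : U) : OmegaR R ((val (val x)).1, 0).
Proof. by split => /=; [have [] := set_valP (val x)|]. Qed.

Definition flat_obj (x : U) : OmegaR R := SigSub (mem_set (flat_subproof x)).

Lemma flat_map (x y : U) : OmegaR_le (val (val x)) (val (val y)) ->
  OmegaR_le (val (flat_obj x)) (val (flat_obj y)).
Proof. by case=> h1 h2 _; split. Qed.

Definition flat : functor (sub_category U) (OmegaR_category R).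
Proof.
apply: (@Functor (sub_category U) (OmegaR_category R) flat_obj flat_map).
- by move=> x; exact: (@Prop_irrelevance (OmegaR_le _ _)).
- by move=> x y z f g; exact: (@Prop_irrelevance (OmegaR_le _ _)).
Defined.

Definition flat_persistent : functor (sub_category U) (DiagP R) :=
  functor_comp (persistent S) flat.

Lemma flat_le (x : U) : OmegaR_le (val (flat_obj x)) (val (val x)).
Proof. by split => //=; have [] := set_valP (val x). Qed.

Lemma thicken_natural (x y : U) (f : OmegaR_le (val (val x)) (val (val y))) :
  compC (@persistent_map R N S (flat_obj y) (val y) (flat_le y)) (@persistent_map R N S (flat_obj x) (flat_obj y) (flat_map f)) =
  compC (@persistent_map R N S (val x) (val y) f) (@persistent_map R N S (flat_obj x) (val x) (flat_le x)).
Proof. by apply: span_hom_eq; apply/continuousEP => z; apply: val_inj. Qed.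

Definition thicken : nat_trans flat_persistent (restriction U (persistent S)) :=
  @NatTrans _ _ flat_persistent (restriction U (persistent S))
    (fun x : U => @persistent_map R N S (flat_obj x) (val x) (flat_le x)) thicken_natural.

Lemma near_p (v : R * R) : Omega R v -> thickening (D_p S v) 0 `<=` sublevel C Sp 1.
Proof.
move=> [_ v12 v1]; rewrite thickening0 D_pE // shell0 => x [Cx xb]; split => //.
exact: le_trans xb (ltW v1).
Qed.

Lemma near_pq (v : R * R) : Omega R v -> thickening (D_pq S v) 0 `<=` sublevel C Sp 1 `\` Sp.
Proof.
move=> [v0 v12 v1]; rewrite thickening0 D_pqE ?(lt_trans v12) // => x [Cx /andP[xa xb]].
split; first by split => //; exact: le_trans xb (ltW v1).
by move=> Sx; move: xa; rewrite dd_in // leNgt v0.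
Qed.

Lemma near_q (v : R * R) : Omega R v -> thickening (D_q S v) 0 `<=` stratum_q S.
Proof.
move=> [v0 v12 v1]; rewrite thickening0 D_qE ?(lt_trans v12) // => x [Cx /andP[xa xb]].
by split => // Sx; move: xa; rewrite dd_in // leNgt v0.
Qed.

Definition flat_collar_map (x : U) : Defs.Hom (flat_persistent x) (collar_diagram S).
Proof.
unshelve eexists (Defs.incl (near_p (flat_subproof x).1)) (Defs.incl (near_pq (flat_subproof x).1))
  (Defs.incl (near_q (flat_subproof x).1)).
- by apply/continuousEP => z; apply: val_inj.
- by apply/continuousEP => z; apply: val_inj.
Defined.

Lemma flat_collar_natural (x y : U) (f : OmegaR_le (val (val x)) (val (val y))) :
  compC (flat_collar_map y) (@persistent_map R N S (flat_obj x) (flat_obj y) (flat_map f)) = compC (idC _) (flat_collar_map x).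
Proof. by apply: span_hom_eq; apply/continuousEP => z; apply: val_inj. Qed.

Definition flat_collar : nat_trans flat_persistent (constant_functor (sub_category U) (collar_diagram S)) :=
  @NatTrans _ _ flat_persistent (constant_functor (sub_category U) (collar_diagram S))
    flat_collar_map flat_collar_natural.

Lemma flat_collar_weq (x : U) : DiagP_weq (flat_collar x).
Proof.
have [v0 v12 v1] := (flat_subproof x).1; have v11 := lt_trans v12 v1.
have shw (a b be : R) (K B : set V) (KB : thickening K 0 `<=` B) : K = shell C Sp a b ->
  0 <= a < 1 -> a < b -> b < 1 /\ be = 1 \/ b = 2 /\ be = 2 ->
  a = 0 /\ B = sublevel C Sp be \/ 0 < a /\ B = sublevel C Sp be `\` Sp ->
  weak_homotopy_equivalence (Defs.incl KB).
  by move=> KE; move: KB; rewrite KE => KB; exact: (shell_weq kC kS dC dS reg).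
split.
- apply: (shw 0 _ 1 _ _ _ (D_pE kS v1)); first by rewrite lexx ltr01.
  + exact: lt_trans v12.
  + by left.
  + by left.
- apply: (shw _ _ 1 _ _ _ (D_pqE kS v1 v11)); first by rewrite ltW.
  + exact: v12.
  + by left.
  + by right.
- apply: (shw _ _ 2 _ _ _ (D_qE kS v11)); first by rewrite ltW.
  + by apply: lt_trans v11 _; rewrite ltr1n.
  + by right.
  + right; split => //; congr (_ `\` _); apply/seteqP; split => [y Cy|y []//].
    by split => //; exact: dd_le2.
Qed.

End Flat.

(** The size r of admissible thickenings has to be constant on a box, for the union
    of the boxes to be open. *)
Definition uniform_box (w : R * R) (r : R) := 0 < r < 2 /\
  forall v, Omega R v -> `|v.1 - w.1| < r -> `|v.2 - w.2| < r ->
    [/\ r <= (v.2 - v.1) / 2, walls_regular C Sp v.1 r & walls_regular C Sp v.2 r].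

Definition regular_nbhd : set (OmegaR R) :=
  \bigcup_(w in [set w : (R * R) * R | uniform_box w.1 w.2])
    [set x : OmegaR R | [/\ `|(val x).1.1 - w.1.1| < w.2, `|(val x).1.2 - w.1.2| < w.2 & (val x).2 < w.2 / 2]].

Lemma regular_nbhd_open : open regular_nbhd.
Proof.
apply: bigcup_open => -[[w1 w2] r] _ /=.
have cv : continuous (val : OmegaR R -> (R * R) * R) by exact: continuous_val.
have cdist (f : OmegaR R -> R) (c : R) : continuous f -> continuous (fun x => `|f x - c|).
  apply: (@continuous_after _ _ _ f (fun y => `|y - c|)) => y.
  by apply: (@continuous_comp _ _ _ (fun y => y - c) Num.norm); [apply: cvgB; [exact: cvg_id|exact: cvg_cst]|exact: norm_continuous].
have c1 : continuous (fun x : OmegaR R => (val x).1) by apply: (@continuous_after _ _ _ (val : OmegaR R -> (R * R) * R) fst) => //; exact: continuous_fst.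
have c11 : continuous (fun x : OmegaR R => (val x).1.1) by apply: (@continuous_after _ _ _ (fun x : OmegaR R => (val x).1) fst) => //; exact: continuous_fst.
have c12 : continuous (fun x : OmegaR R => (val x).1.2) by apply: (@continuous_after _ _ _ (fun x : OmegaR R => (val x).1) snd) => //; exact: continuous_snd.
have c2 : continuous (fun x : OmegaR R => (val x).2) by apply: (@continuous_after _ _ _ (val : OmegaR R -> (R * R) * R) snd) => //; exact: continuous_snd.
have op (f : OmegaR R -> R) (c : R) : continuous f -> open [set x | f x < c].
  by move=> /continuousP cf; exact: (cf [set y | y < c] (@open_lt _ c)).
have -> : [set x : OmegaR R | [/\ `|(val x).1.1 - w1| < r, `|(val x).1.2 - w2| < r & (val x).2 < r / 2]] =
   [set x | `|(val x).1.1 - w1| < r] `&` ([set x | `|(val x).1.2 - w2| < r] `&` [set x | (val x).2 < r / 2]).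
  by apply/seteqP; split => x; [case|move=> [? []]].
apply: openI; first exact: op (cdist _ _ c11).
by apply: openI; [exact: op (cdist _ _ c12)|exact: op].
Qed.

Lemma regular_nbhd0 (x : OmegaR R) : (val x).2 = 0 -> regular_nbhd x.
Proof.
move=> x0; have [[v0 v12 v1] _] := set_valP x.
set v := (val x).1 in v0 v12 v1.
have v1' : 0 < v.1 < 1 by rewrite v0; lra.
have v2' : 0 < v.2 < 1 by rewrite v1 andbT; lra.
have [r1 r10 h1] := walls v1'; have [r2 r20 h2] := walls v2'.
pose r := Num.min (Num.min r1 r2) (Num.min 1 ((v.2 - v.1) / 4)).
have [r0 [rr1 [rr2 [rl rv]]]] : 0 < r /\ r <= r1 /\ r <= r2 /\ r <= 1 /\ r <= (v.2 - v.1) / 4.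
  by rewrite /r !lt_min r10 r20 ltr01 divr_gt0 ?subr_gt0 // !ge_min !lexx !orbT.
exists (v, r); last first.
  by split; rewrite /= ?subrr ?normr0 // x0 divr_gt0.
split => /=; first by apply/andP; split => //; lra.
move=> v' _ d1 d2; split.
- by move: d1 d2; rewrite !ltr_norml => /andP[? ?] /andP[? ?]; lra.
- by apply: walls_regular_sub (rr1) (h1 _ _); exact: lt_le_trans d1 rr1.
- by apply: walls_regular_sub (rr2) (h2 _ _); exact: lt_le_trans d2 rr2.
Qed.

Lemma thicken_collar_weq (x : regular_nbhd) : DiagP_weq (thicken regular_nbhd x).
Proof.
have [[w r] /= [/andP[r0 r2] box] [d1 d2 al]] := set_valP x.
have [Ov al0] := set_valP (val x); have [v0 v12 v1] := Ov.
have [rv w1 w2] := box _ Ov d1 d2.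
have v11 := lt_trans v12 v1.
have a2 : (val (val x)).2 < 2 by lra.
have alr : (val (val x)).2 <= r / 2 by exact: ltW.
have thw (a b : R) (K : set V) (KB : thickening K 0 `<=` thickening K (val (val x)).2) :
    K = shell C Sp a b ->
    (forall y, 0 < dd (shell C Sp a b) y <= r -> exists v, good (-1) setT (shell C Sp a b) y v) ->
    weak_homotopy_equivalence (Defs.incl KB).
  move=> KE gd; have kK : compact K by rewrite KE; exact: shell_compact.
  apply: thicken_weq => //; rewrite KE in kK *.
  by apply: (good_collar _ kK r0 r2 gd al0 alr); exact: (definable_shell _ _ dC dS).
split.
- apply: (thw _ _ _ _ (D_pE kS v1)) => y; rewrite shell0.
  by have [h _] := w2 y; exact: h.
- apply: (thw _ _ _ _ (D_pqE kS v1 v11)) => y yr.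
  apply: (shell_good rv) (yr) _.
  + by have [_ h] := w1 y; exact: h.
  + by have [h _] := w2 y; exact: h.
  + by case/andP: yr => _ yr; exact: le_lt_trans yr r2.
- apply: (thw _ _ _ _ (D_qE kS v11)) => y; rewrite shell2.
  by have [_ h] := w1 y; exact: h.
Qed.

(** Level 1 has to be strictly inside the range where levels are regular; 16 / 15
    is the ratio that the dyadic stages need. *)
Lemma collar_of_stratum : exists H, collar (sublevel C Sp 1) Sp H.
Proof.
have SC : Sp `<=` C := @stratum_p_sub R N S.
have dY : M N (sublevel C Sp 1) by rewrite -shell0; exact: (definable_shell _ _ dC dS).
have [rho hrho] := retraction_near_exists kC dY.
apply: (@collar_exists R N C Sp 1 (16 / 15) rho (compactV_closed kC) kS SC hrho); try lra.
- by move=> t /andP[t0 t1]; apply: reg; [right|apply/andP; split => //; lra].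
- exact: band_controlled_germ dC dS kS.
Qed.

(** The values at thickening 0 sit between the persistent diagram, which thickens
    them, and the constant diagram, in which they are included. *)
Lemma persistent_constant :
  homotopically_constant regular_nbhd (persistent S) (stratification_diagram S).
Proof.
have [H cH] := collar_of_stratum; rewrite /homotopically_constant.
pose W := @objectwise (sub_category regular_nbhd) (DiagP R) (@DiagP_weq R).
have i1 := @localization_iso (functor_category (sub_category regular_nbhd) (DiagP R)) W _ _
  (thicken regular_nbhd) thicken_collar_weq.
have i2 := @localization_iso (functor_category (sub_category regular_nbhd) (DiagP R)) W _ _
  (flat_collar regular_nbhd) (@flat_collar_weq regular_nbhd).
apply: isomorphic_trans (isomorphic_sym i1) _; apply: isomorphic_trans i2 _.
exact: collar_stratification cH _.
Qed.

End Neighbourhood.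

(** The closed stratum is only assumed closed in the carrier. *)
Lemma stratum_p_compact (R : realType) (N : nat) (S : sample R N) :
  stratified S -> compact (carrier S) -> compact (stratum_p S).
Proof.
move=> cS kC.
have h : compact ((val : carrier S -> 'rV[R]_N) @` [set x : carrier S | stratum_p S (val x)]).
  apply: continuous_compact; first by apply: continuous_subspaceT; exact: continuous_val.
  by apply: subclosed_compact cS (compact_subtype kC) _.
have -> : stratum_p S = (val : carrier S -> 'rV[R]_N) @` [set x : carrier S | stratum_p S (val x)].
  apply/seteqP; split => [x Sx|_ [x Sx <-] //].
  by exists (SigSub (mem_set (stratum_p_sub Sx))).
exact: h.
Qed.

Theorem proposition3p22 (R : realType) (M : ominimal_structure R) (N : nat)
  (S : sample R N)
  (S_stratified : definably_stratified M S)
  (S_compact : compact (carrier S)) :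
  exists2 lambda : R, 0 < lambda &
    exists U : set (OmegaR R),
      [/\ open U,
          forall x : OmegaR R, (val x).2 = 0 -> U x
        & homotopically_constant U (persistent (rescale lambda S))
            (stratification_diagram (rescale lambda S))].
Proof.
have [strat dp dq] := S_stratified.
have kS := stratum_p_compact strat S_compact.
have dC : M N (carrier S).
  have -> : carrier S = stratum_p S `|` stratum_q S.
    apply/seteqP; split => x; last by case=> [/stratum_p_sub|[]].
    by move=> Cx; have [Sx|nSx] := pselect (stratum_p S x); [left|right].
  exact: definableU.
have [lam l0 [reg walls]] := magnify dC dp S_compact kS.
exists lam => //; exists (regular_nbhd (rescale lam S)); split.
- exact: regular_nbhd_open.
- exact: regular_nbhd0.
- apply: (persistent_constant (M := M)) => //.
  + exact: compact_scale.
  + exact: compact_scale.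
  + exact: definable_scale.
  + exact: definable_scale.
Qed.
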